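(* For all $1<p<\infty$ and all $\omega\in L^p(\mathbb{R}^n,\Lambda\mathbb{R}^n)$, the Beurling–Ahlfors operator factorises as $$\mathcal{S}(\omega)=-\mathbf{R}\triangle(\widehat{\omega}\triangle\mathbf{R})=-(\mathbf{R}\triangle\widehat{\omega})\triangle\mathbf{R}.$$
   Context: $\Lambda\mathbb{R}^n$ is the exterior algebra with induced inner product, and $\triangle$ is the Euclidean Clifford product on it, i.e. the associative product generated by $e_i\triangle e_j+e_j\triangle e_i=2\langle e_i,e_j\rangle$, with $v\triangle w=v\lrcorner w+v\wedge w$ for vectors $v$. The main involution is $\widehat w=\sum_k(-1)^k\langle w\rangle_k$, where $\langle w\rangle_k$ is the $\Lambda^k$-component. The scalar Riesz transforms are $\mathcal{R}_{e_j}f(x)=\frac{2}{\sigma_n}\,\mathrm{p.v.}\int_{\mathbb{R}^n}\frac{(x_j-y_j)f(y)}{|x-y|^{n+1}}dy$, with $\sigma_n$ the $n$-dimensional volume of $\mathbb{S}^n\subset\mathbb{R}^{n+1}$, acting componentwise on multivector fields; $\mathbf{R}=\sum_j\mathcal{R}_{e_j}e_j$ is a formal symbol, meaning $\mathbf{R}\triangle F=\sum_je_j\triangle\mathcal{R}_{e_j}F$ and $F\triangle\mathbf{R}=\sum_j(\mathcal{R}_{e_j}F)\triangle e_j$. The Beurling–Ahlfors operator $\mathcal{S}$ is the Fourier multiplier operator $\mathcal{F}(\mathcal{S}\omega)(\xi)=\widehat{M}(\xi)\mathcal{F}(\omega)(\xi)$, where $M(\xi)=I-2|\xi|^{-2}\xi\otimes\xi$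 is the reflection in the hyperplane orthogonal to $\xi$ and $\widehat M(\xi)$ is its exterior extension (the exterior-algebra homomorphism of $\Lambda\mathbb{R}^n$ fixing $1$ and restricting to $M(\xi)$ on $\mathbb{R}^n$, complexified); equivalently $\mathcal{S}=(dd^*-d^*d)\circ\Delta^{-1}$ with $\Delta=\sum_j\partial_j^2$ acting componentwise and $d^*$ the formal adjoint of $d$. *)

(* Defs.v *)
(* MathComp-Analysis, over an arbitrary [R : realType]; points of R^n are row
   vectors ['rV[R]_n]. *)
From HB Require Import structures.
From mathcomp Require Import all_boot all_order all_algebra.
From mathcomp Require Import all_classical all_reals all_analysis.
From mathcomp Require Import complex.

Set Implicit Arguments.
Unset Strict Implicit.
Unset Printing Implicit Defensive.
Import Order.TTheory GRing.Theory Num.Theory.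
Import numFieldNormedType.Exports.

Local Open Scope ring_scope.

Section multivectors.
Context (K : comNzRingType) (n : nat).

(* The exterior algebra of K^n, in coordinates with respect to the basis
   e_I = e_(i_1) /\ ... /\ e_(i_k), I = {i_1 < ... < i_k}, which is orthonormal
   for the induced inner product. *)
Definition multivector := {ffun {set 'I_n} -> K^o}.

Definition blade (I : {set 'I_n}) : multivector := [ffun J => (J == I)%:R].

Definition mvec (v : 'rV[K]_n) : multivector := \sum_i v 0 i *: blade [set i].

Definition mv_inner (u w : multivector) : K := \sum_I u I * w I.

(* Transpositions needed to sort the concatenation of the increasing
   enumerations of I and J. *)
Definition inversions (I J : {set 'I_n}) : nat :=
  (\sum_(i in I) \sum_(j in J) (j < i))%N.

Definition symdiff (I J : {set 'I_n}) : {set 'I_n} := (I :\: J) :|: (J :\: I).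

Definition wedge (u w : multivector) : multivector :=
  \sum_(I : {set 'I_n}) \sum_(J : {set 'I_n} | [disjoint I & J])
    ((-1) ^+ inversions I J * (u I * w J)) *: blade (I :|: J).

(* Sorting e_I e_J costs one sign per inversion, and a repeated index
   contributes the factor e_i e_i = 1. *)
Definition clifford (u w : multivector) : multivector :=
  \sum_I \sum_J
    ((-1) ^+ inversions I J * (u I * w J)) *: blade (symdiff I J).

(* The interior product by a vector: the adjoint of left exterior
   multiplication. *)
Definition lcontr (v w : multivector) : multivector :=
  [ffun J => mv_inner w (wedge v (blade J))].

Definition grade (k : nat) (w : multivector) : multivector :=
  [ffun I : {set 'I_n} => if #|I| == k then w I else 0].

Definition main_involution (w : multivector) : multivector :=
  \sum_(k < n.+1) (-1) ^+ k *: grade k w.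

(* The exterior extension of the linear map with matrix A, acting on column
   vectors. *)
Definition exterior_map (A : 'M[K]_n) (w : multivector) : multivector :=
  \sum_I w I *: \big[wedge/blade finset.set0]_(i <- enum I) mvec (col i A)^T.

Lemma multivectorE (w : multivector) : w = \sum_I w I *: blade I.
Proof.
apply/ffunP => J; rewrite sum_ffunE (bigD1 J)//= big1.
  by rewrite !ffunE eqxx addr0; exact/esym/mulr1.
by move=> I IJ; rewrite !ffunE eq_sym (negPf IJ) scaler0.
Qed.

Lemma clifford_linear_l w : linear (clifford ^~ w).
Proof.
move=> a u v; rewrite /clifford scaler_sumr -big_split/=.
apply: eq_bigr => I _; rewrite scaler_sumr -big_split/=; apply: eq_bigr => J _.
rewrite !ffunE scalerA -scalerDl; congr (_ *: _).
by rewrite mulrDl mulrDr -!mulrA [a * _]mulrCA.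
Qed.

Lemma clifford_linear_r u : linear (clifford u).
Proof.
move=> a v w; rewrite /clifford scaler_sumr -big_split/=.
apply: eq_bigr => I _; rewrite scaler_sumr -big_split/=; apply: eq_bigr => J _.
rewrite !ffunE scalerA -scalerDl; congr (_ *: _).
by rewrite !mulrDr [u I * _]mulrCA [a * _]mulrCA.
Qed.

Lemma clifford_suml (T : finType) (a : T -> K) (x : T -> multivector) w :
  clifford (\sum_i a i *: x i) w = \sum_i a i *: clifford (x i) w.
Proof.
elim/big_rec2: _ => [|i y1 y2 _ <-]; last exact: clifford_linear_l.
have := clifford_linear_l w 1 0 0; rewrite !scale1r addr0 => /eqP.
by rewrite -subr_eq subrr => /eqP <-.
Qed.

Lemma clifford_sumr (T : finType) (a : T -> K) (x : T -> multivector) w :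
  clifford w (\sum_i a i *: x i) = \sum_i a i *: clifford w (x i).
Proof.
elim/big_rec2: _ => [|i y1 y2 _ <-]; last exact: clifford_linear_r.
have := clifford_linear_r w 1 0 0; rewrite !scale1r addr0 => /eqP.
by rewrite -subr_eq subrr => /eqP <-.
Qed.

Lemma clifford_blade I J :
  clifford (blade I) (blade J) = (-1) ^+ inversions I J *: blade (symdiff I J).
Proof.
rewrite /clifford (bigD1 I)//= (bigD1 J)//= !ffunE !eqxx !mulr1.
rewrite big1 ?addr0; last first.
  by move=> L LJ; rewrite !ffunE (negPf LJ) mulr0 mulr0 scale0r.
rewrite big1 ?addr0// => L LI; rewrite big1// => M _.
by rewrite !ffunE (negPf LI) mul0r mulr0 scale0r.
Qed.

Lemma odd_sum_symdiff (f : 'I_n -> nat) I J :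
  odd (\sum_(i in symdiff I J) f i) =
  odd (\sum_(i in I) f i) (+) odd (\sum_(i in J) f i).
Proof.
rewrite !(big_mkcond (fun i => i \in _)) !(big_morph odd oddD (erefl : odd 0 = false)).
rewrite -big_split; apply: eq_bigr => i _ /=; rewrite !inE.
by case: (i \in I); case: (i \in J); rewrite ?addbF ?addbb.
Qed.

Lemma odd_inversionsl I J L :
  odd (inversions (symdiff I J) L) = odd (inversions I L) (+) odd (inversions J L).
Proof. exact: odd_sum_symdiff. Qed.

Lemma odd_inversionsr I J L :
  odd (inversions L (symdiff I J)) = odd (inversions L I) (+) odd (inversions L J).
Proof.
by rewrite /inversions !(exchange_big _ _ _ (mem L))/= odd_sum_symdiff.
Qed.

Lemma symdiffA : associative symdiff.
Proof.
move=> I J L; apply/finset.setP => i; rewrite !inE.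
by case: (i \in I); case: (i \in J); case: (i \in L).
Qed.

Lemma cliffordZl a u w : clifford (a *: u) w = a *: clifford u w.
Proof.
have := clifford_suml (fun _ : 'I_1 => a) (fun _ => u) w.
by rewrite !big_ord1.
Qed.

Lemma cliffordZr a u w : clifford u (a *: w) = a *: clifford u w.
Proof.
have := clifford_sumr (fun _ : 'I_1 => a) (fun _ => w) u.
by rewrite !big_ord1.
Qed.

Lemma clifford_bladeA I J L :
  clifford (blade I) (clifford (blade J) (blade L)) =
  clifford (clifford (blade I) (blade J)) (blade L).
Proof.
rewrite !clifford_blade cliffordZr cliffordZl !clifford_blade !scalerA symdiffA.
congr (_ *: _); rewrite -!exprD -signr_odd -[RHS]signr_odd !oddD.
rewrite odd_inversionsl odd_inversionsr.
set a := odd (inversions J L); set b := odd (inversions I J); set c := odd _.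
clearbody a b c.
by case: a b c => -[] [].
Qed.

Lemma cliffordA : associative clifford.
Proof.
move=> u v w; rewrite (multivectorE u) !clifford_suml.
apply: eq_bigr => I _; congr (_ *: _).
rewrite (multivectorE v) clifford_suml !clifford_sumr clifford_suml.
apply: eq_bigr => J _; congr (_ *: _).
rewrite (multivectorE w) !clifford_sumr; apply: eq_bigr => L _.
by rewrite clifford_bladeA.
Qed.

Lemma inversions11 (i j : 'I_n) :
  inversions [set i]%SET [set j]%SET = (j < i)%N.
Proof. by rewrite /inversions !big_set1. Qed.

Lemma mvec_delta (i : 'I_n) : mvec (delta_mx 0 i) = blade [set i]%SET.
Proof.
rewrite /mvec (bigD1 i)//= !mxE !eqxx scale1r big1 ?addr0// => j ji.
by rewrite mxE eqxx/= (negPf ji) scale0r.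
Qed.

Lemma clifford_basis (i j : 'I_n) :
  clifford (mvec (delta_mx 0 i)) (mvec (delta_mx 0 j)) +
  clifford (mvec (delta_mx 0 j)) (mvec (delta_mx 0 i)) =
  (2 * (i == j)%:R) *: blade finset.set0.
Proof.
rewrite !mvec_delta !clifford_blade !inversions11.
have [->|ij] := eqVneq i j.
  rewrite ltnn mulr1 expr0 scale1r -mulr2n -scaler_nat.
  by congr (_ *: blade _); apply/finset.setP => k; rewrite !inE andNb.
rewrite mulr0 scale0r (_ : symdiff [set j]%SET _ = symdiff [set i]%SET [set j]%SET).
  rewrite -scalerDl; case: ltngtP => [||/val_inj ji]; last by rewrite ji eqxx in ij.
  - by rewrite expr0 expr1 ?addrN ?addNr scale0r.
  - by rewrite expr0 expr1 ?addrN ?addNr scale0r.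
by rewrite /symdiff finset.setUC.
Qed.

Lemma cliffordE u w L :
  clifford u w L = \sum_I \sum_J
    (-1) ^+ inversions I J * (u I * w J) * (L == symdiff I J)%:R.
Proof.
rewrite /clifford sum_ffunE; apply: eq_bigr => I _; rewrite sum_ffunE.
by apply: eq_bigr => J _; rewrite !ffunE.
Qed.

Lemma wedgeE u w L :
  wedge u w L = \sum_(I : {set 'I_n}) \sum_(J : {set 'I_n} | [disjoint I & J])
    (-1) ^+ inversions I J * (u I * w J) * (L == I :|: J)%:R.
Proof.
rewrite /wedge sum_ffunE; apply: eq_bigr => I _; rewrite sum_ffunE.
by apply: eq_bigr => J _; rewrite !ffunE.
Qed.

Lemma mvec_eq0 v (I : {set 'I_n}) : #|I| != 1 -> mvec v I = 0.
Proof.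
move=> I1; rewrite /mvec sum_ffunE big1// => i _; rewrite !ffunE.
have [E|_] := eqVneq I [set i]%SET; first by rewrite E cards1 in I1.
by rewrite scaler0.
Qed.

Lemma sum_delta (F : {set 'I_n} -> K) J0 (P : pred {set 'I_n}) :
  \sum_(J | P J) F J * (J == J0)%:R = if P J0 then F J0 else 0.
Proof.
case: ifPn => PJ; last first.
  rewrite big1// => J PJ'; case: eqP => [E|]; last by rewrite mulr0.
  by rewrite E (negPf PJ) in PJ'.
rewrite (bigD1 J0)//= eqxx mulr1 big1 ?addr0// => J /andP[_ /negPf ->].
by rewrite mulr0.
Qed.

Lemma clifford_vec (v : 'rV[K]_n) (w : multivector) :
  clifford (mvec v) w = lcontr (mvec v) w + wedge (mvec v) w.
Proof.
apply/ffunP => L; rewrite !ffunE cliffordE wedgeE /mv_inner.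
under [X in _ = X + _]eq_bigr => J _ do rewrite wedgeE mulr_sumr.
rewrite [X in _ = X + _]exchange_big -big_split/=; apply: eq_bigr => I _.
have [/cards1P[i ->{I}]|/mvec_eq0 I0] := boolP (#|I| == 1); last first.
  have z J (x : K) : (-1) ^+ inversions I J * (mvec v I * w J) * x = 0.
    by rewrite I0 mul0r mulr0 mul0r.
 
  rewrite big1 ?[X in _ + X]big1 ?addr0 => [|J _|J _]; try exact: z.
  rewrite big1// => J _; rewrite big1 ?mulr0// => M _.
  by rewrite I0 mul0r mulr0 mul0r.
set u := mvec v [set i]%SET; set I := [set i]%SET.
have disjI (M : {set 'I_n}) : [disjoint I & M] = (i \notin M) by rewrite /I disjoints1.
have symI M N : (M == symdiff I N) = (N == symdiff I M).
  have symK N' : symdiff I (symdiff I N') = N'.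
    by apply/finset.setP => k; rewrite !inE; case: (k == i); case: (k \in N').
  by apply/eqP/eqP => ->; rewrite symK.
under eq_bigr => J _ do rewrite symI.
rewrite sum_delta.
have inner (J : {set 'I_n}) : \sum_(M : {set 'I_n} | [disjoint I & M])
    (-1) ^+ inversions I M * (u * blade L M) * (J == I :|: M)%:R =
    if i \notin L then
      (-1) ^+ inversions I L * u * (J == I :|: L)%:R else 0.
  rewrite -disjI; transitivity (\sum_(M : {set 'I_n} | [disjoint I & M])
      (-1) ^+ inversions I M * u * (J == I :|: M)%:R * (M == L)%:R).
    by apply: eq_bigr => M _; rewrite ffunE mulrA mulrAC.
  exact: sum_delta.
under [X in _ = X + _]eq_bigr => J _ do rewrite inner.
have invI (M N : {set 'I_n}) : M :\ i = N :\ i -> inversions I M = inversions I N.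
  rewrite /inversions !big_set1 => MN.
  have E (Q : {set 'I_n}) : (\sum_(j in Q) (j < i) = \sum_(j in Q :\ i) (j < i))%N.
    have [iQ|iQ] := boolP (i \in Q); first by rewrite (big_setD1 i)//= ltnn.
    by apply: eq_bigl => j; rewrite !inE; have [->|//] := eqVneq j i; rewrite (negPf iQ).
  by rewrite E MN -E.
have [iL|iL] := boolP (i \in L) => /=.
  rewrite big1 ?add0r; last by move=> J _; rewrite mulr0.
  rewrite (eq_bigr (fun J => (-1) ^+ inversions I J * (u * w J) *
     (J == symdiff I L)%:R)); last first.
    move=> J; rewrite disjI => iJ; congr (_ * _%:R).
    rewrite -symI; congr (nat_of_bool (_ == _)); apply/finset.setP => k.
    rewrite /I !inE; have [->|_] := eqVneq k i; last by rewrite andbF.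
    by rewrite (negPf iJ).
  apply/esym; etransitivity; first exact: sum_delta.
  by rewrite disjI /I !inE eqxx iL.
rewrite [X in _ + X]big1 ?addr0; last first.
  move=> J _; case: eqP => [LE|]; last by rewrite mulr0.
  by rewrite LE /I !inE eqxx in iL.
rewrite (eq_bigr (fun J => (w J * ((-1) ^+ inversions I L * u)) *
   (J == I :|: L)%:R)); last by move=> J _; rewrite mulrA.
apply/esym; etransitivity; first exact: sum_delta.
rewrite (_ : symdiff I L = I :|: L); last first.
  apply/finset.setP => k; rewrite /I !inE.
  by have [->|_] := eqVneq k i; rewrite ?(negPf iL) ?andbF.
rewrite (invI (I :|: L) L); last first.
  by apply/finset.setP => k; rewrite /I !inE; case: (k == i).
by rewrite mulrC mulrA.
Qed.

End multivectors.

Local Open Scope classical_set_scope.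

Lemma product_sigma_finite (R : realType) d1 d2 (T1 : measurableType d1)
    (T2 : measurableType d2) (m1 : {sigma_finite_measure set T1 -> \bar R})
    (m2 : {sigma_finite_measure set T2 -> \bar R}) :
  sigma_finite setT (product_measure1 m1 m2).
Proof.
have /sigma_finiteP[F [TF ndF Foo]] := sigma_finiteT m1.
have /sigma_finiteP[G [TG ndG Goo]] := sigma_finiteT m2.
exists (fun k => F k `*` G k).
  rewrite -setXTT TF TG predeqE => -[x y]; split=> [[/= [i _ Fi] [j _ Gj]]|].
    exists (maxn i j) => //; split.
    - by move: x Fi; exact/subsetPset/ndF/leq_maxl.
    - by move: y Gj; exact/subsetPset/ndG/leq_maxr.
  by move=> [i _ []/= ? ?]; split; exists i.
move=> k; have [? ?] := Foo k; have [? ?] := Goo k.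
split; first exact: measurableX.
by rewrite product_measure1E// lte_mul_pinfty// ge0_fin_numE.
Qed.

Section row_vector_measurable.
Context (R : realType) (n : nat).

(* The product sigma-algebra, which on R^n is the Borel sigma-algebra. *)
Let coord : 'I_n -> 'rV[R]_n -> measurableTypeR R := fun i x => x 0 i.

Let rv_set0 : g_sigma_preimage coord set0.
Proof. exact: sigma_algebra0. Qed.

Let rv_setC A : g_sigma_preimage coord A -> g_sigma_preimage coord (~` A).
Proof. exact: sigma_algebraC. Qed.

Let rv_bigcup (F : _^nat) : (forall i, g_sigma_preimage coord (F i)) ->
  g_sigma_preimage coord (\bigcup_i F i).
Proof. exact: sigma_algebra_bigcup. Qed.

HB.instance Definition _ := @isMeasurable.Build default_measure_display
  'rV[R]_n (g_sigma_preimage coord) rv_set0 rv_setC rv_bigcup.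

Lemma measurable_rv_coord (i : 'I_n) :
  measurable_fun setT (fun x : 'rV[R]_n => x 0 i : measurableTypeR R).
Proof.
move=> _ Y mY; rewrite setTI; apply: sub_sigma_algebra => /=.
rewrite -bigcup_seq/=; exists i => /=; first by rewrite mem_index_enum.
by exists Y => //; rewrite setTI.
Qed.

Lemma measurable_fun_rvP d (T : measurableType d) (f : T -> 'rV[R]_n) :
  (forall i, measurable_fun setT (fun x => f x 0 i : measurableTypeR R)) ->
  measurable_fun setT f.
Proof.
move=> mf.
suff : g_sigma_preimage (fun i => coord i \o f) `<=` measurable.
  by rewrite g_sigma_preimage_comp => prefS _ A mA; apply: prefS; exists A.
apply: smallest_sub; first exact: sigma_algebra_measurable.
rewrite /coord; case: n f mf => [|m] f mf; first by rewrite big_ord0.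
rewrite -bigcup_mkord_ord; apply: bigcup_sub => i Ii.
by move=> A [B mB <-]; exact: mf.
Qed.

End row_vector_measurable.

Section lebesgue_rv.
Context (R : realType).

Definition rv_cons n (z : measurableTypeR R * 'rV[R]_n) : 'rV[R]_n.+1 :=
  \row_i if unlift ord0 i is Some j then z.2 0 j else z.1.

Definition rv_uncons n (x : 'rV[R]_n.+1) : measurableTypeR R * 'rV[R]_n :=
  (x 0 ord0, \row_j x 0 (lift ord0 j)).

Lemma rv_consK n : cancel (@rv_cons n) (@rv_uncons n).
Proof.
move=> [t v]; rewrite /rv_uncons mxE unlift_none; congr pair.
by apply/rowP => j; rewrite !mxE liftK.
Qed.

Lemma rv_unconsK n : cancel (@rv_uncons n) (@rv_cons n).
Proof.
move=> x; apply/rowP => i; rewrite mxE.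
by case: unliftP => [j|] ->; rewrite //= mxE.
Qed.

Lemma measurable_rv_cons n : measurable_fun setT (@rv_cons n).
Proof.
apply: measurable_fun_rvP => i; rewrite /rv_cons.
under eq_fun do rewrite mxE.
case: unliftP => [j|] _; last exact: measurable_fst.
exact: (measurableT_comp (measurable_rv_coord j) measurable_snd).
Qed.

Lemma measurable_rv_uncons n : measurable_fun setT (@rv_uncons n).
Proof.
apply/measurable_fun_pairP; split; first exact: measurable_rv_coord.
apply: measurable_fun_rvP => i /=; under eq_fun do rewrite mxE.
exact: measurable_rv_coord.
Qed.

Section step.
Context (n : nat) (m : {sigma_finite_measure set 'rV[R]_n -> \bar R}).

Definition lebesgue_rv_step : set 'rV[R]_n.+1 -> \bar R :=
  pushforward (product_measure1 (@lebesgue_measure R) m) (@rv_cons n).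

Let step0 : lebesgue_rv_step set0 = 0%E.
Proof. by rewrite /lebesgue_rv_step /pushforward preimage_set0 measure0. Qed.

Let step_ge0 A : (0 <= lebesgue_rv_step A)%E.
Proof. exact: (@measure_ge0 _ _ _ (product_measure1 lebesgue_measure m)). Qed.

Let step_sigma_additive : semi_sigma_additive lebesgue_rv_step.
Proof.
move=> F mF tF mUF; rewrite /lebesgue_rv_step /pushforward preimage_bigcup.
have mcons A : measurable A -> measurable (@rv_cons n @^-1` A).
  by move=> mA; rewrite -[X in measurable X]setTI; exact: measurable_rv_cons.
apply: measure_semi_sigma_additive.
- by move=> k; exact: mcons.
- apply/trivIsetP => /= i j _ _ ij; rewrite -preimage_setI.
  by move/trivIsetP : tF => /(_ _ _ _ _ ij) ->//; rewrite preimage_set0.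
- by rewrite -preimage_bigcup; exact: mcons.
Qed.

HB.instance Definition _ := isMeasure.Build _ _ _
  lebesgue_rv_step step0 step_ge0 step_sigma_additive.

Let step_sigma_finite : sigma_finite setT lebesgue_rv_step.
Proof.
pose L : {sigma_finite_measure set (measurableTypeR R) -> \bar R} :=
  @lebesgue_measure R.
have [F TF Foo] := product_sigma_finite L m.
exists (fun k => @rv_uncons n @^-1` F k).
  by rewrite -preimage_bigcup -TF preimage_setT.
move=> k; have [mFk Fkoo] := Foo k; split.
  by rewrite -[X in measurable X]setTI; exact: measurable_rv_uncons.
rewrite /lebesgue_rv_step /pushforward -comp_preimage.
rewrite (_ : @rv_uncons n \o @rv_cons n = id)//.
by apply/funext => z; exact: rv_consK.
Qed.

HB.instance Definition _ := Measure_isSigmaFinite.Build _ _ _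
  lebesgue_rv_step step_sigma_finite.

End step.

(* Lebesgue measure on R^n: a point mass for n = 0, and the product of
   [lebesgue_measure] with Lebesgue measure on R^n, transported along the
   isomorphism R x R^n = R^(n+1), in the successor case. *)
Fixpoint lebesgue_rv n : {sigma_finite_measure set 'rV[R]_n -> \bar R} :=
  match n with
  | 0 => dirac (0 : 'rV[R]_0)
  | m.+1 => lebesgue_rv_step (lebesgue_rv m)
  end.

Lemma lebesgue_rv_box n (A : 'I_n -> set (measurableTypeR R)) :
  (forall i, measurable (A i)) ->
  lebesgue_rv n [set x | forall i, A i (x 0 i)] =
  (\prod_(i < n) @lebesgue_measure R (A i))%E.
Proof.
elim: n A => [|n IHn] A mA.
  by rewrite big_ord0 /= diracE mem_set// => -[].
rewrite big_ord_recl -IHn; last by move=> i; exact: mA.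
pose B := [set x : 'rV[R]_n | forall i, A (lift ord0 i) (x 0 i)].
have mB : measurable B.
  rewrite (_ : B = \bigcap_(i in [set: 'I_n])
      ((fun x : 'rV[R]_n => x 0 i) @^-1` A (lift ord0 i))).
    apply: fin_bigcap_measurable => // i _.
    by rewrite -[X in measurable X]setTI; exact: measurable_rv_coord.
  by apply/seteqP; split=> [x Bx i _|x Bx i]; [exact: Bx|exact: (Bx i I)].
rewrite -(product_measure1E lebesgue_measure (lebesgue_rv n) (mA ord0) mB).
rewrite [LHS]/= /lebesgue_rv_step /pushforward.
congr (product_measure1 _ _ _).
apply/seteqP; split=> [z /= Az|z /= [A0z Bz] i].
  split; first by have := Az ord0; rewrite mxE unlift_none.
  by move=> i; have := Az (lift ord0 i); rewrite mxE liftK.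
by rewrite mxE; case: unliftP => [j ->|->//]; exact: Bz.
Qed.

End lebesgue_rv.

Section beurling_ahlfors.
Context (R : realType) (n : nat).
Local Notation mu := (lebesgue_rv R n).

Definition dotv (x y : 'rV[R]_n) : R := \sum_i x 0 i * y 0 i.

(* The Euclidean norm; the library norm [`|x|] of a row vector is the maximum
   norm. *)
Definition enorm (x : 'rV[R]_n) : R := Num.sqrt (dotv x x).

(* Multivector fields, and fields with values in the complexification of the
   exterior algebra, which is where Fourier transforms live. *)
Definition mvfield := 'rV[R]_n -> multivector R n.
Definition cmvfield := 'rV[R]_n -> multivector R[i] n.

Definition complexify (F : mvfield) : cmvfield :=
  fun x => [ffun I => real_complex R (F x I)].

Definition mv_norm (w : multivector R n) : R := Num.sqrt (mv_inner w w).

Definition cmv_norm (w : multivector R[i] n) : R :=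
  Num.sqrt (\sum_I (complex.Re (w I) ^+ 2 + complex.Im (w I) ^+ 2)).

Definition Lp_norm (p : R) (F : mvfield) : \bar R :=
  Lnorm mu p%:E (fun x => (mv_norm (F x))%:E).

Definition cLp_norm (p : R) (F : cmvfield) : \bar R :=
  Lnorm mu p%:E (fun x => (cmv_norm (F x))%:E).

Definition in_Lp (p : R) (F : mvfield) : Prop :=
  (forall I, measurable_fun setT (fun x => F x I : R)) /\
  (Lp_norm p F < +oo)%E.

Definition partials (s : seq 'I_n) (f : 'rV[R]_n -> R) : 'rV[R]_n -> R :=
  foldr (fun i g x => 'D_(delta_mx 0 i) g x) f s.

Definition schwartz_fun (f : 'rV[R]_n -> R) : Prop :=
  forall s : seq 'I_n,
    (forall x, differentiable (partials s f) x) /\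
    (forall k : nat, exists C : R, forall x,
      enorm x ^+ k * `|partials s f x| <= C).

Definition schwartz (F : mvfield) : Prop :=
  forall I, schwartz_fun (fun x => F x I).

Definition cis (t : R) : R[i] := Complex (cos t) (sin t).

Definition cintegral (f : 'rV[R]_n -> R[i]) : R[i] :=
  Complex (\int[mu]_x complex.Re (f x)) (\int[mu]_x complex.Im (f x)).

Definition fourier (F : cmvfield) : cmvfield :=
  fun xi => [ffun I => cintegral (fun x => cis (- (2 * pi * dotv x xi)) * F x I)].

Definition inv_fourier (F : cmvfield) : cmvfield :=
  fun x => [ffun I => cintegral (fun xi => cis (2 * pi * dotv x xi) * F xi I)].

Definition reflection (xi : 'rV[R]_n) : 'M[R]_n :=
  1%:M - (2 * enorm xi ^- 2) *: (xi^T *m xi).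

Definition ba_symbol (xi : 'rV[R]_n) : multivector R[i] n -> multivector R[i] n :=
  exterior_map (map_mx (real_complex R) (reflection xi)).

(* On Schwartz fields the transform is integrable and the symbol is bounded, so
   the multiplier operator is given by an absolutely convergent integral. *)
Definition ba_schwartz (F : mvfield) : cmvfield :=
  inv_fourier (fun xi => ba_symbol xi (fourier (complexify F) xi)).

(* [is_beurling_ahlfors p w u] says that u represents the value at w of the
   multiplier operator on L^p, that is, of the extension by continuity of
   [ba_schwartz] from Schwartz fields to L^p: u is the L^p limit of
   [ba_schwartz phi] as the Schwartz field phi tends to w in L^p. *)
Definition is_beurling_ahlfors (p : R) (w u : mvfield) : Prop :=
  [/\ in_Lp p u,
      forall d : R, 0 < d ->
        exists2 phi, schwartz phi & (Lp_norm p (fun x => (phi x - w x)%R) < d%:E)%E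
    & forall e : R, 0 < e -> exists2 d : R, 0 < d &
        forall phi, schwartz phi -> (Lp_norm p (fun x => (phi x - w x)%R) < d%:E)%E ->
          (cLp_norm p (fun x => (ba_schwartz phi x - complexify u x)%R) < e%:E)%E].

(* The n-dimensional volume of the unit sphere in R^(n+1) is n + 1 times the
   volume of the ball it bounds. *)
Definition sphere_volume : R :=
  n.+1%:R * fine (lebesgue_rv R n.+1
    [set x : 'rV[R]_n.+1 | \sum_i x 0 i ^+ 2 <= 1]).

Definition riesz (j : 'I_n) (f : 'rV[R]_n -> R) (x : 'rV[R]_n) : R :=
  2 / sphere_volume *
  lim ((\int[mu]_(y in [set y | e < enorm (x - y)])
          ((x 0 j - y 0 j) * f y / enorm (x - y) ^+ n.+1)) @[e --> 0^'+]).

Definition riesz_mv (j : 'I_n) (F : mvfield) : mvfield :=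
  fun x => [ffun I => riesz j (fun y => F y I) x].

(* The Clifford products of F with the formal vector sum_j R_(e_j) e_j on the
   left and on the right. *)
Definition riesz_cliffordl (F : mvfield) : mvfield :=
  fun x => \sum_j clifford (mvec (delta_mx 0 j)) (riesz_mv j F x).

Definition riesz_cliffordr (F : mvfield) : mvfield :=
  fun x => \sum_j clifford (riesz_mv j F x) (mvec (delta_mx 0 j)).

Definition involution_field (F : mvfield) : mvfield :=
  fun x => main_involution (F x).

End beurling_ahlfors.

(* Main.v *)
(** The L^p boundedness of the maximal truncated Riesz transforms is obtained by
    the method of rotations with a Gaussian weight: the kernel
    [x_j / |x|^(n+1)] is an average of one-dimensional Hilbert kernels over
    directions distributed as a Gaussian, and transference along lines reduces
    the bound to the Hilbert transform on R.  There, for [1 < p <= 2] and [g >= 0],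
    the Cauchy integral [u + iv] of [g] in the half plane has values in [u > 0];
    as the integral of [Re (u + iv)^p] over a horizontal line does not depend on
    the line and so vanishes, and [|v|^p <= A u^p - B Re (u + iv)^p] for suitable
    [A, B], the conjugate Poisson integral is bounded on L^p.  Duality gives
    [p > 2], and the semigroup property together with the Hardy-Littlewood theorem
    gives the maximal version.

    On Schwartz functions Fourier inversion exhibits the Riesz transforms as the
    multipliers [-i xi_j / |xi|], so [R_i R_j] has the symmetric multiplier
    [- xi_i xi_j / |xi|^2].  Density of Schwartz functions turns this into almost
    everywhere convergence of the truncations and commutation of the Riesz
    transforms on L^p; associativity of the Clifford product then makes both
    sides of the statement equal to the same double sum.

    Finally, for a unit vector [m] the map [w |-> m w^ m], where [w^] is the main
    involution, is a homomorphism of the exterior product, because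
    [2 v /\ w = v w + w^ v] for vectors [v].  It fixes [1] and sends a vector [v]
    to [- m v m = v - 2 <m, v> m], hence is the exterior extension of the
    reflection. *)
From HB Require Import structures.
Require Import Defs.
From mathcomp Require Import all_boot all_order all_algebra.
From mathcomp Require Import all_classical all_reals all_analysis.
From mathcomp Require Import measurable_realfun lebesgue_integral_under.
From mathcomp Require Import ring lra.
Set Implicit Arguments.
Unset Strict Implicit.
Unset Printing Implicit Defensive.
Import Order.TTheory GRing.Theory Num.Theory.
Import numFieldNormedType.Exports.
Local Open Scope classical_set_scope.
Local Open Scope ring_scope.

(** [riesz] is a pointwise [lim] of truncations, so the limit has to be shown to exist almost
    everywhere for every L^p field. An abstract bounded extension would not do, whence the maximal
    inequality. Each maximal bound is stated for a finite list of radii, uniformly in the list; only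
    later do the lists exhaust the positive rationals.

    In the factorisation an outer [riesz] acts on an inner one, which is known only off a null set
    and takes default values where the limit fails. Integrals ignore null sets even for integrands
    not known to be measurable, so the inner transform can be exchanged for the representative [rz]
    without changing the outer one at any point.

    Two classical evaluations are bypassed. The constant [2 / sigma] comes from layer-cake
    identities for the Gaussian in which the volume of the ball stays unknown, so no Gamma function
    appears. The multiplier is found by passing to the limit inside a Gaussian average, so the
    Dirichlet integral is never computed. *)

Notation intg mu f := (mu.-integrable setT (EFin \o f)).

(** * Parameter integrals and changes of variables *)

Section integration.
Context d (T : measurableType d) (R : realType).
Variable mu : {measure set T -> \bar R}.
Implicit Types f g : T -> R.

Lemma intg_measurable f : intg mu f -> measurable_fun setT f.
Proof. by move=> /measurable_int/measurable_EFinP. Qed.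

Lemma intgP f : measurable_fun setT f ->
  (\int[mu]_x `|f x|%:E < +oo)%E -> intg mu f.
Proof. by move=> mf foo; apply/integrableP; split => //; exact/measurable_EFinP. Qed.

Lemma intg_lty f : intg mu f -> (\int[mu]_x `|f x|%:E < +oo)%E.
Proof. by move=> /integrableP[]. Qed.

(* Monotonicity needs no measurability: the integral of a nonnegative function
   is a supremum over simple functions. *)
Lemma int_mono (f g : T -> \bar R) : (forall x, 0 <= f x)%E ->
  (forall x, f x <= g x)%E -> (\int[mu]_x f x <= \int[mu]_x g x)%E.
Proof.
move=> f0 fg; rewrite !ge0_integralTE//; last by move=> x; exact: le_trans (fg x).
apply: le_ereal_sup => _ [h /= hf <-]; exists h => //= x.
exact: le_trans (hf x) (fg x).
Qed.

Lemma int_Zl (k : R) f : 0 <= k -> measurable_fun setT f -> (forall x, 0 <= f x) ->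
  (\int[mu]_x (k * f x)%:E = k%:E * \int[mu]_x (f x)%:E)%E.
Proof.
move=> k0 mf f0; rewrite -ge0_integralZl//; first exact/measurable_EFinP.
by move=> x _; rewrite lee_fin.
Qed.

Lemma int_Zr (k : R) f : 0 <= k -> measurable_fun setT f -> (forall x, 0 <= f x) ->
  (\int[mu]_x (f x * k)%:E = (\int[mu]_x (f x)%:E) * k%:E)%E.
Proof.
move=> k0 mf f0; rewrite muleC -int_Zl//.
by apply: eq_integral => x _; rewrite mulrC.
Qed.

Lemma intg_le g f : measurable_fun setT f -> (forall x, `|f x| <= g x) ->
  intg mu g -> intg mu f.
Proof.
move=> mf fg; apply: le_integrable => //; first exact/measurable_EFinP.
by move=> x _ /=; rewrite lee_fin (le_trans (fg x))// ler_norm.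
Qed.

Lemma intgD f g : intg mu f -> intg mu g -> intg mu (fun x => f x + g x).
Proof.
by move=> fi gi; apply: eq_integrable (integrableD measurableT fi gi).
Qed.

Lemma intgZ a f : intg mu f -> intg mu (fun x => a * f x).
Proof.
by move=> fi; apply: eq_integrable (integrableZl measurableT a fi).
Qed.

Lemma intgB f g : intg mu f -> intg mu g -> intg mu (fun x => f x - g x).
Proof.
by move=> fi gi; apply: eq_integrable (integrableB measurableT fi gi).
Qed.

Lemma intg_norm f : intg mu f -> intg mu (fun x => `|f x|).
Proof.
by move=> fi; apply: eq_integrable (integrable_abse fi).
Qed.

Lemma intg0 : intg mu (fun=> 0).
Proof. exact: integrable0. Qed.

Lemma intg_sum (I : Type) (r : seq I) (F : I -> T -> R) :
  (forall i, intg mu (F i)) -> intg mu (fun x => \sum_(i <- r) F i x).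
Proof.
move=> Fi; elim: r => [|i r IHr].
  by apply: eq_integrable intg0 => // x _ /=; rewrite big_nil.
by apply: eq_integrable (intgD (Fi i) IHr) => // x _ /=; rewrite big_cons.
Qed.

Lemma RintD f g : intg mu f -> intg mu g ->
  \int[mu]_x (f x + g x) = \int[mu]_x f x + \int[mu]_x g x.
Proof. by move=> fi gi; rewrite -RintegralD. Qed.

Lemma RintB f g : intg mu f -> intg mu g ->
  \int[mu]_x (f x - g x) = \int[mu]_x f x - \int[mu]_x g x.
Proof. by move=> fi gi; rewrite -RintegralB. Qed.

Lemma RintZ a f : intg mu f -> \int[mu]_x (a * f x) = a * \int[mu]_x f x.
Proof. by move=> fi; rewrite -RintegralZl. Qed.

Lemma eq_Rint f g : f =1 g -> \int[mu]_x f x = \int[mu]_x g x.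
Proof. by move=> fg; apply: eq_Rintegral. Qed.

Lemma Rint_sum (I : Type) (r : seq I) (F : I -> T -> R) :
  (forall i, intg mu (F i)) ->
  \int[mu]_x (\sum_(i <- r) F i x) = \sum_(i <- r) \int[mu]_x F i x.
Proof.
move=> Fi; elim: r => [|i r IHr].
  by under eq_Rint do rewrite big_nil; rewrite big_nil /Rintegral integral0.
rewrite big_cons -IHr -RintD//; last exact: intg_sum.
by apply: eq_Rint => x; rewrite big_cons.
Qed.

Lemma EFin_Rint f : intg mu f -> (\int[mu]_x f x)%:E = (\int[mu]_x (f x)%:E)%E.
Proof. by move=> fi; rewrite fineK//; exact: integrable_fin_num. Qed.

Lemma le_Rint f g : intg mu f -> intg mu g -> (forall x, f x <= g x) ->
  \int[mu]_x f x <= \int[mu]_x g x.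
Proof. by move=> fi gi fg; apply: le_Rintegral. Qed.

Lemma le_normr_Rint f : intg mu f -> `|\int[mu]_x f x| <= \int[mu]_x `|f x|.
Proof. by move=> fi; exact: le_normr_Rintegral. Qed.

(** An infinite right-hand side makes the bound trivial. It can therefore be used at every point for
    the sections of a product integrand, including the sections that are not integrable. *)
Lemma abse_Rint_le f : measurable_fun setT f ->
  (`|\int[mu]_x f x|%:E <= \int[mu]_x `|f x|%:E)%E.
Proof.
move=> mf; have [foo|foo] := ltP (\int[mu]_x `|f x|%:E)%E +oo%E.
  have fi := intgP mf foo.
  by rewrite -EFin_Rint ?lee_fin; [exact: le_normr_Rint|exact: intg_norm].
by move: foo; rewrite leye_eq => /eqP ->; rewrite leey.
Qed.

Lemma Rint_dct (f_ : nat -> T -> R) f g :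
  (forall n, measurable_fun setT (f_ n)) ->
  (forall x, f_ ^~ x @ \oo --> f x) -> intg mu g ->
  (forall n x, `|f_ n x| <= g x) ->
  intg mu f /\ (\int[mu]_x f_ n x) @[n --> \oo] --> \int[mu]_x f x.
Proof.
move=> mf cf gi fg.
have mlim : measurable_fun setT f by exact: measurable_fun_cvg (fun x _ => cf x).
have [] := @dominated_convergence _ T R mu setT measurableT
  (fun n => EFin \o f_ n) (EFin \o f) (EFin \o g).
- by move=> n; exact/measurable_EFinP.
- exact/measurable_EFinP.
- by apply: aeW => x _; apply: cvg_EFin; [exact: nearW|exact: cf].
- exact: gi.
- by apply: aeW => x n _ /=; rewrite lee_fin.
move=> fi _ cvi; split => //.
by move: cvi; rewrite -EFin_Rint// => /fine_cvgP[].
Qed.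

End integration.

(** * Fubini and Tonelli for real-valued integrands *)

Section fubini.
Context d1 d2 (T1 : measurableType d1) (T2 : measurableType d2) (R : realType).
Variables (m1 : {sigma_finite_measure set T1 -> \bar R}).
Variables (m2 : {sigma_finite_measure set T2 -> \bar R}).
Implicit Types F : T1 -> T2 -> R.

Lemma measurable_curry_l F x : measurable_fun setT (fun z => F z.1 z.2) ->
  measurable_fun setT (F x).
Proof. by move=> mF; exact: (measurableT_comp mF (measurable_pair1 x)). Qed.

Lemma measurable_curry_r F y : measurable_fun setT (fun z => F z.1 z.2) ->
  measurable_fun setT (F ^~ y).
Proof. by move=> mF; exact: (measurableT_comp mF (measurable_pair2 y)). Qed.

Lemma measurable_swap F : measurable_fun setT (fun z => F z.1 z.2) ->
  measurable_fun setT (fun z : T2 * T1 => F z.2 z.1).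
Proof.
move=> mF.
exact: (measurableT_comp mF (measurable_fun_pair measurable_snd measurable_fst)).
Qed.

(** Tonelli applied to the positive and negative parts gives measurability also where the section is
    not integrable and the real integral is a default value. *)
Lemma measurable_Rint_l F : measurable_fun setT (fun z => F z.1 z.2) ->
  measurable_fun setT (fun x => \int[m2]_y F x y).
Proof.
move=> mF; rewrite /Rintegral; apply: measurableT_comp => //.
have mFE : measurable_fun setT (fun z : T1 * T2 => (F z.1 z.2)%:E).
  exact/measurable_EFinP.
rewrite [X in measurable_fun _ X](_ : _ = (fun x =>
  \int[m2]_y (fun z : T1 * T2 => (F z.1 z.2)%:E)^\+%E (x, y) -
  \int[m2]_y (fun z : T1 * T2 => (F z.1 z.2)%:E)^\-%E (x, y))%E); last first.
  apply/funext => x; rewrite [LHS]integralE; congr (_ - _)%E;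
    apply: eq_integral => y _.
    exact: (congr1 (@^~ y) (funepos_comp (fun z => (F z.1 z.2)%:E) (pair x))).
  exact: (congr1 (@^~ y) (funeneg_comp (fun z => (F z.1 z.2)%:E) (pair x))).
apply: emeasurable_funB.
- apply: (measurable_fun_fubini_tonelli_F (m2 := m2)
    ((fun z : T1 * T2 => (F z.1 z.2)%:E)^\+%E)) => //.
  exact: measurable_funepos.
- apply: (measurable_fun_fubini_tonelli_F (m2 := m2)
    ((fun z : T1 * T2 => (F z.1 z.2)%:E)^\-%E)) => //.
  exact: measurable_funeneg.
Qed.

Lemma tonelli F : measurable_fun setT (fun z => F z.1 z.2) ->
  (forall x y, 0 <= F x y) ->
  (\int[m1]_x \int[m2]_y (F x y)%:E = \int[m2]_y \int[m1]_x (F x y)%:E)%E.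
Proof.
move=> mF F0.
have mFE : measurable_fun setT (fun z : T1 * T2 => (F z.1 z.2)%:E).
  exact/measurable_EFinP.
apply: (fubini_tonelli (m1 := m1) (m2 := m2) (fun z => (F z.1 z.2)%:E)) => //.
by move=> z; rewrite lee_fin.
Qed.

(** Absolute integrability in one fixed order of integration. Tonelli transfers it to the other
    order ([intg2_sym]), so the easier order can be the one that is bounded. *)
Definition intg2 F := measurable_fun setT (fun z => F z.1 z.2) /\
  (\int[m1]_x \int[m2]_y `|F x y|%:E < +oo)%E.

Lemma intg2_integrable F : intg2 F ->
  (m1 \x m2)%E.-integrable setT (EFin \o (fun z => F z.1 z.2)).
Proof.
move=> [mF Foo]; apply/integrable12ltyP; first exact/measurable_EFinP.
exact: Foo.
Qed.

Lemma intg2_swap F : intg2 F -> (\int[m2]_y \int[m1]_x `|F x y|%:E < +oo)%E.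
Proof.
move=> [mF Foo]; rewrite -(@tonelli (fun x y => `|F x y|))//.
exact: measurableT_comp.
Qed.

Lemma intg2_ae1 F : intg2 F -> {ae m1, forall x, intg m2 (F x)}.
Proof. by move=> /intg2_integrable/ae_integrable1. Qed.

Lemma intg2_ae2 F : intg2 F -> {ae m2, forall y, intg m1 (F ^~ y)}.
Proof. by move=> /intg2_integrable/ae_integrable2. Qed.

Lemma intg_Rint_l F : intg2 F -> intg m1 (fun x => \int[m2]_y F x y).
Proof.
move=> [mF Foo]; apply: intgP; first exact: measurable_Rint_l.
apply: le_lt_trans Foo; apply: int_mono => // x; apply: abse_Rint_le; exact: measurable_curry_l.
Qed.

End fubini.

Section fubini2.
Context d1 d2 (T1 : measurableType d1) (T2 : measurableType d2) (R : realType).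
Variables (m1 : {sigma_finite_measure set T1 -> \bar R}).
Variables (m2 : {sigma_finite_measure set T2 -> \bar R}).
Implicit Types F : T1 -> T2 -> R.

Lemma intg2_sym F : intg2 m1 m2 F -> intg2 m2 m1 (fun y x => F x y).
Proof. by move=> iF; split; [exact: measurable_swap (iF.1)|exact: intg2_swap]. Qed.

Lemma Rint_fubini F : intg2 m1 m2 F ->
  \int[m1]_x (\int[m2]_y F x y) = \int[m2]_y (\int[m1]_x F x y).
Proof.
move=> iF; have iF' := intg2_integrable iF.
apply: EFin_inj; rewrite EFin_Rint; last exact: intg_Rint_l.
transitivity (\int[m1]_x \int[m2]_y (F x y)%:E)%E.
  apply: ae_eq_integral => //.
  - by apply/measurable_EFinP; case: iF => mF _; exact: measurable_Rint_l.
  - exact: (measurable_fubini_F iF').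
  - have := intg2_ae1 iF; apply: filterS => x ix _.
    by rewrite EFin_Rint.
rewrite (Fubini iF').
have iG : intg m2 (fun y => \int[m1]_x F x y).
  exact: intg_Rint_l (intg2_sym iF).
rewrite EFin_Rint//; apply: ae_eq_integral => //.
- exact: (measurable_fubini_G iF').
- exact/measurable_EFinP/(intg_measurable iG).
- by have := intg2_ae2 iF; apply: filterS => x ix _; rewrite EFin_Rint.
Qed.

End fubini2.

Lemma intg2_prod d1 d2 (T1 : measurableType d1) (T2 : measurableType d2)
    (R : realType) (m1 : {sigma_finite_measure set T1 -> \bar R})
    (m2 : {sigma_finite_measure set T2 -> \bar R})
    (F : T1 -> T2 -> R) (a : T1 -> R) (b : T2 -> R) :
  measurable_fun setT (fun z => F z.1 z.2) ->
  intg m1 a -> intg m2 b -> (forall x y, `|F x y| <= a x * b y) ->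
  intg2 m1 m2 F.
Proof.
move=> mF ia ib Fab; split => //.
apply: (@le_lt_trans _ _ (\int[m1]_x \int[m2]_y (`|a x| * `|b y|)%:E)%E).
  apply: int_mono => x; first exact: integral_ge0.
  apply: int_mono => y //; rewrite lee_fin (le_trans (Fab x y))//.
  by rewrite -normrM ler_norm.
under eq_integral => x _.
  rewrite (_ : (\int[m2]_y _)%E = (`|a x|%:E * \int[m2]_y `|b y|%:E)%E).
    over.
  rewrite -ge0_integralZl//; last first.
  by apply/measurable_EFinP; apply: measurableT_comp (intg_measurable ib).
rewrite ge0_integralZr//; last 2 first.
- by apply/measurable_EFinP; apply: measurableT_comp (intg_measurable ia).
- exact: integral_ge0.
rewrite lte_mul_pinfty ?integral_ge0//; last exact: intg_lty.
by rewrite ge0_fin_numE ?integral_ge0//; exact: intg_lty.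
Qed.

(** * Change of variables along a map that scales measure by a constant *)

Section transport.
Context d1 d2 (X : measurableType d1) (Y : measurableType d2) (R : realType).
Variables (mu : {measure set X -> \bar R}) (nu : {measure set Y -> \bar R}).
Variables (phi : X -> Y) (mphi : measurable_fun setT phi) (c : R).
Hypothesis c_gt0 : 0 < c.
Hypothesis nuE : forall A, measurable A -> nu A = (c%:E * mu (phi @^-1` A))%E.

Let push : {measure set Y -> \bar R} :=
  measure_function_pushforward__canonical__measure_function_Measure mu mphi.
Let cnn : {nonneg R} := NngNum (ltW c_gt0).

Lemma ge0_int_transport (f : Y -> \bar R) : measurable_fun setT f ->
  (forall y, 0 <= f y)%E ->
  (\int[nu]_y f y = c%:E * \int[mu]_x f (phi x))%E.
Proof.
move=> mf f0; rewrite -[c]/(cnn%:num).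
transitivity (\int[mscale cnn push]_y f y)%E.
  by apply: eq_measure_integral => A mA _; exact: nuE.
by rewrite ge0_integral_mscale// (ge0_integral_pushforward mphi).
Qed.

Lemma intg_transport (f : Y -> R) : intg nu f -> intg mu (f \o phi).
Proof.
move=> fi; have mf := intg_measurable fi; apply: intgP.
  exact: measurableT_comp.
have := intg_lty fi; rewrite (ge0_int_transport (f := fun y => `|f y|%:E))//; last first.
  by apply/measurable_EFinP; exact: measurableT_comp.
apply: contraTT; rewrite -!leNgt !leye_eq => /eqP ->.
by rewrite gt0_muley ?lte_fin.
Qed.

Lemma Rint_transport (f : Y -> R) : intg nu f ->
  \int[nu]_y f y = c * \int[mu]_x f (phi x).
Proof.
move=> fi; have mf := intg_measurable fi.
have mfE : measurable_fun setT (EFin \o f) by exact/measurable_EFinP.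
apply: EFin_inj; rewrite EFinM !EFin_Rint//; last exact: intg_transport.
rewrite integralE [in RHS]integralE.
rewrite (ge0_int_transport (f := (EFin \o f)^\+%E))//; last exact: measurable_funepos.
rewrite (ge0_int_transport (f := (EFin \o f)^\-%E))//; last exact: measurable_funeneg.
rewrite (funepos_comp (EFin \o f) phi : (fun x => (f (phi x))%:E)^\+%E = _).
rewrite (funeneg_comp (EFin \o f) phi : (fun x => (f (phi x))%:E)^\-%E = _).
rewrite [RHS]muleBr// fin_num_adde_defl// fin_numN -(funeneg_comp (EFin \o f) phi).
exact: (integrable_neg_fin_num measurableT (intg_transport fi)).
Qed.

End transport.

Section affine.
Context (R : realType).
Local Notation leb := (@lebesgue_measure R).
Implicit Types a b : R.

Lemma measurable_affine a b :
  measurable_fun setT (fun x : measurableTypeR R => a * x + b : measurableTypeR R).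
Proof. by apply: measurable_funD => //; exact: measurable_funM. Qed.

(** Both sides are measures that agree on half-open intervals, and such a measure is Lebesgue
    measure. *)
Let leb_affine_gt0 a b (A : set (measurableTypeR R)) : 0 < a -> measurable A ->
  leb A = (a%:E * leb ((fun x : measurableTypeR R => (a * x + b)%R : measurableTypeR R) @^-1` A))%E.
Proof.
move=> a0 mA.
pose push : {measure set (measurableTypeR R) -> \bar R} :=
  measure_function_pushforward__canonical__measure_function_Measure leb
    (measurable_affine a b).
apply: (lebesgue_measure_unique (mu := mscale (NngNum (ltW a0)) push)) => //.
move=> _ [[x y]] _ <-; rewrite /=.
transitivity (a%:E * leb ((fun r : R => (a * r + b)%R) @^-1` `]x, y]%classic))%E => //.
rewrite (_ : (fun r => a * r + b) @^-1` _ = `](x - b) / a, (y - b) / a]%classic); last first.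
  apply/seteqP; split=> z /=; rewrite !in_itv/= ltr_pdivrMr// ler_pdivlMr//;
    by rewrite ltrBlDr lerBrDr [z * a]mulrC.
rewrite !lebesgue_measure_itv/= !lte_fin ltr_pM2r ?invr_gt0// ltrD2r.
case: ifPn => xy; last by rewrite mule0.
rewrite -!EFinB -EFinM; congr _%:E.
by rewrite mulrC -mulrBl mulrVK ?unitfE ?gt_eqF//; ring.
Qed.

Lemma leb_affine a b (A : set (measurableTypeR R)) : a != 0 -> measurable A ->
  leb A = (`|a|%:E * leb ((fun x : measurableTypeR R => (a * x + b)%R : measurableTypeR R) @^-1` A))%E.
Proof.
move=> a0 mA; have [a_gt0|] := ltP 0 a; first by rewrite gtr0_norm//; exact: leb_affine_gt0.
rewrite le_eqVlt (negPf a0)/= => alt0; rewrite ltr0_norm//.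
have na0 : 0 < - a by rewrite oppr_gt0.
rewrite (leb_affine_gt0 b na0 mA); congr (_ * _)%E.
rewrite -[LHS]lebesgue_measureN.
  by congr (lebesgue_measure _); apply/seteqP; split=> x /=; rewrite mulrNN.
by rewrite -[X in measurable X]setTI; exact: measurable_affine.
Qed.

Lemma ge0_int_affine a b (f : R -> \bar R) : a != 0 -> measurable_fun setT f ->
  (forall x, 0 <= f x)%E ->
  (\int[leb]_x f x = `|a|%:E * \int[leb]_x f (a * x + b)%R)%E.
Proof.
move=> a0 mf f0; have na0 : 0 < `|a| by rewrite normr_gt0.
exact: (ge0_int_transport (measurable_affine a b) na0 (fun A => @leb_affine a b A a0)).
Qed.

Lemma intg_affine a b (f : R -> R) : a != 0 -> intg leb f ->
  intg leb (fun x => f (a * x + b)).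
Proof.
move=> a0; have na0 : 0 < `|a| by rewrite normr_gt0.
exact: (intg_transport (measurable_affine a b) na0 (fun A => @leb_affine a b A a0)).
Qed.

Lemma Rint_affine a b (f : R -> R) : a != 0 -> intg leb f ->
  \int[leb]_x f x = `|a| * \int[leb]_x f (a * x + b).
Proof.
move=> a0; have na0 : 0 < `|a| by rewrite normr_gt0.
exact: (Rint_transport (measurable_affine a b) na0 (fun A => @leb_affine a b A a0)).
Qed.

End affine.

Section powers.
Context d (T : measurableType d) (R : realType).
Variable mu : {measure set T -> \bar R}.

Lemma measurable_fun_powR (f : T -> R) p : measurable_fun setT f ->
  measurable_fun setT (fun x => f x `^ p).
Proof. by move=> mf; exact: (measurableT_comp (measurable_powR p)). Qed.

Lemma powRD_le (a b p : R) : 0 <= a -> 0 <= b -> 0 <= p ->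
  (a + b) `^ p <= 2 `^ p * (a `^ p + b `^ p).
Proof.
move=> a0 b0 p0; wlog ab : a b a0 b0 / a <= b.
  by move=> h; have [/h->//|/ltW/h] := leP a b; rewrite addrC [X in _ * X]addrC; apply.
apply: (@le_trans _ _ ((2 * b) `^ p)).
  by apply: ge0_ler_powR; rewrite ?nnegrE//; lra.
by rewrite powRM// ler_wpM2l ?powR_ge0// lerDr powR_ge0.
Qed.

Lemma hoelder_int (f g : T -> R) p q : measurable_fun setT f ->
  measurable_fun setT g -> 0 < p -> 0 < q -> p^-1 + q^-1 = 1 ->
  (\int[mu]_x `|f x * g x|%:E <=
   (\int[mu]_x (`|f x| `^ p)%:E) `^ p^-1 * (\int[mu]_x (`|g x| `^ q)%:E) `^ q^-1)%E.
Proof.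
move=> mf mg p0 q0 pq.
by have := hoelder mu mf mg p0 q0 pq; rewrite Lnorm1 unlock.
Qed.

(** Hölder's inequality for [w^(1/p) g] and [w^(1/q)] with [q] conjugate to [p]; after raising to
    the power [p] the second factor carries the exponent [p / q = p - 1]. *)
Lemma jensen_int (w g : T -> R) p : 1 < p -> intg mu w -> measurable_fun setT g ->
  (forall x, 0 <= w x) -> (forall x, 0 <= g x) ->
  ((\int[mu]_x (w x * g x)%:E) `^ p <=
    ((\int[mu]_x w x) `^ (p - 1))%:E * \int[mu]_x (w x * g x `^ p)%:E)%E.
Proof.
move=> p1 wi mg w0 g0; have p0 : 0 < p by lra.
pose q := p / (p - 1); have q0 : 0 < q by apply: divr_gt0; lra.
have pq : p^-1 + q^-1 = 1 by rewrite /q invf_div; field; lra.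
have mw := intg_measurable wi.
have mwp r : measurable_fun setT (fun x => w x `^ r) by exact: measurable_fun_powR.
have mf : measurable_fun setT (fun x => w x `^ p^-1 * g x) by exact: measurable_funM.
have := hoelder_int mf (mwp q^-1) p0 q0 pq.
under eq_integral => x _.
  rewrite mulrAC -powRD; last by rewrite pq oner_eq0.
  rewrite pq powRr1// ger0_norm ?mulr_ge0//.
  over.
under [X in (_ <= X `^ _ * _)%E -> _]eq_integral => x _.
  rewrite ger0_norm ?mulr_ge0 ?powR_ge0// powRM ?powR_ge0// -powRrM mulVf ?gt_eqF// powRr1//.
  over.
under [X in (_ <= _ * X `^ _)%E -> _]eq_integral => x _.
  rewrite ger0_norm ?powR_ge0// -powRrM mulVf ?gt_eqF// powRr1//.
  over.
rewrite -(EFin_Rint wi).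
have i0 : (0 <= \int[mu]_x (w x * g x)%:E)%E.
  by apply: integral_ge0 => x _; rewrite lee_fin mulr_ge0.
have j0 : (0 <= \int[mu]_x (w x * g x `^ p)%:E)%E.
  by apply: integral_ge0 => x _; rewrite lee_fin mulr_ge0// powR_ge0.
move=> /(gt0_ler_poweR (ltW p0)) => /(_ _ _)/le_trans; apply.
- by rewrite in_itv/= i0 leey.
- rewrite in_itv; apply/andP; split; last exact: leey.
  by apply: mule_ge0; exact: poweR_ge0.
rewrite poweRM ?poweR_ge0// -poweRrM mulVf ?gt_eqF// poweRe1//.
rewrite -poweRrM poweR_EFin muleC; rewrite (_ : q^-1 * p = p - 1)//.
by rewrite /q invf_div mulrVK ?unitfE ?gt_eqF.
Qed.

End powers.

Section finite_max.
Context (R : realDomainType) (I : Type).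

(** Suprema over truncation radii are taken over finite lists, which keeps them measurable and lets
    a common lower bound of the radii be chosen. The base value 0 is harmless, because the families
    are nonnegative. *)
Definition mx (E : seq I) (F : I -> R) : R := \big[Num.max/0]_(e <- E) F e.

Lemma mx_ge0 E F : 0 <= mx E F.
Proof. by rewrite /mx; elim/big_rec: _ => // i x _ x0; rewrite le_max x0 orbT. Qed.

End finite_max.

Lemma mx_le_in (R : realDomainType) (I : eqType) (E : seq I) (F : I -> R) b :
  0 <= b -> {in E, forall e, F e <= b} -> mx E F <= b.
Proof.
move=> b0 Fb; rewrite /mx big_seq; elim/big_rec: _ => // i x /Fb h xb.
by rewrite ge_max h.
Qed.

Lemma le_mx (R : realDomainType) (I : eqType) (E : seq I) (F : I -> R) e :
  e \in E -> F e <= mx E F.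
Proof.
rewrite /mx; elim: E => // i E IHE; rewrite inE big_cons le_max => /orP[/eqP->|/IHE->].
  by rewrite lexx.
by rewrite orbT.
Qed.

Lemma measurable_mx d (T : measurableType d) (R : realType) (I : Type) (E : seq I)
  (F : I -> T -> R) : (forall e, measurable_fun setT (F e)) ->
  measurable_fun setT (fun x => mx E (F ^~ x)).
Proof.
move=> mF; rewrite /mx; elim: E => [|e E IHE].
  rewrite [X in measurable_fun _ X](_ : _ = cst 0)//.
  by apply/funext => x; rewrite big_nil.
rewrite [X in measurable_fun _ X](_ : _ =
    (fun x => Num.max (F e x) (\big[Num.max/0]_(j <- E) F j x))).
  exact: measurable_maxr.
by apply/funext => x; rewrite big_cons.
Qed.

(** * Fundamental theorem of calculus on segments and half-lines *)

Section calculus.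
Context (R : realType).
Local Notation leb := (@lebesgue_measure R).
Implicit Types F f : R -> R.

Lemma is_derive_cont f (x df : R) : is_derive x 1 f df -> {for x, continuous f}.
Proof.
by move=> dfx; apply: differentiable_continuous; apply/derivable1_diffP.
Qed.

Lemma ftc F f (a b : R) : a <= b ->
  (forall x, a <= x <= b -> is_derive x 1 F (f x)) ->
  (forall x, a <= x <= b -> {for x, continuous f}) ->
  (\int[leb]_(x in `[a, b]) (f x)%:E)%E = (F b - F a)%:E.
Proof.
rewrite le_eqVlt => /predU1P[<-|ab] dF cf.
  by rewrite set_itv1 integral_set1 subrr.
rewrite EFinB; apply: continuous_FTC2 => //.
- apply: continuous_in_subspaceT => x; rewrite inE/= in_itv/=; exact: cf.
- split.
  + by move=> x; rewrite in_itv/= => /andP[/ltW ax /ltW xb]; apply: ex_derive; apply: dF; rewrite ax.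
  + apply: cvg_at_right_filter; apply: is_derive_cont; apply: dF; rewrite lexx ltW//.
  + apply: cvg_at_left_filter; apply: is_derive_cont; apply: dF; rewrite lexx ltW//.
- move=> x; rewrite in_itv/= => /andP[/ltW ax /ltW xb].
  by rewrite derive1E; apply: derive_val; apply: dF; rewrite ax.
Qed.

Lemma ftcR F f (a b : R) : a <= b ->
  (forall x, a <= x <= b -> is_derive x 1 F (f x)) ->
  (forall x, a <= x <= b -> {for x, continuous f}) ->
  \int[leb]_(x in `[a, b]) f x = F b - F a.
Proof. by move=> ab dF cf; rewrite /Rintegral (ftc ab dF cf). Qed.

Lemma ftcy F f (a l : R) : (forall x, a <= x -> is_derive x 1 F (f x)) ->
  (forall x, a <= x -> {for x, continuous f}) ->
  (forall x, a <= x -> 0 <= f x) -> F x @[x --> +oo] --> l ->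
  (\int[leb]_(x in `]a, +oo[) (f x)%:E)%E = (l - F a)%:E.
Proof.
move=> dF cf f0 Fl; have cF x : a <= x -> {for x, continuous F}.
  by move=> /dF/is_derive_cont.
have cfw : {within `[a, +oo[, continuous f}.
  by apply: continuous_in_subspaceT => x; rewrite inE/= in_itv/= andbT; exact: cf.
rewrite integral_itv_obnd_cbnd; last first.
  apply/measurable_EFinP; apply: (@measurable_funS _ _ _ _ `[a, +oo[%classic) => //.
    by apply: subset_itv => //=; rewrite bnd_simp.
  exact: subspace_continuous_measurable_fun.
rewrite EFinB; apply: ge0_continuous_FTC2y => //.
- by move=> x /ltW/dF dx; apply: ex_derive.
- by apply: cvg_at_right_filter; exact: cF.
- move=> x; rewrite in_itv/= andbT => /ltW/dF dx.
  by rewrite derive1E; exact: derive_val.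
Qed.

End calculus.

Lemma measurable_natr_bool d (T : measurableType d) (R : realType) (b : T -> bool) :
  measurable_fun setT b -> measurable_fun setT (fun x => (b x)%:R : R).
Proof.
move=> mb; rewrite (_ : (fun _ => _) = \1_(b @^-1` [set true])).
  apply: measurable_indic; rewrite -[X in measurable X]setTI; exact: mb.
apply/funext => x; rewrite indicE; congr (_%:R).
by case E : (b x); [rewrite mem_set|rewrite memNset//= E].
Qed.

Lemma int_mct d (T : measurableType d) (R : realType)
    (mu : {measure set T -> \bar R}) (g : nat -> T -> \bar R) (f : T -> \bar R) :
  (forall n, measurable_fun setT (g n)) -> (forall n x, 0 <= g n x)%E ->
  (forall x, nondecreasing_seq (g ^~ x)) -> (forall x, g ^~ x @ \oo --> f x) ->
  (\int[mu]_x g n x)%E @[n --> \oo] --> (\int[mu]_x f x)%E.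
Proof.
move=> mg g0 ndg gf.
have := @cvg_monotone_convergence _ _ R mu setT measurableT g mg
  (fun n x _ => g0 n x) (fun x _ => ndg x).
rewrite (_ : (\int[mu]_x limn (g ^~ x))%E = (\int[mu]_x f x)%E)//.
by apply: eq_integral => x _; exact/cvg_lim.
Qed.

Section layer_cake.
Context (R : realType).
Local Notation leb := (@lebesgue_measure R).

Lemma measurable_invr : measurable_fun setT (fun x : R => x^-1).
Proof.
have m0 : measurable ([set 0] : set R) by exact: measurable_set1.
have mC : measurable (~` [set 0] : set R) by exact: measurableC.
rewrite -(setUv [set 0]); apply/measurable_funU => //; split.
  have h : measurable_fun [set 0 : R] (fun _ : R => 0 : R) by exact: measurable_cst.
  by apply: eq_measurable_fun h => x; rewrite inE/= => ->; rewrite invr0.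
apply: open_continuous_measurable_fun.
  rewrite openC; exact: closed_eq.
by move=> x; rewrite inE => /eqP x0; exact: inv_continuous.
Qed.

Lemma measurable_inv d (T : measurableType d) (f : T -> R) :
  measurable_fun setT f -> measurable_fun setT (fun x => (f x)^-1).
Proof. by move=> mf; exact: (measurableT_comp measurable_invr mf). Qed.

Lemma int_natr_bool d (T : measurableType d) (mu : {measure set T -> \bar R})
    (b : T -> bool) (f : T -> R) :
  (\int[mu]_x ((b x)%:R * f x)%:E = \int[mu]_(x in [set x | b x]) (f x)%:E)%E.
Proof.
rewrite [RHS]integral_mkcond; apply: eq_integral => x _; rewrite patchE.
by case: ifPn; rewrite ?notin_setE ?inE/=; [move=> ->; rewrite mul1r|move/negP/negPf->; rewrite mul0r].
Qed.

Lemma Rint_natr_bool d (T : measurableType d) (mu : {measure set T -> \bar R})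
    (b : T -> bool) (f : T -> R) :
  \int[mu]_x ((b x)%:R * f x) = \int[mu]_(x in [set x | b x]) f x.
Proof. by rewrite /Rintegral int_natr_bool. Qed.

Lemma measurable_lec (c : R) : measurable_fun setT (fun x : R => c <= x).
Proof. exact: measurable_fun_ler. Qed.

Lemma measurable_gec (c : R) : measurable_fun setT (fun x : R => x <= c).
Proof. exact: measurable_fun_ler. Qed.

Lemma measurable_ltc (c : R) : measurable_fun setT (fun x : R => c < x).
Proof. exact: measurable_fun_ltr. Qed.

Lemma measurable_gtc (c : R) : measurable_fun setT (fun x : R => x < c).
Proof. exact: measurable_fun_ltr. Qed.

(** For [r < 1] the integrand is unbounded at 0, so the interval is exhausted by [[1/(n+1), a]],
    where [x^r / r] is an antiderivative. Exponents below 1 do occur: [r = p - 1] in the maximal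
    inequality and [r = 1 - n/s] for the tail of the Riesz kernel. *)
Lemma powR_layer (r a : R) : 0 < r -> 0 <= a ->
  (\int[leb]_x ((0 < x <= a)%R%:R * x `^ (r - 1))%:E = (r^-1 * a `^ r)%:E)%E.
Proof.
move=> r0; rewrite le_eqVlt => /predU1P[<-|a0].
  rewrite powR0 ?gt_eqF// mulr0 integral0_eq// => x _.
  by case: ltP => x0; rewrite ?mul0r// leNgt x0 mul0r.
pose c n : R := n.+1%:R^-1.
have c0 n : 0 < c n by rewrite invr_gt0.
pose g n (x : R) : \bar R := ((c n <= x <= a)%R%:R * x `^ (r - 1))%:E.
have mg n : measurable_fun setT (g n).
  apply/measurable_EFinP; apply: measurable_funM.
    apply: measurable_natr_bool; apply: measurable_and; first exact: measurable_lec.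
    exact: measurable_gec.
  exact: measurable_fun_powR.
have ig n : (\int[leb]_x g n x = (if c n <= a then r^-1 * a `^ r - r^-1 * c n `^ r else 0)%:E)%E.
  rewrite int_natr_bool; case: ifPn => ca; last first.
    rewrite (_ : [set _ | _] = set0) ?integral_set0//.
    by apply/seteqP; split => x//= /andP[/le_trans h /h]; rewrite (negPf ca).
  rewrite (_ : [set _ | _] = `[c n, a]%classic); last first.
    by apply/seteqP; split => x/=; rewrite in_itv.
  apply: (@ftc _ (fun x => r^-1 * x `^ r)) => // x /andP[cx xa];
    have x0 : 0 < x by exact: lt_le_trans cx.
  - have dx := @is_derive1_powR R r x x0.
    apply: is_derive_eq; rewrite ?scaler0 ?addr0 ?add0r /GRing.scale/=.
    by rewrite mulrA mulVf ?mul1r// gt_eqF.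
  - exact: is_derive_cont (@is_derive1_powR R (r - 1) x x0).
have gf x : g ^~ x @ \oo --> ((0 < x <= a)%R%:R * x `^ (r - 1))%:E.
  have [x0|x0] := ltP 0 x.
    apply: cvg_near_cst; near=> n; rewrite /g (_ : c n <= x)//.
    by apply: ltW; near: n; exact: (near_infty_natSinv_lt (PosNum x0)).
  apply: cvg_near_cst; near=> n; rewrite /g (_ : c n <= x = false)//.
  by apply/negbTE; rewrite -ltNge (le_lt_trans x0).
have g0 n x : (0 <= g n x)%E by rewrite lee_fin mulr_ge0 ?powR_ge0.
have ndg x : nondecreasing_seq (g ^~ x).
  move=> m n mn; rewrite lee_fin ler_wpM2r ?powR_ge0// ler_nat.
  case: (leP x a); rewrite ?andbF ?andbT// => _.
  have := le_trans (_ : c n <= c m); move/(_ x).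
  by case: (c m <= x) => [->//|//]; rewrite lef_pV2 ?posrE// ler_nat.
have /cvg_lim <-// := int_mct (mu := leb) mg g0 ndg gf.
apply/cvg_lim => //; rewrite (funext ig : (fun n => _) = _).
apply: cvg_EFin; first exact: nearW.
have cc0 : c n @[n --> \oo] --> 0 by exact: cvg_harmonic.
have : (r^-1 * a `^ r - r^-1 * c n `^ r) @[n --> \oo] --> r^-1 * a `^ r - r^-1 * 0.
  apply: cvgB; first exact: cvg_cst.
  apply: cvgM; first exact: cvg_cst.
  by have /cvg_at_rightP := powR_cvg0 r0; apply; split.
rewrite mulr0 subr0.
apply: cvg_trans; apply: near_eq_cvg; near=> n.
rewrite /= ifT//; near: n.
by apply: (cvgr_le _ cc0).
Unshelve. all: by end_near. Qed.

End layer_cake.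

(** * Conjugate functions on the line *)

Section kernels.
Context (R : realType).
Local Notation leb := (@lebesgue_measure R).
Implicit Types e t x : R.

(** The Poisson kernel, the conjugate Poisson kernel and the truncated Hilbert kernel, all without
    the factor [1 / pi]; accordingly [pk e] has integral [pi]. *)
Definition pk e t : R := e / (t ^+ 2 + e ^+ 2).
Definition qk e t : R := t / (t ^+ 2 + e ^+ 2).
Definition hk e t : R := (e < `|t|)%R%:R / t.

Definition cv (k g : R -> R) (x : R) : R := \int[leb]_t (k (x - t) * g t).

Lemma sqrD_gt0 e t : 0 < e -> 0 < t ^+ 2 + e ^+ 2.
Proof. by move=> e0; rewrite ltr_wpDl ?sqr_ge0// exprn_gt0. Qed.

Lemma pk_gt0 e t : 0 < e -> 0 < pk e t.
Proof. by move=> e0; rewrite divr_gt0// sqrD_gt0. Qed.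

Lemma pk_ge0 e t : 0 < e -> 0 <= pk e t.
Proof. by move=> e0; exact/ltW/pk_gt0. Qed.

Lemma pk_le e t : 0 < e -> pk e t <= e^-1.
Proof.
move=> e0; rewrite /pk ler_pdivrMr ?sqrD_gt0// mulrDr.
rewrite expr2 [e ^+ 2]expr2 mulrA mulrA mulVf ?gt_eqF// mul1r lerDr.
by rewrite -mulrA mulr_ge0 ?invr_ge0 ?(ltW e0)// -expr2 sqr_ge0.
Qed.

Lemma qk_le e t : 0 < e -> `|qk e t| <= e^-1.
Proof.
move=> e0; have h := sqrD_gt0 t e0.
rewrite /qk normrM normfV (gtr0_norm h) ler_pdivrMr// ler_pdivlMl//.
rewrite -[t ^+ 2]real_normK ?num_real//; have := normr_ge0 t; set u := `|t|; nra.
Qed.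

(** For [|t| > e] the difference is [e^2 / (t (t^2 + e^2))] with [e^2 / |t| <= e]; for [|t| <= e] it
    is [- qk e t]. In this way truncations are traded for conjugate Poisson integrals. *)
Lemma hk_sub_qk e t : 0 < e -> `|hk e t - qk e t| <= pk e t.
Proof.
move=> e0; have h := sqrD_gt0 t e0; have t2 : t ^+ 2 = `|t| ^+ 2 by rewrite real_normK ?num_real.
rewrite /hk /qk /pk; case: ltP => [et|te].
  have t0 : t != 0 by rewrite -normr_gt0; lra.
  rewrite mulr1n; have -> : 1 / t - t / (t ^+ 2 + e ^+ 2) = e ^+ 2 / t / (t ^+ 2 + e ^+ 2).
    by field; rewrite t0 gt_eqF//.
  rewrite normrM [X in _ * X]normfV (gtr0_norm h) ler_pM2r ?invr_gt0//.
  rewrite normrM normfV ger0_norm ?sqr_ge0// ler_pdivrMr; last by lra.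
  by rewrite expr2 ler_wpM2l//; lra.
rewrite mul0r sub0r normrN normrM normfV (gtr0_norm h).
by rewrite ler_wpM2r// invr_ge0 ltW.
Qed.

Lemma hk_le e t : 0 < e -> `|hk e t| <= e^-1.
Proof.
move=> e0; rewrite /hk; case: ltP => et; last by rewrite mul0r normr0 invr_ge0 ltW.
rewrite mul1r normfV lef_pV2 ?posrE ?ltW//; exact: lt_trans et.
Qed.

Lemma measurable_pk e : measurable_fun setT (pk e).
Proof.
apply: measurable_funM => //; apply: measurable_inv.
by apply: measurable_funD => //; exact: measurable_funX.
Qed.

Lemma measurable_qk e : measurable_fun setT (qk e).
Proof.
apply: measurable_funM => //; apply: measurable_inv.
by apply: measurable_funD => //; exact: measurable_funX.
Qed.

Lemma measurable_hk e : measurable_fun setT (hk e).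
Proof.
apply: measurable_funM; last exact: measurable_invr.
by apply: measurable_natr_bool; apply: measurable_fun_ltr => //.
Qed.

Lemma pkN e t : pk e (- t) = pk e t.
Proof. by rewrite /pk sqrrN. Qed.

Lemma is_derive_pk e t : 0 < e ->
  is_derive t 1 (pk e) (- (2 * e * t / (t ^+ 2 + e ^+ 2) ^+ 2)).
Proof.
move=> e0; have h : t ^+ 2 + e ^+ 2 != 0 by rewrite gt_eqF// sqrD_gt0.
rewrite /pk; apply: is_derive_eq; rewrite /GRing.scale/= !mulr1; field.
exact: h.
Qed.

Lemma cvg_pk e : 0 < e -> pk e t @[t --> +oo] --> 0.
Proof.
move=> e0; apply/cvgrPdist_le => d d0; near=> t.
have t1 : 1 <= t by near: t; apply: nbhs_pinfty_ge; rewrite num_real.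
have te : e / d <= t by near: t; apply: nbhs_pinfty_ge; rewrite num_real.
rewrite sub0r normrN (ger0_norm (pk_ge0 _ e0)) /pk ler_pdivrMr ?sqrD_gt0//.
move: te; rewrite ler_pdivrMr// => te.
have : t * d <= d * t ^+ 2 by rewrite mulrC ler_pM2l// expr2 ler_peMl//; lra.
have := mulr_ge0 (ltW d0) (sqr_ge0 e); lra.
Unshelve. all: by end_near. Qed.

(** A radially decreasing kernel is a positive superposition of indicators of intervals; the weight
    is minus its derivative. *)
Lemma pk_layer e t : 0 < e ->
  (\int[leb]_r ((`|t| < r)%R%:R * (2 * e * r / (r ^+ 2 + e ^+ 2) ^+ 2))%:E
   = (pk e t)%:E)%E.
Proof.
move=> e0; rewrite int_natr_bool.
rewrite (_ : [set _ | _] = `]`|t|, +oo[%classic); last first.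
  by apply/seteqP; split=> r/=; rewrite in_itv/= andbT.
have -> : pk e t = 0 - - pk e `|t|.
  by rewrite sub0r opprK /pk real_normK ?num_real.
apply: (@ftcy _ (fun r => - pk e r) _ _ 0).
- move=> r _; have h := is_derive_pk r e0.
  by apply: is_derive_eq; rewrite opprK.
- move=> r _; have h := sqrD_gt0 r e0.
  have h2 : (r ^+ 2 + e ^+ 2) ^+ 2 != 0 by rewrite expf_neq0// gt_eqF.
  by apply: is_derive_cont.
- move=> r tr; apply: divr_ge0; last exact: sqr_ge0.
  by rewrite !mulr_ge0 ?(ltW e0)// (le_trans _ tr).
- by rewrite -oppr0; apply: cvgN; exact: cvg_pk.
Qed.

Lemma int_pk e : 0 < e -> (\int[leb]_t (pk e t)%:E = pi%:E)%E.
Proof.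
move=> e0; rewrite ge0_symfun_integralT; last 3 first.
- by move=> t; exact: pk_ge0.
- by move=> t; exact: is_derive_cont (is_derive_pk t e0).
- by move=> t; rewrite /= pkN.
rewrite -set_itvcy -integral_itv_obnd_cbnd; last first.
  by apply/measurable_EFinP; apply: measurable_funTS; exact: measurable_pk.
have -> : (pi%:E = 2%:E * (pi / 2 - atan (0 / e))%:E :> \bar R)%E.
  by rewrite mul0r atan0 subr0 -EFinM; congr (_%:E); field.
congr (_ * _)%E; apply: (@ftcy _ (fun t => atan (t / e)) _ _ (pi / 2)).
- move=> t _; apply: is_derive_eq.
  rewrite /GRing.scale/= mulr0 add0r mulr1 /pk; field.
  by rewrite !gt_eqF ?sqrD_gt0// addrC sqrD_gt0.
- by move=> t _; exact: is_derive_cont (is_derive_pk t e0).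
- by move=> t _; exact: pk_ge0.
- apply: (cvg_comp _ _ _ (@cvgy_atan R)).
  by apply: gt0_cvgMly; rewrite ?invr_gt0//.
Qed.

Lemma intg_pk e : 0 < e -> intg leb (pk e).
Proof.
move=> e0; apply: intgP; first exact: measurable_pk.
under eq_integral => t _ do rewrite (ger0_norm (pk_ge0 t e0)).
by rewrite int_pk// ltry.
Qed.

Lemma intg_pk_shift e x : 0 < e -> intg leb (fun t => pk e (x - t)).
Proof.
move=> e0; have := intg_affine x (_ : -1 != 0 :> R) (intg_pk e0).
rewrite oppr_eq0 oner_neq0 => /(_ isT); apply: eq_integrable => // t _ /=.
by rewrite mulN1r addrC.
Qed.

Lemma int_pk_shift e x : 0 < e -> (\int[leb]_t (pk e (x - t))%:E = pi%:E)%E.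
Proof.
move=> e0; rewrite -(int_pk e0).
rewrite (@ge0_int_affine R (-1) x (fun t => (pk e t)%:E)) ?oppr_eq0 ?oner_neq0//.
- rewrite normrN1 mul1e; apply: eq_integral => t _.
  by rewrite mulN1r addrC.
- by apply/measurable_EFinP; exact: measurable_pk.
- by move=> t; rewrite lee_fin pk_ge0.
Qed.

Lemma int_pk_cst e x (l : R) : 0 < e -> 0 <= l ->
  (\int[leb]_t (pk e (x - t) * l)%:E = (pi * l)%:E)%E.
Proof.
move=> e0 l0; rewrite EFinM -(int_pk_shift x e0) -ge0_integralZr//.
- by apply/measurable_EFinP; exact: intg_measurable (intg_pk_shift x e0).
- by move=> t _; rewrite lee_fin pk_ge0.
Qed.

Lemma measurable_shift (k : R -> R) : measurable_fun setT k ->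
  measurable_fun setT (fun z : R * R => k (z.1 - z.2)).
Proof. by move=> mk; apply: (measurableT_comp mk); exact: measurable_funB. Qed.

Lemma measurable_shift1 (k : R -> R) x : measurable_fun setT k ->
  measurable_fun setT (fun t => k (x - t)).
Proof. by move=> mk; apply: (measurableT_comp mk); exact: measurable_funB. Qed.

Lemma measurable_cv (k g : R -> R) : measurable_fun setT k ->
  measurable_fun setT g -> measurable_fun setT (cv k g).
Proof.
move=> mk mg; apply: (@measurable_Rint_l _ _ _ _ R leb (fun x t => k (x - t) * g t)).
apply: measurable_funM; first exact: measurable_shift.
exact: measurableT_comp.
Qed.

(** In the layers of [pk_layer] only integrals of [h] over balls centred at [x] occur. Each is
    compared with that of the constant [l], whose Poisson integral is exactly [pi * l]. *)
Lemma pk_le_avg e (h : R -> R) x (l : R) : 0 < e -> measurable_fun setT h ->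
  (forall t, 0 <= h t) -> 0 <= l ->
  (forall r, 0 < r ->
    (\int[leb]_(t in ball x r) (h t)%:E <= (2 * r * l)%:E)%E) ->
  (\int[leb]_t (pk e (x - t) * h t)%:E <= (pi * l)%:E)%E.
Proof.
move=> e0 mh h0 l0 hl.
pose w r := 2 * e * r / (r ^+ 2 + e ^+ 2) ^+ 2.
have mw : measurable_fun setT w.
  apply: measurable_funM; first exact: measurable_funM.
  apply: measurable_inv; apply: measurable_funX.
  by apply: measurable_funD => //; exact: measurable_funX.
have layer (g : R -> R) : measurable_fun setT g -> (forall t, 0 <= g t) ->
  (\int[leb]_t (pk e (x - t) * g t)%:E =
   \int[leb]_r (((0 < r)%R%:R * w r)%:E * \int[leb]_(t in ball x r) (g t)%:E))%E.
  move=> mg g0.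
  pose F (t r : R) : R := (`|x - t| < r)%R%:R * w r * g t.
  have F0 t r : 0 <= F t r.
    rewrite /F; case: ltP => xr; last by rewrite !mul0r.
    rewrite mul1r mulr_ge0// divr_ge0 ?sqr_ge0// !mulr_ge0 ?(ltW e0)//.
    by rewrite (le_trans _ (ltW xr)).
  have mF : measurable_fun setT (fun z : R * R => F z.1 z.2).
    apply: measurable_funM; last exact: measurableT_comp.
    apply: measurable_funM; last exact: measurableT_comp.
    apply: measurable_natr_bool; apply: measurable_fun_ltr => //.
    by apply: measurableT_comp => //; exact: measurable_funB.
  transitivity (\int[leb]_t \int[leb]_r (F t r)%:E)%E.
    apply: eq_integral => t _; rewrite EFinM -pk_layer// -ge0_integralZr//.
    - apply/measurable_EFinP; apply: measurable_funM => //.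
      by apply: measurable_natr_bool; exact: measurable_ltc.
    - move=> r _; rewrite lee_fin; case: ltP => xr; last by rewrite mul0r.
      rewrite mul1r divr_ge0 ?sqr_ge0// !mulr_ge0 ?(ltW e0)//.
      by rewrite (le_trans _ (ltW xr)).
    - by rewrite lee_fin.
  rewrite tonelli//; apply: eq_integral => r _.
  have [r0|r0] := ltP 0 r; last first.
    rewrite mul0r mul0e integral0_eq// => t _.
    by rewrite /F ltNge (le_trans r0)// !mul0r.
  rewrite mul1r -int_natr_bool -ge0_integralZl//.
  - apply: eq_integral => t _; rewrite -EFinM; congr (_%:E).
    by rewrite /F mulrAC mulrC.
  - apply/measurable_EFinP; apply: measurable_funM => //.
    apply: measurable_natr_bool; apply: measurable_fun_ltr => //.
    by apply: measurableT_comp => //; exact: measurable_funB.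
  - by move=> t _; rewrite lee_fin mulr_ge0.
  - by rewrite lee_fin divr_ge0 ?sqr_ge0// !mulr_ge0 ?(ltW e0)// ltW.
rewrite layer//.
have := layer (cst l) (measurable_cst _) (fun=> l0).
rewrite [X in X = _ -> _](int_pk_cst x e0 l0) => ->.
apply: int_mono => r.
  apply: mule_ge0; last by apply: integral_ge0 => t _; rewrite lee_fin.
  rewrite lee_fin; case: ltP => r0; last by rewrite mul0r.
  by rewrite mul1r divr_ge0 ?sqr_ge0// !mulr_ge0 ?(ltW e0)// ltW.
case: ltP => r0; last by rewrite mul0r !mul0e.
rewrite mul1r lee_wpmul2l//.
  by rewrite lee_fin divr_ge0 ?sqr_ge0// !mulr_ge0 ?(ltW e0)// ltW.
apply: (le_trans (hl _ r0)).
rewrite (integral_cst leb (measurable_ball x r) l%:E : \int[leb]_(t in ball x r) (cst l t)%:E = _)%E.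
rewrite [X in (_ <= _ * X)%E](_ : _ = (r *+ 2)%:E); last first.
  exact: lebesgue_measure_ball (ltW r0).
by rewrite -EFinM lee_fin; lra.
Qed.

End kernels.

(** * The maximal inequality for Poisson integrals *)

Section poisson_maximal.
Context (R : realType).
Local Notation leb := (@lebesgue_measure R).
Implicit Types (h : R -> R).

Lemma intg_cv (k g : R -> R) (b x : R) : measurable_fun setT k ->
  (forall t, `|k t| <= b) -> intg leb g -> intg leb (fun t => k (x - t) * g t).
Proof.
move=> mk kb gi; apply: (intg_le _ _ (intgZ b (intg_norm gi))).
- apply: measurable_funM; [exact: measurable_shift1|exact: intg_measurable gi].
- by move=> t; rewrite normrM ler_wpM2r.
Qed.

Lemma intg_pkM (e : R) h (m x : R) : 0 < e -> measurable_fun setT h ->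
  (forall t, `|h t| <= m) -> intg leb (fun t => pk e (x - t) * h t).
Proof.
move=> e0 mh hm; apply: (intg_le _ _ (intgZ m (intg_pk_shift x e0))).
- by apply: measurable_funM => //; apply: measurable_shift1; exact: measurable_pk.
- move=> t; rewrite normrM (ger0_norm (pk_ge0 _ e0)) mulrC ler_wpM2r//.
  exact: pk_ge0.
Qed.

Lemma cv_pk_ge0 (e : R) h (x : R) : 0 < e -> (forall t, 0 <= h t) -> 0 <= cv (pk e) h x.
Proof.
move=> e0 h0; apply: Rintegral_ge0 => t _.
by rewrite mulr_ge0// pk_ge0.
Qed.

Lemma HL_maximal_avg h (x l : R) : (forall t, 0 <= h t) ->
  (HL_maximal h x <= l%:E)%E -> forall r : R, 0 < r ->
  (\int[leb]_(t in ball x r) (h t)%:E <= (2 * r * l)%:E)%E.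
Proof.
move=> h0 hl r r0.
have : (iavg h (ball x r) <= l%:E)%E.
  apply: le_trans hl; apply: ereal_sup_ubound; exists r => //=.
  by rewrite in_itv/= r0.
rewrite /iavg lebesgue_measure_ball ?(ltW r0)//.
have r2 : 0 < r *+ 2 by rewrite pmulrn_lgt0.
rewrite inver gt_eqF//.
under eq_integral => t _ do rewrite gee0_abs ?lee_fin//.
rewrite lee_pdivrMl ?pmulrn_lgt0// -EFinM.
by rewrite mulr_natl.
Qed.

(* Weak type (1,1) for the part of [h] above the level, combined with the layer
   cake formula. *)
Lemma poisson_maximal (p : R) : 1 < p -> exists2 C : R, 0 <= C &
  forall h (m : R) (E : seq R), measurable_fun setT h -> (forall t, 0 <= h t) ->
    (forall t, h t <= m) -> {in E, forall e : R, 0 < e} ->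
  (\int[leb]_x (mx E (fun e => cv (pk e) h x) `^ p)%:E <=
   C%:E * \int[leb]_x (h x `^ p)%:E)%E.
Proof.
move=> p1; have p0 : 0 < p by lra.
exists ((3 * pi) `^ p * p * 3 * (p - 1)^-1).
  by rewrite !mulr_ge0 ?powR_ge0 ?invr_ge0//; lra.
move=> h m E mh h0 hm E0.
have m0 : 0 <= m by exact: le_trans (h0 0) (hm 0).
pose M x := mx E (fun e => cv (pk e) h x).
have mM : measurable_fun setT M.
  by apply: measurable_mx => e; apply: measurable_cv => //; exact: measurable_pk.
have M0 x : 0 <= M x by exact: mx_ge0.
have pi0 : 0 < pi :> R by exact: pi_gt0.
have [->|hp_lty] := eqVneq (\int[leb]_x (h x `^ p)%:E)%E +oo%E.
  rewrite gt0_muley ?leey// lte_fin !mulr_gt0 ?powR_gt0 ?invr_gt0//; lra.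
pose h1 l t := (l < h t)%R%:R * h t.
have mh1 l : measurable_fun setT (h1 l).
  by apply: measurable_funM => //; apply: measurable_natr_bool; exact: measurable_fun_ltr.
have h10 l t : 0 <= h1 l t by rewrite mulr_ge0.
(* Where the maximal function of [h1 l] is at most [l], the Poisson integrals of [h1 l] and of the
   remainder, which is at most [l], are each at most [pi * l]. Their sum stays strictly below
   [3 * pi * l]. The constant in [3 / l] is that of the Hardy-Littlewood inequality. *)
have weak (l : R) : 0 < l -> (leb [set x | (3 * pi * l <= M x)%R] <=
    (3 / l)%:E * \int[leb]_t (h1 l t)%:E)%E.
  move=> l0; have loc : locally_integrable setT (h1 l).
    split => //; first exact: openT.
    move=> K _ cK; apply: (@le_lt_trans _ _ (\int[leb]_(t in K) cst m%:E t)%E).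
      apply: ge0_le_integral => //.
      + exact: compact_measurable.
      + apply/measurable_EFinP; apply: measurable_funTS.
        by apply: measurableT_comp => //; exact: mh1.
      + move=> t _; rewrite lee_fin ger0_norm// /h1.
        by case: ltP => _; rewrite ?mul1r ?mul0r.
    rewrite integral_cst; last exact: compact_measurable.
    rewrite lte_mul_pinfty ?lee_fin//.
    exact: compact_finite_measure.
  have := maximal_inequality loc l0.
  under [X in (_ <= _ * X)%E -> _]eq_integral => t _ do rewrite gee0_abs ?lee_fin//.
  apply: le_trans; apply: le_measure.
  - rewrite inE -[X in measurable X]setTI.
    have := measurable_fun_ler (measurable_cst (3 * pi * l)) mM.
    by move=> /(_ measurableT [set true] I).
  - rewrite inE -[X in measurable X]setTI; apply: emeasurable_fun_o_infty => //.
    exact: measurable_HL_maximal.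
  move=> x /= lM; rewrite ltNge; apply/negP => HLl.
  suff : M x <= 2 * pi * l by have := mulr_gt0 pi0 l0; lra.
  apply: mx_le_in; first by rewrite !mulr_ge0// ltW.
  move=> e /E0 e0; have avg := HL_maximal_avg (h10 l) HLl.
  have := pk_le_avg e0 (mh1 l) (h10 l) (ltW l0) avg.
  have i1 : intg leb (fun t => pk e (x - t) * h1 l t).
    apply: (@intg_pkM e (h1 l) m x e0) => // t.
    rewrite ger0_norm// /h1; case: ltP => _; by rewrite ?mul1r ?mul0r.
  have i2 : intg leb (fun t => pk e (x - t) * l).
    by apply: (@intg_pkM e (cst l) l x e0) => // t; rewrite ger0_norm// ltW.
  rewrite -EFin_Rint// lee_fin => h1l.
  have il : \int[leb]_t (pk e (x - t) * l) = pi * l.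
    by apply: EFin_inj; rewrite EFin_Rint// int_pk_cst// ltW.
  apply: (@le_trans _ _ (\int[leb]_t (pk e (x - t) * h1 l t + pk e (x - t) * l))).
    apply: le_Rint.
    - by apply: (@intg_pkM e h m x e0) => // t; rewrite ger0_norm.
    - exact: intgD.
    - move=> t; rewrite -mulrDr ler_wpM2l ?pk_ge0// /h1.
      by case: ltP => hl; rewrite ?mul1r ?mul0r ?add0r// lerDl ltW.
  by rewrite RintD// il; lra.
pose K := (3 * pi) `^ p * p.
have K0 : 0 <= K by rewrite mulr_ge0 ?powR_ge0// ltW.
(* Layer cake for [M^p] with the levels rescaled by [3 * pi], so that the weak bound applies to each
   level; the rescaling and the derivative of [l^p] give [K = (3 pi)^p p]. *)
pose F (x l : R) : R := K * ((0 < l <= M x / (3 * pi))%R%:R * l `^ (p - 1)).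
have F0 x l : 0 <= F x l.
  by apply: mulr_ge0 => //; apply: mulr_ge0; rewrite ?powR_ge0.
have mF : measurable_fun setT (fun z : R * R => F z.1 z.2).
  apply: measurable_funM => //; apply: measurable_funM; last first.
    exact: measurable_fun_powR measurable_snd.
  apply: measurable_natr_bool; apply: measurable_and.
    by apply: measurable_fun_ltr.
  apply: measurable_fun_ler => //; apply: measurable_funM => //.
  exact: measurableT_comp.
have -> : (\int[leb]_x (M x `^ p)%:E = \int[leb]_x \int[leb]_l (F x l)%:E)%E.
  apply: eq_integral => x _; rewrite /F.
  have mq : measurable_fun setT (fun l : R => (0 < l <= M x / (3 * pi))%R%:R * l `^ (p - 1)).
    apply: measurable_funM; last exact: measurable_fun_powR.
    apply: measurable_natr_bool; apply: measurable_and; first exact: measurable_ltc.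
    exact: measurable_gec.
  rewrite (int_Zl leb K0 mq); last by move=> l; rewrite mulr_ge0 ?powR_ge0.
  rewrite powR_layer//; last by rewrite divr_ge0// mulr_ge0// ltW.
  rewrite -EFinM; congr (_%:E); set u := M x / (3 * pi).
  have u0 : 0 <= u by rewrite divr_ge0// mulr_ge0// ltW.
  have -> : M x = 3 * pi * u.
    by rewrite /u mulrC divfK// gt_eqF// mulr_gt0.
  rewrite powRM//; last by rewrite mulr_ge0// ltW.
  by rewrite /K -mulrA [p * (_ * _)]mulrA mulfV ?gt_eqF// mul1r.
rewrite tonelli//.
(* The weak bound lowers the exponent of [l] to [p - 2]. Integrating up to [h x] then produces
   [h^(p-1) / (p - 1)], and the factors collected are the constant announced at the start. *)
pose G (x l : R) : R := K * 3 * ((0 < l <= h x)%R%:R * l `^ (p - 1 - 1)) * h x.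
have G0 x l : 0 <= G x l.
  apply: mulr_ge0 => //; apply: mulr_ge0; first exact: mulr_ge0.
  by rewrite mulr_ge0 ?powR_ge0.
have mG : measurable_fun setT (fun z : R * R => G z.1 z.2).
  apply: measurable_funM; last exact: measurableT_comp.
  apply: measurable_funM => //; apply: measurable_funM; last first.
    exact: measurable_fun_powR measurable_snd.
  apply: measurable_natr_bool; apply: measurable_and.
    by apply: measurable_fun_ltr.
  by apply: measurable_fun_ler => //; exact: measurableT_comp.
apply: (@le_trans _ _ (\int[leb]_l \int[leb]_x (G x l)%:E)%E).
  apply: int_mono => l; first by apply: integral_ge0 => x _; rewrite lee_fin.
  have [l0|l0] := ltP 0 l; last first.
    rewrite integral0_eq ?integral_ge0// => x _; first by rewrite lee_fin.
    by rewrite /F ltNge l0/= mul0r mulr0.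
  rewrite (_ : (\int[leb]_x (F x l)%:E)%E =
     ((K * l `^ (p - 1))%:E * leb [set x | (3 * pi * l <= M x)%R])%E); last first.
    have mb : measurable_fun setT (fun x => 3 * pi * l <= M x) by exact: measurable_fun_ler.
    have Kl : 0 <= K * l `^ (p - 1) by rewrite mulr_ge0 ?powR_ge0.
    transitivity (\int[leb]_x (K * l `^ (p - 1) * ((3 * pi * l <= M x)%R%:R * 1))%:E)%E.
      apply: eq_integral => x _; congr (_%:E).
      rewrite /F l0/= ler_pdivlMr ?mulr_gt0// [l * _]mulrC mulr1.
      by rewrite [_%:R * _]mulrC mulrA.
    rewrite int_Zl//; last by apply: measurable_funM => //; exact: measurable_natr_bool.
    congr (_ * _)%E; rewrite (int_natr_bool leb (fun x => 3 * pi * l <= M x) (cst 1)).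
    rewrite (integral_cst leb _ 1%:E : \int[leb]_(x in _) (cst 1 x)%:E = _)%E ?mul1e//.
    by rewrite -[X in measurable X]setTI; exact: (mb measurableT [set true] I).
  apply: (@le_trans _ _ ((K * l `^ (p - 1))%:E * ((3 / l)%:E * \int[leb]_t (h1 l t)%:E))%E).
    by apply: lee_wpmul2l; [rewrite lee_fin mulr_ge0 ?powR_ge0|exact: weak].
  rewrite muleA -EFinM -ge0_integralZl//.
  - apply: int_mono => x.
      by rewrite -EFinM lee_fin !mulr_ge0 ?powR_ge0 ?invr_ge0// ltW.
    rewrite -EFinM lee_fin /G /h1 l0/=.
    case: ltP => lh; last by rewrite mul0r mulr0; have := G0 x l; rewrite /G l0.
    rewrite (ltW lh) !mul1r ler_wpM2r//.
    rewrite [l `^ (p - 1 - 1)]powRB ?powRr1 ?(ltW l0)//; last first.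
      by apply/implyP => _; rewrite gt_eqF.
    by rewrite le_eqVlt; apply/orP; left; apply/eqP; ring.
  - by apply/measurable_EFinP; exact: mh1.
  - by move=> x _; rewrite lee_fin.
  - by rewrite lee_fin !mulr_ge0 ?powR_ge0 ?invr_ge0// ltW.
rewrite -tonelli//.
have C0 : 0 <= (3 * pi) `^ p * p * 3 * (p - 1)^-1.
  by rewrite !mulr_ge0 ?powR_ge0 ?invr_ge0//; lra.
rewrite -(int_Zl leb C0); [|exact: measurable_fun_powR|by move=> x; exact: powR_ge0].
apply: int_mono => x; first by apply: integral_ge0 => l _; rewrite lee_fin.
rewrite (_ : (\int[leb]_l (G x l)%:E)%E = (\int[leb]_l
    ((K * 3 * h x) * ((0 < l <= h x)%R%:R * l `^ (p - 1 - 1)))%:E)%E); last first.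
  by apply: eq_integral => l _; congr (_%:E); rewrite /G mulrAC.
rewrite int_Zl; first last.
- by move=> l; rewrite mulr_ge0 ?powR_ge0.
- apply: measurable_funM; last exact: measurable_fun_powR.
  apply: measurable_natr_bool; apply: measurable_and; first exact: measurable_ltc.
  exact: measurable_gec.
- by apply: mulr_ge0 => //; exact: mulr_ge0.
rewrite powR_layer//; last by lra.
rewrite -!EFinM lee_fin -/K -(mulr_powRB1 (h0 x) p0).
by rewrite le_eqVlt; apply/orP; left; apply/eqP; ring.
Qed.

End poisson_maximal.

(** * Powers of [U + iV] in the right half plane *)

Section power.
Context (R : realType).
Implicit Types (p U V x : R).

(* Real and imaginary parts of the principal branch of [(U + iV)^p], for [U > 0]. *)
Definition rePow p U V := expR (p / 2 * ln (U ^+ 2 + V ^+ 2)) * cos (p * atan (V / U)).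
Definition imPow p U V := expR (p / 2 * ln (U ^+ 2 + V ^+ 2)) * sin (p * atan (V / U)).

(** For [|t|] near [pi / 2] the angle [p |t|] lies in [(pi/2, pi]], where the cosine is negative;
    [p <= 2] keeps it below [pi]. Elsewhere [cos t] is bounded below. The angle [t0], halfway
    between [pi / (2 p)] and [pi / 2], separates the regimes: [b] makes [- b cos (p t)] at least 1
    beyond [t0], and [a] makes [a (cos t)^p] at least [1 + b] before it. *)
Lemma cos_sin_bound p : 1 < p -> p <= 2 -> exists a b : R, [/\ 0 <= a, 0 <= b &
  forall t : R, `|t| < pi / 2 -> `|sin t| `^ p <= a * cos t `^ p - b * cos (p * t)].
Proof.
move=> p1 p2; have pi0 : 0 < pi :> R := pi_gt0 R.
pose t0 : R := (pi / (2 * p) + pi / 2) / 2.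
have p0 : 0 < p by lra.
have t0l : pi / (2 * p) < t0.
  have : pi / (2 * p) < pi / 2; last by rewrite /t0; lra.
  by rewrite ltr_pM2l// ltf_pV2 ?posrE//; lra.
have t0r : t0 < pi / 2.
  have : pi / (2 * p) < pi / 2; last by rewrite /t0; lra.
  by rewrite ltr_pM2l// ltf_pV2 ?posrE//; lra.
have t00 : 0 < t0 by apply: lt_trans t0l; rewrite divr_gt0//; lra.
have pt0l : pi / 2 < p * t0.
  by rewrite -ltr_pdivrMl// mulrC (_ : pi / 2 / p = pi / (2 * p))//; field; rewrite gt_eqF.
have pt0r : p * t0 <= pi.
  apply: (@le_trans _ _ (2 * t0)); last by lra.
  by rewrite ler_pM2r.
have c0 : cos (p * t0) < 0.
  have -> : p * t0 = (p * t0 - pi) + pi by ring.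
  by rewrite cosDpi oppr_lt0; apply: cos_gt0_pihalf; apply/andP; split; lra.
have ct0 : 0 < cos t0 by apply: cos_gt0_pihalf; rewrite t0r/= andbT; lra.
pose b := - (cos (p * t0))^-1.
have b0 : 0 < b by rewrite oppr_gt0 invr_lt0.
pose a := (1 + b) / cos t0 `^ p.
have a0 : 0 <= a by rewrite divr_ge0 ?powR_ge0//; lra.
exists a, b; split => //; first exact: ltW.
move=> t ht; have [ct cpt] : cos t = cos `|t| /\ cos (p * t) = cos (p * `|t|).
  by have [t1|t1] := leP 0 t; [rewrite ger0_norm|rewrite ltr0_norm// mulrN !cosN].
rewrite ct cpt; set s := `|t| in ht *; have s0 : 0 <= s by exact: normr_ge0.
have cs : 0 < cos s by apply: cos_gt0_pihalf; rewrite ht andbT; lra.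
have sin1 : `|sin t| `^ p <= 1.
  rewrite -[leRHS](_ : 1 `^ p = 1); last by rewrite powR1.
  apply: ge0_ler_powR; rewrite ?nnegrE//; first by rewrite ltW.
  by rewrite ler_norml sin_geN1 sin_le1.
apply: le_trans sin1 _.
have ps : 0 <= p * s by rewrite mulr_ge0// ltW.
have pspi : p * s <= pi.
  by apply: (@le_trans _ _ (2 * s)); [rewrite ler_wpM2r|lra].
have [st|st] := leP t0 s.
  have : cos (p * s) <= cos (p * t0).
    have pst : p * t0 <= p * s by rewrite ler_pM2l.
    have [->//|ne] := eqVneq (p * t0) (p * s).
    apply/ltW; rewrite ltr_cos ?in_itv/= ?ps ?pspi ?pt0r ?andbT//.
      by rewrite lt_neqAle ne.
    lra.
  move=> h; have : 1 <= - (b * cos (p * s)).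
    rewrite /b mulNr opprK -(mulVf (_ : cos (p * t0) != 0)); last by rewrite lt_eqF.
    by rewrite ler_nM2l// invr_lt0.
  have := mulr_ge0 a0 (powR_ge0 (cos s) p); lra.
have h1 : 1 + b <= a * cos s `^ p.
  rewrite /a mulrAC ler_pdivlMr ?powR_gt0// ler_pM2l; last by lra.
  apply: ge0_ler_powR; rewrite ?nnegrE; [lra|exact: ltW|exact: ltW|].
  by apply/ltW; rewrite ltr_cos ?in_itv/= ?s0 ?andbT ?(ltW t00)//=; lra.
have : b * cos (p * s) <= b by rewrite ger_pMr// cos_le1.
lra.
Qed.

Lemma powR_half p A : 0 < A -> expR (p / 2 * ln A) = A `^ (p / 2).
Proof. by move=> A0; rewrite /powR gt_eqF. Qed.

Lemma abs_rePow p U V B : 0 <= p -> 0 < U -> `|U| <= B -> `|V| <= B ->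
  `|rePow p U V| <= (2 * B ^+ 2) `^ (p / 2) /\ `|imPow p U V| <= (2 * B ^+ 2) `^ (p / 2).
Proof.
move=> p0 U0 UB VB; have A0 : 0 < U ^+ 2 + V ^+ 2 by rewrite ltr_pwDl ?sqr_ge0// exprn_gt0.
have AB : expR (p / 2 * ln (U ^+ 2 + V ^+ 2)) <= (2 * B ^+ 2) `^ (p / 2).
  rewrite powR_half//; apply: ge0_ler_powR; rewrite ?nnegrE; first by lra.
  - exact: ltW.
  - by rewrite mulr_ge0// sqr_ge0.
  - rewrite -[U ^+ 2]real_normK ?num_real// -[V ^+ 2]real_normK ?num_real//.
    have := normr_ge0 U; have := normr_ge0 V; nra.
split; rewrite normrM gtr0_norm ?expR_gt0//.
- by rewrite (le_trans _ AB)// ger_pMr ?expR_gt0// ler_norml cos_geN1 cos_le1.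
- by rewrite (le_trans _ AB)// ger_pMr ?expR_gt0// ler_norml sin_geN1 sin_le1.
Qed.

(** Both sides are homogeneous of degree [p], so polar coordinates with angle in [(-pi/2, pi/2)]
    reduce the claim to [cos_sin_bound]. *)
Lemma rePow_bound p : 1 < p -> p <= 2 -> exists a b : R, [/\ 0 <= a, 0 <= b &
  forall U V, 0 < U -> `|V| `^ p <= a * U `^ p - b * rePow p U V].
Proof.
move=> p1 p2; have [a [b [a0 b0 h]]] := cos_sin_bound p1 p2; exists a, b; split=> // U V U0.
have A0 : 0 < U ^+ 2 + V ^+ 2 by rewrite ltr_pwDl ?sqr_ge0// exprn_gt0.
set t := atan (V / U); set r := Num.sqrt (U ^+ 2 + V ^+ 2).
have r0 : 0 < r by rewrite sqrtr_gt0.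
have rE : Num.sqrt (1 + (V / U) ^+ 2) = r / U.
  have -> : 1 + (V / U) ^+ 2 = (U ^+ 2 + V ^+ 2) / U ^+ 2 by field; rewrite gt_eqF.
  rewrite sqrtrM ?(ltW A0)// sqrtrV ?sqr_ge0// sqrtr_sqr gtr0_norm//.
have ct : cos t = U / r by rewrite cos_atan rE invf_div.
have UE : U = r * cos t by rewrite ct; field; rewrite gt_eqF.
have ct0 : cos t != 0 by rewrite ct mulf_neq0 ?gt_eqF ?invr_gt0.
have VE : V = r * sin t.
  have : tan t = V / U by rewrite atanK.
  rewrite /tan => /(congr1 (fun z => z * cos t)); rewrite divfK// => ->.
  rewrite ct; field; by rewrite !gt_eqF.
have rp : r `^ p = expR (p / 2 * ln (U ^+ 2 + V ^+ 2)).
  by rewrite powR_half// /r -powR12_sqrt ?(ltW A0)// -powRrM mulrC.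
rewrite /rePow -rp -/t {1}VE normrM (gtr0_norm r0) powRM ?(ltW r0)//.
rewrite [X in a * X `^ p]UE powRM ?(ltW r0)//; last by rewrite ct divr_ge0 ?ltW.
have -> : a * (r `^ p * cos t `^ p) - b * (r `^ p * cos (p * t)) =
  r `^ p * (a * cos t `^ p - b * cos (p * t)) by ring.
rewrite ler_wpM2l ?powR_ge0// h// ltr_norml /t.
by rewrite atan_ltpi2 andbT atan_gtNpi2.
Qed.

Section curve.
Variables (p : R) (U V : R -> R) (s dU dV : R).
Hypotheses (hU : is_derive s 1 U dU) (hV : is_derive s 1 V dV) (U0 : 0 < U s).

Let A := U s ^+ 2 + V s ^+ 2.
Let A0 : 0 < A. Proof. by rewrite ltr_pwDl ?sqr_ge0// exprn_gt0. Qed.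
Let a := expR (p / 2 * ln A).
Let t := atan (V s / U s).

Let dln : is_derive s 1 (fun s => ln (U s ^+ 2 + V s ^+ 2))
  (2 * (U s * dU + V s * dV) / A).
Proof.
have hA : is_derive s 1 (fun s => U s ^+ 2 + V s ^+ 2) (2 * (U s * dU + V s * dV)).
  by apply: is_derive_eq; rewrite /GRing.scale/=; ring.
have := is_derive1_comp (is_derive1_ln A0 : is_derive ((fun s => U s ^+ 2 + V s ^+ 2) s) 1 (@ln R) _) hA.
by rewrite mulrC.
Qed.

Let datan : is_derive s 1 (fun s => atan (V s / U s)) ((U s * dV - V s * dU) / A).
Proof.
have U1 : U s != 0 by rewrite gt_eqF.
have hq : is_derive s 1 (fun s => V s / U s) ((U s * dV - V s * dU) / U s ^+ 2).
  by apply: is_derive_eq; rewrite /GRing.scale/=; field.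
have := is_derive1_comp (is_derive1_atan (V s / U s) : is_derive ((fun s => V s / U s) s) 1 (atan : R -> R) _) hq.
move=> h; apply: is_derive_eq h _; rewrite /A; field.
by rewrite U1 gt_eqF//= gt_eqF.
Qed.

Let dexp : is_derive s 1 (fun s => expR (p / 2 * ln (U s ^+ 2 + V s ^+ 2)))
  (a * (p * (U s * dU + V s * dV) / A)).
Proof.
have h : is_derive s 1 (fun s => p / 2 * ln (U s ^+ 2 + V s ^+ 2))
    (p * (U s * dU + V s * dV) / A).
  apply: (is_derive_eq (is_deriveM (is_derive_cst (p / 2) s 1) dln)).
  by rewrite scaler0 addr0 /GRing.scale/=; field; rewrite gt_eqF.
exact: is_derive1_comp (is_derive_expR _) h.
Qed.

Let dangle : is_derive s 1 (fun s => p * atan (V s / U s)) (p * (U s * dV - V s * dU) / A).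
Proof.
apply: (is_derive_eq (is_deriveM (is_derive_cst p s 1) datan)).
by rewrite scaler0 addr0 /GRing.scale/= mulrA.
Qed.

(** With [z = U + iV] this and its companion are [d (z^p) = p z^p conj(z) dz / |z|^2], where
    [conj(z) dz] has real part [U dU + V dV] and imaginary part [U dV - V dU]. *)
Lemma is_derive_rePow : is_derive s 1 (fun s => rePow p (U s) (V s))
  (p * a * (cos (p * t) * (U s * dU + V s * dV) - sin (p * t) * (U s * dV - V s * dU)) / A).
Proof.
have dc := is_derive1_comp (is_derive_cos _) dangle.
apply: (is_derive_eq (is_deriveM dexp dc)); rewrite /GRing.scale/= -/t -/A -/a; field.
by rewrite gt_eqF.
Qed.

Lemma is_derive_imPow : is_derive s 1 (fun s => imPow p (U s) (V s))
  (p * a * (sin (p * t) * (U s * dU + V s * dV) + cos (p * t) * (U s * dV - V s * dU)) / A).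
Proof.
have dc := is_derive1_comp (is_derive_sin _) dangle.
apply: (is_derive_eq (is_deriveM dexp dc)); rewrite /GRing.scale/= -/t -/A -/a; field.
by rewrite gt_eqF.
Qed.

Lemma is_derive_rePowE : is_derive s 1 (fun s => rePow p (U s) (V s))
  (p * (rePow p (U s) (V s) * (U s * dU + V s * dV) -
        imPow p (U s) (V s) * (U s * dV - V s * dU)) / A).
Proof.
apply: is_derive_eq is_derive_rePow _; rewrite /rePow /imPow -/A -/t -/a; field.
by rewrite gt_eqF.
Qed.

Lemma is_derive_imPowE : is_derive s 1 (fun s => imPow p (U s) (V s))
  (p * (imPow p (U s) (V s) * (U s * dU + V s * dV) +
        rePow p (U s) (V s) * (U s * dV - V s * dU)) / A).
Proof.
apply: is_derive_eq is_derive_imPow _; rewrite /rePow /imPow -/A -/t -/a; field.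
by rewrite gt_eqF.
Qed.

End curve.

(** The estimate [|d (z^p)| <= p |z|^(p-1) |dz|] up to a numerical factor. It provides the uniform
    bound for differentiating [(u + iv)^p] under an integral sign. *)
Lemma abs_dPow p U V (du dv B D : R) : 1 < p -> 0 < U -> `|U| <= B -> `|V| <= B ->
  `|du| <= D -> `|dv| <= D ->
  `|p * (rePow p U V * (U * du + V * dv) - imPow p U V * (U * dv - V * du)) /
    (U ^+ 2 + V ^+ 2)| <=
  p * 4 * D * (2 * B ^+ 2) `^ ((p - 1) / 2).
Proof.
move=> p1 U0 UB VB uD vD.
rewrite /rePow /imPow; set c := cos _; set k := sin _; set e := expR _.
have -> : p * (e * c * (U * du + V * dv) - e * k * (U * dv - V * du)) /
    (U ^+ 2 + V ^+ 2) =
  p * e * (c * (U * du + V * dv) - k * (U * dv - V * du)) / (U ^+ 2 + V ^+ 2) by ring.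
have c1 : `|c| <= 1 by rewrite ler_norml cos_geN1 cos_le1.
have k1 : `|k| <= 1 by rewrite ler_norml sin_geN1 sin_le1.
rewrite {}/e.
have A0 : 0 < U ^+ 2 + V ^+ 2 by rewrite ltr_pwDl ?sqr_ge0// exprn_gt0.
set A := U ^+ 2 + V ^+ 2 in A0 *; set r := Num.sqrt A.
have r0 : 0 < r by rewrite sqrtr_gt0.
have rr : r ^+ 2 = A by rewrite sqr_sqrtr// ltW.
have D0 : 0 <= D by exact: le_trans (normr_ge0 _) uD.
have Ur : `|U| <= r by rewrite -sqrtr_sqr; apply: ler_wsqrtr; rewrite /A lerDl sqr_ge0.
have Vr : `|V| <= r by rewrite -sqrtr_sqr; apply: ler_wsqrtr; rewrite /A lerDr sqr_ge0.
have b1 : `|U * du + V * dv| <= 2 * (r * D).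
  apply: (le_trans (ler_normD _ _)); rewrite !normrM.
  have := ler_pM (normr_ge0 _) (normr_ge0 _) Ur uD.
  have := ler_pM (normr_ge0 _) (normr_ge0 _) Vr vD; lra.
have b2 : `|U * dv - V * du| <= 2 * (r * D).
  apply: (le_trans (ler_normB _ _)); rewrite !normrM.
  have := ler_pM (normr_ge0 _) (normr_ge0 _) Ur vD.
  have := ler_pM (normr_ge0 _) (normr_ge0 _) Vr uD; lra.
have b3 : `|c * (U * du + V * dv) - k * (U * dv - V * du)| <= 4 * (r * D).
  apply: (le_trans (ler_normB _ _)); rewrite !normrM.
  have := ler_pM (normr_ge0 _) (normr_ge0 _) c1 b1.
  have := ler_pM (normr_ge0 _) (normr_ge0 _) k1 b2; lra.
have rE : r = A `^ 2^-1 by rewrite powR12_sqrt// ltW.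
have pw : A `^ (p / 2) * r / A = A `^ ((p - 1) / 2).
  have -> : (p - 1) / 2 = p / 2 + 2^-1 - 1 by lra.
  by rewrite powRB ?(gt_eqF A0) ?implybT// powRD ?(gt_eqF A0) ?implybT// powRr1 ?ltW// rE.
rewrite !normrM powR_half// [`|A^-1|]gtr0_norm ?invr_gt0//.
rewrite [`|p|]gtr0_norm; last by lra.
rewrite [`|A `^ _|]ger0_norm ?powR_ge0//.
apply: (@le_trans _ _ (p * A `^ (p / 2) * (4 * (r * D)) / A)).
  rewrite ler_wpM2r ?invr_ge0 ?(ltW A0)// ler_wpM2l// mulr_ge0 ?powR_ge0//; lra.
have -> : p * A `^ (p / 2) * (4 * (r * D)) / A = p * 4 * D * (A `^ (p / 2) * r / A) by ring.
rewrite pw ler_wpM2l//; first by rewrite !mulr_ge0//; lra.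
apply: ge0_ler_powR; rewrite ?nnegrE; [lra|exact: ltW| |].
  by rewrite mulr_ge0// sqr_ge0.
rewrite /A -[U ^+ 2]real_normK ?num_real// -[V ^+ 2]real_normK ?num_real//.
have := normr_ge0 U; have := normr_ge0 V; nra.
Qed.

End power.

(** * Differentiation and continuity under the integral sign *)

Section parameter_integrals.
Context d (T : measurableType d) (R : realType).
Variable mu : {measure set T -> \bar R}.

(** The factor [phi] carries the parameter and [g] the integrability, so a bound on the derivative
    of [phi] that is uniform near [a] is enough for domination. *)
Lemma Rint_deriv (phi dphi : R -> T -> R) (g : T -> R) (a r M : R) : 0 < r ->
  intg mu g ->
  (forall s t, a - r < s < a + r -> is_derive s 1 (phi ^~ t) (dphi s t)) ->
  (forall s t, a - r < s < a + r -> `|dphi s t| <= M) ->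
  (forall s, a - r < s < a + r -> intg mu (fun t => phi s t * g t)) ->
  is_derive a 1 (fun s => \int[mu]_t (phi s t * g t)) (\int[mu]_t (dphi a t * g t)).
Proof.
move=> r0 gi dphiE dphiM phii.
have Ia : a \in `]a - r, a + r[ by rewrite in_itv/=; apply/andP; split; lra.
have M0 : 0 <= M by apply: le_trans (dphiM a point _); rewrite ?normr_ge0//; apply/andP; split; lra.
have dE s t : a - r < s < a + r ->
    is_derive s 1 (fun s => phi s t * g t) (dphi s t * g t).
  by move=> /(dphiE _ t) h; apply: is_derive_eq; rewrite scaler0 add0r /GRing.scale/= mulrC.
have p1 s t : a - r < s < a + r ->
    partial1of2 (fun s t => phi s t * g t) s t = dphi s t * g t.
  by move=> /(dE _ t) h; rewrite partial1of2E; exact: derive_val.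
have intf s : `]a - r, a + r[%classic s ->
    mu.-integrable setT (EFin \o (fun t => phi s t * g t)).
  by rewrite /= in_itv/=; exact: phii.
have derf s (t : T) : `]a - r, a + r[%classic s -> setT t ->
    derivable ((fun s t => phi s t * g t) ^~ t) s 1.
  by rewrite /= in_itv/= => /(dE _ t) h _; exact: ex_derive.
have G0 (t : T) : 0 <= M * `|g t| by exact: mulr_ge0.
have Gub s (t : T) : `]a - r, a + r[%classic s -> setT t ->
    `|partial1of2 (fun s t => phi s t * g t) s t| <= M * `|g t|.
  by rewrite /= in_itv/= => sI _; rewrite p1// normrM ler_wpM2r// dphiM.
have d1 := @derivable_under_integral R _ _ mu _ setT measurableT a _ _ Ia intf
  derf _ G0 (intgZ M (intg_norm gi)) Gub.
have d2 := @differentiation_under_integral R _ _ mu _ setT measurableT a _ _ Ia intf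
  derf _ G0 (intgZ M (intg_norm gi)) Gub.
apply: DeriveDef => //; rewrite -derive1E d2.
by apply: eq_Rint => t; rewrite p1// ; move: Ia; rewrite in_itv.
Qed.

Lemma Rint_cont (phi : R -> T -> R) (g : T -> R) (M : R) : intg mu g ->
  (forall s, measurable_fun setT (phi s)) ->
  (forall s t, {for s, continuous (phi ^~ t)}) -> (forall s t, `|phi s t| <= M) ->
  continuous (fun s => \int[mu]_t (phi s t * g t)).
Proof.
move=> gi mphi cphi phiM a.
have ib s : intg mu (fun t => phi s t * g t).
  apply: (intg_le _ _ (intgZ M (intg_norm gi))).
    by apply: measurable_funM; [exact: mphi|exact: intg_measurable gi].
  by move=> t; rewrite normrM ler_wpM2r.
have Ia : a \in `]a - 1, a + 1[ by rewrite in_itv/=; apply/andP; split; lra.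
apply: (@continuity_under_integral R _ _ mu (fun s t => phi s t * g t) setT
  measurableT (a - 1) (a + 1) _ _ _ (intgZ M (intg_norm gi))).
- by move=> s _; exact: ib.
- apply: aeW => t _ s _; apply: (@cvgM R _ (nbhs s)) => //; first exact: cphi.
  exact: cvg_cst.
- by move=> s _; apply: aeW => t _; rewrite normrM ler_wpM2r.
- by rewrite inE.
Qed.

End parameter_integrals.

(** * The Cauchy integral of a bounded, compactly supported density *)

Section cauchy.
Context (R : realType).
Local Notation leb := (@lebesgue_measure R).
Implicit Types (x y t s : R).

(** The partial derivatives of the kernels: [d1k] is the derivative of [pk] in [x] and of [qk] in
    [y], while [d2k] is that of [pk] in [y] and minus that of [qk] in [x]. These are the
    Cauchy-Riemann equations. *)
Definition d1k y x : R := - (2 * x * y / (x ^+ 2 + y ^+ 2) ^+ 2).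
Definition d2k y x : R := (x ^+ 2 - y ^+ 2) / (x ^+ 2 + y ^+ 2) ^+ 2.

Lemma is_derive_kx y s t : 0 < y ->
  is_derive s 1 (fun s => pk y (s - t)) (d1k y (s - t)) /\
  is_derive s 1 (fun s => qk y (s - t)) (- d2k y (s - t)).
Proof.
move=> y0; have h : (s - t) ^+ 2 + y ^+ 2 != 0 by rewrite gt_eqF// sqrD_gt0.
by split; rewrite /pk /qk /d1k /d2k; apply: is_derive_eq;
  rewrite /GRing.scale/= ?mulr1 ?mulr0 ?addr0 ?subr0; field.
Qed.

Lemma is_derive_ky s x : 0 < s ->
  is_derive s 1 (fun s => pk s x) (d2k s x) /\
  is_derive s 1 (fun s => qk s x) (d1k s x).
Proof.
move=> y0; have h : x ^+ 2 + s ^+ 2 != 0 by rewrite gt_eqF// sqrD_gt0.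
by split; rewrite /pk /qk /d1k /d2k; apply: is_derive_eq;
  rewrite /GRing.scale/= ?mulr1 ?mulr0 ?addr0 ?add0r ?subr0; field.
Qed.

Lemma dk_le y x : 0 < y -> `|d1k y x| <= y ^- 2 /\ `|d2k y x| <= y ^- 2.
Proof.
move=> y0; have h := sqrD_gt0 x y0.
have y2 : 0 < y ^+ 2 by rewrite exprn_gt0.
have x2 : 0 <= x ^+ 2 by exact: sqr_ge0.
have e (a : R) : `|a| <= x ^+ 2 + y ^+ 2 -> `|a / (x ^+ 2 + y ^+ 2) ^+ 2| <= y ^- 2.
  move=> ah; rewrite normrM normfV (gtr0_norm (exprn_gt0 2 h)).
  rewrite ler_pdivrMr ?exprn_gt0// mulrC ler_pdivlMr//.
  apply: (@le_trans _ _ ((x ^+ 2 + y ^+ 2) * y ^+ 2)); first by rewrite ler_wpM2r// ltW.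
  by rewrite [X in _ <= X]expr2 ler_wpM2l ?(ltW h)//; lra.
split; last by apply: e; rewrite ler_norml; lra.
rewrite /d1k -mulNr; apply: e; rewrite normrN !normrM gtr0_norm// (gtr0_norm y0).
rewrite -[x ^+ 2]real_normK ?num_real// -subr_ge0.
by rewrite (_ : _ - _ = (`|x| - y) ^+ 2) ?sqr_ge0//; ring.
Qed.

Lemma cont_dk y s t : 0 < y ->
  {for s, continuous (fun s => d1k y (s - t))} /\ {for s, continuous (fun s => d2k y (s - t))}.
Proof.
move=> y0; have h : (s - t) ^+ 2 + y ^+ 2 != 0 by rewrite gt_eqF// sqrD_gt0.
have h2 : ((s - t) ^+ 2 + y ^+ 2) ^+ 2 != 0 by rewrite expf_neq0.
by split; rewrite /d1k /d2k; apply: is_derive_cont.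
Qed.

Lemma measurable_dk y : measurable_fun setT (d1k y) /\ measurable_fun setT (d2k y).
Proof.
have md : measurable_fun setT (fun x : R => ((x ^+ 2 + y ^+ 2) ^+ 2)^-1).
  apply: measurable_inv; apply: measurable_funX.
  by apply: measurable_funD => //; exact: measurable_funX.
split.
  apply: measurableT_comp => //; apply: measurable_funM => //.
  by apply: measurable_funM => //; exact: measurable_funM.
apply: measurable_funM => //; apply: measurable_funB => //; exact: measurable_funX.
Qed.

Variables (g : R -> R) (m p : R).
Hypotheses (mg : measurable_fun setT g) (g0 : forall t, 0 <= g t).
Hypothesis (gm : forall t, g t <= m * (`|t| <= m)%R%:R) (m0 : 0 <= m).
Hypotheses (p1 : 1 < p) (p2 : p <= 2) (gpos : 0 < \int[leb]_t g t).

Lemma intg_bcs : intg leb g.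
Proof.
have ib : intg leb (fun t => (`|t| <= m)%R%:R).
  apply: intgP.
    by apply: measurable_natr_bool; apply: measurable_fun_ler.
  rewrite (_ : (\int[leb]_x _)%E = (\int[leb]_x ((`|x : R| <= m)%R%:R * 1)%:E)%E).
    rewrite (int_natr_bool leb (fun x : R => `|x| <= m) (fun=> 1)).
    rewrite (_ : [set _ | _] = `[- m, m]%classic); last first.
      by apply/seteqP; split=> x/=; rewrite in_itv/= ler_norml.
    rewrite integral_cst//= mul1e lebesgue_measure_itv/=.
    by case: ifPn => _; rewrite ?ltry// -EFinB ltry.
  by apply: eq_integral => x _; rewrite mulr1 ger0_norm.
apply: (intg_le _ _ (intgZ m ib)) => // t.
by rewrite ger0_norm.
Qed.

Let I := \int[leb]_t g t.
Let u y x := cv (pk y) g x.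
Let v y x := cv (qk y) g x.

Lemma cv_le (k : R -> R) b x : measurable_fun setT k -> (forall t, `|k t| <= b) ->
  `|cv k g x| <= b * I.
Proof.
move=> mk kb; have ik := intg_cv x mk kb intg_bcs.
apply: (le_trans (le_normr_Rint ik)).
rewrite /I -RintZ; last exact: intg_bcs.
apply: le_Rint; [exact: intg_norm|exact: intgZ intg_bcs|].
by move=> t; rewrite normrM [`|g t|]ger0_norm// ler_wpM2r.
Qed.

(** On the support of [g] the kernel is bounded below, and [g] has positive mass. Positivity of [u]
    keeps [u + iv] in the domain of the principal branch. *)
Lemma u_gt0 y x : 0 < y -> 0 < u y x.
Proof.
move=> y0.
have b : 0 < y / ((`|x| + m) ^+ 2 + y ^+ 2).
  by rewrite divr_gt0// sqrD_gt0.
apply: (@lt_le_trans _ _ (y / ((`|x| + m) ^+ 2 + y ^+ 2) * I)); first exact: mulr_gt0.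
rewrite /I -RintZ; last exact: intg_bcs.
have ik : intg leb (fun t => pk y (x - t) * g t).
  apply: (@intg_cv _ _ _ y^-1) => //; [exact: measurable_pk| |exact: intg_bcs].
  by move=> t; rewrite ger0_norm ?pk_le ?pk_ge0.
apply: le_Rint => //; first exact: intgZ intg_bcs.
move=> t; have [tm|tm] := leP `|t| m; last first.
  have : g t <= 0 by have := gm t; rewrite [`|t| <= m]leNgt tm mulr0.
  have := g0 t; move=> a c; have -> : g t = 0 by lra.
  by rewrite !mulr0.
rewrite ler_wpM2r// /pk ler_pM2l// lef_pV2 ?posrE ?sqrD_gt0// lerD2r.
rewrite -[(x - t) ^+ 2]real_normK ?num_real//.
have := ler_normB x t; have := normr_ge0 (x - t); have := normr_ge0 x; nra.
Qed.

Lemma is_derive_uvx y x : 0 < y ->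
  is_derive x 1 (u y) (cv (d1k y) g x) /\ is_derive x 1 (v y) (- cv (d2k y) g x).
Proof.
move=> y0; have mpk := @measurable_pk R y; have mqk := @measurable_qk R y.
have bp t : `|pk y t| <= y^-1 by rewrite ger0_norm ?pk_le ?pk_ge0.
split.
  apply: (@Rint_deriv _ _ R leb (fun s t => pk y (s - t)) (fun s t => d1k y (s - t)) g x 1 (y ^- 2)) => //.
  - exact: intg_bcs.
  - by move=> s t _; have [] := is_derive_kx s t y0.
  - by move=> s t _; have [] := dk_le (s - t) y0.
  - by move=> s _; exact: intg_cv intg_bcs.
rewrite (_ : - cv (d2k y) g x = \int[leb]_t (- d2k y (x - t) * g t)); last first.
  rewrite /cv -mulN1r -RintZ.
    by apply: eq_Rint => t; rewrite mulN1r mulNr.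
  apply: (@intg_cv _ _ _ (y ^- 2)); [by have [] := measurable_dk y| |exact: intg_bcs].
  by move=> t; have [] := dk_le t y0.
apply: (@Rint_deriv _ _ R leb (fun s t => qk y (s - t)) (fun s t => - d2k y (s - t)) g x 1 (y ^- 2)) => //.
- exact: intg_bcs.
- by move=> s t _; have [] := is_derive_kx s t y0.
- by move=> s t _; rewrite normrN; have [] := dk_le (s - t) y0.
- move=> s _; apply: (@intg_cv _ _ _ y^-1) => //; last exact: intg_bcs.
  by move=> t; exact: qk_le.
Qed.

Lemma is_derive_uvy y x : 0 < y ->
  is_derive y 1 (u ^~ x) (cv (d2k y) g x) /\ is_derive y 1 (v ^~ x) (cv (d1k y) g x).
Proof.
move=> y0.
have hy s : y - y / 2 < s < y + y / 2 -> 0 < s by move=> /andP[]; lra.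
have hb s : y - y / 2 < s < y + y / 2 -> s ^- 2 <= (y / 2) ^- 2.
  move=> h; have s0 := hy _ h; rewrite lef_pV2 ?posrE ?exprn_gt0//; last by lra.
  by rewrite ler_sqr ?nnegrE; lra.
split.
  apply: (@Rint_deriv _ _ R leb (fun s t => pk s (x - t)) (fun s t => d2k s (x - t)) g y (y / 2)
    ((y / 2) ^- 2)); [lra|exact: intg_bcs| | |].
  - by move=> s t /hy s0; have [] := is_derive_ky (x - t) s0.
  - by move=> s t h; have [_] := dk_le (x - t) (hy _ h) => /le_trans; apply; exact: hb.
  - move=> s /hy s0; apply: (@intg_cv _ _ _ s^-1) => //; last exact: intg_bcs.
      exact: measurable_pk.
    by move=> t; rewrite ger0_norm ?pk_le ?pk_ge0.
apply: (@Rint_deriv _ _ R leb (fun s t => qk s (x - t)) (fun s t => d1k s (x - t)) g y (y / 2)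
  ((y / 2) ^- 2)); [lra|exact: intg_bcs| | |].
- by move=> s t /hy s0; have [] := is_derive_ky (x - t) s0.
- by move=> s t h; have [+ _] := dk_le (x - t) (hy _ h) => /le_trans; apply; exact: hb.
- move=> s /hy s0; apply: (@intg_cv _ _ _ s^-1) => //; last exact: intg_bcs.
    exact: measurable_qk.
  by move=> t; exact: qk_le.
Qed.

Lemma cont_cv_dk y : 0 < y -> continuous (cv (d1k y) g) /\ continuous (cv (d2k y) g).
Proof.
move=> y0; split.
  apply: (@Rint_cont _ _ R leb (fun s t => d1k y (s - t)) g (y ^- 2)); first exact: intg_bcs.
  - by move=> s; apply: measurable_shift1; have [] := measurable_dk y.
  - by move=> s t; have [] := cont_dk s t y0.
  - by move=> s t; have [] := dk_le (s - t) y0.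
apply: (@Rint_cont _ _ R leb (fun s t => d2k y (s - t)) g (y ^- 2)); first exact: intg_bcs.
- by move=> s; apply: measurable_shift1; have [] := measurable_dk y.
- by move=> s t; have [] := cont_dk s t y0.
- by move=> s t; have [] := dk_le (s - t) y0.
Qed.

Lemma uv_le y x : 0 < y -> `|u y x| <= y^-1 * I /\ `|v y x| <= y^-1 * I.
Proof.
move=> y0; split; apply: cv_le; [exact: measurable_pk| |exact: measurable_qk|].
  by move=> t; rewrite ger0_norm ?pk_le ?pk_ge0.
by move=> t; exact: qk_le.
Qed.

Lemma cv_dk_le y x : 0 < y ->
  `|cv (d1k y) g x| <= y ^- 2 * I /\ `|cv (d2k y) g x| <= y ^- 2 * I.
Proof.
move=> y0; have [m1 m2] := measurable_dk y.
by split; apply: cv_le => // t; have [] := dk_le t y0.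
Qed.

(** The bound does not deteriorate as [y] tends to 0; it controls the vertical sides of the
    rectangle in the contour argument. *)
Lemma uv_far y x : 0 < y -> m < `|x| ->
  `|u y x| <= (`|x| - m)^-1 * I /\ `|v y x| <= (`|x| - m)^-1 * I.
Proof.
move=> y0 mx.
have far (k : R -> R) : measurable_fun setT k -> (forall t, `|k t| <= y^-1) ->
    (forall t, t != 0 -> `|k t| <= `|t|^-1) -> `|cv k g x| <= (`|x| - m)^-1 * I.
  move=> mk kb kf; have ik := intg_cv x mk kb intg_bcs.
  apply: (le_trans (le_normr_Rint ik)).
  rewrite /I -RintZ; last exact: intg_bcs.
  apply: le_Rint; [exact: intg_norm|exact: intgZ intg_bcs|].
  move=> t; rewrite normrM [`|g t|]ger0_norm//.
  have [tm|tm] := leP `|t| m; last first.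
    have : g t <= 0 by have := gm t; rewrite [`|t| <= m]leNgt tm mulr0.
    have := g0 t; move=> a c; have -> : g t = 0 by lra.
    by rewrite !mulr0.
  rewrite ler_wpM2r//; have xt : `|x| - m <= `|x - t|.
    by apply: le_trans (lerB_dist x t); lra.
  have xt0 : x - t != 0 by rewrite -normr_gt0; lra.
  apply: (le_trans (kf _ xt0)); rewrite lef_pV2 ?posrE//; last by lra.
  by rewrite normr_gt0.
have sq (t : R) : t != 0 -> `|t| * y <= t ^+ 2 + y ^+ 2 /\ `|t| * `|t| <= t ^+ 2 + y ^+ 2.
  move=> _; rewrite -[t ^+ 2]real_normK ?num_real//; have := normr_ge0 t; set z := `|t| => z0.
  by split; [have := sqr_ge0 (z - y); nra|have := sqr_ge0 y; rewrite -expr2; lra].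
split; apply: far.
- exact: measurable_pk.
- by move=> t; rewrite ger0_norm ?pk_le ?pk_ge0.
- move=> t t0; have [h _] := sq t t0.
  rewrite ger0_norm ?pk_ge0// /pk ler_pdivrMr ?sqrD_gt0// ler_pdivlMl ?normr_gt0//.
- exact: measurable_qk.
- by move=> t; exact: qk_le.
- move=> t t0; have [_ h] := sq t t0.
  rewrite /qk normrM normfV (gtr0_norm (sqrD_gt0 t y0)).
  by rewrite ler_pdivrMr ?sqrD_gt0// ler_pdivlMl ?normr_gt0.
Qed.

Let G y x := rePow p (u y x) (v y x).
Let K y x := imPow p (u y x) (v y x).
Let dG y x := p * (G y x * (u y x * cv (d2k y) g x + v y x * cv (d1k y) g x) -
  K y x * (u y x * cv (d1k y) g x - v y x * cv (d2k y) g x)) / (u y x ^+ 2 + v y x ^+ 2).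

Lemma is_derive_Gy y x : 0 < y -> is_derive y 1 (G ^~ x) (dG y x).
Proof.
move=> y0; have [du dv] := is_derive_uvy x y0.
exact: (is_derive_rePowE p du dv (u_gt0 x y0)).
Qed.

(** Together with [is_derive_Gy], a Cauchy-Riemann equation for [(u + iv)^p]: the vertical
    derivative of the real part is an exact horizontal derivative. *)
Lemma is_derive_Kx y x : 0 < y -> is_derive x 1 (K y) (- dG y x).
Proof.
move=> y0; have [du dv] := is_derive_uvx x y0.
apply: is_derive_eq (is_derive_imPowE p du dv (u_gt0 x y0)) _.
by rewrite /dG /G /K; ring.
Qed.

Lemma cont_u y : 0 < y -> continuous (u y) /\ continuous (v y).
Proof.
by move=> y0; split=> x; have [du dv] := is_derive_uvx x y0; exact: is_derive_cont.
Qed.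

Lemma cont_G y : 0 < y -> continuous (G y) /\ continuous (K y).
Proof.
move=> y0; split=> x; last by have := is_derive_Kx x y0; exact: is_derive_cont.
have [du dv] := is_derive_uvx x y0.
exact: is_derive_cont (is_derive_rePowE p du dv (u_gt0 x y0)).
Qed.

Lemma cont_dG y : 0 < y -> continuous (dG y).
Proof.
move=> y0 x; have [cG cK] := cont_G y0; have [cu cvv] := cont_u y0.
have [c1 c2] := cont_cv_dk y0.
have A0 : u y x ^+ 2 + v y x ^+ 2 != 0.
  by rewrite gt_eqF// ltr_pwDl ?sqr_ge0// exprn_gt0// u_gt0.
apply: cvgM.
  apply: cvgM; first exact: cvg_cst.
  apply: cvgB; apply: cvgM; [exact: cG| |exact: cK|].
    by apply: cvgD; apply: cvgM; [exact: cu|exact: c2|exact: cvv|exact: c1].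
  by apply: cvgB; apply: cvgM; [exact: cu|exact: c1|exact: cvv|exact: c2].
apply: cvgV => //.
by apply: cvgD; apply: cvgM; [exact: cu|exact: cu|exact: cvv|exact: cvv].
Qed.

Let chi (N x : R) : R := (- N <= x <= N)%R%:R.

Lemma measurable_chi N : measurable_fun setT (chi N).
Proof.
apply: measurable_natr_bool; apply: measurable_and; first exact: measurable_lec.
exact: measurable_gec.
Qed.

Lemma int_chi (N : R) : 0 <= N -> (\int[leb]_x (chi N x)%:E = (2 * N)%:E)%E.
Proof.
move=> N0; transitivity (\int[leb]_x (chi N x * 1)%:E)%E.
  by apply: eq_integral => x _; rewrite mulr1.
rewrite (int_natr_bool leb (fun x : R => - N <= x <= N) (fun=> 1)).
rewrite (_ : [set _ | _] = `[- N, N]%classic); last first.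
  by apply/seteqP; split=> x/=; rewrite in_itv.
rewrite integral_cst//= mul1e lebesgue_measure_itv/=.
rewrite lte_fin; case: ltP => h; first by rewrite -EFinB; congr (_%:E); ring.
by congr (_%:E); lra.
Qed.

Lemma intg_chi (N : R) : 0 <= N -> intg leb (chi N).
Proof.
move=> N0; apply: intgP; first exact: measurable_chi.
have -> : (\int[leb]_x `|chi N x|%:E = \int[leb]_x (chi N x)%:E)%E.
  by apply: eq_integral => x _; rewrite ger0_norm.
by rewrite int_chi// ltry.
Qed.

Lemma intg_bounded_chi (N : R) (f : R -> R) (b : R) : 0 <= N -> measurable_fun setT f ->
  (forall x, `|f x| <= b) -> intg leb (fun x => f x * chi N x).
Proof.
move=> N0 mf fb; apply: (intg_le _ _ (intgZ b (intg_chi N0))).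
  by apply: measurable_funM => //; exact: measurable_chi.
by move=> x; rewrite normrM [`|chi N x|]ger0_norm// ler_wpM2r.
Qed.

Let J N y := \int[leb]_x (G y x * chi N x).

Let bd (y : R) := (2 * (y^-1 * I) ^+ 2) `^ (p / 2).

Lemma G_le y x : 0 < y -> `|G y x| <= bd y.
Proof.
move=> y0; have [ub vb] := uv_le x y0.
by have [] := abs_rePow (ltW (lt_trans ltr01 p1)) (u_gt0 x y0) ub vb.
Qed.

(** The derivative of the integrand is [dG], which has the antiderivative [- K y] in [x], so only
    the two endpoints survive. *)
Lemma is_derive_J (N y : R) : 0 <= N -> 0 < y -> is_derive y 1 (J N) (K y (- N) - K y N).
Proof.
move=> N0 y0.
have hy s : y - y / 2 < s < y + y / 2 -> 0 < s by move=> /andP[]; lra.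
have I0 : 0 <= I by exact: ltW.
have hb s : y - y / 2 < s < y + y / 2 -> s^-1 <= (y / 2)^-1.
  by move=> h; have s0 := hy _ h; rewrite lef_pV2 ?posrE//; lra.
have h := @Rint_deriv _ _ R leb G dG (chi N) y (y / 2)
  (p * 4 * ((y / 2)^-1 ^+ 2 * I) * (2 * ((y / 2)^-1 * I) ^+ 2) `^ ((p - 1) / 2)).
have -> : K y (- N) - K y N = \int[leb]_t (dG y t * chi N t).
  under eq_Rint do rewrite mulrC.
  rewrite (Rint_natr_bool leb (fun x : R => - N <= x <= N)).
  rewrite (_ : [set _ | _] = `[- N, N]%classic); last first.
    by apply/seteqP; split=> x/=; rewrite in_itv.
  have -> : K y (- N) - K y N = - K y N - - K y (- N) by rewrite opprK addrC.
  apply/esym; apply: (@ftcR R (fun x => - K y x) (dG y) (- N) N).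
  - lra.
  - move=> x _; have dK := is_derive_Kx x y0.
    by apply: is_derive_eq; rewrite opprK.
  - by move=> x _; exact: cont_dG.
apply: h; [lra|exact: intg_chi| | |].
- by move=> s t /hy s0; exact: is_derive_Gy.
- move=> s t hs; have s0 := hy _ hs; have [ub vb] := uv_le t s0.
  have [d1 d2] := cv_dk_le t s0; have sb := hb _ hs.
  have s1 : 0 <= s^-1 by rewrite invr_ge0 ltW.
  have ss : s ^- 2 * I <= (y / 2)^-1 ^+ 2 * I.
    by rewrite ler_wpM2r// -exprVn ler_sqr ?nnegrE// (le_trans s1).
  apply: abs_dPow => //; [exact: u_gt0| | | |].
  + by apply: (le_trans ub); rewrite ler_wpM2r.
  + by apply: (le_trans vb); rewrite ler_wpM2r.
  + exact: le_trans d2 ss.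
  + exact: le_trans d1 ss.
- move=> s /hy s0; apply: (@intg_bounded_chi _ _ (bd s)) => //.
    by apply: continuous_measurable_fun; have [] := cont_G s0.
  by move=> x; exact: G_le.
Qed.

(** Cauchy's theorem on the rectangle over [[-N, N]] between heights [d] and [N]. On the top side
    and on the vertical sides the integrand is at most [q], of order [N^-p]; the top contributes
    [2 N q] and the sides at most [2 q N]. The condition [2 m < N] turns [1 / (N - m)] into
    [2 / N]. *)
Lemma J_bound (d N : R) : 0 < d -> d < N -> 1 <= N -> 2 * m < N ->
  `|J N d| <= 4 * ((8 * I ^+ 2) `^ (p / 2)) * (N^-1) `^ (p - 1).
Proof.
move=> d0 dN N1 mN; have N0 : 0 < N by lra.
have I0 : 0 <= I by exact: ltW.
have p0 : 0 < p := lt_trans ltr01 p1.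
pose q := (2 * (2 * N^-1 * I) ^+ 2) `^ (p / 2).
have q0 : 0 <= q by exact: powR_ge0.
have Ni : 0 < N^-1 by rewrite invr_gt0.
have JNN : `|J N N| <= 2 * N * q.
  have iG : intg leb (fun x => G N x * chi N x).
    apply: (@intg_bounded_chi _ _ (bd N)); first lra.
      by apply: continuous_measurable_fun; have [] := cont_G N0.
    by move=> x; exact: G_le.
  apply: (le_trans (le_normr_Rint iG)).
  apply: (@le_trans _ _ (\int[leb]_x (q * chi N x))).
    apply: le_Rint; [exact: intg_norm|by apply: intgZ; apply: intg_chi; lra|].
    move=> x; rewrite normrM [`|chi N x|]ger0_norm// ler_wpM2r//.
    apply: (le_trans (G_le x N0)); apply: ge0_ler_powR; rewrite ?nnegrE.
    - by lra.
    - by rewrite mulr_ge0// sqr_ge0.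
    - by rewrite mulr_ge0// sqr_ge0.
    - rewrite ler_pM2l// ler_sqr ?nnegrE ?mulr_ge0 ?(ltW Ni)//.
      by have := mulr_ge0 (ltW Ni) I0; lra.
  rewrite RintZ; last by apply: intg_chi; lra.
  rewrite /Rintegral int_chi/=; last by lra.
  by rewrite mulrC.
have mN1 : m < N by have := m0; lra.
have Nm : 0 < N - m by lra.
have h1 : (N - m)^-1 <= 2 * N^-1.
  by rewrite -[2]invrK -invfM lef_pV2 ?posrE ?mulr_gt0//; lra.
have h2 : (2 * ((N - m)^-1 * I) ^+ 2) `^ (p / 2) <= q.
  apply: ge0_ler_powR; rewrite ?nnegrE.
  - by lra.
  - by rewrite mulr_ge0// sqr_ge0.
  - by rewrite mulr_ge0// sqr_ge0.
  - rewrite ler_pM2l// ler_sqr ?nnegrE; first exact: ler_wpM2r.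
      by rewrite mulr_ge0// invr_ge0 ltW.
    by rewrite !mulr_ge0// ltW.
have dJ y : d <= y -> is_derive y 1 (J N) (K y (- N) - K y N).
  by move=> dy; apply: is_derive_J; [exact: ltW|exact: lt_le_trans dy].
(* The mean value theorem stands in for the integral over the vertical sides. *)
have [y /[!in_itv]/= /andP[dy yN] JE] : exists2 y, y \in `]d, N[ &
    J N N - J N d = (K y (- N) - K y N) * (N - d).
  apply: MVT => //.
    by move=> y /[!in_itv]/= /andP[dy _]; apply: dJ; exact: ltW.
  apply: derivable_within_continuous => y /[!in_itv]/= /andP[dy _].
  by have h := dJ _ dy; exact: ex_derive.
have y0 : 0 < y := lt_trans d0 dy.
have Kq x : `|x| = N -> `|K y x| <= q.
  move=> xN.
  have mx : m < `|x| by rewrite xN.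
  have [ub vb] := uv_far y0 mx; rewrite xN in ub vb.
  have [_ h] := abs_rePow (ltW p0) (u_gt0 x y0) ub vb.
  exact: (le_trans h).
have K1 := Kq N (gtr0_norm N0).
have K2 := Kq (- N) (etrans (normrN N) (gtr0_norm N0)).
have J2 : `|J N d| <= 4 * N * q.
  move: JNN JE K1 K2 q0 N0 d0 dN; clear.
  move: (J N N) (J N d) (K y N) (K y (- N)) q => JN Jd KN KN' q JNN JE K1 K2 q0 N0 d0 dN.
  have -> : Jd = JN - (KN' - KN) * (N - d) by rewrite -JE; ring.
  apply: (le_trans (ler_normB _ _)); rewrite normrM [`|N - d|]ger0_norm; last by lra.
  have h : `|KN' - KN| <= 2 * q by apply: (le_trans (ler_normB _ _)); lra.
  have : `|KN' - KN| * (N - d) <= 2 * q * N.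
    by apply: ler_pM => //; lra.
  lra.
apply: (le_trans J2); rewrite /q.
have -> : 2 * (2 * N^-1 * I) ^+ 2 = (8 * I ^+ 2) * N^-1 ^+ 2 by ring.
rewrite powRM; [|by rewrite mulr_ge0 ?sqr_ge0|exact: sqr_ge0].
have -> : (N^-1 ^+ 2) `^ (p / 2) = N^-1 * N^-1 `^ (p - 1).
  rewrite mulr_powRB1 ?(ltW Ni)// -(powR_mulrn 2 (ltW Ni)) -powRrM; congr (_ `^ _).
  by rewrite mulrC divfK.
set A := (8 * I ^+ 2) `^ _; set B := N^-1 `^ _.
have -> : 4 * N * (A * (N^-1 * B)) = 4 * A * B * (N * N^-1) by ring.
by rewrite mulfV ?mulr1// gt_eqF.
Qed.

Lemma rePow_int_bound (d N : R) : 0 < d -> d < N -> 1 <= N -> 2 * m < N ->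
  `|\int[leb]_x (rePow p (cv (pk d) g x) (cv (qk d) g x) * (- N <= x <= N)%R%:R)| <=
  4 * ((8 * (\int[leb]_t g t) ^+ 2) `^ (p / 2)) * (N^-1) `^ (p - 1).
Proof. exact: J_bound. Qed.

End cauchy.

(** * The semigroup law for Poisson and conjugate Poisson kernels *)

Section semigroup.
Context (R : realType).
Local Notation leb := (@lebesgue_measure R).

Lemma cvg_atan_nat (y c : R) : 0 < c ->
  atan ((n.+1%:R + y) / c) @[n --> \oo] --> pi / 2.
Proof.
move=> c0; apply: (cvg_comp (fun n : nat => (n.+1%:R + y) / c) _ _ (@cvgy_atan R)).
apply/cvgryPge => A; near=> n; rewrite ler_pdivlMr// -lerBlDr.
apply: (@le_trans _ _ n%:R); last by rewrite ler_nat.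
by near: n; exact: nbhs_infty_ger.
Unshelve. all: by end_near. Qed.

Lemma cvg_ln_ratio (y a b : R) : 0 < a -> 0 < b ->
  ln (((n.+1%:R + y) ^+ 2 + a ^+ 2) / (n.+1%:R ^+ 2 + b ^+ 2)) @[n --> \oo] --> (0 : R).
Proof.
move=> a0 b0; rewrite -(@ln1 R).
pose f (n : nat) : R := ((n.+1%:R + y) ^+ 2 + a ^+ 2) / (n.+1%:R ^+ 2 + b ^+ 2).
suff hf : f n @[n --> \oo] --> (1 : R) by exact: (cvg_comp _ _ hf (continuous_ln ltr01)).
pose c := `|2 * y| + `|y ^+ 2 + a ^+ 2 - b ^+ 2|.
have alg (N : R) : 0 < N ^+ 2 + b ^+ 2 -> ((N + y) ^+ 2 + a ^+ 2) / (N ^+ 2 + b ^+ 2) - 1 =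
    (2 * y * N + (y ^+ 2 + a ^+ 2 - b ^+ 2)) / (N ^+ 2 + b ^+ 2).
  by move=> D0; field; rewrite gt_eqF.
apply/cvgrPdist_le => d d0; near=> n; rewrite /f.
have n1 : 1 <= n.+1%:R :> R by rewrite ler1n.
set N := n.+1%:R in n1 *; have N0 : 0 < N by lra.
have D0 : 0 < N ^+ 2 + b ^+ 2 by rewrite ltr_wpDl ?sqr_ge0// exprn_gt0.
rewrite distrC (alg N D0).
rewrite normrM normfV (gtr0_norm D0) ler_pdivrMr//.
apply: (@le_trans _ _ (c * N)).
  apply: (le_trans (ler_normD _ _)); rewrite (normrM (2 * y) N) (gtr0_norm N0).
  rewrite /c [leRHS]mulrDl lerD2l.
  by rewrite ler_peMr.
have cN : c <= d * N.
  rewrite mulrC -ler_pdivrMr//; apply: (@le_trans _ _ n%:R); last by rewrite ler_nat.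
  by near: n; exact: nbhs_infty_ger.
apply: (@le_trans _ _ (d * N * N)); first by rewrite ler_pM2r.
by rewrite -mulrA ler_pM2l// -expr2 lerDl sqr_ge0.
Unshelve. all: by end_near. Qed.

Lemma Rint_chi_cvg (f : R -> R) : intg leb f ->
  \int[leb]_(x in `[- n.+1%:R, n.+1%:R]) f x @[n --> \oo] --> \int[leb]_x f x.
Proof.
move=> fi; have mf := intg_measurable fi.
pose F n (x : R) := (- n.+1%:R <= x <= n.+1%:R)%R%:R * f x.
have [_] : intg leb f /\ (\int[leb]_x F n x @[n --> \oo] --> \int[leb]_x f x).
  apply: (Rint_dct _ _ (intg_norm fi)); rewrite /F.
- move=> n; apply: measurable_funM => //.
  apply: measurable_natr_bool; apply: measurable_and; first exact: measurable_lec.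
  exact: measurable_gec.
- move=> x; apply: cvg_near_cst; near=> n.
  rewrite (_ : (- n.+1%:R <= _ <= n.+1%:R) = true) ?mul1r// -ler_norml.
  apply: (@le_trans _ _ n%:R); last by rewrite ler_nat.
  by near: n; exact: nbhs_infty_ger.
- by move=> n x; rewrite normrM ger0_norm// ler_piMl// lern1 leq_b1.
apply: cvg_trans; apply: near_eq_cvg; apply: nearW => n.
rewrite (Rint_natr_bool leb (fun x : R => - n.+1%:R <= x <= n.+1%:R)).
by congr Rintegral; apply/seteqP; split=> x/=; rewrite in_itv.
Unshelve. all: by end_near. Qed.

(** Partial fractions in [s]: [al], [be] and [ga] are the coefficients of the logarithm and of the
    two arctangents in an antiderivative. At infinity the logarithms cancel and the arctangents
    contribute [pi]. The assumption [a != b] keeps the denominator [Dm] positive at [x = 0]. *)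
Lemma pk_qk_semigroup (a b x : R) : 0 < a -> 0 < b -> a != b ->
  \int[leb]_s (pk a (x - s) * qk b s) = pi * qk (a + b) x.
Proof.
move=> a0 b0 ab.
have ifs : intg leb (fun s => pk a (x - s) * qk b s).
  apply: (@intg_pkM _ a (qk b) b^-1 x a0); first exact: measurable_qk.
  by move=> t; exact: qk_le.
rewrite -(cvg_lim (@Rhausdorff R) (Rint_chi_cvg ifs)); apply/cvg_lim => //.
pose Dm : R := x ^+ 2 + (a - b) ^+ 2; pose Dp : R := x ^+ 2 + (a + b) ^+ 2.
have Dm0 : 0 < Dm by rewrite ltr_wpDl ?sqr_ge0// exprn_even_gt0// subr_eq0.
have Dp0 : 0 < Dp by rewrite ltr_wpDl ?sqr_ge0// exprn_gt0//; lra.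
pose al : R := - (a * (x ^+ 2 + a ^+ 2 - b ^+ 2)) / (Dm * Dp).
pose be : R := x * (x ^+ 2 + a ^+ 2 + b ^+ 2) / (Dm * Dp).
pose ga : R := - (2 * a * b * x) / (Dm * Dp).
pose A (s : R) : R := (s - x) ^+ 2 + a ^+ 2.
pose B (s : R) : R := s ^+ 2 + b ^+ 2.
have A0 s : 0 < A s by rewrite ltr_wpDl ?sqr_ge0// exprn_gt0.
have B0 s : 0 < B s by rewrite ltr_wpDl ?sqr_ge0// exprn_gt0.
pose F (s : R) : R := al / 2 * ln (A s / B s) + be * atan ((s - x) / a) + ga * atan (s / b).
have dF (s : R) : is_derive s 1 F (pk a (x - s) * qk b s).
  have h1 : is_derive s 1 (fun s => A s / B s)
      ((2 * (s - x) * B s - 2 * s * A s) / B s ^+ 2).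
    have B1 : s ^+ 2 + b ^+ 2 != 0 by rewrite gt_eqF// (B0 s).
    rewrite /A /B; apply: is_derive_eq; rewrite /GRing.scale/= ?mulr1 ?mulr0 ?addr0 ?subr0; field.
    exact: B1.
  have AB0 : 0 < A s / B s by rewrite divr_gt0.
  have h2 := is_derive1_comp (is_derive1_ln AB0 : is_derive ((fun s => A s / B s) s) 1 (@ln R) _) h1.
  have h3 := is_deriveM (is_derive_cst (al / 2) s 1) h2.
  have h4 : is_derive s 1 (fun s => be * atan ((s - x) / a)) (be * (a / A s)).
    apply: is_derive_eq; rewrite /GRing.scale/= ?mulr1 ?mulr0 ?addr0 ?add0r ?subr0 /A; field.
    by rewrite !gt_eqF ?(A0 s)//= addrC (A0 s).
  have h5 : is_derive s 1 (fun s => ga * atan (s / b)) (ga * (b / B s)).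
    apply: is_derive_eq; rewrite /GRing.scale/= ?mulr1 ?mulr0 ?addr0 ?add0r ?subr0 /B; field.
    by rewrite !gt_eqF ?(B0 s)//= addrC (B0 s).
  apply: (is_derive_eq (is_deriveD (is_deriveD h3 h4) h5)).
  rewrite /GRing.scale/= ?mulr1 ?mulr0 ?addr0 /pk /qk.
  have -> : (x - s) ^+ 2 + a ^+ 2 = A s by rewrite /A; ring.
  rewrite -/(B s) /al /be /ga.
  have Am := gt_eqF (A0 s); have Bm := gt_eqF (B0 s).
  have Dmn := gt_eqF Dm0; have Dpn := gt_eqF Dp0.
  move: Am Bm Dmn Dpn; rewrite /A /B /Dm /Dp => Am Bm Dmn Dpn.
  by field; rewrite Am Bm Dmn Dpn.
have FE n : \int[leb]_(s in `[- n.+1%:R, n.+1%:R]) (pk a (x - s) * qk b s) =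
    F n.+1%:R - F (- n.+1%:R).
  apply: ftcR => [|s _].
  - by rewrite (@le_trans _ _ 0)// oppr_le0.
  - have k1 : (x - s) ^+ 2 + a ^+ 2 != 0 by rewrite gt_eqF// sqrD_gt0.
    have k2 : s ^+ 2 + b ^+ 2 != 0 by rewrite gt_eqF// sqrD_gt0.
    by rewrite /pk /qk; apply: is_derive_cont.
have Fn n : F n.+1%:R - F (- n.+1%:R) =
   al / 2 * ln (((n.+1%:R + - x) ^+ 2 + a ^+ 2) / (n.+1%:R ^+ 2 + b ^+ 2)) -
   al / 2 * ln (((n.+1%:R + x) ^+ 2 + a ^+ 2) / (n.+1%:R ^+ 2 + b ^+ 2)) +
   (be * atan ((n.+1%:R + - x) / a) + be * atan ((n.+1%:R + x) / a)) +
   (ga * atan ((n.+1%:R + 0) / b) + ga * atan ((n.+1%:R + 0) / b)).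
  rewrite /F /A /B addr0 sqrrN (_ : - n.+1%:R - x = - (n.+1%:R + x)); last by ring.
  rewrite sqrrN !mulNr !atanN; ring.
rewrite (funext (fun n => etrans (FE n) (Fn n)) : (fun n => _) = _).
have -> : pi * qk (a + b) x = al / 2 * 0 - al / 2 * 0 +
    (be * (pi / 2) + be * (pi / 2)) + (ga * (pi / 2) + ga * (pi / 2)).
  have Dmn := gt_eqF Dm0; have Dpn := gt_eqF Dp0.
  rewrite /qk -/Dp /be /ga; move: Dmn Dpn; rewrite /Dm /Dp => Dmn Dpn.
  by field; rewrite Dmn Dpn.
apply: cvgD; first apply: cvgD; first apply: cvgB.
- by apply: cvgM; [exact: cvg_cst|exact: cvg_ln_ratio].
- by apply: cvgM; [exact: cvg_cst|exact: cvg_ln_ratio].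
- by apply: cvgD; apply: cvgM; [exact: cvg_cst|exact: cvg_atan_nat|exact: cvg_cst|exact: cvg_atan_nat].
- by apply: cvgD; apply: cvgM; [exact: cvg_cst|exact: cvg_atan_nat|exact: cvg_cst|exact: cvg_atan_nat].
Qed.

(* The conjugate Poisson integral at height [a + b] is the Poisson integral of
   the one at height [b]. *)
Lemma cv_qk_semigroup (g : R -> R) (a b x : R) : 0 < a -> 0 < b -> a != b ->
  intg leb g ->
  `|cv (qk (a + b)) g x| <= pi^-1 * cv (pk a) (fun s => `|cv (qk b) g s|) x.
Proof.
move=> a0 b0 ab gi; have mg := intg_measurable gi.
have pi0 : 0 < pi :> R by exact: pi_gt0.
have mqb : measurable_fun setT (cv (qk b) g) by apply: measurable_cv => //; exact: measurable_qk.
have qb s : `|cv (qk b) g s| <= b^-1 * \int[leb]_t `|g t|.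
  have ik := intg_cv s (@measurable_qk R b) (fun t => qk_le t b0) gi.
  apply: (le_trans (le_normr_Rint ik)); rewrite -RintZ; last exact: intg_norm.
  apply: le_Rint; [exact: intg_norm|exact: intgZ (intg_norm gi)|].
  by move=> t; rewrite normrM ler_wpM2r// qk_le.
pose F s t := pk a (x - s) * (qk b (s - t) * g t).
have iF : intg2 leb leb F.
  apply: (intg2_prod _ (intg_pk_shift x a0) (intgZ b^-1 (intg_norm gi))).
    apply: measurable_funM.
      by apply: (measurableT_comp (measurable_pk a)); exact: measurable_funB.
    apply: measurable_funM; last exact: measurableT_comp.
    by apply: measurable_shift; exact: measurable_qk.
  move=> s t; rewrite /F normrM (ger0_norm (pk_ge0 (x - s) a0)) ler_wpM2l ?pk_ge0//.
  by rewrite normrM ler_wpM2r// qk_le.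
have E : pi * cv (qk (a + b)) g x = \int[leb]_s (pk a (x - s) * cv (qk b) g s).
  transitivity (\int[leb]_s \int[leb]_t F s t); last first.
    apply: eq_Rint => s; rewrite /F RintZ//.
    exact: (intg_cv s (@measurable_qk R b) (fun t => qk_le t b0) gi).
  rewrite (Rint_fubini iF) /cv -RintZ; last first.
    have ab0 : 0 < a + b by lra.
    exact: (intg_cv x (@measurable_qk R (a + b)) (fun t => qk_le t ab0) gi).
  apply: eq_Rint => t; rewrite /F.
  have it : intg leb (fun s => pk a (x - s) * qk b (s - t)).
    apply: (@intg_pkM _ a (fun s => qk b (s - t)) b^-1 x a0); last by move=> s; exact: qk_le.
    by apply: (measurableT_comp (measurable_qk b)); exact: measurable_funB.
  under eq_Rint => s do rewrite mulrA mulrC.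
  rewrite RintZ// mulrA mulrC -(pk_qk_semigroup (x - t) a0 b0 ab); congr (_ * _).
  rewrite (@Rint_affine _ 1 (- t) _ (oner_neq0 _)); last first.
    apply: (@intg_pkM _ a (qk b) b^-1 (x - t) a0); first exact: measurable_qk.
    by move=> s; exact: qk_le.
  rewrite normr1 mul1r; apply: eq_Rint => s; rewrite mul1r.
  by congr (pk a _ * _); ring.
have ->: cv (qk (a + b)) g x = pi^-1 * \int[leb]_s (pk a (x - s) * cv (qk b) g s).
  by rewrite -E mulrA mulVf ?mul1r// gt_eqF.
have i1 : intg leb (fun s => pk a (x - s) * cv (qk b) g s) by exact: (intg_pkM x a0 mqb qb).
rewrite normrM gtr0_norm ?invr_gt0// ler_pM2l ?invr_gt0//.
apply: (le_trans (le_normr_Rint i1)); apply: le_Rint; first exact: intg_norm.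
  apply: (intg_pkM x a0 _ (m := b^-1 * \int[leb]_t `|g t|)); first exact: measurableT_comp.
  by move=> s; rewrite normr_id.
by move=> s; rewrite normrM (ger0_norm (pk_ge0 (x - s) a0)).
Qed.

End semigroup.

(** * Conjugate functions and maximal Hilbert transforms on L^p *)

Section hilbert.
Context (R : realType).
Local Notation leb := (@lebesgue_measure R).
Implicit Types (g : R -> R) (m p d : R).

(** Bounded with compact support; a single number controls the height and the support, which is all
    that the contour argument uses quantitatively. *)
Definition bcs m g := [/\ measurable_fun setT g, 0 <= m &
  forall t, `|g t| <= m * (`|t| <= m)%R%:R].

Lemma bcs_intg m g : bcs m g -> intg leb g.
Proof.
move=> [mg m0 gm].
have h : intg leb (fun t => `|g t|).
  by apply: (@intg_bcs _ (fun t => `|g t|) m) => //; exact: measurableT_comp.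
by apply: (intg_le _ _ h).
Qed.

Lemma bcs_le m g t : bcs m g -> `|g t| <= m.
Proof.
move=> [_ m0 gm]; apply: le_trans (gm t) _.
by rewrite -[leRHS]mulr1 ler_wpM2l// lern1 leq_b1.
Qed.

Lemma mx1 (F : R -> R) d : 0 <= F d -> mx [:: d] F = F d.
Proof. by move=> F0; rewrite /mx big_cons big_nil max_l. Qed.

Lemma poisson_Lp p : 1 < p -> exists2 C : R, 0 <= C &
  forall g m d, bcs m g -> (forall t, 0 <= g t) -> 0 < d ->
  (\int[leb]_x (cv (pk d) g x `^ p)%:E <= C%:E * \int[leb]_x (g x `^ p)%:E)%E.
Proof.
move=> p1; have [C C0 h] := poisson_maximal p1; exists C => // g m d gb g0 d0.
have [mg m0 gm] := gb.
have E0 : {in [:: d], forall e : R, 0 < e} by move=> e; rewrite inE => /eqP ->.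
have gle t : g t <= m by rewrite -(ger0_norm (g0 t)); exact: bcs_le gb.
apply: le_trans (h g m [:: d] mg g0 gle E0).
apply: int_mono => x; rewrite lee_fin ?powR_ge0// mx1//.
exact: cv_pk_ge0.
Qed.

Lemma cvg_comp_shift (T : topologicalType) (N : nat) (u : nat -> T) (l : T) :
  u @ \oo --> l -> (fun n => u (n + N)%N) @ \oo --> l.
Proof. by move=> h; exact: cvg_comp (cvg_addnr N) h. Qed.

Lemma bcs_powR_lty m g p : 0 < p -> bcs m g -> (\int[leb]_t (`|g t| `^ p)%:E < +oo)%E.
Proof.
move=> p0 gb; have [mg m0 gm] := gb.
have h : intg leb (fun t => m `^ p * (- m <= t <= m)%R%:R) by apply: intgZ; exact: intg_chi.
apply: le_lt_trans (intg_lty h); apply: int_mono => t; rewrite lee_fin ?powR_ge0//.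
rewrite -ler_norml [leRHS]ger0_norm ?mulr_ge0 ?powR_ge0//; have := gm t.
case: (`|t| <= m); rewrite ?mulr1 ?mulr0 => h1.
  by apply: ge0_ler_powR; rewrite ?nnegrE// ltW.
have -> : `|g t| = 0 by apply/eqP; rewrite eq_le h1/=.
by rewrite powR0// gt_eqF.
Qed.

Lemma cvg_powR_inv p (N : nat) : 0 < p ->
  ((n + N).+1%:R^-1 : R) `^ p @[n --> \oo] --> (0 : R).
Proof.
move=> p0; have /cvg_at_rightP := powR_cvg0 p0; apply; split.
  by move=> n; rewrite invr_gt0.
exact: (cvg_comp_shift N (@cvg_harmonic R)).
Qed.

(** Integrating [rePow_bound] over [[-N, N]] leaves a Poisson term, controlled by the maximal
    inequality, and an error of order [N^(1-p)] from [rePow_int_bound], which disappears as [N]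
    grows because [p > 1]. *)
Lemma conjugate_le2 p : 1 < p -> p <= 2 -> exists2 C : R, 0 <= C &
  forall g m d, bcs m g -> (forall t, 0 <= g t) -> 0 < d ->
  (\int[leb]_x (`|cv (qk d) g x| `^ p)%:E <= C%:E * \int[leb]_x (g x `^ p)%:E)%E.
Proof.
move=> p1 p2; have [a [b [a0 b0 hab]]] := rePow_bound p1 p2.
have [C C0 hC] := poisson_Lp p1.
exists (a * C); first exact: mulr_ge0.
move=> g m d gb g0 d0; have [mg m0 gm'] := gb; have gi := bcs_intg gb.
have p0 : 0 < p by exact: lt_trans p1.
have gm t : g t <= m * (`|t| <= m)%R%:R by rewrite -(ger0_norm (g0 t)).
set I := \int[leb]_t g t.
have I0 : 0 <= I by apply: Rintegral_ge0.
have mv : measurable_fun setT (cv (qk d) g) by apply: measurable_cv => //; exact: measurable_qk.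
have mu : measurable_fun setT (cv (pk d) g) by apply: measurable_cv => //; exact: measurable_pk.
have vI x : `|cv (qk d) g x| <= d^-1 * I.
  by apply: (cv_le mg g0 gm _ (@measurable_qk R d)) => t; exact: qk_le.
have uI x : `|cv (pk d) g x| <= d^-1 * I.
  apply: (cv_le mg g0 gm _ (@measurable_pk R d)) => t.
  by rewrite ger0_norm ?pk_le ?pk_ge0.
have u0 x : 0 <= cv (pk d) g x by exact: cv_pk_ge0.
(* Without mass the positivity of [u] fails, but then [v] vanishes identically. *)
have [I0'|Ipos] : I = 0 \/ 0 < I by move: I0; rewrite le_eqVlt => /predU1P[|]; [left|right].
  rewrite integral0_eq; first by apply: mule_ge0; rewrite ?lee_fin ?mulr_ge0//;
    apply: integral_ge0 => x _; rewrite lee_fin powR_ge0.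
  move=> x _; have := vI x; rewrite I0' mulr0 normr_le0 => /eqP ->.
  by rewrite normr0 powR0// gt_eqF.
pose V n x := (- n.+1%:R <= (x : R) <= n.+1%:R)%R%:R * `|cv (qk d) g x| `^ p.
have mchi n : measurable_fun setT (fun x : R => (- n.+1%:R <= x <= n.+1%:R)%R%:R : R).
  apply: measurable_natr_bool; apply: measurable_and; first exact: measurable_lec.
  exact: measurable_gec.
have mV n : measurable_fun setT (V n).
  apply: measurable_funM => //; apply: measurable_fun_powR.
  exact: measurableT_comp.
have V0 n x : 0 <= V n x by rewrite mulr_ge0 ?powR_ge0.
have limV : (\int[leb]_x (V n x)%:E)%E @[n --> \oo] -->
    (\int[leb]_x (`|cv (qk d) g x| `^ p)%:E)%E.
  apply: int_mct => [n|n x|x|x].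
  - by apply/measurable_EFinP; exact: mV.
  - by rewrite lee_fin.
  - move=> k l kl; rewrite lee_fin ler_wpM2r ?powR_ge0// ler_nat.
    have kl' : k.+1%:R <= l.+1%:R :> R by rewrite ler_nat.
    by case: (boolP (- k.+1%:R <= x <= k.+1%:R)) => // /andP[h1 h2];
      rewrite (_ : (- l.+1%:R <= x <= l.+1%:R)) //; apply/andP; split; lra.
  - apply: cvg_near_cst; near=> n; congr (_%:E).
    rewrite /V (_ : (- n.+1%:R <= _ <= n.+1%:R) = true) ?mul1r// -ler_norml.
    apply: (@le_trans _ _ n%:R); last by rewrite ler_nat.
    by near: n; exact: nbhs_infty_ger.
set P := (\int[leb]_x (cv (pk d) g x `^ p)%:E)%E.
have P0 : (0 <= P)%E by apply: integral_ge0 => x _; rewrite lee_fin powR_ge0.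
pose c := b * (4 * ((8 * I ^+ 2) `^ (p / 2))).
(* The shift by [N0] makes the size conditions of [rePow_int_bound] hold for every term of the
   sequence. *)
have [N0 N0P] : exists N0 : nat, d < N0%:R /\ 2 * m < N0%:R.
  exists (maxn (Num.truncn d).+1 (Num.truncn (2 * m)).+1).
  by split; [apply: (lt_le_trans (truncnS_gt d))|apply: (lt_le_trans (truncnS_gt (2 * m)))];
    rewrite ler_nat ?leq_maxl ?leq_maxr.
have key n : (\int[leb]_x (V (n + N0)%N x)%:E <= a%:E * P +
    (c * ((n + N0).+1%:R^-1 : R) `^ (p - 1))%:E)%E.
  set N := (n + N0)%N; have NN0 : N0%:R <= N%:R :> R by rewrite ler_nat leq_addl.
  have NS : N.+1%:R = N%:R + 1 :> R by rewrite -natr1.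
  have [dN mN] := N0P.
  pose chi (x : R) : R := (- N.+1%:R <= x <= N.+1%:R)%R%:R.
  have chi0 x : 0 <= chi x by [].
  have N10 : 0 <= N.+1%:R :> R by [].
  have ichi (f : R -> R) (B : R) : measurable_fun setT f -> (forall x, `|f x| <= B) ->
      intg leb (fun x => f x * chi x).
    exact: (intg_bounded_chi N10).
  have pI0 : 0 <= d^-1 * I by rewrite mulr_ge0 ?invr_ge0// ltW.
  have powI f : `|f| <= d^-1 * I -> `| `|f| `^ p| <= (d^-1 * I) `^ p.
    by move=> h; rewrite ger0_norm ?powR_ge0// ge0_ler_powR ?nnegrE// ltW.
  have iV : intg leb (fun x => `|cv (qk d) g x| `^ p * chi x).
    apply: (ichi _ ((d^-1 * I) `^ p)); last by move=> x; exact: powI.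
    by apply: measurable_fun_powR; exact: measurableT_comp.
  have iU : intg leb (fun x => cv (pk d) g x `^ p * chi x).
    apply: (ichi _ ((d^-1 * I) `^ p)); first exact: measurable_fun_powR.
    by move=> x; rewrite -{1}(ger0_norm (u0 x)); exact: powI.
  have iG : intg leb (fun x => rePow p (cv (pk d) g x) (cv (qk d) g x) * chi x).
    apply: (ichi _ ((2 * (d^-1 * I) ^+ 2) `^ (p / 2))).
      by apply: continuous_measurable_fun; have [] := cont_G p mg g0 gm Ipos d0.
    by move=> x; exact: (G_le mg g0 gm p1 Ipos x d0).
  have -> : (\int[leb]_x (V N x)%:E = \int[leb]_x (`|cv (qk d) g x| `^ p * chi x)%:E)%E.
    by apply: eq_integral => x _; rewrite mulrC.
  rewrite -EFin_Rint//.
  apply: (@le_trans _ _ (\int[leb]_x (a * (cv (pk d) g x `^ p * chi x) -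
     b * (rePow p (cv (pk d) g x) (cv (qk d) g x) * chi x)))%:E).
    rewrite lee_fin; apply: le_Rint => //; first by apply: intgB; exact: intgZ.
    move=> x; have := hab _ (cv (qk d) g x) (u_gt0 mg g0 gm Ipos x d0).
    by move/(ler_wpM2r (chi0 x)); rewrite mulrBl -!mulrA.
  rewrite RintB; [|exact: intgZ|exact: intgZ].
  rewrite !RintZ// EFinB; apply: leeD.
    rewrite EFinM lee_wpmul2l ?lee_fin// EFin_Rint//.
    apply: int_mono => x; rewrite lee_fin ?mulr_ge0 ?powR_ge0//.
    by rewrite -[leRHS]mulr1 ler_wpM2l ?powR_ge0// lern1 leq_b1.
  rewrite -EFinN lee_fin.
  have := @rePow_int_bound R g m p mg g0 gm m0 p1 Ipos d N.+1%:R d0.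
  rewrite NS => /(_ ltac:(lra) ltac:(have := ler0n R N; lra) ltac:(lra)).
  rewrite -NS -/chi /c -!mulrA => /(ler_wpM2l b0); apply: le_trans.
  by rewrite -mulrN ler_wpM2l// -normrN ler_norm.
have Poo : P \is a fin_num.
  rewrite ge0_fin_numE//; apply: le_lt_trans (hC g m d gb g0 d0) _.
  rewrite lte_mul_pinfty ?lee_fin//; apply: le_lt_trans (bcs_powR_lty p0 gb).
  by apply: int_mono => x; rewrite lee_fin ?powR_ge0// ger0_norm.
have lim2 : (a%:E * P + (c * ((n + N0).+1%:R^-1 : R) `^ (p - 1))%:E)%E @[n --> \oo] --> (a%:E * P)%E.
  rewrite -[in X in _ --> X](fineK Poo) -EFinM -[X in _ --> X%:E]addr0 -[in X in _ --> X](mulr0 c).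
  under eq_fun do rewrite -(fineK Poo) -EFinM -EFinD.
  apply: cvg_EFin; first exact: nearW.
  apply: (@cvg_trans _ ((a * fine P + c * (n + N0).+1%:R^-1 `^ (p - 1)) @[n --> \oo])); first by apply: cvg_trans.
  apply: cvgD; first exact: cvg_cst.
  by apply: cvgMr; apply: cvg_powR_inv; rewrite subr_gt0.
have lim1 := cvg_comp_shift N0 limV.
apply: (@le_trans _ _ (a%:E * P)%E).
  rewrite -(cvg_lim _ lim1)// -(cvg_lim _ lim2)//; apply: lee_lim.
  - by apply/cvg_ex; eexists; exact: lim1.
  - by apply/cvg_ex; eexists; exact: lim2.
  - by apply: nearW => n; exact: key.
by rewrite EFinM -muleA lee_wpmul2l ?lee_fin//; exact: hC gb g0 d0.
Unshelve. all: end_near. Qed.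

Lemma bcs_pos m g : bcs m g -> bcs m (fun t => Num.max (g t) 0).
Proof.
move=> [mg m0 gm]; split=> //; first exact: measurable_maxr.
by move=> t; apply: le_trans (gm t); rewrite ger0_norm ?le_max ?lexx ?orbT// ge_max ler_norm/=.
Qed.

Lemma bcs_opp m g : bcs m g -> bcs m (fun t => - g t).
Proof.
move=> [mg m0 gm]; split=> //; first exact: measurable_funN.
by move=> t; rewrite normrN.
Qed.

Lemma signed_bound (k : R -> R) p (C b : R) : 0 < p -> 0 <= C ->
  measurable_fun setT k -> (forall t, `|k t| <= b) ->
  (forall g m, bcs m g -> (forall t, 0 <= g t) ->
    (\int[leb]_x (`|cv k g x| `^ p)%:E <= C%:E * \int[leb]_x (g x `^ p)%:E)%E) ->
  forall g m, bcs m g ->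
    (\int[leb]_x (`|cv k g x| `^ p)%:E <=
      (2 `^ p * (C + C))%:E * \int[leb]_x (`|g x| `^ p)%:E)%E.
Proof.
move=> p0 C0 mk kb h g m gb; have [mg m0 gm] := gb.
pose g1 t := Num.max (g t) 0; pose g2 t := Num.max (- g t) 0.
have b1 : bcs m g1 := bcs_pos gb.
have b2 : bcs m g2 := bcs_pos (bcs_opp gb).
have g10 t : 0 <= g1 t by rewrite le_max lexx orbT.
have g20 t : 0 <= g2 t by rewrite le_max lexx orbT.
have gE t : g t = g1 t - g2 t.
  by rewrite /g1 /g2; case: (leP 0 (g t)) => h0; case: (leP 0 (- g t)) => h1; lra.
have cvE x : cv k g x = cv k g1 x - cv k g2 x.
  rewrite /cv -RintB; [|exact: intg_cv (bcs_intg b1)|exact: intg_cv (bcs_intg b2)].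
  by apply: eq_Rint => t; rewrite -mulrBr -gE.
have mc f : measurable_fun setT f -> measurable_fun setT (fun x => `|cv k f x| `^ p).
  by move=> mf; apply: measurable_fun_powR; apply: measurableT_comp => //; exact: measurable_cv.
have [m1 _ _] := b1; have [m2 _ _] := b2.
apply: (@le_trans _ _ (\int[leb]_x (2 `^ p * (`|cv k g1 x| `^ p + `|cv k g2 x| `^ p))%:E)%E).
  apply: int_mono => x; rewrite lee_fin ?powR_ge0// cvE.
  apply: le_trans (powRD_le _ _ (ltW p0)) => //.
  by apply: ge0_ler_powR; rewrite ?nnegrE ?addr_ge0 ?ler_normB// ltW.
have mD : measurable_fun setT (fun x => `|cv k g1 x| `^ p + `|cv k g2 x| `^ p).
  by apply: measurable_funD; exact: mc.
rewrite int_Zl ?powR_ge0//.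
rewrite EFinM -muleA lee_wpmul2l ?lee_fin ?powR_ge0//.
under eq_integral do rewrite EFinD.
rewrite ge0_integralD//=; [|by apply/measurable_EFinP; exact: mc..].
rewrite EFinD ge0_muleDl ?lee_fin//.
apply: leeD.
  apply: le_trans (h _ _ b1 g10) _; rewrite lee_wpmul2l ?lee_fin//.
  apply: int_mono => x; rewrite lee_fin ?powR_ge0//; apply: ge0_ler_powR; rewrite ?nnegrE ?(ltW p0)//.
  by rewrite ge_max ler_norm/=.
apply: le_trans (h _ _ b2 g20) _; rewrite lee_wpmul2l ?lee_fin//.
apply: int_mono => x; rewrite lee_fin ?powR_ge0//; apply: ge0_ler_powR; rewrite ?nnegrE ?(ltW p0)//.
by rewrite ge_max -normrN ler_norm/=.
Qed.

Lemma conjugate_signed_le2 p : 1 < p -> p <= 2 -> exists2 C : R, 0 <= C &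
  forall g m d, bcs m g -> 0 < d ->
  (\int[leb]_x (`|cv (qk d) g x| `^ p)%:E <= C%:E * \int[leb]_x (`|g x| `^ p)%:E)%E.
Proof.
move=> p1 p2; have [C C0 h] := conjugate_le2 p1 p2.
exists (2 `^ p * (C + C)); first by rewrite mulr_ge0 ?powR_ge0 ?addr_ge0.
move=> g m d gb d0.
apply: (signed_bound _ C0 (@measurable_qk R d) (fun t => qk_le t d0) _ gb).
  exact: lt_trans p1.
by move=> f m' fb f0; exact: h fb f0 d0.
Qed.

(** Fubini; the sign is that of the odd kernel when [x - t] becomes [t - x]. *)
Lemma cv_duality (k g w : R -> R) (b m m' : R) : measurable_fun setT k ->
  (forall t, `|k t| <= b) -> (forall t, k (- t) = - k t) -> bcs m g -> bcs m' w ->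
  \int[leb]_x (cv k g x * w x) = - \int[leb]_x (g x * cv k w x).
Proof.
move=> mk kb ko gb wb; have [mg m0 gm] := gb; have [mw m'0 wm] := wb.
have gi := bcs_intg gb; have wi := bcs_intg wb.
pose F x t := k (x - t) * g t * w x.
have F2 : intg2 leb leb F.
  apply: (@intg2_prod _ _ _ _ R leb leb F (fun x => b * `|w x|) (fun t => `|g t|)).
  - apply: measurable_funM; last exact: (measurableT_comp mw measurable_fst).
    apply: measurable_funM; first exact: measurable_shift.
    exact: (measurableT_comp mg measurable_snd).
  - by apply: intgZ; exact: intg_norm.
  - exact: intg_norm.
  - move=> x t; rewrite /F 2!normrM -mulrA mulrCA [X in X <= _]mulrC -mulrA.
    by rewrite -mulrA; apply: ler_wpM2r; rewrite ?mulr_ge0 ?kb.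
transitivity (\int[leb]_x \int[leb]_t F x t).
  apply: eq_Rint => x; rewrite /F /cv mulrC -RintZ; last exact: intg_cv.
  by apply: eq_Rint => t; rewrite mulrC.
rewrite Rint_fubini// -mulN1r -RintZ.
  apply: eq_Rint => t; rewrite /F /cv mulrA -RintZ; last exact: intg_cv.
  by apply: eq_Rint => x; rewrite -opprB ko; ring.
have h : intg leb (fun x : R => (b * \int[leb]_t `|w t|) * `|g x|).
  by apply: intgZ; exact: intg_norm.
apply: (intg_le _ _ h); last first.
- move=> x; rewrite normrM mulrC ler_wpM2r//.
  apply: le_trans (le_normr_Rint _) _; first exact: intg_cv.
  rewrite -RintZ; last exact: intg_norm.
  apply: le_Rint; [by apply: intg_norm; exact: intg_cv|by apply: intgZ; exact: intg_norm|].
  by move=> t; rewrite normrM ler_wpM2r.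
- by apply: measurable_funM => //; exact: measurable_cv.
Qed.

(* Testing the conjugate function against |v|^(p-1) sign v passes from the
   exponent q <= 2 to the dual exponent p. *)
Lemma conjugate_bound p : 1 < p -> exists2 C : R, 0 <= C &
  forall g m d, bcs m g -> 0 < d ->
  (\int[leb]_x (`|cv (qk d) g x| `^ p)%:E <= C%:E * \int[leb]_x (`|g x| `^ p)%:E)%E.
Proof.
move=> p1; have [p2|p2] := lerP p 2; first exact: conjugate_signed_le2.
have p0 : 0 < p by exact: lt_trans p1.
pose q := p / (p - 1).
have q1 : 1 < q by rewrite ltr_pdivlMr ?subr_gt0// mul1r ltrBlDr ltrDl.
have q2 : q <= 2 by rewrite ler_pdivrMr ?subr_gt0//; lra.
have q0 : 0 < q by exact: lt_trans q1.
have pq : p^-1 + q^-1 = 1 by rewrite /q; field; rewrite !gt_eqF// subr_gt0.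
have pqM : (p - 1) * q = p by rewrite /q; field; rewrite gt_eqF// subr_gt0.
have [C C0 hC] := conjugate_signed_le2 q1 q2.
exists ((C `^ q^-1) `^ p); first exact: powR_ge0.
move=> g m d gb d0; have [mg m0 gm] := gb.
pose v := cv (qk d) g.
have mv : measurable_fun setT v by apply: measurable_cv => //; exact: measurable_qk.
have [B B0 vB] : exists2 B : R, 0 <= B & forall x, `|v x| <= B.
  exists (d^-1 * \int[leb]_t `|g t|).
    by rewrite mulr_ge0 ?invr_ge0 ?(ltW d0)//; apply: Rintegral_ge0.
  move=> x; apply: le_trans (le_normr_Rint _) _.
    by apply: intg_cv; [exact: measurable_qk|move=> t; exact: qk_le|exact: bcs_intg gb].
  rewrite -RintZ; last by apply: intg_norm; exact: bcs_intg gb.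
  apply: le_Rint.
  - by apply: intg_norm; apply: intg_cv; [exact: measurable_qk|move=> t; exact: qk_le|exact: bcs_intg gb].
  - by apply: intgZ; apply: intg_norm; exact: bcs_intg gb.
  - by move=> t; rewrite normrM ler_wpM2r// qk_le.
pose chi (N x : R) : R := (- N <= x <= N)%R%:R.
(* The extremal function of duality, cut off to [[-N, N]]: it is again of class [bcs], pairs with
   [v] to [|v|^p], and its [q]-th power is [|v|^p] on that interval. *)
pose w N x := Num.sg (v x) * `|v x| `^ (p - 1) * chi N x.
have chiN N x : chi N x = (`|x| <= N)%R%:R by rewrite /chi -ler_norml.
have wv N x : v x * w N x = `|v x| `^ p * chi N x.
  rewrite /w !mulrA; congr (_ * _).
  rewrite [v x * _]mulrC -normrEsg -{1}(powRr1 (normr_ge0 (v x))) -powRD.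
    by rewrite addrCA subrr addr0.
  by rewrite addrCA subrr addr0 (gt_eqF p0).
have wq N x : `|w N x| `^ q = `|v x| `^ p * chi N x.
  rewrite /w /chi; case: (- N <= x <= N); last by rewrite !mulr0 normr0 powR0// gt_eqF.
  rewrite !mulr1 normrM (ger0_norm (powR_ge0 _ _)) normr_sg.
  have [->|v0] := eqVneq (v x) 0; first by rewrite mul0r normr0 !powR0// gt_eqF.
  by rewrite mul1r -powRrM pqM.
have wb N : 0 <= N -> bcs (Num.max N (B `^ (p - 1))) (w N).
  move=> N0; split; last 1 first.
  - move=> x; rewrite /w chiN !normrM (ger0_norm (powR_ge0 _ _)) normr_nat normr_sg.
    have [xN|_] := boolP (`|x| <= N); last by rewrite mulr0 mulr_ge0// le_max N0.
    rewrite (_ : (`|x| <= _) = true) ?le_max ?xN// !mulr1.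
    apply: (@le_trans _ _ (B `^ (p - 1))); last by rewrite le_max lexx orbT.
    have -> : B `^ (p - 1) = 1 * B `^ (p - 1) by rewrite mul1r.
    apply: ler_pM; rewrite ?powR_ge0//; first by case: (v x != 0).
    by apply: ge0_ler_powR; rewrite ?nnegrE// subr_ge0 ltW.
  - apply: measurable_funM; last exact: measurable_chi.
    apply: measurable_funM; last by apply: measurable_fun_powR; exact: measurableT_comp.
    have -> : (fun x => Num.sg (v x)) = (fun y : R => (0 < y)%R%:R - (y < 0)%R%:R) \o v.
      by apply/funext => y /=; case: sgrP => // _; rewrite ?subr0 ?sub0r ?subrr.
    apply: measurableT_comp mv; apply: measurable_funB; apply: measurable_natr_bool.
      exact: measurable_ltc.
    exact: measurable_gtc.
  - by rewrite le_max N0.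
pose G := (\int[leb]_x (`|g x| `^ p)%:E)%E.
have G0 : (0 <= G)%E by apply: integral_ge0 => x _; rewrite lee_fin powR_ge0.
have Goo : (G < +oo)%E := bcs_powR_lty p0 gb.
have GE : G = (fine G)%:E by rewrite fineK// ge0_fin_numE.
have fG0 : 0 <= fine G by exact: fine_ge0.
pose X N := \int[leb]_x (`|v x| `^ p * chi N x).
have iX N : 0 <= N -> intg leb (fun x => `|v x| `^ p * chi N x).
  move=> N0; apply: (@intg_bounded_chi _ _ _ (B `^ p)) => //.
    by apply: measurable_fun_powR; exact: measurableT_comp.
  by move=> x; rewrite ger0_norm ?powR_ge0//; apply: ge0_ler_powR; rewrite ?nnegrE// ltW.
have XE N : 0 <= N -> (X N)%:E = (\int[leb]_x (`|v x| `^ p * chi N x)%:E)%E.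
  by move=> N0; rewrite /X EFin_Rint//; exact: iX.
have key N : 0 <= N -> ((X N)%:E <= ((C `^ q^-1) `^ p)%:E * G)%E.
  move=> N0; have X0 : 0 <= X N by apply: Rintegral_ge0 => x _; rewrite mulr_ge0 ?powR_ge0.
  rewrite GE -EFinM lee_fin.
  (* Duality moves the kernel onto [w N]; Hölder and the exponent [q <= 2] bound [X N] by its own
     power [1 / q]. The cut-off makes [X N] finite, so that power can be divided out. *)
  have h1 : X N <= (fine G) `^ p^-1 * (C * X N) `^ q^-1.
    have XX : X N = - \int[leb]_x (g x * cv (qk d) (w N) x).
      rewrite -(@cv_duality (qk d) g (w N) d^-1 _ _ _ _ _ gb (wb N N0)).
      - by apply: eq_Rint => x; rewrite wv.
      - exact: measurable_qk.
      - by move=> t; exact: qk_le.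
      - by move=> t; rewrite /qk sqrrN mulNr.
    rewrite {1}XX; apply: le_trans (ler_norm _) _; rewrite normrN -lee_fin.
    have mcw : measurable_fun setT (cv (qk d) (w N)).
      by apply: measurable_cv; [exact: measurable_qk|have [] := wb N N0].
    apply: le_trans (abse_Rint_le _ _) _; first exact: measurable_funM.
    have H := hoelder_int (@lebesgue_measure R) mg mcw p0 q0 pq.
    apply: (le_trans H); rewrite -/G GE EFinM; apply: lee_pmul; rewrite ?poweR_ge0// ?poweR_EFin//.
    rewrite -poweR_EFin; apply: (@gt0_ler_poweR _ q^-1 _).
    - by rewrite invr_ge0 ltW.
    - by rewrite in_itv/= leey andbT; apply: integral_ge0 => x _; rewrite lee_fin powR_ge0.
    - by rewrite in_itv/= leey andbT lee_fin mulr_ge0.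
    apply: le_trans (hC _ _ _ (wb N N0) d0) _.
    by rewrite EFinM XE// lee_wpmul2l ?lee_fin//; apply: int_mono => x;
      rewrite lee_fin ?powR_ge0// wq.
  have [->|Xn0] := eqVneq (X N) 0; first by rewrite mulr_ge0 ?powR_ge0.
  have Xp : 0 < X N by rewrite lt_neqAle eq_sym Xn0.
  have h2 : (X N) `^ p^-1 <= C `^ q^-1 * fine G `^ p^-1.
    have e1 : X N = (X N) `^ p^-1 * (X N) `^ q^-1.
      by rewrite -powRD ?pq ?powRr1// Xn0 implybT.
    rewrite -(ler_pM2r (powR_gt0 q^-1 Xp)) -e1.
    by apply: le_trans h1 _; rewrite powRM// mulrA [_ * C `^ _]mulrC.
  have -> : X N = ((X N) `^ p^-1) `^ p by rewrite -powRrM mulVf ?powRr1// gt_eqF.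
  have -> : (C `^ q^-1) `^ p * fine G = (C `^ q^-1 * fine G `^ p^-1) `^ p.
    by rewrite powRM ?powR_ge0// -[in RHS](powRrM (fine G)) mulVf ?powRr1// gt_eqF.
  by apply: ge0_ler_powR; rewrite ?nnegrE ?mulr_ge0 ?powR_ge0// ltW.
have lim1 : (\int[leb]_x (`|v x| `^ p * chi n%:R x)%:E)%E @[n --> \oo] -->
    (\int[leb]_x (`|v x| `^ p)%:E)%E.
  apply: int_mct => [n|n x|x|x].
  - apply/measurable_EFinP; apply: measurable_funM; last exact: measurable_chi.
    by apply: measurable_fun_powR; exact: measurableT_comp.
  - by rewrite lee_fin mulr_ge0 ?powR_ge0.
  - move=> k l kl; rewrite lee_fin ler_wpM2l ?powR_ge0// !chiN ler_nat.
    case: (boolP (`|x| <= k%:R)) => // h; rewrite (le_trans h)// ler_nat//.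
  - apply: cvg_near_cst; near=> n; congr (_%:E).
    rewrite chiN (_ : (`|x| <= _) = true) ?mulr1//.
    by near: n; exact: nbhs_infty_ger.
rewrite -/G -(cvg_lim _ lim1)//; apply: lime_le.
  by apply/cvg_ex; eexists; exact: lim1.
by apply: nearW => n; rewrite -XE// key.
Unshelve. all: end_near. Qed.

(** The factor 2 keeps the heights [e - d] and [d] distinct, as [pk_qk_semigroup] requires. *)
Lemma seq_lb (E : seq R) : {in E, forall e, 0 < e} ->
  exists2 d : R, 0 < d & {in E, forall e, 2 * d < e}.
Proof.
elim: E => [|e E IH] h; first by exists 1.
have [d d0 hd] := IH (fun x xE => h x (mem_behead (s := e :: E) xE)).
have e0 : 0 < e by apply: h; rewrite mem_head.
exists (Num.min d (e / 3)); first by rewrite lt_min d0 divr_gt0.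
move=> x; rewrite inE => /predU1P[->|/hd xd].
  apply: (@le_lt_trans _ _ (2 * (e / 3))); last by lra.
  by rewrite ler_wpM2l// ge_min lexx orbT.
by apply: le_lt_trans xd; rewrite ler_wpM2l// ge_min lexx.
Qed.

(** By [hk_sub_qk] the truncation at [e] is the conjugate Poisson integral at height [e] up to a
    Poisson integral of [|g|]. The former is dominated by the Poisson integral, at height [e - d],
    of one function [|cv (qk d) g|] common to all radii. Two Poisson maximal functions remain. *)
Lemma hilbert_maximal p : 1 < p -> exists2 C : R, 0 <= C &
  forall g m (E : seq R), bcs m g -> {in E, forall e, 0 < e} ->
  (\int[leb]_x (mx E (fun e => `|cv (hk e) g x|) `^ p)%:E <=
   C%:E * \int[leb]_x (`|g x| `^ p)%:E)%E.
Proof.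
move=> p1; have p0 : 0 < p by exact: lt_trans p1.
have [C C0 hC] := conjugate_bound p1; have [D D0 hD] := poisson_maximal p1.
exists (2 `^ p * (D * C + D)).
  by rewrite mulr_ge0 ?powR_ge0// addr_ge0// mulr_ge0.
move=> g m E gb E0; have [mg m0 gm] := gb; have gi := bcs_intg gb.
have [d d0 dE] := seq_lb E0.
pose h (x : R) : R := `|cv (qk d) g x|.
have mh : measurable_fun setT h.
  by apply: measurableT_comp => //; apply: measurable_cv => //; exact: measurable_qk.
have h0 x : 0 <= h x by rewrite /h.
have hB x : h x <= d^-1 * \int[leb]_t `|g t|.
  apply: le_trans (le_normr_Rint _) _.
    by apply: intg_cv => //; [exact: measurable_qk|move=> t; exact: qk_le].
  rewrite -RintZ; last exact: intg_norm.
  apply: le_Rint.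
  - by apply: intg_norm; apply: intg_cv => //; [exact: measurable_qk|move=> t; exact: qk_le].
  - by apply: intgZ; apply: intg_norm.
  - by move=> t; rewrite normrM ler_wpM2r// qk_le.
have mng : measurable_fun setT (fun t => `|g t|) by exact: measurableT_comp.
pose E' := [seq e - d | e <- E].
have E'0 : {in E', forall e, 0 < e}.
  by move=> _ /mapP[e eE ->]; have := dE _ eE; lra.
pose F1 x := mx E' (fun e => cv (pk e) h x).
pose F2 x := mx E (fun e => cv (pk e) (fun t => `|g t|) x).
have mF1 : measurable_fun setT F1.
  by apply: measurable_mx => e; apply: measurable_cv => //; exact: measurable_pk.
have mF2 : measurable_fun setT F2.
  by apply: measurable_mx => e; apply: measurable_cv => //; exact: measurable_pk.
have F10 x : 0 <= F1 x by exact: mx_ge0.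
have F20 x : 0 <= F2 x by exact: mx_ge0.
have pi1 : pi^-1 <= 1 :> R by rewrite invf_le1 ?pi_gt0//; have := @pi_ge2 R; lra.
have main x : mx E (fun e => `|cv (hk e) g x|) <= F1 x + F2 x.
  apply: mx_le_in; first exact: addr_ge0.
  move=> e eE; have e0 := E0 _ eE; have de := dE _ eE.
  have ed : e = (e - d) + d by rewrite subrK.
  have s1 : `|cv (qk e) g x| <= F1 x.
    rewrite {1}ed; apply: le_trans (cv_qk_semigroup _ _ _ _ gi) _ => //; [lra| |].
      by apply/eqP; lra.
    apply: (@le_trans _ _ (cv (pk (e - d)) h x)).
      by rewrite -[leRHS]mul1r ler_wpM2r// cv_pk_ge0//; lra.
    by apply: (@le_mx _ _ E' (fun e => cv (pk e) h x)); apply/mapP; exists e.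
  have s2 : cv (pk e) (fun t => `|g t|) x <= F2 x.
    by apply: (@le_mx _ _ E (fun e => cv (pk e) (fun t => `|g t|) x)).
  have i1 : intg leb (fun t => hk e (x - t) * g t).
    by apply: intg_cv => //; [exact: measurable_hk|move=> t; exact: hk_le].
  have i2 : intg leb (fun t => qk e (x - t) * g t).
    by apply: intg_cv => //; [exact: measurable_qk|move=> t; exact: qk_le].
  have i3 : intg leb (fun t => pk e (x - t) * `|g t|).
    apply: (@intg_cv _ _ _ e^-1) => //; [exact: measurable_pk| |exact: intg_norm].
    by move=> t; rewrite ger0_norm ?pk_le ?pk_ge0.
  have -> : cv (hk e) g x = cv (qk e) g x + (cv (hk e) g x - cv (qk e) g x) by rewrite addrC subrK.
  apply: le_trans (ler_normD _ _) _; apply: lerD => //; apply: le_trans s2.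
  rewrite /cv -RintB//; apply: le_trans (le_normr_Rint _) _; first exact: intgB.
  apply: le_Rint => //; first by apply: intg_norm; exact: intgB.
  by move=> t; rewrite -mulrBl normrM ler_wpM2r// hk_sub_qk.
set G := (\int[leb]_x (`|g x| `^ p)%:E)%E.
have G0 : (0 <= G)%E by apply: integral_ge0 => x _; rewrite lee_fin powR_ge0.
apply: (@le_trans _ _ (\int[leb]_x (2 `^ p * (F1 x `^ p + F2 x `^ p))%:E)%E).
  apply: int_mono => x; rewrite lee_fin ?powR_ge0//.
  apply: le_trans (powRD_le _ _ (ltW p0)) => //.
  by apply: ge0_ler_powR; rewrite ?nnegrE ?mx_ge0 ?addr_ge0// ltW.
have mD : measurable_fun setT (fun x => F1 x `^ p + F2 x `^ p).
  by apply: measurable_funD; exact: measurable_fun_powR.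
rewrite int_Zl ?powR_ge0//; last by move=> x; rewrite addr_ge0 ?powR_ge0.
rewrite EFinM -muleA lee_wpmul2l ?lee_fin ?powR_ge0//.
under eq_integral do rewrite EFinD.
rewrite ge0_integralD//=; last 4 first.
- by move=> x _; rewrite lee_fin powR_ge0.
- by apply/measurable_EFinP; exact: measurable_fun_powR.
- by move=> x _; rewrite lee_fin powR_ge0.
- by apply/measurable_EFinP; exact: measurable_fun_powR.
rewrite EFinD ge0_muleDl ?lee_fin ?mulr_ge0//.
apply: leeD.
  apply: le_trans (hD h _ E' mh h0 hB E'0) _.
  by rewrite EFinM -muleA lee_wpmul2l ?lee_fin//; exact: hC gb d0.
apply: le_trans (hD _ m E mng _ _ E0) _ => //.
by move=> t; exact: bcs_le gb.
Qed.

End hilbert.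

(** * The method of rotations *)

Section lebesgue_rv_affine.
Context (R : realType).
Local Notation leb := (@lebesgue_measure R).
Local Notation mu n := (lebesgue_rv R n).

Lemma ge0_int_rvS n (f : 'rV[R]_n.+1 -> \bar R) : measurable_fun setT f ->
  (forall x, 0 <= f x)%E ->
  (\int[mu n.+1]_x f x = \int[leb]_t \int[mu n]_v f (rv_cons (t, v)))%E.
Proof.
move=> mf f0.
have E A : measurable A ->
    mu n.+1 A = (1%:E * (leb \x mu n)%E (@rv_cons R n @^-1` A))%E by rewrite mul1e.
rewrite (@ge0_int_transport _ _ _ _ R (leb \x mu n)%E (mu n.+1) _
  (@measurable_rv_cons R n) 1 ltr01 E f mf f0) mul1e.
rewrite -(@fubini_tonelli1 _ _ _ _ R leb (mu n) (f \o @rv_cons R n))//.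
  exact: measurableT_comp mf (@measurable_rv_cons R n).
by move=> x; exact: f0.
Qed.

Lemma measurable_affine_rv n (t : R) (a : 'rV[R]_n) :
  measurable_fun setT (fun x : 'rV[R]_n => t *: x + a).
Proof.
apply: measurable_fun_rvP => i; under eq_fun do rewrite !mxE.
apply: (measurableT_comp (@measurable_affine R t (a 0 i))).
exact: measurable_rv_coord.
Qed.

(** Induction on the dimension: each coordinate split off contributes one factor [|t|]. *)
Lemma ge0_int_affine_rv n (t : R) (a : 'rV[R]_n) (f : 'rV[R]_n -> \bar R) : t != 0 ->
  measurable_fun setT f -> (forall x, 0 <= f x)%E ->
  (\int[mu n]_x f x = (`|t| ^+ n)%:E * \int[mu n]_x f (t *: x + a)%R)%E.
Proof.
move=> t0; elim: n a f => [|n IH] a f mf f0.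
  rewrite expr0 mul1e; apply: eq_integral => x _; congr f.
  by apply/rowP => -[].
have mfc : measurable_fun setT (fun z : measurableTypeR R * 'rV[R]_n => f (rv_cons z)).
  exact: measurableT_comp mf (@measurable_rv_cons R n).
have mfr s : measurable_fun setT (fun v => f (rv_cons (s, v))).
  by apply: (measurableT_comp mfc); apply/measurable_fun_pairP; split; [exact: measurable_cst|exact: measurable_id].
rewrite ge0_int_rvS// [in RHS]ge0_int_rvS//; last first.
  by apply: (measurableT_comp mf); exact: measurable_affine_rv.
pose a' : 'rV[R]_n := \row_j a 0 (lift ord0 j).
have consE s v : t *: rv_cons (s, v) + a = rv_cons (t * s + a 0 ord0, t *: v + a').
  apply/rowP => i; rewrite !mxE; by case: unliftP => [j|] -> /=; rewrite ?mxE ?liftK ?unlift_none/= ?mxE.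
under [in RHS]eq_integral => s _ do under eq_integral => v _ do rewrite consE.
have inner s : (\int[mu n]_v f (rv_cons (s, v)) =
    (`|t| ^+ n)%:E * \int[mu n]_v f (rv_cons (s, t *: v + a')%R))%E.
  by rewrite (IH a' (fun v => f (rv_cons (s, v)))).
pose h (s : R) := (\int[mu n]_v f (rv_cons (s, t *: v + a')%R))%E.
have mh : measurable_fun setT h.
  apply: (@measurable_fun_fubini_tonelli_F _ _ _ _ R (mu n)
    (fun z : measurableTypeR R * 'rV[R]_n => f (rv_cons (z.1, t *: z.2 + a')))).
  apply: (measurableT_comp mfc); apply/measurable_fun_pairP; split.
    exact: measurable_fst.
  exact: (measurableT_comp (@measurable_affine_rv n t a') measurable_snd).
  by move=> z; exact: f0.
have h0 s : (0 <= h s)%E by apply: integral_ge0 => v _; exact: f0.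
transitivity (\int[leb]_s ((`|t| ^+ n)%:E * h s))%E.
  by apply: eq_integral => s _; exact: inner.
rewrite ge0_integralZl; [|exact: measurableT|exact: mh|by move=> s _; exact: h0|by rewrite lee_fin exprn_ge0].
rewrite (@ge0_int_affine R t (a 0 ord0) h)//.
by rewrite muleA -EFinM exprSr.
Qed.

Lemma leb_affine_rv n (t : R) (a : 'rV[R]_n) A : t != 0 -> measurable A ->
  mu n A = ((`|t| ^+ n)%:E * mu n ((fun x : 'rV[R]_n => t *: x + a)%R @^-1` A))%E.
Proof.
move=> t0 mA; have mt := @measurable_affine_rv n t a.
rewrite -[in LHS](setIT A) -integral_indic// (@ge0_int_affine_rv n t a)//; last first.
  by apply/measurable_EFinP; exact: measurable_indic.
congr (_ * _)%E; rewrite -[in RHS](setIT (_ @^-1` _)) -integral_indic//.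
by rewrite -[X in measurable X]setTI; exact: mt.
Qed.

Let c_gt0 n (t : R) : t != 0 -> 0 < `|t| ^+ n.
Proof. by move=> t0; rewrite exprn_gt0// normr_gt0. Qed.

Lemma intg_affine_rv n (t : R) (a : 'rV[R]_n) (f : 'rV[R]_n -> R) : t != 0 ->
  intg (mu n) f -> intg (mu n) (fun x => f (t *: x + a)).
Proof.
move=> t0; apply: (intg_transport (measurable_affine_rv t a) (c_gt0 n t0)) => A mA.
exact: leb_affine_rv.
Qed.

Lemma Rint_affine_rv n (t : R) (a : 'rV[R]_n) (f : 'rV[R]_n -> R) : t != 0 ->
  intg (mu n) f ->
  \int[mu n]_x f x = `|t| ^+ n * \int[mu n]_x f (t *: x + a).
Proof.
move=> t0; apply: (Rint_transport (measurable_affine_rv t a) (c_gt0 n t0)) => A mA.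
exact: leb_affine_rv.
Qed.

Lemma ge0_int_shift_rv n (a : 'rV[R]_n) (f : 'rV[R]_n -> \bar R) :
  measurable_fun setT f -> (forall x, 0 <= f x)%E ->
  (\int[mu n]_x f x = \int[mu n]_x f (x + a)%R)%E.
Proof.
move=> mf f0; rewrite (@ge0_int_affine_rv n 1 a)// ?oner_neq0//.
by rewrite normr1 expr1n mul1e; apply: eq_integral => x _; rewrite scale1r.
Qed.

Lemma intg_shift_rv n (a : 'rV[R]_n) (f : 'rV[R]_n -> R) :
  intg (mu n) f -> intg (mu n) (fun x => f (x + a)).
Proof.
move=> fi; have := @intg_affine_rv n 1 a f (oner_neq0 R) fi.
by under eq_fun do rewrite scale1r.
Qed.

Lemma Rint_shift_rv n (a : 'rV[R]_n) (f : 'rV[R]_n -> R) :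
  intg (mu n) f -> \int[mu n]_x f x = \int[mu n]_x f (x + a).
Proof.
move=> fi; rewrite (@Rint_affine_rv n 1 a)// ?oner_neq0// normr1 expr1n mul1r.
by apply: eq_Rint => x; rewrite scale1r.
Qed.

Lemma intg_refl_rv n (a : 'rV[R]_n) (f : 'rV[R]_n -> R) :
  intg (mu n) f -> intg (mu n) (fun x => f (a - x)).
Proof.
move=> fi; have := @intg_affine_rv n (-1) a f (ltac:(by rewrite oppr_eq0 oner_neq0)) fi.
by under eq_fun do rewrite scaleN1r addrC.
Qed.

Lemma Rint_refl_rv n (a : 'rV[R]_n) (f : 'rV[R]_n -> R) :
  intg (mu n) f -> \int[mu n]_x f x = \int[mu n]_x f (a - x).
Proof.
move=> fi; rewrite (@Rint_affine_rv n (-1) a)// ?oppr_eq0 ?oner_neq0// normrN normr1 expr1n mul1r.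
by apply: eq_Rint => x; rewrite scaleN1r addrC.
Qed.

Lemma ge0_int_refl_rv n (a : 'rV[R]_n) (f : 'rV[R]_n -> \bar R) :
  measurable_fun setT f -> (forall x, 0 <= f x)%E ->
  (\int[mu n]_x f x = \int[mu n]_x f (a - x)%R)%E.
Proof.
move=> mf f0; rewrite (@ge0_int_affine_rv n (-1) a)// ?oppr_eq0 ?oner_neq0//.
rewrite normrN normr1 expr1n mul1e; apply: eq_integral => x _.
by rewrite scaleN1r addrC.
Qed.

Section measurable_vectors.
Context d (T : measurableType d) (n : nat).
Implicit Types (f g : T -> 'rV[R]_n).

Lemma measurable_coord f i : measurable_fun setT f ->
  measurable_fun setT (fun x => f x 0 i : R).
Proof. by move=> mf; exact: measurableT_comp (@measurable_rv_coord R n i) mf. Qed.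

Lemma measurable_rvD f g : measurable_fun setT f -> measurable_fun setT g ->
  measurable_fun setT (fun x => f x + g x).
Proof.
move=> mf mg; apply: measurable_fun_rvP => i; under eq_fun do rewrite mxE.
by apply: measurable_funD; exact: measurable_coord.
Qed.

Lemma measurable_rvZ (t : T -> R) f : measurable_fun setT t -> measurable_fun setT f ->
  measurable_fun setT (fun x => t x *: f x).
Proof.
move=> mt mf; apply: measurable_fun_rvP => i; under eq_fun do rewrite mxE.
by apply: measurable_funM => //; exact: measurable_coord.
Qed.

Lemma measurable_rvN f : measurable_fun setT f -> measurable_fun setT (fun x => - f x).
Proof.
move=> mf; apply: measurable_fun_rvP => i; under eq_fun do rewrite mxE.
by apply: measurable_funN; exact: measurable_coord.
Qed.

Lemma measurable_rvB f g : measurable_fun setT f -> measurable_fun setT g ->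
  measurable_fun setT (fun x => f x - g x).
Proof. by move=> mf mg; apply: measurable_rvD => //; exact: measurable_rvN. Qed.

Lemma measurable_dotv f g : measurable_fun setT f -> measurable_fun setT g ->
  measurable_fun setT (fun x => dotv (f x) (g x)).
Proof.
move=> mf mg; apply: measurable_sum => i.
by apply: measurable_funM; exact: measurable_coord.
Qed.

Lemma measurable_enorm f : measurable_fun setT f ->
  measurable_fun setT (fun x => enorm (f x)).
Proof.
move=> mf; apply: (@measurableT_comp _ _ _ _ _ _ (@Num.sqrt R)); last exact: measurable_dotv.
by apply: continuous_measurable_fun => x; exact: sqrt_continuous.
Qed.

End measurable_vectors.

End lebesgue_rv_affine.

Section euclid.
Context (R : realType) (n : nat).
Implicit Types (x y z : 'rV[R]_n) (t : R).

Lemma dotvv_ge0 x : 0 <= dotv x x.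
Proof. by apply: sumr_ge0 => i _; rewrite -expr2 sqr_ge0. Qed.

Lemma dotvC x y : dotv x y = dotv y x.
Proof. by apply: eq_bigr => i _; rewrite mulrC. Qed.

Lemma dotvDl x y z : dotv (x + y) z = dotv x z + dotv y z.
Proof. by rewrite /dotv -big_split; apply: eq_bigr => i _; rewrite mxE mulrDl. Qed.

Lemma dotvZl t x y : dotv (t *: x) y = t * dotv x y.
Proof. by rewrite /dotv mulr_sumr; apply: eq_bigr => i _; rewrite mxE mulrA. Qed.

Lemma dotvZr t x y : dotv x (t *: y) = t * dotv x y.
Proof. by rewrite dotvC dotvZl dotvC. Qed.

Lemma dotvNl x y : dotv (- x) y = - dotv x y.
Proof. by rewrite -scaleN1r dotvZl mulN1r. Qed.

Lemma dotvBl x y z : dotv (x - y) z = dotv x z - dotv y z.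
Proof. by rewrite dotvDl dotvNl. Qed.

Lemma enorm_ge0 x : 0 <= enorm x. Proof. exact: sqrtr_ge0. Qed.

Lemma enorm2 x : enorm x ^+ 2 = dotv x x.
Proof. by rewrite sqr_sqrtr// dotvv_ge0. Qed.

Lemma enormZ t x : enorm (t *: x) = `|t| * enorm x.
Proof. by rewrite /enorm dotvZl dotvZr mulrA sqrtrM -?expr2 ?sqr_ge0// sqrtr_sqr. Qed.

Lemma enormN x : enorm (- x) = enorm x.
Proof. by rewrite -scaleN1r enormZ normrN normr1 mul1r. Qed.

Lemma coord_le_enorm x i : `|x 0 i| <= enorm x.
Proof.
rewrite -sqrtr_sqr ler_wsqrtr// /dotv (bigD1 i)//= -expr2 lerDl.
by apply: sumr_ge0 => j _; rewrite -expr2 sqr_ge0.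
Qed.

Lemma enorm_eq0 x : (enorm x == 0) = (x == 0).
Proof.
apply/idP/eqP => [/eqP x0|->]; last first.
  by rewrite /enorm /dotv big1 ?sqrtr0// => i _; rewrite mxE mul0r.
apply/rowP => i; rewrite mxE; apply/eqP; rewrite -normr_le0 -x0.
exact: coord_le_enorm.
Qed.

Lemma enorm0 : enorm (0 : 'rV[R]_n) = 0.
Proof. by apply/eqP; rewrite enorm_eq0. Qed.

Lemma enorm_gt0 x : (0 < enorm x) = (x != 0).
Proof. by rewrite lt_neqAle eq_sym enorm_eq0 enorm_ge0 andbT. Qed.

(** Coordinatewise domination; the factor [n] is not sharp, but only a linear bound in each vector
    is used. *)
Lemma dotv_le x y : `|dotv x y| <= n%:R * (enorm x * enorm y).
Proof.
apply: le_trans (ler_norm_sum _ _ _) _.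
apply: (@le_trans _ _ (\sum_(i < n) enorm x * enorm y)).
  by apply: ler_sum => i _; rewrite normrM ler_pM// coord_le_enorm.
by rewrite sumr_const card_ord mulr_natl lexx.
Qed.

End euclid.

(** * Gaussian integrals, the volume of the ball and Gaussian dilates *)

Section gaussian.
Context (R : realType).
Local Notation leb := (@lebesgue_measure R).
Local Notation mu n := (lebesgue_rv R n).

Lemma measurable_bool_set d (T : measurableType d) (b : T -> bool) :
  measurable_fun setT b -> measurable [set x | b x].
Proof.
move=> mb; rewrite (_ : [set x | b x] = setT `&` b @^-1` [set true]).
  exact: mb.
by rewrite setTI; apply/seteqP; split => x.
Qed.

Lemma measurable_enorm_ball n (N : R) : measurable [set x : 'rV[R]_n | enorm x <= N].
Proof.
apply: measurable_bool_set; apply: measurable_fun_ler; last exact: measurable_cst.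
by apply: measurable_enorm; exact: measurable_id.
Qed.

Lemma measurable_box n (A : 'I_n -> set (measurableTypeR R)) : (forall i, measurable (A i)) ->
  measurable [set x : 'rV[R]_n | forall i, A i (x 0 i)].
Proof.
move=> mA; rewrite (_ : mkset _ = \bigcap_(i in [set: 'I_n])
    ((fun x : 'rV[R]_n => x 0 i) @^-1` A i)).
  apply: fin_bigcap_measurable => // i _.
  by rewrite -[X in measurable X]setTI; exact: measurable_rv_coord.
by apply/seteqP; split=> [x Bx i _|x Bx i]; [exact: Bx|exact: (Bx i I)].
Qed.

Lemma set1_box n (x : 'rV[R]_n) :
  [set x] = [set y : 'rV[R]_n | forall i, [set x 0 i] (y 0 i)].
Proof. by apply/seteqP; split => [y -> //|y yx]; apply/rowP. Qed.

Lemma mu_ball_lty n (N : R) : (mu n [set x | (enorm x <= N)%R] < +oo)%E.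
Proof.
pose A (i : 'I_n) : set (measurableTypeR R) := `[- N, N]%classic.
have mA i : measurable (A i) by exact: measurable_itv.
have mB : measurable [set x : 'rV[R]_n | forall i, A i (x 0 i)].
  exact: measurable_box.
apply: (@le_lt_trans _ _ (mu n [set x | forall i, A i (x 0 i)])).
  apply: le_measure; rewrite ?inE//; first exact: measurable_enorm_ball.
  move=> x /= xN i; rewrite /A/= in_itv/= -ler_norml.
  exact: le_trans (coord_le_enorm x i) xN.
rewrite lebesgue_rv_box//.
suff [] : (0 <= \prod_(i < n) leb (A i))%E /\ (\prod_(i < n) leb (A i) < +oo)%E by [].
apply: (big_ind (fun x => 0 <= x /\ x < +oo)%E) => [|x y [x0 xy] [y0 yy]|i _].
- by rewrite ltry.
- split; first exact: mule_ge0.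
  by rewrite lte_mul_pinfty// ge0_fin_numE.
- split; first exact: measure_ge0.
  by rewrite /A lebesgue_measure_itv/=; case: ifP => _; rewrite ?ltry.
Qed.

Lemma intg_ball n (N : R) : intg (mu n) (fun x => (enorm x <= N)%R%:R).
Proof.
apply: intgP.
  apply: measurable_natr_bool; apply: measurable_fun_ler; last exact: measurable_cst.
  by apply: measurable_enorm; exact: measurable_id.
rewrite (_ : integral _ _ _ = mu n [set x | enorm x <= N]); first exact: mu_ball_lty.
rewrite -[in RHS](setIT [set x | _]) -integral_indic//; last exact: measurable_enorm_ball.
apply: eq_integral => x _; rewrite indicE ger0_norm//; congr (_%:R%:E).
by apply/esym; congr nat_of_bool; apply/idP/idP; rewrite inE.
Qed.

Lemma mu_point n (x : 'rV[R]_n) : (0 < n)%N -> mu n [set x] = 0%E.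
Proof.
case: n x => // n x _.
rewrite set1_box; apply: etrans (@lebesgue_rv_box R n.+1 (fun i => [set x 0 i]) _) _.
  by move=> i; exact: measurable_set1.
by rewrite big_ord_recl lebesgue_measure_set1 mul0e.
Qed.

Lemma ae_neq n (x : 'rV[R]_n) : (0 < n)%N -> {ae mu n, forall y, y != x}.
Proof.
move=> n0; exists [set x]; split.
- by rewrite set1_box; apply: (@measurable_box n (fun i => [set x 0 i])) => i; exact: measurable_set1.
- exact: mu_point.
- by move=> y /= /negP; rewrite negbK => /eqP.
Qed.

(** Normalised to have integral 1 and to be its own Fourier transform. *)
Definition gs n (x : 'rV[R]_n) := expR (- (pi * dotv x x)).

Lemma gs_gt0 n (x : 'rV[R]_n) : 0 < gs x. Proof. exact: expR_gt0. Qed.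

Lemma gs_ge0 n (x : 'rV[R]_n) : 0 <= gs x. Proof. exact: expR_ge0. Qed.

Lemma gs_le1 n (x : 'rV[R]_n) : gs x <= 1.
Proof. by rewrite /gs -expR0 ler_expR oppr_le0 mulr_ge0 ?pi_ge0 ?dotvv_ge0. Qed.

Lemma measurable_gs n : measurable_fun setT (@gs n).
Proof.
apply: measurableT_comp => //; apply: measurable_funN.
apply: measurable_funM; first exact: measurable_cst.
by apply: measurable_dotv; exact: measurable_id.
Qed.

Lemma int_gauss1 : (\int[leb]_t (expR (- (pi * t ^+ 2)))%:E = 1)%E.
Proof.
have sp0 : 0 < Num.sqrt pi :> R by rewrite sqrtr_gt0 pi_gt0.
have := @integralT_gauss R.
rewrite (@ge0_int_affine R (Num.sqrt pi) 0 (fun x => (gauss_fun x)%:E)); last 3 first.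
- by rewrite gt_eqF.
- by apply/measurable_EFinP; exact: measurable_gauss_fun.
- by move=> x; rewrite lee_fin gauss_fun_ge0.
rewrite gtr0_norm// => h.
rewrite (_ : (\int[leb]_t (expR (- (pi * t ^+ 2)))%:E)%E =
  \int[leb]_x (gauss_fun (Num.sqrt pi * x + 0))%:E)%E; last first.
  apply: eq_integral => x _; rewrite /gauss_fun addr0 exprMn sqr_sqrtr ?pi_ge0//.
by rewrite -[LHS]mul1e -(mulVf (lt0r_neq0 sp0)) EFinM -muleA h -EFinM mulVf// gt_eqF.
Qed.

Lemma measurable_gauss1 : measurable_fun setT (fun t : R => expR (- (pi * t ^+ 2))).
Proof.
apply: measurableT_comp => //; apply: measurable_funN.
by apply: measurable_funM => //; exact: measurable_funX.
Qed.

Lemma int_gs n : (\int[mu n]_x (gs x)%:E = 1)%E.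
Proof.
elim: n => [|n IH].
  rewrite (@integral_dirac _ _ (0 : 'rV[R]_0) R setT measurableT (fun x => (gs x)%:E)).
    by rewrite diracT mul1e /gs /dotv big_ord0 mulr0 oppr0 expR0.
  by apply/measurable_EFinP; exact: measurable_gs.
rewrite ge0_int_rvS; last 2 first.
- by apply/measurable_EFinP; exact: measurable_gs.
- by move=> x; rewrite lee_fin gs_ge0.
rewrite -int_gauss1; apply: eq_integral => t _.
transitivity (\int[mu n]_v (expR (- (pi * t ^+ 2)) * gs v)%:E)%E.
  apply: eq_integral => v _; congr (_%:E).
  rewrite /gs -expRD; congr expR; rewrite /dotv big_ord_recl mxE unlift_none/= -expr2.
  rewrite mulrDr opprD; congr (_ - _ * _); apply: eq_bigr => i _.
  by rewrite mxE liftK.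
rewrite int_Zl ?expR_ge0//; [|exact: measurable_gs|by move=> x; exact: gs_ge0].
by rewrite IH mule1.
Qed.

Lemma intg_gs n : intg (mu n) (@gs n).
Proof.
apply: intgP; first exact: measurable_gs.
under eq_integral do rewrite ger0_norm ?gs_ge0//.
by rewrite int_gs ltry.
Qed.

Lemma Rint_gs n : \int[mu n]_x gs x = 1.
Proof. by apply: EFin_inj; rewrite EFin_Rint ?int_gs//; exact: intg_gs. Qed.

Lemma gsZ n (t : R) (x : 'rV[R]_n) : gs (t *: x) = expR (- (pi * t ^+ 2 * dotv x x)).
Proof. by rewrite /gs dotvZl dotvZr expr2 !mulrA. Qed.

Lemma intg_gsZ n (t : R) : t != 0 -> intg (mu n) (fun x : 'rV[R]_n => gs (t *: x)).
Proof.
move=> t0; have := @intg_affine_rv R n t 0 (@gs n) t0 (@intg_gs n).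
by under eq_fun do rewrite addr0.
Qed.

(** A linear factor costs a dilation: [gs x] is [gs (x/2)] times [exp (- (3/4) pi |x|^2)], and
    [1 + s <= 2 (1 + (3/4) pi s^2)]. *)
Lemma enorm_gs_le n (x : 'rV[R]_n) : (1 + enorm x) * gs x <= 2 * gs (2^-1 *: x).
Proof.
have e : gs x = gs (2^-1 *: x) * expR (- (pi * (3 / 4) * dotv x x)).
  by rewrite gsZ -expRD /gs; congr expR; field.
rewrite e mulrCA [2 * _]mulrC ler_wpM2l ?gs_ge0// expRN ler_pdivrMr ?expR_gt0//.
apply: (@le_trans _ _ (2 * (1 + pi * (3 / 4) * dotv x x))); last first.
  by rewrite ler_wpM2l// expR_ge1Dx.
have := @pi_ge2 R; have := enorm_ge0 x; rewrite -enorm2.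
move: (enorm x) => s s0 p2; have : 2 * s ^+ 2 <= pi * s ^+ 2 by rewrite ler_wpM2r// sqr_ge0.
by nra.
Qed.

Lemma intg_enorm_gs n : intg (mu n) (fun x : 'rV[R]_n => (1 + enorm x) * gs x).
Proof.
have h : intg (mu n) (fun x : 'rV[R]_n => 2 * gs (2^-1 *: x)).
  by apply: intgZ; apply: intg_gsZ; rewrite invr_eq0.
apply: (intg_le _ _ h) => [|x].
  apply: measurable_funM; last exact: measurable_gs.
  by apply: measurable_funD => //; apply: measurable_enorm; exact: measurable_id.
by rewrite ger0_norm ?enorm_gs_le// mulr_ge0 ?gs_ge0// addr_ge0 ?enorm_ge0.
Qed.

Lemma intg_coord_gs n (j : 'I_n) : intg (mu n) (fun x : 'rV[R]_n => x 0 j * gs x).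
Proof.
apply: (intg_le _ _ (@intg_enorm_gs n)) => [|x].
  by apply: measurable_funM; [exact: measurable_rv_coord|exact: measurable_gs].
rewrite normrM (ger0_norm (gs_ge0 x)) ler_wpM2r ?gs_ge0//.
by apply: le_trans (coord_le_enorm x j) _; rewrite lerDr.
Qed.

Let mb n : measurable [set x : 'rV[R]_n | enorm x <= 1].
Proof. exact: measurable_enorm_ball. Qed.

Lemma mu_ballZ n (a : R) : (0 < n)%N -> 0 <= a ->
  mu n [set x | enorm x <= a] = ((a ^+ n)%:E * mu n [set x | (enorm x <= 1)%R])%E.
Proof.
move=> n0; rewrite le_eqVlt => /predU1P[<-|a0].
  rewrite expr0n gtn_eqF//= mul0e (_ : mkset _ = [set 0]); first exact: mu_point.
  apply/seteqP; split => x /=; last by move=> ->; rewrite enorm0.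
  by move=> h; apply/eqP; rewrite -enorm_eq0 eq_le h enorm_ge0.
rewrite (@leb_affine_rv R n a 0); [|by rewrite gt_eqF|exact: measurable_enorm_ball].
rewrite gtr0_norm//; congr (_ * mu n _)%E; apply/seteqP; split => x /=;
  by rewrite addr0 enormZ gtr0_norm// -ler_pdivlMl ?mulr1 ?mulVf ?gt_eqF//.
Qed.

(** [V] is the volume of the unit ball and [X] the integral over the levels [y] of the [n]-th power
    of the radius of the ball [gs >= y]. Only the relation [V * X = 1] is ever used. *)
Let V n : \bar R := mu n [set x : 'rV[R]_n | enorm x <= 1].
Let X n : \bar R :=
  (\int[leb]_y ((0 < y <= 1)%R%:R * Num.sqrt (- ln y / pi) ^+ n)%:E)%E.

Lemma int_unit_itv (a : R) : 0 <= a ->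
  (\int[leb]_y ((0 < y <= a)%R%:R)%:E = a%:E)%E.
Proof.
move=> a0; have := @powR_layer R 1 a ltr01 a0; rewrite subrr invr1 mul1r powRr1// => <-.
by apply: eq_integral => y _; rewrite powRr0 mulr1.
Qed.

Lemma le_exp_iff (y s : R) : 0 < y <= 1 -> 0 <= s ->
  (y <= expR (- (pi * s ^+ 2))) = (s <= Num.sqrt (- ln y / pi)).
Proof.
move=> /andP[y0 y1] s0; have l0 : 0 <= - ln y / pi.
  by rewrite divr_ge0 ?pi_ge0// oppr_ge0 ln_le0.
rewrite -{1}(lnK y0) ler_expR lerNr -[in RHS](ler_pXn2r (n := 2)) ?nnegrE ?sqrtr_ge0//.
by rewrite sqr_sqrtr// ler_pdivlMr ?pi_gt0// mulrC.
Qed.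

Let measurable_a n : measurable_fun setT (fun y : R => (0 < y <= 1)%R%:R * Num.sqrt (- ln y / pi) ^+ n).
Proof.
apply: measurable_funM.
  apply: measurable_natr_bool; apply: measurable_and; first exact: measurable_ltc.
  exact: measurable_gec.
apply: measurable_funX; apply: (@measurableT_comp _ _ _ _ _ _ (@Num.sqrt R)).
  by apply: continuous_measurable_fun => x; exact: sqrt_continuous.
apply: measurable_funM => //; apply: measurable_funN; exact: measurable_ln.
Qed.

Let measurable_exp_le d (T : measurableType d) (h : T -> R) : measurable_fun setT h ->
  measurable_fun setT (fun z : T * R => (0 < z.2 <= h z.1)%R%:R : R).
Proof.
move=> mh; apply: measurable_natr_bool; apply: measurable_and.
  by apply: measurable_fun_ltr => //; exact: measurable_snd.
by apply: measurable_fun_ler; [exact: measurable_snd|exact: measurableT_comp mh measurable_fst].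
Qed.

(** Layer cake for the Gaussian, which has integral 1 and whose superlevel sets are balls of radius
    [sqrt (- ln y / pi)]. *)
Let VX n : (0 < n)%N -> (V n * X n = 1)%E.
Proof.
move=> n0; rewrite -(int_gs n).
transitivity (\int[mu n]_x (\int[leb]_y ((0 < y <= gs x)%R%:R)%:E))%E; last first.
  by apply: eq_integral => x _; rewrite int_unit_itv ?gs_ge0.
rewrite (@tonelli _ _ _ _ R (mu n) leb (fun x y => (0 < y <= gs x)%R%:R)); last 2 first.
- by apply: measurable_exp_le; exact: measurable_gs.
- by move=> x y.
rewrite /X -ge0_integralZl; [|exact: measurableT
  |by apply/measurable_EFinP; exact: measurable_a
  |by move=> y _; rewrite lee_fin mulr_ge0// exprn_ge0// sqrtr_ge0|exact: measure_ge0].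
apply: eq_integral => y _; have [y01|y01] := boolP (0 < y <= 1).
  rewrite mul1r muleC -mu_ballZ ?sqrtr_ge0//.
  rewrite -[in LHS](setIT [set x | _]) -integral_indic//; last exact: measurable_enorm_ball.
  apply: eq_integral => x _; rewrite indicE; congr (_%:R%:E).
  rewrite /gs -enorm2 le_exp_iff ?enorm_ge0//; case/andP: (y01) => -> _ /=.
  by congr nat_of_bool; apply/idP/idP; rewrite inE.
rewrite mul0r mule0 integral0_eq// => x _; congr (_%:E).
case: (boolP (0 < y <= gs x)) => // /andP[h1 h2]; move/negP: y01; case.
by rewrite h1 (le_trans h2)// gs_le1.
Qed.

Let V_fin n : (0 < n)%N -> V n = (fine (V n))%:E.
Proof. by move=> n0; rewrite fineK// ge0_fin_numE//; exact: mu_ball_lty. Qed.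

Lemma ball1_gt0 n : (0 < n)%N -> 0 < fine (V n).
Proof.
move=> n0; rewrite lt_neqAle fine_ge0 ?measure_ge0// andbT; apply/eqP => v0.
have := VX n0; rewrite V_fin// -v0 mul0e => /eqP.
by rewrite eqe eq_sym oner_eq0.
Qed.

Let XE n : (0 < n)%N -> X n = (fine (V n))^-1%:E.
Proof.
move=> n0; have v0 := ball1_gt0 n0.
by rewrite -[LHS]mul1e -(mulVf (lt0r_neq0 v0)) EFinM -muleA -V_fin// VX// mule1.
Qed.

Lemma sphere_volumeE n : sphere_volume R n = n.+1%:R * fine (V n.+1).
Proof.
rewrite /sphere_volume /V; congr (_ * fine (mu _ _)); apply/funext => x /=.
have -> : \sum_i x 0 i ^+ 2 = enorm x ^+ 2.
  by rewrite enorm2; apply: eq_bigr => i _; rewrite expr2.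
by rewrite expr_le1 ?enorm_ge0.
Qed.

Lemma sphere_volume_gt0 n : 0 < sphere_volume R n.
Proof. by rewrite sphere_volumeE mulr_gt0// ball1_gt0. Qed.

Lemma int_invpow (n : nat) (b : R) : 0 < b ->
  (\int[leb]_t ((b <= t)%R%:R * t ^- n.+2)%:E = (n.+1%:R^-1 * b ^- n.+1)%:E)%E.
Proof.
move=> b0; rewrite (@int_natr_bool R _ _ leb (fun t : R => b <= t) (fun t => t ^- n.+2)).
rewrite (_ : [set x | _] = `[b, +oo[%classic); last first.
  by apply/seteqP; split => x /=; rewrite in_itv/= andbT.
rewrite -integral_itv_obnd_cbnd; last first.
  apply/measurable_funTS/measurable_EFinP; apply: measurable_inv; exact: measurable_funX.
have nz : (n.+1%:R : R) != 0 by rewrite pnatr_eq0.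
have dF x : b <= x -> is_derive x 1 (fun t : R => - (n.+1%:R^-1 * t ^- n.+1)) (x ^- n.+2).
  move=> bx; have x0 : x != 0 by rewrite gt_eqF// (lt_le_trans b0).
  have d0 : is_derive x 1 (fun t : R => t ^+ n.+1) (n.+1%:R * x ^+ n).
    have := @is_deriveX R R id n.+1 x 1 1 (is_derive_id _ _).
    by rewrite /GRing.scale/= mulr1 exprfctE.
  have d1 := @is_deriveV R (fun t : R => t ^+ n.+1) x _ 1 (expf_neq0 _ x0) d0.
  have d2 := is_deriveN (is_deriveZ n.+1%:R^-1 d1).
  apply: (@is_derive_eq _ _ _ _ _ _ _ _ d2).
  rewrite /GRing.scale/= !exprS; have y0 : x ^+ n != 0 by rewrite expf_neq0.
  by move: y0 nz; move: (x ^+ n) (n.+1%:R : R) => y m y0 m0; field; rewrite x0 y0 m0.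
rewrite (@ftcy R (fun t : R => - (n.+1%:R^-1 * t ^- n.+1)) _ b 0).
- by rewrite sub0r opprK.
- move=> x bx; apply: cvgV; first by rewrite expf_neq0// gt_eqF// (lt_le_trans b0).
  exact: exprn_continuous.
- by move=> x bx; rewrite invr_ge0 exprn_ge0// (le_trans _ bx)// ltW.
- rewrite -oppr0; apply: cvgN; rewrite -(mulr0 n.+1%:R^-1); apply: cvgMr.
  have h : \forall a \near +oo, 0 < (a : R) ^+ n.+1.
    by exists 0; split => // y y0; rewrite exprn_gt0.
  apply: (proj2 (gtr0_cvgV0 h)); apply/cvgryPge => A.
  exists (Num.max 1 A); split; [exact: num_real|move=> y; rewrite gt_max => /andP[y1 yA]].
  apply: (le_trans (ltW yA)); rewrite exprS ler_peMr//; first by apply: ltW; exact: lt_trans y1.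
  by rewrite exprn_ege1// ltW.
Qed.

Let measurable_invpow n : measurable_fun setT (fun t : R => t ^- n).
Proof. by apply: measurable_inv; exact: measurable_funX. Qed.

(* The layer-cake formula for the Gaussian in R^(n+1) brings in the volume of the
   unit ball of R^(n+1), hence the normalisation of the Riesz transforms. *)
Lemma int_gs_dilates n (u : 'rV[R]_n) : u != 0 ->
  (\int[leb]_t ((0 < t)%R%:R * (t ^- n.+2 * gs (t^-1 *: u)))%:E =
   ((sphere_volume R n * enorm u ^+ n.+1)^-1)%:E)%E.
Proof.
move=> u0; have e0 : 0 < enorm u by rewrite enorm_gt0.
pose F (t y : R) : R := (0 < t)%R%:R * t ^- n.+2 * (0 < y <= gs (t^-1 *: u))%R%:R.
have mG : measurable_fun setT (fun t : R => gs (t^-1 *: u)).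
  apply: measurableT_comp; first exact: measurable_gs.
  by apply: measurable_rvZ; [exact: measurable_inv|exact: measurable_cst].
have F0 t y : 0 <= F t y.
  rewrite /F mulr_ge0//; case: (ltP 0 t) => t0; rewrite ?mul0r// mul1r invr_ge0.
  by rewrite exprn_ge0// ltW.
transitivity (\int[leb]_t \int[leb]_y (F t y)%:E)%E.
  apply: eq_integral => t _; rewrite /F int_Zl; last 3 first.
  - by have := F0 t (gs (t^-1 *: u)); rewrite /F gs_gt0 lexx mulr1.
  - apply: measurable_natr_bool; apply: measurable_and; first exact: measurable_ltc.
    exact: measurable_gec.
  - by [].
  by rewrite int_unit_itv ?gs_ge0// -EFinM mulrA.
rewrite tonelli//; last first.
  apply: measurable_funM; last exact: (measurable_exp_le mG).
  apply: (@measurableT_comp _ _ _ _ _ _ (fun t : R => (0 < t)%R%:R * t ^- n.+2)) => //.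
  apply: measurable_funM; last exact: measurable_invpow.
  by apply: measurable_natr_bool; exact: measurable_ltc.
(* At a fixed level the condition on [t] is the half-line [t >= |u| / a], on which [t^-(n+2)]
   integrates to [(a / |u|)^(n+1) / (n+1)]. The power [a^(n+1)] integrated over the levels is [X] in
   dimension [n + 1], although [u] lives in dimension [n]. *)
have inner y : (\int[leb]_t (F t y)%:E =
    ((n.+1%:R * enorm u ^+ n.+1)^-1 * ((0 < y <= 1)%R%:R * Num.sqrt (- ln y / pi) ^+ n.+1))%:E)%E.
  have [y01|y01] := boolP (0 < y <= 1); last first.
    rewrite mul0r mulr0 integral0_eq// => t _; congr (_%:E); rewrite /F.
    case: (boolP (0 < y <= _)) => [/andP[h1 h2]|_]; last by rewrite mulr0.
    by move/negP: y01; case; rewrite h1 (le_trans h2)// gs_le1.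
  rewrite mul1r; set a := Num.sqrt _.
  have Fa t : 0 < t -> (y <= gs (t^-1 *: u)) = (enorm u <= a * t).
    move=> t0; rewrite /gs -enorm2 le_exp_iff ?enorm_ge0// enormZ gtr0_norm ?invr_gt0//.
    by rewrite ler_pdivrMl// mulrC.
  case/andP: (y01) => y0 _.
  have : 0 <= a by exact: sqrtr_ge0.
  rewrite le_eqVlt => /predU1P[a0|a0].
    rewrite -a0 expr0n mulr0 integral0_eq// => t _; congr (_%:E); rewrite /F y0/=.
    case: (ltP 0 t) => t0; last by rewrite !mul0r.
    by rewrite Fa// -a0 mul0r leNgt e0 mulr0.
  rewrite -[RHS](_ : (n.+1%:R^-1 * (enorm u / a) ^- n.+1)%:E = _); last first.
    congr (_%:E); rewrite expr_div_n invf_div invfM; ring.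
  rewrite -int_invpow ?divr_gt0//; apply: eq_integral => t _; congr (_%:E); rewrite /F y0/=.
  case: (ltP 0 t) => t0.
    by rewrite Fa// mul1r mulrC ler_pdivrMr// [t * a]mulrC.
  rewrite !mul0r; case: (leP (enorm u / a) t) => // h; last by rewrite mul0r.
  by have := lt_le_trans (divr_gt0 e0 a0) h; rewrite ltNge t0.
under eq_integral do rewrite inner.
rewrite int_Zl; last 3 first.
- by rewrite invr_ge0 mulr_ge0// exprn_ge0// enorm_ge0.
- exact: measurable_a.
- by move=> y; rewrite mulr_ge0// exprn_ge0// sqrtr_ge0.
rewrite -/(X n.+1) XE// -EFinM sphere_volumeE; congr (_%:E).
by rewrite -!invfM; congr (_^-1); rewrite mulrAC.
Qed.

(** Both signs of [t] contribute equally, which produces the numerator 2 of the Riesz constant. *)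
Lemma int_gs_dilates_abs n (u : 'rV[R]_n) : u != 0 ->
  (\int[leb]_t (`|t| ^- n.+2 * gs (t^-1 *: u))%:E =
   (2 / (sphere_volume R n * enorm u ^+ n.+1))%:E)%E.
Proof.
move=> u0; pose f (t : R) := (0 < t)%R%:R * (t ^- n.+2 * gs (t^-1 *: u)).
have f0 t : 0 <= f t.
  rewrite /f; case: (ltP 0 t) => t0; rewrite ?mul0r// mul1r mulr_ge0 ?gs_ge0//.
  by rewrite invr_ge0 exprn_ge0// ltW.
have mf : measurable_fun setT f.
  apply: measurable_funM; first by apply: measurable_natr_bool; exact: measurable_ltc.
  apply: measurable_funM; first exact: measurable_invpow.
  apply: measurableT_comp; first exact: measurable_gs.
  by apply: measurable_rvZ; [exact: measurable_inv|exact: measurable_cst].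
have mfN : measurable_fun setT (fun t : R => f (- t)) by apply: (measurableT_comp mf); exact: measurable_funN.
transitivity (\int[leb]_t ((f t)%:E + (f (- t))%:E))%E.
  apply: eq_integral => t _; rewrite -EFinD; congr (_%:E); rewrite /f oppr_gt0.
  case: (ltgtP 0 t) => t0; rewrite ?mul0r ?mul1r ?addr0 ?add0r.
  - by rewrite gtr0_norm.
  - by rewrite ltr0_norm// invrN scaleNr /gs dotvNl dotvC dotvNl opprK.
  - by rewrite -t0 normr0 expr0n/= invr0 mul0r.
rewrite ge0_integralD//=; last 4 first.
- by move=> t _; rewrite lee_fin.
- exact/measurable_EFinP.
- by move=> t _; rewrite lee_fin.
- exact/measurable_EFinP.
have -> : (\int[leb]_t (f (- t))%:E = \int[leb]_t (f t)%:E)%E.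
  rewrite [RHS](@ge0_int_affine R (-1) 0 (fun t => (f t)%:E)) ?oppr_eq0 ?oner_neq0//.
  + rewrite normrN normr1 mul1e; apply: eq_integral => t _.
    by rewrite mulN1r addr0.
  + exact/measurable_EFinP.
  +rewrite int_gs_dilates// -EFinD; congr EFin.
have s0 := sphere_volume_gt0 n; have e0 : enorm u != 0 by rewrite enorm_eq0.
have y0 : enorm u ^+ n.+1 != 0 by rewrite expf_neq0.
move: s0 y0; move: (sphere_volume R n) (enorm u ^+ n.+1) => s y s0 y0.
by field; rewrite y0 gt_eqF.
Qed.

End gaussian.

(** Measurability by descent on the shape of the function; the leaves are constants, projections and
    hypotheses of the context. *)
Ltac mfun := repeat first
  [ exact: measurable_cst | exact: measurable_fst | exact: measurable_snd
  | exact: measurable_id | assumption | apply: measurable_natr_bool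
  | apply: measurable_and | apply: measurable_fun_ltr | apply: measurable_fun_ler
  | apply: measurable_inv | apply: measurable_rvB | apply: measurable_rvZ
  | apply: measurable_rvD | apply: measurable_enorm | apply: measurable_dotv
  | apply: measurable_coord
  | match goal with |- measurable_fun _ (fun x => fst _) => apply: (measurableT_comp measurable_fst) end
  | match goal with |- measurable_fun _ (fun x => snd _) => apply: (measurableT_comp measurable_snd) end
  | match goal with |- measurable_fun _ (fun x => `|_|) => apply: measurableT_comp => // end
  | match goal with |- measurable_fun _ (fun x => _ ^+ _) => apply: measurable_funX end
  | match goal with |- measurable_fun _ (fun x => gs _) =>
      apply: measurableT_comp; first exact: measurable_gs end
  | match goal with H : measurable_fun _ ?f |- measurable_fun _ (fun x => ?f _) =>
      apply: (measurableT_comp H) end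
  | match goal with |- measurable_fun _ (fun x => _ * _) => apply: measurable_funM end
  | match goal with |- measurable_fun _ (fun x => _ + - _) => apply: measurable_funB end
  | match goal with |- measurable_fun _ (fun x => _ + _) => apply: measurable_funD end
  | match goal with |- measurable_fun _ (fun x => - _) => apply: measurable_funN end ].

(** * Truncated Riesz transforms as Gaussian averages of directional transforms *)

Section rotation.
Context (R : realType) (n : nat).
Local Notation leb := (@lebesgue_measure R).
Local Notation mu := (lebesgue_rv R n).
Local Notation sigma := (sphere_volume R n).
Implicit Types (f : 'rV[R]_n -> R) (x u z : 'rV[R]_n) (e N B : R) (j : 'I_n).

(** Truncation on both sides: the outer radius makes the kernel integrable against bounded functions
    and keeps transference on finite segments. *)
Definition ann e N (s : R) : R := (e < s <= N)%R%:R.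

Definition rk j u : R := 2 / sigma * (u 0 j / enorm u ^+ n.+1).

Definition tr j e N f x : R := \int[mu]_u (ann e N (enorm u) * rk j u * f (x - u)).

(** The Hilbert transform along the line directed by [z], which is not normalised; the truncation
    concerns the displacement [t z], so that it matches the annulus of [tr]. *)
Definition hz e N f x z : R :=
  \int[leb]_t (ann e N (`|t| * enorm z) / t * f (x - t *: z)).

Lemma ann_ge0 e N s : 0 <= ann e N s. Proof. by []. Qed.

Lemma measurable_ann e N : measurable_fun setT (ann e N).
Proof. by apply: measurable_natr_bool; apply: measurable_and; [exact: measurable_ltc|exact: measurable_gec]. Qed.

Lemma measurable_rk j : measurable_fun setT (rk j).
Proof. by rewrite /rk; mfun. Qed.

Lemma rk_le j u : u != 0 -> `|rk j u| <= 2 / sigma * enorm u ^- n.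
Proof.
move=> u0; have e0 : 0 < enorm u by rewrite enorm_gt0.
have s0 := sphere_volume_gt0 R n.
rewrite /rk normrM ger0_norm ?divr_ge0 ?(ltW s0)// ler_wpM2l ?divr_ge0 ?(ltW s0)//.
rewrite normrM normfV [`|_ ^+ _|]ger0_norm ?exprn_ge0 ?enorm_ge0//.
rewrite ler_pdivrMr ?exprn_gt0// exprSr mulrA mulVf ?mul1r ?coord_le_enorm//.
by rewrite expf_neq0// gt_eqF.
Qed.

Lemma ann_rk_le j e N u : 0 < e ->
  `|ann e N (enorm u) * rk j u| <= 2 / sigma * e ^- n * (enorm u <= N)%R%:R.
Proof.
move=> e0; have s0 := sphere_volume_gt0 R n.
have c0 : 0 <= 2 / sigma * e ^- n by rewrite mulr_ge0 ?divr_ge0 ?(ltW s0)// invr_ge0 exprn_ge0// ltW.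
rewrite /ann; have [/andP[eu ->]|_] := boolP (e < enorm u <= N); last first.
  by rewrite mul0r normr0 mulr_ge0.
have eu0 : 0 < enorm u by exact: lt_trans eu.
rewrite mul1r mulr1; apply: le_trans (rk_le j _) _; first by rewrite -enorm_gt0.
rewrite ler_wpM2l ?divr_ge0 ?(ltW s0)// lef_pV2 ?posrE ?exprn_gt0//.
by apply: lerXn2r; rewrite ?nnegrE ltW.
Qed.

Lemma intg_tr j e N f B x : 0 < e -> measurable_fun setT f -> (forall y, `|f y| <= B) ->
  intg mu (fun u => ann e N (enorm u) * rk j u * f (x - u)).
Proof.
move=> e0 mf fB.
have h : intg mu (fun u => (B * (2 / sigma * e ^- n)) * (enorm u <= N)%R%:R).
  by apply: intgZ; exact: intg_ball.
have ma := @measurable_ann e N; have mr := @measurable_rk j.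
apply: (intg_le _ _ h) => [|u]; first by mfun.
by rewrite normrM mulrC -mulrA; apply: ler_pM => //; exact: ann_rk_le.
Qed.

Lemma ann_div_le e N t z : 0 < e ->
  `|ann e N (`|t| * enorm z) / t| <= enorm z / e * (- (N / enorm z) <= t <= N / enorm z)%R%:R.
Proof.
move=> e0; have z0 := enorm_ge0 z.
rewrite /ann; have [/andP[et tN]|_] := boolP (e < _ <= N); last first.
  by rewrite mul0r normr0 mulr_ge0// divr_ge0// ltW.
have zp : 0 < enorm z.
  rewrite lt_neqAle z0 andbT; apply/eqP => z00.
  by move: et; rewrite -z00 mulr0 ltNge ltW.
have tp : 0 < `|t|.
  rewrite lt_neqAle normr_ge0 andbT; apply/eqP => t0.
  by move: et; rewrite -t0 mul0r ltNge ltW.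
rewrite -ler_norml ler_pdivlMr// tN mul1r mulr1 normfV -div1r ler_pdivrMr//.
by rewrite mulrAC ler_pdivlMr// mul1r mulrC ltW.
Qed.

Lemma intg_hz e N f B x z : 0 < e -> measurable_fun setT f -> (forall y, `|f y| <= B) ->
  intg leb (fun t => ann e N (`|t| * enorm z) / t * f (x - t *: z)).
Proof.
move=> e0 mf fB.
have ma := @measurable_ann e N.
have mF : measurable_fun setT (fun t : R => ann e N (`|t| * enorm z) / t * f (x - t *: z)) by mfun.
have [N0|N0] := ltP N 0.
  rewrite (_ : (fun t => _) = fun=> 0); first exact: intg0.
  apply/funext => t; rewrite /ann; case: (boolP (e < _ <= N)) => [/andP[h1 h2]|_]; last by rewrite !mul0r.
  by have := lt_trans (lt_le_trans (lt_trans e0 h1) h2) N0; rewrite ltxx.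
have h : intg leb (fun t => (B * (enorm z / e)) * (- (N / enorm z) <= t <= N / enorm z)%R%:R).
  by apply: intgZ; apply: intg_chi; rewrite divr_ge0// enorm_ge0.
apply: (intg_le _ _ h) => [|t]; first exact: mF.
by rewrite normrM mulrC -mulrA; apply: ler_pM => //; exact: ann_div_le.
Qed.

Section formula.
Variables (j : 'I_n) (e N B : R) (f : 'rV[R]_n -> R) (x : 'rV[R]_n).
Hypotheses (e0 : 0 < e) (mf : measurable_fun setT f) (fB : forall y, `|f y| <= B).

(** [F] and [A] are one integrand in two variables linked by [z = u / t]. The Jacobian [|t|^-n], the
    kernel [1 / t] and the coordinate [z_j = u_j / t] combine to [|t|^-(n+2) u_j]. *)
Let F (t : R) z : R :=
  ann e N (`|t| * enorm z) / t * (z 0 j * gs z) * f (x - t *: z).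
Let A (t : R) u : R :=
  `|t| ^- n.+2 * gs (t^-1 *: u) * (ann e N (enorm u) * u 0 j * f (x - u)).

Let ma := @measurable_ann e N.

Let mF : measurable_fun setT (fun q : R * 'rV[R]_n => F q.1 q.2).
Proof. by rewrite /F; mfun. Qed.

Let mA : measurable_fun setT (fun q : R * 'rV[R]_n => A q.1 q.2).
Proof. by rewrite /A; mfun. Qed.

Let B0 : 0 <= B. Proof. exact: le_trans (normr_ge0 _) (fB 0). Qed.

Let F0 z : F 0 z = 0. Proof. by rewrite /F invr0 mulr0 !mul0r. Qed.

Let A0 u : A 0 u = 0.
Proof. by rewrite /A normr0 expr0n/= invr0 !mul0r. Qed.

Let FA t u : t != 0 -> `|t^-1| ^+ n * F t (t^-1 *: u) = A t u.
Proof.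
move=> t0; rewrite /F /A.
have -> : `|t| * enorm (t^-1 *: u) = enorm u.
  by rewrite enormZ mulrA -normrM mulfV// normr1 mul1r.
rewrite scalerA mulfV// scale1r mxE.
have -> : `|t| ^- n.+2 = `|t|^-1 ^+ n * (t^-1 * t^-1).
  by rewrite -invfM -expr2 -(real_normK (num_real t)) -addn2 exprD invfM exprVn.
by rewrite normfV; ring.
Qed.

Let intF t : (\int[mu]_z `|F t z|%:E = \int[mu]_u `|A t u|%:E)%E.
Proof.
have [->|t0] := eqVneq t 0.
  by apply: eq_integral => z _; rewrite F0 A0.
have ti : t^-1 != 0 by rewrite invr_eq0.
have mFt := measurable_curry_l t mF.
rewrite (@ge0_int_affine_rv R n t^-1 0 (fun z => `|F t z|%:E))//; last first.
  by apply/measurable_EFinP; exact: measurableT_comp.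
rewrite -int_Zl.
- apply: eq_integral => u _; rewrite addr0 -(FA u t0) [in RHS]normrM; congr ((_ * _)%:E).
  by rewrite normrX normr_id.
- by rewrite exprn_ge0.
- apply: measurableT_comp => //.
  by apply: (measurableT_comp mFt); exact: measurable_affine_rv.
- by [].
Qed.

Let intgF t : intg mu (F t).
Proof.
have [->|t0] := eqVneq t 0.
  by rewrite (_ : F 0 = fun=> 0); [exact: intg0|apply/funext => z; rewrite F0].
have h : intg mu (fun z => (B * `|t|^-1) * `|z 0 j * gs z|).
  by apply: intgZ; apply: intg_norm; exact: intg_coord_gs.
apply: (intg_le (measurable_curry_l t mF) _ h) => z.
rewrite /F 2!normrM (_ : B * _ * _ = `|t|^-1 * `|z 0 j * gs z| * B); last by ring.
apply: ler_pM; rewrite ?mulr_ge0//; apply: ler_wpM2r => //; rewrite normrM normfV -[leRHS]mul1r ler_wpM2r ?invr_ge0//.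
by rewrite /ann normr_nat lern1 leq_b1.
Qed.

Let RintF t : \int[mu]_z F t z = \int[mu]_u A t u.
Proof.
have [->|t0] := eqVneq t 0.
  by apply: eq_Rint => z; rewrite F0 A0.
have ti : t^-1 != 0 by rewrite invr_eq0.
rewrite (@Rint_affine_rv R n t^-1 0 (F t) ti (intgF t)) -RintZ.
  by apply: eq_Rint => u; rewrite addr0 FA.
exact: (@intg_affine_rv R n t^-1 0 (F t) ti (intgF t)).
Qed.

Let intA u : (\int[leb]_t `|A t u|%:E = `|ann e N (enorm u) * rk j u * f (x - u)|%:E)%E.
Proof.
have [->|u0] := eqVneq u 0.
  have z : ann e N (enorm (0 : 'rV[R]_n)) = 0.
    by rewrite /ann enorm0 (_ : e < 0 = false)// ltNge ltW.
  rewrite /A z !mul0r normr0 integral0_eq// => t _.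
  by rewrite !(mul0r, mulr0) normr0.
have s0 := sphere_volume_gt0 R n.
transitivity (\int[leb]_t (`|t| ^- n.+2 * gs (t^-1 *: u) * `|ann e N (enorm u) * u 0 j * f (x - u)|)%:E)%E.
  apply: eq_integral => t _; congr (_%:E); rewrite /A normrM ger0_norm//.
  by rewrite mulr_ge0 ?gs_ge0// invr_ge0 exprn_ge0.
rewrite int_Zr//; last 2 first.
- by mfun.
- by move=> t; rewrite mulr_ge0 ?gs_ge0// invr_ge0 exprn_ge0.
rewrite int_gs_dilates_abs// -EFinM; congr (_%:E).
have d0 : 0 <= 2 / (sigma * enorm u ^+ n.+1).
  by rewrite divr_ge0// mulr_ge0 ?exprn_ge0 ?enorm_ge0// ltW.
rewrite -[X in X * _](ger0_norm d0) -normrM; congr `|_|.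
by rewrite /rk invfM; ring.
Qed.

Let intg2A : intg2 mu leb (fun u t => A t u).
Proof.
split; first by rewrite /A; mfun.
under eq_integral do rewrite intA.
exact: intg_lty (intg_tr j N x e0 mf fB).
Qed.

Let intg2F : intg2 leb mu F.
Proof.
split=> //; under eq_integral do rewrite intF.
by have [_] := intg2_sym intg2A.
Qed.

Let RintA u : \int[leb]_t A t u = ann e N (enorm u) * rk j u * f (x - u).
Proof.
have [->|u0] := eqVneq u 0.
  have z : ann e N (enorm (0 : 'rV[R]_n)) = 0.
    by rewrite /ann enorm0 (_ : e < 0 = false)// ltNge ltW.
  rewrite z !mul0r (eq_Rint _ (g := fun=> 0)) ?Rintegral_cst ?mul0r// => t.
  by rewrite /A z !(mul0r, mulr0).
have i : intg leb (fun t => `|t| ^- n.+2 * gs (t^-1 *: u)).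
  apply: intgP; first by mfun.
  under eq_integral => t _ do rewrite ger0_norm ?mulr_ge0 ?gs_ge0 ?invr_ge0 ?exprn_ge0//.
  by rewrite int_gs_dilates_abs// ltry.
transitivity (\int[leb]_t ((ann e N (enorm u) * u 0 j * f (x - u)) * (`|t| ^- n.+2 * gs (t^-1 *: u)))).
  by apply: eq_Rint => t; rewrite /A mulrC.
rewrite RintZ// (_ : \int[leb]_t _ = 2 / (sigma * enorm u ^+ n.+1)).
  by rewrite /rk invfM; ring.
by apply: EFin_inj; rewrite EFin_Rint// int_gs_dilates_abs.
Qed.

(** Integrating [A] over [t] rebuilds the Riesz kernel through [int_gs_dilates_abs]; integrating [F]
    over [t] first gives the transform along each line. Fubini identifies the two. *)
Lemma rotation : tr j e N f x = \int[mu]_z (z 0 j * gs z * hz e N f x z).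
Proof.
transitivity (\int[mu]_u (\int[leb]_t A t u)).
  by apply: eq_Rint => u; rewrite RintA.
rewrite Rint_fubini//; transitivity (\int[leb]_t (\int[mu]_z F t z)).
  by apply: eq_Rint => t; rewrite RintF.
rewrite (Rint_fubini intg2F); apply: eq_Rint => z; rewrite /hz -RintZ.
  by apply: eq_Rint => t; rewrite /F; ring.
exact: intg_hz mf fB.
Qed.

End formula.

(** The length [2 N / |z|] of the interval compensates the kernel bound [|z| / e], so the bound is
    uniform in the direction. *)
Lemma hz_le e N f B x z : 0 < e -> 0 <= N -> measurable_fun setT f -> (forall y, `|f y| <= B) ->
  `|hz e N f x z| <= B * (2 * N / e).
Proof.
move=> e0 N0 mf fB; have B0 : 0 <= B := le_trans (normr_ge0 _) (fB 0).
have i := intg_hz N x z e0 mf fB.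
apply: le_trans (le_normr_Rint i) _.
have c0 : 0 <= N / enorm z by rewrite divr_ge0// enorm_ge0.
have h : intg leb (fun t => (B * (enorm z / e)) * (- (N / enorm z) <= t <= N / enorm z)%R%:R).
  by apply: intgZ; exact: intg_chi.
apply: (@le_trans _ _ (\int[leb]_t ((B * (enorm z / e)) * (- (N / enorm z) <= t <= N / enorm z)%R%:R))).
  apply: le_Rint => //; first exact: intg_norm.
  by move=> t; rewrite normrM mulrC -mulrA; apply: ler_pM => //; exact: ann_div_le.
rewrite RintZ; last exact: intg_chi.
rewrite (_ : \int[leb]_t _ = 2 * (N / enorm z)); last first.
  by apply: EFin_inj; rewrite EFin_Rint ?int_chi//; exact: intg_chi.
rewrite -mulrA ler_wpM2l//; have [->|z0] := eqVneq (enorm z) 0.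
  by rewrite !mul0r mulr_ge0// ?invr_ge0 ?mulr_ge0// ltW.
by rewrite le_eqVlt; apply/orP; left; apply/eqP; field; rewrite z0 gt_eqF.
Qed.

End rotation.

(** * Transference from lines to R^n *)

Section transference.
Context (R : realType) (n : nat).
Local Notation leb := (@lebesgue_measure R).
Local Notation mu := (lebesgue_rv R n).
Implicit Types (f : 'rV[R]_n -> R) (x u z : 'rV[R]_n) (e N B p : R) (j : 'I_n) (E : seq R).

Lemma hz0 e N f x : 0 < e -> hz e N f x 0 = 0.
Proof.
move=> e0; rewrite /hz (eq_Rint _ (g := fun=> 0)) ?Rintegral_cst ?mul0r// => t.
by rewrite /ann enorm0 mulr0 (_ : e < 0 = false) ?mul0r// ltNge ltW.
Qed.

Lemma ann_hk e N t z : z != 0 -> e <= N ->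
  ann e N (`|t| * enorm z) / t = hk (e / enorm z) t - hk (N / enorm z) t.
Proof.
move=> z0 eN; have zp : 0 < enorm z by rewrite enorm_gt0.
rewrite /hk -mulrBl; congr (_ * _); rewrite /ann !ltr_pdivrMr// leNgt.
case: (ltP e (`|t| * enorm z)) => h1; case: (ltP N (`|t| * enorm z)) => h2; rewrite ?subrr ?subr0//.
by have := lt_le_trans h2 (le_trans h1 eN); rewrite ltxx.
Qed.

Definition hmax E N f x z := mx E (fun e => `|hz e N f x z|).

Lemma measurable_hmax E N f : measurable_fun setT f ->
  measurable_fun setT (fun q : 'rV[R]_n * 'rV[R]_n => hmax E N f q.1 q.2).
Proof.
move=> mf; apply: measurable_mx => e; apply: measurableT_comp => //.
have ma := @measurable_ann R e N.
apply: (@measurable_Rint_l _ _ _ _ R leb (fun (q : 'rV[R]_n * 'rV[R]_n) (t : R) =>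
  ann e N (`|t| * enorm q.2) / t * f (q.1 - t *: q.2))).
by mfun.
Qed.

Section line.
Variables (p C : R) (p1 : 1 < p) (C0 : 0 <= C).
Hypothesis hC : forall (g : R -> R) m E, bcs m g -> {in E, forall e, 0 < e} ->
  (\int[leb]_x (mx E (fun e => `|cv (hk e) g x|) `^ p)%:E <=
   C%:E * \int[leb]_x (`|g x| `^ p)%:E)%E.
Variables (f : 'rV[R]_n -> R) (B : R).
Hypotheses (mf : measurable_fun setT f) (fB : forall y, `|f y| <= B).
Variables (E : seq R) (N : R).
Hypotheses (E0 : {in E, forall e, 0 < e}) (N0 : 0 < N).

Let p0 : 0 < p. Proof. exact: lt_trans p1. Qed.
Let B0 : 0 <= B. Proof. exact: le_trans (normr_ge0 _) (fB 0). Qed.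

(** For [|s| <= L] the transform only sees the values of [f] at parameters [|r| <= 2 L], so [f]
    along the line may be cut off to a function of class [bcs], and the one-dimensional maximal
    inequality applies. *)
Lemma hmax_line x z (L := N / enorm z) : z != 0 ->
  (\int[leb]_s ((`|s| <= L)%R%:R * hmax E N f (x + s *: z) z `^ p)%:E <=
   (2 `^ p * C)%:E * \int[leb]_r ((`|r| <= 2 * L)%R%:R * `|f (x + r *: z)| `^ p)%:E)%E.
Proof.
move=> z0; have zp : 0 < enorm z by rewrite enorm_gt0.
have L0 : 0 < L by rewrite divr_gt0.
pose g (r : R) := f (x + r *: z) * (`|r| <= 2 * L)%R%:R.
have mg : measurable_fun setT g.
  by rewrite /g; mfun.
pose m := Num.max B (2 * L).
have gb : bcs m g.
  split => //; first by rewrite le_max B0.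
  move=> t; rewrite /g /m normrM normr_nat.
  case: (boolP (`|t| <= 2 * L)) => tL; last by rewrite mulr0 mulr_ge0// le_max B0.
  by rewrite (_ : (`|t| <= _) = true) ?mulr1 ?le_max ?fB// tL orbT.
(* [L] joins the list because a kernel truncated on both sides is the difference
   [hk (e / |z|) - hk L]; bounding both terms by the same maximum costs the factor 2. *)
pose E' := L :: [seq e / enorm z | e <- E].
have E'0 : {in E', forall e, 0 < e}.
  move=> e; rewrite inE => /predU1P[->//|/mapP[e' e'E ->]].
  by rewrite divr_gt0// E0.
have gi := bcs_intg gb.
have cvE (k : R -> R) (b s : R) : measurable_fun setT k -> (forall t, `|k t| <= b) ->
    cv k g s = \int[leb]_t (k t * g (s - t)).
  move=> mk kb; have i : intg leb (fun t => k (s - t) * g t) by exact: intg_cv.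
  rewrite /cv (@Rint_affine R (-1) s _ _ i) ?oppr_eq0 ?oner_neq0// normrN normr1 mul1r.
  apply: eq_Rint => t; have -> : s - (-1 * t + s) = t by ring.
  by congr (_ * g _); ring.
have main s : `|s| <= L -> hmax E N f (x + s *: z) z <=
    2 * mx E' (fun e => `|cv (hk e) g s|).
  move=> sL; apply: mx_le_in; first by rewrite mulr_ge0// mx_ge0.
  move=> e eE; have e0 := E0 eE.
  have [eN|Ne] := leP e N; last first.
    rewrite /hz (eq_Rint _ (g := fun=> 0)) ?Rintegral_cst ?mul0r ?normr0 ?mulr_ge0 ?mx_ge0// => t.
    rewrite /ann; case: (boolP (e < _ <= N)) => [/andP[h1 h2]|_]; last by rewrite !mul0r.
    by have := lt_trans (lt_le_trans h1 h2) Ne; rewrite ltxx.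
  have ez0 : 0 < e / enorm z by rewrite divr_gt0.
  have -> : hz e N f (x + s *: z) z = cv (hk (e / enorm z)) g s - cv (hk L) g s.
    rewrite (@cvE _ (e / enorm z)^-1); [|exact: measurable_hk|by move=> t; exact: hk_le].
    rewrite (@cvE _ L^-1); [|exact: measurable_hk|by move=> t; exact: hk_le].
    have ii e' : 0 < e' -> intg leb (fun t => hk e' t * g (s - t)).
      move=> e'0; have := @intg_cv R (fun t => g t) (fun t => hk e' (s - t)).
      have i : intg leb (fun t => hk e' (s - t) * g t).
        by apply: intg_cv gi; [exact: measurable_hk|move=> t; exact: hk_le].
      have := @intg_affine R (-1) s _ (ltac:(by rewrite oppr_eq0 oner_neq0)) i.
      under eq_fun => t.
        have -> : s - (-1 * t + s) = t by ring.
        have -> : -1 * t + s = s - t by ring.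
        over.
      by [].
    rewrite -RintB; [|exact: ii|exact: ii].
    apply: eq_Rint => t; rewrite -mulrBl -ann_hk// /g.
    have -> : x + s *: z - t *: z = x + (s - t) *: z by rewrite scalerBl addrA.
    have [h|h] := boolP (`|s - t| <= 2 * L); first by rewrite mulr1.
    rewrite mulr0 mulr0 /ann; case: (boolP (e < _ <= N)) => [/andP[h1 h2]|_]; last by rewrite !mul0r.
    move/negP: h; case; have : `|t| <= L by rewrite ler_pdivlMr.
    by have := ler_normB s t; lra.
  have h1 : `|cv (hk (e / enorm z)) g s| <= mx E' (fun e => `|cv (hk e) g s|).
    apply: (@le_mx _ _ E' (fun e => `|cv (hk e) g s|)); rewrite inE; apply/orP; right.
    by apply/mapP; exists e.
  have h2 : `|cv (hk L) g s| <= mx E' (fun e => `|cv (hk e) g s|).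
    by apply: (@le_mx _ _ E' (fun e => `|cv (hk e) g s|)); rewrite mem_head.
  by apply: le_trans (ler_normB _ _) _; rewrite mulr_natl mulr2n lerD.
have gE : (\int[leb]_r (`|g r| `^ p)%:E =
    \int[leb]_r ((`|r| <= 2 * L)%R%:R * `|f (x + r *: z)| `^ p)%:E)%E.
  apply: eq_integral => r _; congr (_%:E); rewrite /g normrM normr_nat.
  by case: (`|r| <= 2 * L); rewrite ?mulr1 ?mul1r// mulr0 mul0r powR0// gt_eqF.
rewrite -gE EFinM -muleA.
apply: (@le_trans _ _ (\int[leb]_s (2 `^ p * mx E' (fun e => `|cv (hk e) g s|) `^ p)%:E)%E).
  apply: int_mono => s; first by rewrite lee_fin mulr_ge0 ?powR_ge0.
  rewrite lee_fin; case: (boolP (`|s| <= L)) => sL; last by rewrite mul0r mulr_ge0 ?powR_ge0.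
  rewrite mul1r -powRM// ?mx_ge0//; apply: ge0_ler_powR; rewrite ?nnegrE ?(ltW p0) ?mx_ge0 ?mulr_ge0 ?mx_ge0//.
  exact: main.
rewrite int_Zl ?powR_ge0//.
- by rewrite lee_wpmul2l ?lee_fin ?powR_ge0//; exact: hC gb E'0.
- apply: measurable_fun_powR; apply: measurable_mx => e; apply: measurableT_comp => //.
  by apply: measurable_cv => //; exact: measurable_hk.
- by move=> y; exact: powR_ge0.
Qed.

Let Y := (\int[mu]_x (`|f x| `^ p)%:E)%E.

Let measurable_fp : measurable_fun setT (fun x => `|f x| `^ p).
Proof. by apply: measurable_fun_powR; exact: measurableT_comp. Qed.

Let avg (h : 'rV[R]_n -> R) z (L : R) : measurable_fun setT h -> (forall x, 0 <= h x) -> 0 <= L ->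
  (\int[mu]_x \int[leb]_s ((`|s| <= L)%R%:R * h (x + s *: z))%:E =
   (2 * L)%:E * \int[mu]_x (h x)%:E)%E.
Proof.
move=> mh h0 L0.
rewrite (@tonelli _ _ _ _ R mu leb (fun x s => (`|s| <= L)%R%:R * h (x + s *: z))); last 2 first.
- by mfun.
- by move=> x s; rewrite mulr_ge0.
transitivity (\int[leb]_s ((`|s| <= L)%R%:R%:E * \int[mu]_x (h x)%:E))%E.
  apply: eq_integral => s _.
  rewrite int_Zl//; last by mfun.
  congr (_ * _)%E; rewrite [RHS](@ge0_int_shift_rv R n (s *: z) (fun x => (h x)%:E))//.
  exact/measurable_EFinP.
have I0 : (0 <= \int[mu]_x (h x)%:E)%E by apply: integral_ge0 => x _; rewrite lee_fin.
rewrite ge0_integralZr//; last by apply/measurable_EFinP; mfun.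
congr (_ * _)%E; rewrite -(int_chi L0); apply: eq_integral => s _.
by rewrite ler_norml.
Qed.

(** Integrating [hmax_line] over [x] and using translation invariance, the segment on the left has
    length [2 L] and the one on the right [4 L]. Dividing by [2 L] leaves the factor 2,
    independently of [L] and hence of [N] and [z]. *)
Lemma hmax_Lp z : (\int[mu]_x (hmax E N f x z `^ p)%:E <= (2 `^ p * C * 2)%:E * Y)%E.
Proof.
have Y0 : (0 <= Y)%E by apply: integral_ge0 => x _; rewrite lee_fin powR_ge0.
have c0 : 0 <= 2 `^ p * C by rewrite mulr_ge0 ?powR_ge0.
have [->|z0] := eqVneq z 0.
  rewrite integral0_eq ?mule_ge0 ?lee_fin ?mulr_ge0// => x _.
  rewrite /hmax (_ : mx _ _ = 0) ?powR0 ?gt_eqF//; apply/eqP.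
  rewrite eq_le mx_ge0 andbT; apply: mx_le_in => // e /E0 e0.
  by rewrite hz0// normr0.
have zp : 0 < enorm z by rewrite enorm_gt0.
pose L := N / enorm z; have L0 : 0 < L by rewrite divr_gt0.
have mH : measurable_fun setT (fun x => hmax E N f x z `^ p).
  apply: measurable_fun_powR.
  exact: (measurable_curry_r z (measurable_hmax E N mf)).
have h : ((2 * L)%:E * \int[mu]_x (hmax E N f x z `^ p)%:E <=
    (2 * L)%:E * ((2 `^ p * C * 2)%:E * Y))%E.
  rewrite -(@avg (fun x => hmax E N f x z `^ p) z L)//; [|by move=> x; exact: powR_ge0|exact: ltW].
  apply: (@le_trans _ _ (\int[mu]_x ((2 `^ p * C)%:E *
      \int[leb]_r ((`|r| <= 2 * L)%R%:R * `|f (x + r *: z)| `^ p)%:E))%E).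
    apply: int_mono => x; last exact: hmax_line.
    by apply: integral_ge0 => s _; rewrite lee_fin mulr_ge0 ?powR_ge0.
  rewrite ge0_integralZl//.
  - rewrite (@avg (fun x => `|f x| `^ p) z (2 * L))//; last by rewrite mulr_ge0// ltW.
    have e : 2 `^ p * C * (2 * (2 * L)) = 2 * L * (2 `^ p * C * 2) by ring.
    by rewrite !muleA -!EFinM e.
  - apply: (@measurable_fun_fubini_tonelli_F _ _ _ _ R leb
      (fun q : 'rV[R]_n * R => ((`|q.2| <= 2 * L)%R%:R * `|f (q.1 + q.2 *: z)| `^ p)%:E)).
      by apply/measurable_EFinP; mfun; apply: measurable_fun_powR; mfun.
    by move=> q; rewrite lee_fin mulr_ge0 ?powR_ge0.
  - by move=> x _; apply: integral_ge0 => r _; rewrite lee_fin mulr_ge0 ?powR_ge0.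
by move: h; rewrite lee_pmul2l// lte_fin mulr_gt0.
Qed.

Let W := \int[mu]_z ((1 + enorm z) * gs z).

(** The rotation formula dominates the maximum by an integral of [hmax] against [(1 + |z|) gs z].
    Jensen's inequality brings the power inside and Tonelli reduces to [hmax_Lp] for each fixed
    direction. *)
Lemma tr_max_bounded j :
  (\int[mu]_x (mx E (fun e => `|tr j e N f x|) `^ p)%:E <= (W `^ p * (2 `^ p * C * 2))%:E * Y)%E.
Proof.
have Y0 : (0 <= Y)%E by apply: integral_ge0 => x _; rewrite lee_fin powR_ge0.
pose w z := (1 + enorm z) * gs z.
have w0 z : 0 <= w z by rewrite mulr_ge0 ?gs_ge0// addr_ge0 ?enorm_ge0.
have wi : intg mu w by exact: intg_enorm_gs.
have W0 : 0 <= W by apply: Rintegral_ge0 => z _; exact: w0.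
have H0 x z : 0 <= hmax E N f x z by exact: mx_ge0.
have mH := measurable_hmax E N mf.
have [d d0 dE] := seq_lb E0.
have HK x z : hmax E N f x z <= B * (N / d).
  apply: mx_le_in; first by rewrite mulr_ge0// divr_ge0// ltW.
  move=> e eE; have e0 := E0 eE; apply: le_trans (hz_le x z e0 (ltW N0) mf fB) _.
  apply: ler_wpM2l => //; rewrite ler_pdivrMr// mulrAC ler_pdivlMr//.
  by have := ler_wpM2l (ltW N0) (ltW (dE _ eE)); lra.
have iwH x : intg mu (fun z => w z * hmax E N f x z).
  have mHx := measurable_curry_l x mH.
  apply: (intg_le _ _ (intgZ (B * (N / d)) wi)) => [|z].
    by apply: measurable_funM mHx; exact: intg_measurable wi.
  by rewrite normrM !ger0_norm// mulrC ler_wpM2r.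
have s1 x : mx E (fun e => `|tr j e N f x|) <= \int[mu]_z (w z * hmax E N f x z).
  apply: mx_le_in; first by apply: Rintegral_ge0 => z _; exact: mulr_ge0.
  move=> e eE; have e0 := E0 eE.
  rewrite (rotation j N x e0 mf fB).
  have mhz : measurable_fun setT (fun z => hz e N f x z).
    have ma := @measurable_ann R e N.
    apply: (@measurable_Rint_l _ _ _ _ R leb (fun (z : 'rV[R]_n) (t : R) =>
      ann e N (`|t| * enorm z) / t * f (x - t *: z))).
    by mfun.
  have le1 z : `|z 0 j * gs z * hz e N f x z| <= w z * hmax E N f x z.
    rewrite normrM; apply: ler_pM => //; last exact: (le_mx (fun e => `|hz e N f x z|) eE).
    rewrite normrM (ger0_norm (gs_ge0 z)) ler_wpM2r ?gs_ge0//.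
    by apply: le_trans (coord_le_enorm z j) _; rewrite lerDr.
  have i1 : intg mu (fun z => z 0 j * gs z * hz e N f x z).
    apply: (intg_le _ _ (iwH x)) => [|z]; last exact: le1.
    apply: measurable_funM mhz; apply: measurable_funM; last exact: measurable_gs.
    exact: measurable_rv_coord.
  apply: le_trans (le_normr_Rint i1) _; apply: le_Rint => //; exact: intg_norm.
have s2 x : ((mx E (fun e => `|tr j e N f x|) `^ p)%:E <=
    (W `^ (p - 1))%:E * \int[mu]_z (w z * hmax E N f x z `^ p)%:E)%E.
  apply: le_trans (jensen_int p1 wi (measurable_curry_l x mH) w0 (H0 x)).
  rewrite -poweR_EFin; apply: (@gt0_ler_poweR R p (ltW p0)).
  - by rewrite in_itv/= leey andbT lee_fin mx_ge0.
  - rewrite in_itv/= leey andbT; apply: integral_ge0 => z _; rewrite lee_fin mulr_ge0//.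
  - by rewrite -EFin_Rint// lee_fin.
have mwH : measurable_fun setT (fun q : 'rV[R]_n * 'rV[R]_n => w q.2 * hmax E N f q.1 q.2 `^ p).
  apply: measurable_funM; last exact: measurable_fun_powR.
  exact: measurableT_comp (intg_measurable wi) measurable_snd.
apply: (@le_trans _ _ (\int[mu]_x ((W `^ (p - 1))%:E * \int[mu]_z (w z * hmax E N f x z `^ p)%:E))%E).
  by apply: int_mono => x //; rewrite lee_fin powR_ge0.
rewrite ge0_integralZl ?lee_fin ?powR_ge0//; last 2 first.
- apply: (@measurable_fun_fubini_tonelli_F _ _ _ _ R mu
    (fun q : 'rV[R]_n * 'rV[R]_n => (w q.2 * hmax E N f q.1 q.2 `^ p)%:E)).
    exact/measurable_EFinP.
  by move=> q; rewrite lee_fin mulr_ge0 ?powR_ge0.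
- by move=> x _; apply: integral_ge0 => z _; rewrite lee_fin mulr_ge0 ?powR_ge0.
rewrite (@tonelli _ _ _ _ R mu mu (fun x z => w z * hmax E N f x z `^ p))//; last first.
  by move=> x z; rewrite mulr_ge0 ?powR_ge0.
have -> : W `^ p = W `^ (p - 1) * W.
  have [W00|Wn0] := eqVneq W 0; first by rewrite W00 mulr0 powR0// gt_eqF.
  by rewrite -{3}(powRr1 W0) -powRD ?subrK// Wn0 implybT.
rewrite -!mulrA EFinM -muleA lee_wpmul2l ?lee_fin ?powR_ge0//.
apply: (@le_trans _ _ (\int[mu]_z ((w z)%:E * ((2 `^ p * C * 2)%:E * Y)))%E).
  apply: int_mono => z; first by apply: integral_ge0 => x _; rewrite lee_fin mulr_ge0 ?powR_ge0.
  rewrite int_Zl//; last 2 first.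
  - by apply: measurable_fun_powR; exact: (measurable_curry_r z mH).
  - by move=> x; exact: powR_ge0.
  by rewrite lee_wpmul2l ?lee_fin//; exact: hmax_Lp.
rewrite ge0_integralZr//; last 3 first.
- by apply/measurable_EFinP; exact: intg_measurable wi.
- by move=> z _; rewrite lee_fin.
- by rewrite mule_ge0// lee_fin !mulr_ge0 ?powR_ge0.
have -> : W * (2 `^ p * (C * 2)) = W * (2 `^ p * C * 2) by ring.
by rewrite -EFin_Rint// muleA -EFinM.
Qed.

End line.

Lemma tr_maximal p : 1 < p -> exists2 C : R, 0 <= C &
  forall f B E N j, measurable_fun setT f -> (forall y, `|f y| <= B) ->
  {in E, forall e, 0 < e} -> 0 < N ->
  (\int[mu]_x (mx E (fun e => `|tr j e N f x|) `^ p)%:E <=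
    C%:E * \int[mu]_x (`|f x| `^ p)%:E)%E.
Proof.
move=> p1; have [C C0 hC] := hilbert_maximal p1.
eexists; last first.
  move=> f B E N j mf fB E0 N0.
  exact: (tr_max_bounded p1 C0 hC mf fB E0 N0 j).
by rewrite !mulr_ge0 ?powR_ge0.
Qed.

End transference.

(** The power is [exp (p ln)] only away from 0, so the limit 0 is treated separately. *)
Lemma cvg_powR (R : realType) (p l : R) (u : nat -> R) : 0 < p -> (forall k, 0 <= u k) ->
  0 <= l -> u k @[k --> \oo] --> l -> u k `^ p @[k --> \oo] --> l `^ p.
Proof.
move=> p0 u0; rewrite le_eqVlt => /orP[/eqP <-|l0] cu.
  rewrite powR0 ?gt_eqF//; apply/cvgr0Pnorm_lt => e e0.
  have e1 : 0 < e `^ p^-1 by rewrite powR_gt0.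
  move/cvgr0Pnorm_lt : cu => /(_ _ e1) [N _ hN]; exists N => // k Nk.
  have := hN k Nk; rewrite !ger0_norm ?powR_ge0// => h.
  have -> : e = (e `^ p^-1) `^ p by rewrite -powRrM mulVf ?gt_eqF// powRr1// ltW.
  by apply: gt0_ltr_powR; rewrite ?nnegrE ?powR_ge0.
rewrite {2}/powR gt_eqF//.
have h : expR (p * ln (u k)) @[k --> \oo] --> expR (p * ln l).
  apply: (@cvg_comp _ _ _ (fun k => p * ln (u k)) expR); last exact: continuous_expR.
  apply: cvgMr; apply: (@cvg_comp _ _ _ u (@ln R) _ _ _ cu); exact: continuous_ln.
apply: cvg_trans h; apply: near_eq_cvg.
move/cvgr_gt : cu => /(_ _ l0); apply: filterS => k uk.
by rewrite /powR gt_eqF.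
Qed.

(** * Truncations without outer radius and their maximal function *)

Section truncated_riesz.
Context (R : realType) (n : nat).
Local Notation leb := (@lebesgue_measure R).
Local Notation mu := (lebesgue_rv R n).
Local Notation sigma := (sphere_volume R n).
Implicit Types (f : 'rV[R]_n -> R) (x u z : 'rV[R]_n) (e N B p : R) (j : 'I_n) (E : seq R).

Definition Lpf p f := measurable_fun setT f /\ (\int[mu]_x (`|f x| `^ p)%:E < +oo)%E.

Definition te j e f x : R := \int[mu]_u ((e < enorm u)%R%:R * rk j u * f (x - u)).

(** Layer cake: the set where [|u|^-s >= r] is a ball of volume proportional to [r^(-n/s)], which is
    integrable at 0 because [n / s < 1]; the truncation caps the levels at [c]. *)
Lemma int_tail s e : (0 < n)%N -> n%:R < s -> 0 < e ->
  (\int[mu]_u ((e < enorm u)%R%:R * enorm u `^ (- s))%:E < +oo)%E.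
Proof.
move=> n0 ns e0; have s0 : 0 < s by apply: le_lt_trans ns.
pose c := e `^ (- s); have c0 : 0 <= c by exact: powR_ge0.
pose F u r : R := (0 < r <= c)%R%:R * (r <= enorm u `^ (- s))%R%:R.
have mF : measurable_fun setT (fun z : 'rV[R]_n * R => F z.1 z.2).
  by rewrite /F; mfun; apply: measurable_fun_powR; mfun.
apply: (@le_lt_trans _ _ (\int[mu]_u \int[leb]_r (F u r)%:E)%E).
  apply: int_mono => u; first by rewrite lee_fin mulr_ge0 ?powR_ge0.
  case: (boolP (e < enorm u)) => eu; last first.
    by rewrite mul0r; apply: integral_ge0 => r _; rewrite lee_fin mulr_ge0.
  rewrite mul1r -(@int_unit_itv R (enorm u `^ (- s)) (powR_ge0 _ _)).
  apply: int_mono => r; first by rewrite lee_fin.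
  rewrite lee_fin /F; case: (boolP (0 < r <= _)) => [/andP[r0 ru]|_]; last by rewrite mulr_ge0.
  rewrite r0 ru mulr1 (_ : (r <= c) = true)//; apply: le_trans ru _.
  have u0 : 0 < enorm u by exact: lt_trans eu.
  by rewrite /c !powRN lef_pV2 ?posrE ?powR_gt0//; apply: ge0_ler_powR; rewrite ?nnegrE ?(ltW s0) ?(ltW e0) ?(ltW u0) ?(ltW eu).
have F0 u r : 0 <= F u r by rewrite /F mulr_ge0.
rewrite (@tonelli _ _ _ _ R mu leb F mF F0).
pose V := fine (mu [set u : 'rV[R]_n | (enorm u <= 1)%R]).
have VE : mu [set u : 'rV[R]_n | (enorm u <= 1)%R] = V%:E.
  by rewrite /V fineK// ge0_fin_numE//; exact: mu_ball_lty.
pose a := n%:R / s; have a1 : a < 1 by rewrite ltr_pdivrMr// mul1r.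
have E r : (\int[mu]_u (F u r)%:E <= ((0 < r <= c)%R%:R * r `^ ((1 - a) - 1) * V)%:E)%E.
  case: (boolP (0 < r <= c)) => [/andP[r0 rc]|h]; last first.
    rewrite mul0r mul0r (_ : (fun u => (F u r)%:E) = cst 0%E) ?integral0//.
    by apply/funext => u; rewrite /F (negbTE h) mul0r.
  pose t := r `^ (- s^-1); have t0 : 0 <= t by exact: powR_ge0.
  apply: (@le_trans _ _ (\int[mu]_u ((enorm u <= t)%R%:R)%:E)%E).
    apply: int_mono => u; first by rewrite lee_fin.
    rewrite lee_fin /F r0 rc mul1r; case: (boolP (r <= _)) => // ru.
    suff -> : enorm u <= t by [].
    have [u0|u0] := eqVneq (enorm u) 0; first by rewrite u0.
    have u1 : 0 < enorm u by rewrite lt_neqAle eq_sym u0 enorm_ge0.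
    have -> : enorm u = (enorm u `^ (- s)) `^ (- s^-1).
      by rewrite -powRrM mulrNN mulfV ?gt_eqF// powRr1// enorm_ge0.
    have w0 : 0 < enorm u `^ (- s) by rewrite powR_gt0.
    move: ru w0; set w := enorm u `^ _ => ru w0.
    by rewrite /t !powRN lef_pV2 ?posrE ?powR_gt0//; apply: ge0_ler_powR; rewrite ?nnegrE ?invr_ge0 ?(ltW s0) ?(ltW r0) ?(ltW w0).
  have -> : (\int[mu]_u ((enorm u <= t)%R%:R)%:E = mu [set u : 'rV[R]_n | (enorm u <= t)%R])%E.
    have := @int_natr_bool R _ _ mu (fun u : 'rV[R]_n => enorm u <= t) (fun=> 1).
    under eq_integral do rewrite mulr1.
    by move=> ->; rewrite -[RHS]mul1e; exact: (@integral_cst _ _ R mu _ (@measurable_enorm_ball R n t) 1%E).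
  rewrite mu_ballZ// VE -EFinM lee_fin mul1r ler_wpM2r//; first by rewrite /V fine_ge0.
  rewrite -powR_mulrn// -powRrM.
  have -> : - s^-1 * n%:R = 1 - a - 1 by rewrite /a; field; rewrite gt_eqF.
  by [].
apply: (@le_lt_trans _ _ (\int[leb]_r ((0 < r <= c)%R%:R * r `^ ((1 - a) - 1) * V)%:E)%E).
  by apply: int_mono => r; [apply: integral_ge0 => u _; rewrite lee_fin|exact: E].
have V0 : 0 <= V by rewrite /V fine_ge0.
rewrite int_Zr//.
- by rewrite powR_layer ?subr_gt0// -EFinM ltry.
- by mfun; apply: measurable_fun_powR.
- by move=> r; rewrite mulr_ge0 ?powR_ge0.
Qed.

Section Lp.
Variables (p : R) (p1 : 1 < p) (n0 : (0 < n)%N).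

Let p0 : 0 < p. Proof. exact: lt_trans p1. Qed.

Lemma Lpf_shift f x : Lpf p f -> Lpf p (fun u => f (x - u)).
Proof.
move=> [mf fi]; split; first by mfun.
rewrite -(@ge0_int_refl_rv R n x (fun u => (`|f u| `^ p)%:E))//.
by apply/measurable_EFinP; apply: measurable_fun_powR; exact: measurableT_comp.
Qed.

Lemma measurable_tek j e : measurable_fun setT (fun u : 'rV[R]_n => (e < enorm u)%R%:R * rk j u).
Proof. by have mr := @measurable_rk R n j; mfun. Qed.

(** Hölder: off a ball the kernel is of size [|u|^-n], hence in L^q for the conjugate exponent,
    because [n q > n]. *)
Lemma intg_te j e f x : 0 < e -> Lpf p f ->
  intg mu (fun u => (e < enorm u)%R%:R * rk j u * f (x - u)).
Proof.
move=> e0 /(Lpf_shift x)[mf fi].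
pose q := p / (p - 1).
have q1 : 1 < q by rewrite ltr_pdivlMr ?subr_gt0// mul1r ltrBlDr ltrDl.
have q0 : 0 < q by exact: lt_trans q1.
have pq : q^-1 + p^-1 = 1 by rewrite /q; field; rewrite !gt_eqF// subr_gt0.
have mk := measurable_tek j e.
have s0 := sphere_volume_gt0 R n.
apply: intgP; first exact: measurable_funM.
have H := hoelder_int mu mk mf q0 p0 pq.
apply: (le_lt_trans H); apply: lte_mul_pinfty; first exact: poweR_ge0.
  rewrite fin_num_poweR// ge0_fin_numE; last by apply: integral_ge0 => u _; rewrite lee_fin powR_ge0.
  pose c := (2 / sigma) `^ q.
  apply: (@le_lt_trans _ _ (\int[mu]_u (c * ((e < enorm u)%R%:R * enorm u `^ (- (n%:R * q))))%:E)%E).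
    apply: int_mono => u; rewrite lee_fin ?powR_ge0//.
    case: (boolP (e < enorm u)) => eu; last by rewrite !mul0r mulr0 normr0 powR0// gt_eqF.
    have u0 : 0 < enorm u by exact: lt_trans eu.
    have nq : q != 0 by rewrite gt_eqF.
    rewrite !mul1r /c.
    apply: (@le_trans _ _ ((2 / sigma * enorm u ^- n) `^ q)).
      apply: ge0_ler_powR; rewrite ?nnegrE ?(ltW q0)// ?mulr_ge0 ?invr_ge0 ?exprn_ge0 ?enorm_ge0 ?(ltW s0)//.
      by apply: rk_le; rewrite -enorm_gt0.
    rewrite powRM ?invr_ge0 ?exprn_ge0 ?mulr_ge0 ?invr_ge0 ?enorm_ge0 ?(ltW s0)//.
    rewrite ler_wpM2l ?powR_ge0// -powR_mulrn ?enorm_ge0// -powRN -powRrM.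
    by rewrite mulNr.
  rewrite int_Zl.
  - apply: lte_mul_pinfty; [by rewrite lee_fin powR_ge0|by []|].
    by apply: int_tail => //; rewrite ltr_pMr// ltr0n.
  - exact: powR_ge0.
  - by mfun; apply: measurable_fun_powR; mfun.
  - by move=> u; rewrite mulr_ge0 ?powR_ge0.
by rewrite poweR_lty.
Qed.

Lemma cvg_maxr (a b : nat -> R) (la lb : R) : a @ \oo --> la -> b @ \oo --> lb ->
  Num.max (a k) (b k) @[k --> \oo] --> Num.max la lb.
Proof.
move=> ha hb; rewrite maxr_absE; under eq_fun do rewrite maxr_absE.
by apply: cvgMl; apply: cvgD; [exact: cvgD|apply: cvg_norm; exact: cvgB].
Qed.

Lemma cvg_mx (E : seq R) (F : nat -> R -> R) (G : R -> R) :
  {in E, forall e, F ^~ e @ \oo --> G e} -> mx E (F k) @[k --> \oo] --> mx E G.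
Proof.
elim: E => [|e E IH] h.
  rewrite /mx big_nil; under eq_fun do rewrite big_nil.
  exact: cvg_cst.
rewrite /mx big_cons; under eq_fun do rewrite big_cons.
apply: cvg_maxr; first by apply: h; rewrite mem_head.
by apply: IH => e' e'E; apply: h; rewrite inE e'E orbT.
Qed.

(** Fatou: [f] is replaced by 0 where [|f| > k + 1] and the outer radius is [k + 1], so the bound
    for bounded functions applies to each term. *)
Lemma te_maximal C f E j :
  (forall f B E N j, measurable_fun setT f -> (forall y, `|f y| <= B) ->
  {in E, forall e, 0 < e} -> 0 < N ->
  (\int[mu]_x (mx E (fun e => `|tr j e N f x|) `^ p)%:E <=
    C%:E * \int[mu]_x (`|f x| `^ p)%:E)%E) -> 0 <= C ->
  Lpf p f -> {in E, forall e, 0 < e} ->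
  (\int[mu]_x (mx E (fun e => `|te j e f x|) `^ p)%:E <=
    C%:E * \int[mu]_x (`|f x| `^ p)%:E)%E.
Proof.
move=> hC C0 fLp E0; have [mf fi] := fLp.
pose fk (k : nat) y := (`|f y| <= k.+1%:R)%R%:R * f y.
have mfk k : measurable_fun setT (fk k) by rewrite /fk; mfun.
have fkb k y : `|fk k y| <= k.+1%:R.
  by rewrite /fk; case: (boolP (`|f y| <= _)) => h; rewrite ?mul1r// mul0r normr0.
have fkf k y : `|fk k y| <= `|f y|.
  by rewrite /fk; case: (boolP (`|f y| <= _)) => h; rewrite ?mul1r// mul0r normr0.
pose g k x := mx E (fun e => `|tr j e k.+1%:R (fk k) x|).
have cv x e : 0 < e -> tr j e k.+1%:R (fk k) x @[k --> \oo] --> te j e f x.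
  move=> e0; have i := intg_te j x e0 fLp.
  have ma k := @measurable_ann R e k; have mr := @measurable_rk R n j.
  have [||| _ l] := @Rint_dct _ _ R mu (fun (k : nat) u => ann e k.+1%:R (enorm u) * rk j u * fk k (x - u))
    (fun u => (e < enorm u)%R%:R * rk j u * f (x - u)) _ _ _ (intg_norm i).
  - by move=> k; have mak := ma k.+1%:R; have mfk' := mfk k; mfun.
  - move=> u; apply: cvg_near_cst; near=> k; rewrite /ann /fk.
    have h1 : enorm u <= k.+1%:R.
      apply: (@le_trans _ _ k%:R); last by rewrite ler_nat.
      by near: k; exact: nbhs_infty_ger.
    have h2 : `|f (x - u)| <= k.+1%:R.
      apply: (@le_trans _ _ k%:R); last by rewrite ler_nat.
      by near: k; exact: nbhs_infty_ger.
    by rewrite h1 h2 andbT mul1r.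
  - move=> k u; rewrite !normrM; apply: ler_pM => //.
      apply: ler_wpM2r => //; rewrite !ger0_norm ?ann_ge0//; rewrite /ann ler_nat.
      by case: (e < enorm u) => //=; case: (_ <= _).
    by case: (`|f (x - u)| <= _); rewrite ?normr1 ?normr0 ?mul1r ?mul0r.
  exact: l.
have G k : (\int[mu]_x (g k x `^ p)%:E <= C%:E * \int[mu]_x (`|f x| `^ p)%:E)%E.
  apply: (le_trans (hC (fk k) k.+1%:R E k.+1%:R j (mfk k) (fkb k) E0 _)) => //.
  apply: lee_wpmul2l; first by rewrite lee_fin.
  apply: int_mono => y; rewrite lee_fin ?powR_ge0//.
  by apply: ge0_ler_powR; rewrite ?nnegrE ?(ltW p0).
have cvp x : (fun k => (g k x `^ p)%:E) @ \oo --> (mx E (fun e => `|te j e f x|) `^ p)%:E.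
  apply: cvg_EFin; first exact: nearW.
  have c : g k x @[k --> \oo] --> mx E (fun e => `|te j e f x|).
    by apply: cvg_mx => e eE; apply: cvg_norm; apply: cv; exact: E0.
  by apply: (cvg_powR p0) c => [k|]; exact: mx_ge0.
have mg k : measurable_fun setT (fun x => (g k x `^ p)%:E).
  apply/measurable_EFinP; apply: measurable_fun_powR; apply: measurable_mx => e.
  apply: measurableT_comp => //; have mr := @measurable_rk R n j; have ma := @measurable_ann R e k.+1%:R.
  have mfk' := mfk k.
  by apply: (@measurable_Rint_l _ _ _ _ R mu (fun x u =>
    ann e k.+1%:R (enorm u) * rk j u * fk k (x - u))); mfun.
have FA := @fatou _ _ R mu setT measurableT (fun k x => (g k x `^ p)%:E) mg (fun k x _ => ltac:(by rewrite lee_fin powR_ge0)).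
apply: (le_trans _ (le_trans FA _)).
  rewrite le_eqVlt; apply/orP; left; apply/eqP; congr (integral _ _ _); apply/funext => x.
  by have [-> _] := cvg_limn_einf_sup (cvp x).
rewrite limn_einf_lim; apply: lime_le; first exact: is_cvg_einfs.
apply: nearW => k; apply: (le_trans _ (G k)); apply: ereal_inf_lbound; exists k => //=.
Unshelve. all: by end_near.
Qed.

(** Increasing finite lists that exhaust the positive rationals. *)
Definition ek (k : nat) : seq R :=
  [seq ratr r | r <- pmap unpickle (iota 0 k) & 0 < (r : rat)].

Lemma ek_gt0 k : {in ek k, forall e, 0 < e}.
Proof.
by move=> e /mapP[r]; rewrite mem_filter => /andP[r0 _] ->; rewrite ltr0q.
Qed.

Lemma ek_sub k l : (k <= l)%N -> {subset ek k <= ek l}.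
Proof.
move=> kl e /mapP[r]; rewrite mem_filter => /andP[r0 rk] ->; apply: map_f.
rewrite mem_filter r0/=; move: rk; rewrite !mem_pmap => /mapP[i iI ->]; apply: map_f.
by move: iI; rewrite !mem_iota !add0n => /leq_trans; exact.
Qed.

Lemma mem_ek (r : rat) : 0 < r -> ratr r \in ek (pickle r).+1.
Proof.
move=> r0; apply: map_f; rewrite mem_filter r0 mem_pmap -pickleK; apply: map_f.
by rewrite mem_iota add0n ltnS leqnn.
Qed.

(** The strict inequality [e < |u|] makes the truncation right-continuous in [e], so rationals
    tending to [e] from above suffice. *)
Lemma te_rat_approx j f x e (b : R) : 0 < e -> Lpf p f ->
  (forall r : rat, 0 < r -> `|te j (ratr r) f x| <= b) -> `|te j e f x| <= b.
Proof.
move=> e0 fLp h; have [mf _] := fLp; have mr := @measurable_rk R n j.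
have ex k : exists r : rat, ratr r \in `]e, (e + k.+1%:R^-1)[.
  by apply: rat_in_itvoo; rewrite ltrDl invr_gt0.
pose r k := projT1 (cid (ex k)).
have rP k : e < ratr (r k) < e + k.+1%:R^-1.
  by have := projT2 (cid (ex k)); rewrite in_itv.
have r0 k : 0 < r k by rewrite -(ltr0q R); case/andP: (rP k) => /(lt_trans e0).
have i := intg_te j x e0 fLp.
have [||| _ l] := @Rint_dct _ _ R mu (fun (k : nat) u => (ratr (r k) < enorm u)%R%:R * rk j u * f (x - u))
    (fun u => (e < enorm u)%R%:R * rk j u * f (x - u)) _ _ _ (intg_norm i).
- by move=> k; mfun.
- move=> u; apply: cvg_near_cst; have [eu|eu] := ltP e (enorm u); last first.
    apply: nearW => k; have /andP[h1 h2] := rP k.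
    by rewrite ltNge (le_trans eu (ltW h1)).
  have d0 : 0 < enorm u - e by rewrite subr_gt0.
  have [k0 _ hk] := near_infty_natSinv_lt (PosNum d0).
  exists k0 => // k /hk /= h3; have /andP[h1 h2] := rP k.
  by rewrite (lt_trans h2)// -ltrBrDl.
- move=> k u; rewrite !normrM; apply: ler_wpM2r => //; apply: ler_wpM2r => //.
  rewrite !ger0_norm// ler_nat; have /andP[h1 _] := rP k.
  by case: (ltP (ratr (r k)) (enorm u)) => // /(lt_trans h1) ->.
rewrite -/(te j e f x) in l.
have ln : `|te j (ratr (r k)) f x| @[k --> \oo] --> `|te j e f x| by apply: cvg_norm; exact: l.
rewrite -(cvg_lim (@Rhausdorff R) ln); apply: limr_le; first by apply/cvg_ex; eexists; exact: ln.
by apply: nearW => k; exact: h.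
Qed.

(** [P] is the monotone limit of the powers of the maxima over [ek k]. It is extended-real because
    it may be infinite on a null set. *)
Lemma te_sup C f j :
  (forall f B E N j, measurable_fun setT f -> (forall y, `|f y| <= B) ->
  {in E, forall e, 0 < e} -> 0 < N ->
  (\int[mu]_x (mx E (fun e => `|tr j e N f x|) `^ p)%:E <=
    C%:E * \int[mu]_x (`|f x| `^ p)%:E)%E) -> 0 <= C -> Lpf p f ->
  exists P : 'rV[R]_n -> \bar R, [/\ measurable_fun setT P, forall x, (0 <= P x)%E,
    forall x e, 0 < e -> ((`|te j e f x| `^ p)%:E <= P x)%E &
    (\int[mu]_x P x <= C%:E * \int[mu]_x (`|f x| `^ p)%:E)%E].
Proof.
move=> hC C0 fLp; have [mf _] := fLp.
pose g k x := (mx (ek k) (fun e => `|te j e f x|) `^ p)%:E.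
have mg k : measurable_fun setT (g k).
  apply/measurable_EFinP; apply: measurable_fun_powR; apply: measurable_mx => e.
  apply: measurableT_comp => //; have mr := @measurable_rk R n j.
  by apply: (@measurable_Rint_l _ _ _ _ R mu (fun x u =>
    (e < enorm u)%R%:R * rk j u * f (x - u))); mfun.
have g0 k x : (0 <= g k x)%E by rewrite lee_fin powR_ge0.
have nd x : nondecreasing_seq (g ^~ x).
  move=> k l kl; rewrite lee_fin; apply: ge0_ler_powR; rewrite ?nnegrE ?mx_ge0 ?(ltW p0)//.
  apply: mx_le_in; first exact: mx_ge0.
  by move=> e /(ek_sub kl) eE; exact: (le_mx (fun e => `|te j e f x|) eE).
pose P x := limn (g ^~ x).
have cvP x : g ^~ x @ \oo --> P x by exact: ereal_nondecreasing_is_cvgn.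
exists P; split.
- by apply: (emeasurable_fun_cvg g) => [k|x _]; [exact: mg|exact: cvP].
- by move=> x; apply: lime_ge; [apply/cvg_ex; exists (P x)|apply: nearW => k].
- move=> x e e0.
  have gP k : (g k x <= P x)%E.
    apply: lime_ge; first exact: ereal_nondecreasing_is_cvgn.
    by exists k => // m /= km; exact: nd.
  have hP : (0 <= P x)%E := le_trans (g0 0%N x) (gP 0%N).
  case EP : (P x) => [b| |]; [|by rewrite leey|by rewrite EP in hP].
  rewrite lee_fin; rewrite EP lee_fin in hP.
  have -> : b = (b `^ p^-1) `^ p by rewrite -powRrM mulVf ?gt_eqF// powRr1.
  apply: ge0_ler_powR; rewrite ?nnegrE ?powR_ge0 ?(ltW p0)//.
  apply: te_rat_approx => // r r0.
  have h := gP (pickle r).+1; rewrite EP lee_fin in h.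
  have l1 := le_mx (fun e => `|te j e f x|) (mem_ek r0).
  apply: (le_trans l1); set M := mx _ _ in h *.
  have -> : M = (M `^ p) `^ p^-1 by rewrite -powRrM mulfV ?gt_eqF// powRr1// mx_ge0.
  by apply: ge0_ler_powR; rewrite ?nnegrE ?powR_ge0 ?invr_ge0 ?(ltW p0).
have l := @int_mct _ _ R mu g P mg g0 nd cvP.
rewrite -(cvg_lim (@ereal_hausdorff R) l); apply: lime_le; first by apply/cvg_ex; eexists; exact: l.
by apply: nearW => k; apply: te_maximal => //; exact: ek_gt0.
Qed.

(** The substitution [y = x - u] identifies the integral in [riesz] with [te], up to the constant
    already contained in [rk]. *)
Lemma riesz_lim j f x (l : R) : Lpf p f -> te j e f x @[e --> 0^'+] --> l -> riesz j f x = l.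
Proof.
move=> fLp h; have s0 := sphere_volume_gt0 R n; have c0 : 2 / sigma != 0.
  by rewrite mulf_neq0// ?invr_eq0 gt_eqF.
rewrite /riesz; pose I e := \int[mu]_(y in [set y | e < enorm (x - y)])
  ((x 0 j - y 0 j) * f y / enorm (x - y) ^+ n.+1).
have E e : 0 < e -> I e = (2 / sigma)^-1 * te j e f x.
  move=> e0; have i := intg_te j x e0 fLp.
  have i' := intg_refl_rv x i.
  rewrite /I -(@Rint_natr_bool R _ _ mu (fun y => e < enorm (x - y))
     (fun y => (x 0 j - y 0 j) * f y / enorm (x - y) ^+ n.+1)).
  rewrite /te (Rint_refl_rv x i) -RintZ//.
  apply: eq_Rint => y; rewrite subKr /rk !mxE.
  move: c0 (enorm (x - y) ^+ n.+1)^-1; move: (2 / sigma) => c c0 I'.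
  transitivity ((c^-1 * c) * ((e < enorm (x - y))%R%:R * ((x 0 j - y 0 j) * f y * I'))); last by ring.
  by rewrite mulVf// mul1r.
have li : I e @[e --> 0^'+] --> (2 / sigma)^-1 * l.
  have h2 : (2 / sigma)^-1 * te j e f x @[e --> 0^'+] --> (2 / sigma)^-1 * l by apply: cvgMr.
  apply: cvg_trans h2; apply: near_eq_cvg; near=> e; apply/esym; apply: E.
  by near: e; exact: nbhs_right_gt.
rewrite (cvg_lim (@Rhausdorff R) li) mulrA mulfV// mul1r //.
Unshelve. all: by end_near.
Qed.

End Lp.

End truncated_riesz.

(** * Fourier analysis on Schwartz functions *)

Section sine_integral.
Context (R : realType).
Local Notation leb := (@lebesgue_measure R).

Lemma sin_le (t : R) : `|sin t| <= `|t|.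
Proof.
wlog t0 : t / 0 <= t => [h|].
  have [/h//|/ltW t0] := leP 0 t.
  by have := h (- t); rewrite sinN !normrN oppr_ge0 => /(_ t0).
rewrite (ger0_norm t0); have [c _ e] := @MVT_segment R sin cos 0 t t0
  (fun x _ => is_derive_sin x) (continuous_subspaceT (@continuous_sin R)).
move: e; rewrite sin0 !subr0 => ->; rewrite normrM (ger0_norm t0).
by rewrite -[leRHS]mul1r ler_wpM2r// cos_max.
Qed.

Lemma measurable_sin : measurable_fun setT (@sin R).
Proof. by apply: continuous_measurable_fun; exact: continuous_sin. Qed.

Lemma measurable_cos : measurable_fun setT (@cos R).
Proof. by apply: continuous_measurable_fun; exact: continuous_cos. Qed.

Definition sinJ (a b : R) : R := \int[leb]_t ((a < t <= b)%R%:R * (sin t / t)).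

Lemma sinc_le (t : R) : `|sin t / t| <= 1.
Proof.
have [->|t0] := eqVneq t 0; first by rewrite invr0 mulr0 normr0.
by rewrite normrM normfV ler_pdivrMr ?normr_gt0// mul1r sin_le.
Qed.

Let mind (a b : R) : measurable_fun setT (fun t : R => (a < t <= b)%R%:R : R).
Proof.
apply: measurable_natr_bool; apply: measurable_and; first exact: measurable_ltc.
exact: measurable_gec.
Qed.

Lemma int_itvoc (a b : R) : a <= b -> (\int[leb]_t (a < t <= b)%R%:R%:E)%E = (b - a)%:E.
Proof.
move=> ab; transitivity (leb `]a, b]).
  rewrite -[in RHS](setIT `]a, b]%classic) -integral_indic//.
  apply: eq_integral => t _; rewrite indicE; congr (_%:R%:E).
  by congr nat_of_bool; apply/idP/idP; rewrite inE/= in_itv/=.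
rewrite lebesgue_measure_itv/= lte_fin; case: ltP => [_|ba]; first by rewrite -EFinB.
by rewrite (_ : b = a) ?subrr//; apply/eqP; rewrite eq_le ab ba.
Qed.

Lemma intg_itvoc (a b : R) : intg leb (fun t : R => (a < t <= b)%R%:R).
Proof.
apply: intgP; first exact: mind.
under eq_integral do rewrite normr_nat.
have [ab|ba] := leP a b; first by rewrite int_itvoc// ltry.
rewrite integral0_eq ?ltry// => t _.
case: (boolP (a < t <= b)) => // /andP[h1 h2].
by have := lt_trans (lt_le_trans h1 h2) ba; rewrite ltxx.
Qed.

Lemma measurable_sinc : measurable_fun setT (fun t : R => sin t / t).
Proof. by apply: measurable_funM; [exact: measurable_sin|exact: measurable_inv]. Qed.

Lemma intg_sinJ a b : intg leb (fun t => (a < t <= b)%R%:R * (sin t / t)).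
Proof.
apply: (intg_le _ _ (intg_itvoc a b)) => [|t].
  by apply: measurable_funM; [exact: mind|exact: measurable_sinc].
by rewrite normrM normr_nat -[leRHS]mulr1 ler_wpM2l// sinc_le.
Qed.

Lemma sinJ_add a m b : a <= m -> m <= b -> sinJ a b = sinJ a m + sinJ m b.
Proof.
move=> am mb; rewrite /sinJ -RintD; [|exact: intg_sinJ|exact: intg_sinJ].
apply: eq_Rint => t; rewrite -mulrDl; congr (_ * _).
case: (ltP a t) => h1; case: (leP t m) => h2; rewrite ?andbT ?andbF/= ?add0r ?addr0.
- by rewrite (le_trans h2 mb)/=.
- by [].
- by [].
- by have := lt_le_trans h2 (le_trans h1 am); rewrite ltxx.
Qed.

Lemma sinJ_small a b : a <= b -> `|sinJ a b| <= b - a.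
Proof.
move=> ab; apply: le_trans (le_normr_Rint _) _; first exact: intg_sinJ.
apply: (@le_trans _ _ (\int[leb]_t (a < t <= b)%R%:R)).
  apply: le_Rint; [exact: intg_norm (intg_sinJ a b)|exact: intg_itvoc|].
  by move=> t; rewrite normrM normr_nat -[leRHS]mulr1 ler_wpM2l// sinc_le.
by rewrite -lee_fin EFin_Rint ?int_itvoc//; exact: intg_itvoc.
Qed.

(** Integration by parts: the boundary terms give [1/a + 1/b] and the integral of [cos t / t^2] at
    most [1/a - 1/b]. *)
Lemma sinJ_large a b : 0 < a -> a <= b -> `|sinJ a b| <= 2 / a.
Proof.
move=> a0 ab; have x0 (x : R) : a <= x <= b -> x != 0.
  by move=> /andP[ax _]; rewrite gt_eqF// (lt_le_trans a0).
have dV (x : R) : a <= x <= b -> is_derive x 1 (fun t : R => - t^-1) (x ^- 2).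
  move=> /x0 xn0; have d := @is_deriveV R id x 1 1 xn0 (is_derive_id _ _).
  apply: is_derive_eq; rewrite /GRing.scale/= mulr1 opprK//.
have cV (x : R) : a <= x <= b -> {for x, continuous (fun t : R => t ^- 2)}.
  by move=> /x0 xn0; apply: cvgV; [rewrite expf_neq0|exact: exprn_continuous].
have dF (x : R) : a <= x <= b -> is_derive x 1 (fun t : R => - (cos t * t^-1)) (sin x / x + cos x / x ^+ 2).
  move=> /x0 xn0; have d := @is_deriveV R id x 1 1 xn0 (is_derive_id _ _).
  have dM := is_deriveN (is_deriveM (is_derive_cos x) d).
  apply: (@is_derive_eq _ _ _ _ _ _ _ _ dM).
  by rewrite /GRing.scale/=; field.
have cF (x : R) : a <= x <= b -> {for x, continuous (fun t : R => sin t / t + cos t / t ^+ 2)}.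
  move=> h; have xn0 := x0 _ h; apply: cvgD; apply: cvgM.
  - exact: continuous_sin.
  - exact: cvgV.
  - exact: continuous_cos.
  - exact: cV.
have I1 := ftcR ab dF cF.
have I2 := ftcR ab dV cV.
pose chi (t : R) : R := (a <= t <= b)%R%:R.
have mc : measurable_fun setT chi.
  by apply: measurable_natr_bool; apply: measurable_and; [exact: measurable_lec|exact: measurable_gec].
have toI (h : R -> R) : \int[leb]_(t in `[a, b]) h t = \int[leb]_t (chi t * h t).
  by rewrite (@Rint_natr_bool R _ _ leb (fun t : R => a <= t <= b)) .
have ic : intg leb (fun t : R => chi t).
  apply: intgP => //; rewrite (_ : integral _ _ _ = leb `[a, b]).
    by rewrite lebesgue_measure_itv/=; case: ifP => _; rewrite -?EFinB ltry.
  rewrite -[in RHS](setIT `[a, b]%classic) -integral_indic//.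
  apply: eq_integral => t _; rewrite indicE /chi normr_nat; congr (_%:R%:E).
  by congr nat_of_bool; apply/idP/idP; rewrite inE/= in_itv/=.
have bnd (t : R) : a <= t <= b -> t ^- 2 <= a ^- 2.
  move=> /andP[h1 _]; rewrite lef_pV2 ?posrE ?exprn_gt0 ?(lt_le_trans a0)//.
  by apply: lerXn2r; rewrite ?nnegrE ?(ltW a0) ?(le_trans (ltW a0)).
have i2 : intg leb (fun t : R => chi t * t ^- 2).
  apply: (intg_le _ _ (intgZ (a ^- 2) ic)) => [|t].
    by apply: measurable_funM => //; apply: measurable_inv; exact: measurable_funX.
  rewrite /chi; case: (boolP (a <= t <= b)) => h; last by rewrite !mul0r mulr0 normr0.
  by rewrite mul1r mulr1 ger0_norm ?invr_ge0 ?sqr_ge0// bnd.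
have i3 : intg leb (fun t : R => chi t * (cos t / t ^+ 2)).
  apply: (intg_le _ _ i2) => [|t].
    apply: measurable_funM => //; apply: measurable_funM; first exact: measurable_cos.
    by apply: measurable_inv; exact: measurable_funX.
  rewrite !normrM normr_nat ler_wpM2l// normfV -[leRHS]mul1r [`|t ^+ 2|]ger0_norm ?sqr_ge0//.
  by rewrite ler_wpM2r ?invr_ge0 ?sqr_ge0// cos_max.
have E : sinJ a b = \int[leb]_t (chi t * (sin t / t)).
  transitivity (\int[leb]_(t in `]a, b]) (sin t / t)).
    rewrite /sinJ (@Rint_natr_bool R _ _ leb (fun t : R => a < t <= b)).
    by rewrite (_ : [set x | a < x <= b] = `]a, b]%classic).
  rewrite -toI; apply: Rintegral_itv_obnd_cbnd.
  have h : leb.-integrable `]a, b] (EFin \o (fun t => (a < t <= b)%R%:R * (sin t / t))).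
    by apply: (integrableS measurableT) => //; exact: intg_sinJ.
  apply: eq_integrable h => //.
  by move=> t; rewrite inE/= in_itv/= => tab; rewrite tab mul1r.
have i1 : intg leb (fun t : R => chi t * (sin t / t)).
  apply: (intg_le _ _ ic) => [|t]; first by apply: measurable_funM => //; exact: measurable_sinc.
  by rewrite normrM normr_nat -[leRHS]mulr1 ler_wpM2l// sinc_le.
have E1 : sinJ a b = (- (cos b / b) + cos a / a) - \int[leb]_t (chi t * (cos t / t ^+ 2)).
  move: I1; rewrite toI opprK => <-; rewrite E -RintB//.
    by apply: eq_Rint => t; rewrite -mulrBr addrK.
  have := intgD i1 i3; congr (_.-integrable _ _).
  by apply/funext => t /=; rewrite mulrDr.
have b0 : 0 < b by exact: lt_le_trans ab.
have h1 : `|cos a / a| <= a^-1.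
  by rewrite normrM normfV (gtr0_norm a0) -[leRHS]mul1r ler_wpM2r ?invr_ge0 ?(ltW a0)// cos_max.
have h2 : `|cos b / b| <= b^-1.
  by rewrite normrM normfV (gtr0_norm b0) -[leRHS]mul1r ler_wpM2r ?invr_ge0 ?(ltW b0)// cos_max.
have h3 : `|\int[leb]_t (chi t * (cos t / t ^+ 2))| <= a^-1 - b^-1.
  have -> : a^-1 - b^-1 = \int[leb]_t (chi t * t ^- 2) by rewrite -toI I2 opprK addrC.
  apply: le_trans (le_normr_Rint i3) _; apply: le_Rint => //; first exact: intg_norm.
  move=> t; rewrite !normrM normr_nat ler_wpM2l// normfV -[leRHS]mul1r [`|t ^+ 2|]ger0_norm ?sqr_ge0//.
  by rewrite ler_wpM2r ?invr_ge0 ?sqr_ge0// cos_max.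
rewrite E1; apply: le_trans (ler_normB _ _) _.
have h4 := ler_normD (- (cos b / b)) (cos a / a); rewrite normrN in h4.
apply: le_trans (lerD (le_trans h4 (lerD h2 h1)) h3) _.
by rewrite le_eqVlt; apply/orP; left; apply/eqP; ring.
Qed.

(** Splitting at 1, the part below contributes at most 1 and the part above at most 2. *)
Lemma sinJ_le a b : 0 <= a -> a <= b -> `|sinJ a b| <= 3.
Proof.
move=> a0 ab; have [b1|b1] := leP b 1.
  by apply: le_trans (sinJ_small ab) _; lra.
have [a1|a1] := leP a 1; last first.
  apply: le_trans (sinJ_large _ ab) _; first by lra.
  by rewrite ler_pdivrMr; lra.
rewrite (sinJ_add a1 (ltW b1)); apply: le_trans (ler_normD _ _) _.
have := sinJ_small a1; have := sinJ_large ltr01 (ltW b1); lra.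
Qed.

Lemma sinJ_diff a a' b b' : 0 <= a <= 1 -> 0 <= a' <= 1 -> 1 <= b -> 1 <= b' ->
  `|sinJ a b - sinJ a' b'| <= `|a - a'| + 2 / b + 2 / b'.
Proof.
move=> /andP[a0 a1] /andP[a'0 a'1] b1 b'1.
rewrite (sinJ_add a1 b1) (sinJ_add a'1 b'1) opprD addrACA.
have s (x y : R) : 0 <= x -> x <= y -> y <= 1 -> `|sinJ x 1 - sinJ y 1| <= `|x - y|.
  move=> x0 xy y1; rewrite (sinJ_add xy y1) addrK distrC.
  by apply: le_trans (sinJ_small xy) _; exact: ler_norm.
have l (x y : R) : 1 <= x -> x <= y -> `|sinJ 1 x - sinJ 1 y| <= 2 / x.
  move=> x1 xy; rewrite (sinJ_add x1 xy) opprD addNKr normrN.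
  by apply: sinJ_large => //; lra.
have pos (x : R) : 1 <= x -> 0 <= 2 / x by move=> x1; rewrite divr_ge0//; lra.
have h1 : `|sinJ a 1 - sinJ a' 1| <= `|a - a'|.
  by have [h|/ltW h] := leP a a'; [exact: s|rewrite distrC [leRHS]distrC; exact: s].
have h2 : `|sinJ 1 b - sinJ 1 b'| <= 2 / b + 2 / b'.
  have [h|/ltW h] := leP b b'.
    by apply: le_trans (l _ _ b1 h) _; rewrite lerDl pos.
  by rewrite distrC; apply: le_trans (l _ _ b'1 h) _; rewrite lerDr pos.
by apply: le_trans (ler_normD _ _) _; rewrite -addrA; exact: lerD.
Qed.

Definition sinT (e N c : R) : R := \int[leb]_t (ann e N `|t| / t * sin (c * t)).

Lemma intg_sinT e N c : 0 < e -> intg leb (fun t => ann e N `|t| / t * sin (c * t)).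
Proof.
move=> e0; have i : intg leb (fun t : R => `|c| * (- `|N| <= t <= `|N|)%R%:R).
  by apply: intgZ; exact: intg_chi.
have ma := @measurable_ann R e N; have ms := measurable_sin.
apply: (intg_le _ _ i) => [|t]; first by mfun.
rewrite /ann; case: (boolP (e < `|t| <= N)) => [/andP[h1 h2]|_]; last by rewrite !mul0r normr0 mulr_ge0.
have t0 : 0 < `|t| by exact: lt_trans h1.
rewrite -ler_norml (_ : (`|t| <= _) = true) ?mulr1 ?(le_trans h2)// ?ler_norm//.
rewrite !normrM normr1 mul1r normfV mulrC ler_pdivrMr// -normrM; exact: sin_le.
Qed.

(** The integrand is even in [t], and the substitution [t -> |c| t] moves the frequency into the
    endpoints, leaving only its sign as a factor. *)
Lemma sinTE e N c : 0 < e -> sinT e N c = 2 * Num.sg c * sinJ (`|c| * e) (`|c| * N).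
Proof.
move=> e0; have [->|c0] := eqVneq c 0.
  rewrite sgr0 mulr0 mul0r /sinT (eq_Rint _ (g := fun=> 0)) ?Rintegral_cst ?mul0r// => t.
  by rewrite mul0r sin0 mulr0.
have cp : 0 < `|c| by rewrite normr_gt0.
pose f (t : R) := (e < t <= N)%R%:R * (sin (c * t) / t).
have fE t : ann e N `|t| / t * sin (c * t) = f t + f (- t).
  rewrite /f /ann mulrN sinN invrN mulrNN.
  have [t0|t0] := leP 0 t.
    have F : (e < - t <= N) = false.
      by apply/negbTE/negP => /andP[h _]; have := lt_trans e0 h; lra.
    by rewrite F (ger0_norm t0) mulr0n mul0r addr0 mulrAC -mulrA.
  have F : (e < t <= N) = false.
    by apply/negbTE/negP => /andP[h _]; have := lt_trans e0 h; lra.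
  by rewrite F (ltr0_norm t0) mulr0n mul0r add0r mulrAC -mulrA.
have fs : forall t : R, f t = `|c| * Num.sg c * ((`|c| * e < `|c| * t <= `|c| * N)%R%:R * (sin (`|c| * t) / (`|c| * t))).
  move=> t; rewrite /f ltr_pM2l// ler_pM2l//.
  have -> : sin (`|c| * t) = Num.sg c * sin (c * t).
    by rewrite normrEsg -mulrA sin_sg.
  have s2 : Num.sg c * Num.sg c = 1 by rewrite -expr2 sqr_sg c0.
  rewrite invfM -[LHS]mulr1 -s2 -[LHS]mulr1 -[X in _ * X = _](mulfV (lt0r_neq0 cp)).
  by ring.
have i0 := intg_sinJ (`|c| * e) (`|c| * N).
have i1 := @intg_affine R `|c| 0 _ (lt0r_neq0 cp) i0.
have fi : intg leb f.
  have := intgZ (`|c| * Num.sg c) i1; congr (_.-integrable _ _).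
  by apply/funext => t /=; rewrite fs addr0.
have fE2 : \int[leb]_t f t = Num.sg c * sinJ (`|c| * e) (`|c| * N).
  rewrite /sinJ (@Rint_affine R `|c| 0 _ (lt0r_neq0 cp) i0) (ger0_norm (normr_ge0 c)).
  rewrite mulrA [Num.sg c * _]mulrC -RintZ//; apply: eq_Rint => t.
  by rewrite fs addr0.
have fN : intg leb (fun t => f (- t)).
  have := @intg_affine R (-1) 0 f (ltac:(by rewrite oppr_eq0 oner_neq0)) fi.
  by congr (_.-integrable _ _); apply/funext => t /=; rewrite mulN1r addr0.
have fN2 : \int[leb]_t f (- t) = \int[leb]_t f t.
  rewrite [RHS](@Rint_affine R (-1) 0 f (ltac:(by rewrite oppr_eq0 oner_neq0)) fi).
  rewrite normrN normr1 mul1r; apply: eq_Rint => t; by rewrite mulN1r addr0.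
transitivity (\int[leb]_t (f t + f (- t))); first by apply: eq_Rint => t; rewrite fE.
rewrite RintD// fN2 fE2; ring.
Qed.

Lemma sinT_le e N c : 0 < e -> `|sinT e N c| <= 6.
Proof.
move=> e0; have [Ne|eN] := ltP N e.
  rewrite /sinT (eq_Rint _ (g := fun=> 0)) ?Rintegral_cst ?mul0r ?normr0// => t.
  rewrite /ann; case: (boolP (e < _ <= N)) => [/andP[h1 h2]|_]; last by rewrite !mul0r.
  by have := lt_trans (lt_le_trans h1 h2) Ne; rewrite ltxx.
rewrite sinTE// !normrM normr_sg ger0_norm//.
have h : `|sinJ (`|c| * e) (`|c| * N)| <= 3.
  by apply: sinJ_le; [rewrite mulr_ge0// ltW|rewrite ler_wpM2l].
by case: (c != 0); rewrite ?mulr1 ?mulr0 ?mul0r//; move: h; lra.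
Qed.

(** Serves to replace the radii [e / |z|] and [N / |z|], which depend on the direction, by radii
    that do not. *)
Lemma sinT_cvg (e N e' N' : nat -> R) (c : R) :
  (forall k, 0 < e k) -> (forall k, 0 < e' k) ->
  e @ \oo --> (0 : R) -> e' @ \oo --> (0 : R) ->
  N k @[k --> \oo] --> +oo -> N' k @[k --> \oo] --> +oo ->
  sinT (e k) (N k) c - sinT (e' k) (N' k) c @[k --> \oo] --> (0 : R).
Proof.
move=> e0 e'0 le le' lN lN'; have [->|c0] := eqVneq c 0.
  under eq_fun do rewrite !sinTE// sgr0 mulr0 !mul0r subrr.
  exact: cvg_cst.
have cp : 0 < `|c| by rewrite normr_gt0.
have inv0 (M : nat -> R) : M k @[k --> \oo] --> +oo -> 2 / (`|c| * M k) @[k --> \oo] --> (0 : R).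
  move=> lM; have -> : (0 : R) = (2 / `|c|) * 0 by rewrite mulr0.
  have Mp : \forall k \near \oo, 0 < M k by move/cvgryPgt : lM => /(_ 0).
  have h : (M k)^-1 @[k --> \oo] --> (0 : R) by apply/gtr0_cvgV0.
  have : 2 / `|c| * (M k)^-1 @[k --> \oo] --> 2 / `|c| * 0 by exact: cvgMr.
  apply: cvg_trans; apply: near_eq_cvg; apply: nearW => k.
  by rewrite invfM mulrA.
have ce (d : nat -> R) : d @ \oo --> (0 : R) -> `|c| * d k @[k --> \oo] --> (0 : R).
  by move=> h; rewrite -[X in _ --> X](mulr0 `|c|); exact: cvgMr.
pose u k := 2 * (`| `|c| * e k - `|c| * e' k| + 2 / (`|c| * N k) + 2 / (`|c| * N' k)).
have lu : u @ \oo --> (0 : R).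
  have h := cvgD (cvgD (cvg_norm (cvgB (ce _ le) (ce _ le'))) (inv0 _ lN)) (inv0 _ lN').
  rewrite subrr normr0 !addr0 in h.
  by rewrite -[X in _ --> X](mulr0 2); apply: cvgMr; exact: h.
apply/norm_cvg0P.
apply: (@squeeze_cvgr _ _ _ _ (fun=> 0) u); [|exact: cvg_cst|exact: lu].
have small (d : nat -> R) : d @ \oo --> (0 : R) -> \forall k \near \oo, `|c| * d k <= 1.
  by move=> /ce h; apply: (cvgr_le (0 : R)).
have large (M : nat -> R) : M k @[k --> \oo] --> +oo -> \forall k \near \oo, 1 <= `|c| * M k.
  move=> lM; have : \forall k \near \oo, `|c|^-1 <= M k by move/cvgryPge : lM => /(_ `|c|^-1).
  by apply: filterS => k; rewrite -ler_pdivrMl// mulr1.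
near=> k; rewrite normr_ge0/=.
have h1 : `|c| * e k <= 1 by near: k; exact: small.
have h2 : `|c| * e' k <= 1 by near: k; exact: small.
have h3 : 1 <= `|c| * N k by near: k; exact: large.
have h4 : 1 <= `|c| * N' k by near: k; exact: large.
rewrite !sinTE// -mulrBr normrM normrM normr_sg c0 mulr1 ger0_norm// ler_wpM2l//.
apply: sinJ_diff => //; by rewrite ?h1 ?h2 mulr_ge0// ltW.
Unshelve. all: end_near. Qed.

End sine_integral.

(** * The Fourier transform of the Gaussian *)

Section gaussian_fourier.
Context (R : realType) (n : nat).
Local Notation leb := (@lebesgue_measure R).
Local Notation mu := (lebesgue_rv R n).
Implicit Types (x y z xi : 'rV[R]_n) (j : 'I_n).
Local Notation ee j := (delta_mx 0 j : 'rV[R]_n).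

Lemma dotv_ee j x : dotv (ee j) x = x 0 j.
Proof.
rewrite /dotv (bigD1 j)//= mxE !eqxx mul1r big1 ?addr0// => i ij.
by rewrite mxE eqxx/= (negPf ij) mul0r.
Qed.

Lemma Rint_01_cst (f : R -> R) (c : R) : (forall s, f s = c) ->
  \int[leb]_s ((0 <= s <= 1)%R%:R * f s) = c.
Proof.
move=> h; have i : intg leb (fun s : R => (0 <= s <= 1)%R%:R).
  apply: (intg_le _ _ (@intg_chi R 1 ler01)) => [|s].
    by apply: measurable_natr_bool; apply: measurable_and; [exact: measurable_lec|exact: measurable_gec].
  rewrite normr_nat ler_nat; case: (boolP (0 <= s <= 1)) => // /andP[h1 h2].
  by rewrite h2 andbT (le_trans _ h1)// oppr_le0.
transitivity (\int[leb]_s (c * (0 <= s <= 1)%R%:R)).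
  by apply: eq_Rint => s; rewrite h mulrC.
rewrite RintZ// (_ : \int[leb]_s _ = 1) ?mulr1//.
apply: EFin_inj; rewrite EFin_Rint//.
rewrite (_ : (\int[leb]_s _)%E = leb `[0, 1]); last first.
  rewrite -[in RHS](setIT `[0, 1]%classic) -integral_indic//.
  apply: eq_integral => t _; rewrite indicE; congr (_%:R%:E).
  by congr nat_of_bool; apply/idP/idP; rewrite inE/= in_itv/=.
by rewrite lebesgue_measure_itv/= lte_fin ltr01 -EFinB subr0.
Qed.

(* Integrate [F (x + v) - F x = \int_0^1 dF (x + s v) ds] over x and use translation
   invariance on both sides. *)
Lemma Rint_dir_deriv (F dF : 'rV[R]_n -> R) (v : 'rV[R]_n) : intg mu F -> intg mu dF ->
  (forall x (s : R), is_derive s 1 (fun s : R => F (x + s *: v)) (dF (x + s *: v))) ->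
  (forall x, continuous (fun s : R => dF (x + s *: v))) ->
  \int[mu]_x dF x = 0.
Proof.
move=> iF idF hd hc.
pose chi (s : R) : R := (0 <= s <= 1)%R%:R.
have mdF := intg_measurable idF.
pose H x (s : R) := chi s * dF (x + s *: v).
have mc : measurable_fun setT chi.
  by apply: measurable_natr_bool; apply: measurable_and; [exact: measurable_lec|exact: measurable_gec].
have H2 : intg2 leb mu (fun s x => H x s).
  split; first by rewrite /H; mfun.
  have ic := @intg_chi R 1 ler01.
  have i : intg leb (fun s => (\int[mu]_x `|dF x|) * (- 1 <= s <= 1)%R%:R) by apply: intgZ.
  apply: le_lt_trans (intg_lty i); apply: int_mono => s.
    by apply: integral_ge0 => x _; rewrite lee_fin.
  under eq_integral => x _ do rewrite /H normrM.
  rewrite int_Zl//; last by mfun.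
  rewrite -(@ge0_int_shift_rv R n (s *: v) (fun x => `|dF x|%:E))//; last first.
    by apply/measurable_EFinP; exact: measurableT_comp.
  rewrite -EFin_Rint -?EFinM ?lee_fin; last exact: intg_norm.
  have I0 : 0 <= \int[mu]_x `|dF x| by apply: Rintegral_ge0.
  rewrite normrM (ger0_norm I0) mulrC ler_wpM2l// !normr_nat /chi ler_nat.
  case: (boolP (0 <= s <= 1)) => // /andP[h1 h2].
  by rewrite h2 andbT (le_trans _ h1)// oppr_le0.
have E1 x : \int[leb]_s H x s = F (x + v) - F x.
  rewrite /H (@Rint_natr_bool R _ _ leb (fun s : R => 0 <= s <= 1)).
  rewrite (_ : [set s | _] = `[0, 1]%classic); last first.
    by apply/seteqP; split => t /=; rewrite in_itv.
  rewrite (@ftcR R (fun s => F (x + s *: v)) (fun s => dF (x + s *: v)) 0 1 ler01).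
  - by rewrite scale1r scale0r addr0.
  - by move=> s _; exact: hc.
have := Rint_fubini H2.
transitivity (\int[leb]_s (chi s * \int[mu]_x dF x)).
  by apply/esym; exact: (@Rint_01_cst (fun=> \int[mu]_x dF x)).
transitivity (\int[leb]_s (\int[mu]_x H x s)).
  apply: eq_Rint => s; rewrite (Rint_shift_rv (s *: v) idF) -RintZ//.
  exact: intg_shift_rv.
rewrite Rint_fubini//.
under [LHS]eq_Rint do rewrite E1.
by rewrite RintB// -?Rint_shift_rv ?subrr//; exact: intg_shift_rv.
Qed.

Lemma is_derive_gs_line x v (s : R) :
  is_derive s 1 (fun s : R => gs (x + s *: v)) (- (2 * pi * dotv (x + s *: v) v) * gs (x + s *: v)).
Proof.
have e (s' : R) : dotv (x + s' *: v) (x + s' *: v) = dotv x x + 2 * dotv x v * s' + dotv v v * s' ^+ 2.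
  by rewrite dotvDl !dotvZl ![dotv _ (x + _)]dotvC !dotvDl !dotvZl [dotv v x]dotvC; ring.
have -> : (fun s : R => gs (x + s *: v)) = expR \o (fun s : R =>
    - (pi * (dotv x x + 2 * dotv x v * s + dotv v v * s ^+ 2))).
  by apply/funext => s' /=; rewrite /gs e.
rewrite /gs e.
have d1 : is_derive s 1 (fun s : R => - (pi * (dotv x x + 2 * dotv x v * s + dotv v v * s ^+ 2)))
    (- (2 * pi * dotv (x + s *: v) v)).
  apply: is_derive_eq; rewrite /GRing.scale/= ?mulr1 ?mulr0 ?addr0 ?add0r dotvDl dotvZl; ring.
apply: (@is_derive_eq _ _ _ _ _ _ _ _ (is_derive1_comp (is_derive_expR _) d1)).
by rewrite mulrC.
Qed.

Lemma is_derive_sin_line x v xi (s : R) :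
  is_derive s 1 (fun s : R => sin (2 * pi * dotv (x + s *: v) xi))
    (2 * pi * dotv v xi * cos (2 * pi * dotv (x + s *: v) xi)).
Proof.
have e (s' : R) : 2 * pi * dotv (x + s' *: v) xi = 2 * pi * dotv x xi + 2 * pi * dotv v xi * s'.
  by rewrite dotvDl dotvZl; ring.
have -> : (fun s : R => sin (2 * pi * dotv (x + s *: v) xi)) =
    sin \o (fun s : R => 2 * pi * dotv x xi + 2 * pi * dotv v xi * s).
  by apply/funext => s' /=; rewrite e.
rewrite e.
have d1 : is_derive s 1 (fun s : R => 2 * pi * dotv x xi + 2 * pi * dotv v xi * s) (2 * pi * dotv v xi).
  by apply: is_derive_eq; rewrite /GRing.scale/=; ring.
apply: (@is_derive_eq _ _ _ _ _ _ _ _ (is_derive1_comp (is_derive_sin _) d1)).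
by rewrite mulrC.
Qed.

Lemma is_derive_cos_line x v xi (s : R) :
  is_derive s 1 (fun s : R => cos (2 * pi * dotv (x + s *: v) xi))
    (- (2 * pi * dotv v xi * sin (2 * pi * dotv (x + s *: v) xi))).
Proof.
have e (s' : R) : 2 * pi * dotv (x + s' *: v) xi = 2 * pi * dotv x xi + 2 * pi * dotv v xi * s'.
  by rewrite dotvDl dotvZl; ring.
have -> : (fun s : R => cos (2 * pi * dotv (x + s *: v) xi)) =
    cos \o (fun s : R => 2 * pi * dotv x xi + 2 * pi * dotv v xi * s).
  by apply/funext => s' /=; rewrite e.
rewrite e.
have d1 : is_derive s 1 (fun s : R => 2 * pi * dotv x xi + 2 * pi * dotv v xi * s) (2 * pi * dotv v xi).
  by apply: is_derive_eq; rewrite /GRing.scale/=; ring.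
apply: (@is_derive_eq _ _ _ _ _ _ _ _ (is_derive1_comp (is_derive_cos _) d1)).
by rewrite mulrC mulrN.
Qed.

Lemma measurable_csin xi : measurable_fun setT (fun z => sin (2 * pi * dotv z xi)) /\
  measurable_fun setT (fun z => cos (2 * pi * dotv z xi)).
Proof.
have ms := @measurable_sin R; have mc := @measurable_cos R.
by split; mfun.
Qed.

Lemma intg_trig (g : 'rV[R]_n -> R) xi : intg mu g ->
  intg mu (fun z => g z * sin (2 * pi * dotv z xi)) /\
  intg mu (fun z => g z * cos (2 * pi * dotv z xi)).
Proof.
move=> gi; have [m1 m2] := measurable_csin xi; have mg := intg_measurable gi.
by split; apply: (intg_le _ _ (intg_norm gi)); [exact: measurable_funM| |exact: measurable_funM|];
  move=> z; rewrite normrM -[leRHS]mulr1 ler_wpM2l// ?sin_max ?cos_max.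
Qed.

(** The derivative of [gs z sin (2 pi z.xi)] in direction [j] has integral 0. *)
Lemma gs_sin_coord j xi :
  \int[mu]_z (z 0 j * gs z * sin (2 * pi * dotv z xi)) =
  xi 0 j * \int[mu]_z (gs z * cos (2 * pi * dotv z xi)).
Proof.
have [_ i1] := intg_trig xi (@intg_gs R n).
have [i2 _] := intg_trig xi (@intg_coord_gs R n j).
have [i3 _] := intg_trig xi (@intg_gs R n).
pose dF z := (2 * pi * xi 0 j) * (gs z * cos (2 * pi * dotv z xi)) -
  2 * pi * (z 0 j * gs z * sin (2 * pi * dotv z xi)).
have idF : intg mu dF by apply: intgB; exact: intgZ.
have h : \int[mu]_z dF z = 0.
  apply: (@Rint_dir_deriv (fun z => gs z * sin (2 * pi * dotv z xi)) dF (ee j)) => //.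
  - move=> x s; have d := is_deriveM (is_derive_gs_line x (ee j) s) (is_derive_sin_line x (ee j) xi s).
    apply: (@is_derive_eq _ _ _ _ _ _ _ _ d).
    rewrite /dF /GRing.scale/= dotv_ee [dotv _ (ee j)]dotvC dotv_ee; ring.
  - move=> x s; rewrite /dF.
    have cg : {for s, continuous (fun s : R => gs (x + s *: ee j))}.
      exact: is_derive_cont (is_derive_gs_line x (ee j) s).
    have cs := is_derive_cont (is_derive_sin_line x (ee j) xi s).
    have cc := is_derive_cont (is_derive_cos_line x (ee j) xi s).
    have cz : {for s, continuous (fun s : R => (x + s *: ee j) 0 j)}.
      have -> : (fun s : R => (x + s *: ee j) 0 j) = fun s => x 0 j + s.
        by apply/funext => s'; rewrite !mxE !eqxx mulr1.
      by apply: cvgD; [exact: cvg_cst|exact: cvg_id].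
    apply: cvgB; apply: cvgM; try exact: cvg_cst; apply: cvgM => //.
    exact: cvgM.
move: h; rewrite RintB ?RintZ; [|exact: i2|exact: i1|exact: intgZ|exact: intgZ].
move/eqP; rewrite subr_eq0 -mulrA => /eqP/mulfI ->//.
by rewrite mulf_neq0// gt_eqF// pi_gt0.
Qed.

(** As a function of the dilation [t], the transform [G] solves [G' = - 2 pi t |xi|^2 G], obtained
    by differentiating under the integral and applying [gs_sin_coord]. Its product with the inverse
    exponential is therefore constant, equal to 1 at [t = 0]. *)
Lemma gs_fourier (t : R) xi :
  \int[mu]_z (gs z * cos (2 * pi * (t * dotv z xi))) = expR (- (pi * t ^+ 2 * dotv xi xi)).
Proof.
pose G (t : R) := \int[mu]_z (gs z * cos (2 * pi * dotv z (t *: xi))).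
have GE s : G s = \int[mu]_z (gs z * cos (2 * pi * (s * dotv z xi))).
  by apply: eq_Rint => z; rewrite dotvZr.
rewrite -GE.
have dG (s : R) : is_derive s 1 G (- (2 * pi * s * dotv xi xi) * G s).
  (* The derivative in [t] grows linearly in [z]. Taking the wider Gaussian as weight leaves the
     quotient [gs z / w z] to absorb that growth, so the derivative of [phi] is uniformly
     bounded. *)
  pose w z : R := 2 * gs (2^-1 *: z).
  have iw : intg mu w by apply: intgZ; apply: intg_gsZ; rewrite invr_eq0.
  have w0 z : 0 < w z by rewrite mulr_gt0// gs_gt0.
  pose phi (s : R) z := gs z / w z * cos (2 * pi * dotv z (s *: xi)).
  pose dphi (s : R) z := gs z / w z * (- (2 * pi * dotv z xi * sin (2 * pi * dotv z (s *: xi)))).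
  have gw z : (1 + enorm z) * (gs z / w z) <= 1.
    by rewrite mulrA ler_pdivrMr// mul1r enorm_gs_le.
  have wE z (c : R) : gs z / w z * c * w z = gs z * c.
    by rewrite -mulrA [c * _]mulrC mulrA divfK// gt_eqF.
  have -> : G = fun s => \int[mu]_z (phi s z * w z).
    apply/funext => s'; by apply: eq_Rint => z; rewrite /phi wE.
  have -> : - (2 * pi * s * dotv xi xi) * (\int[mu]_z (phi s z * w z)) = \int[mu]_z (dphi s z * w z).
    transitivity (\int[mu]_z (\sum_j (- (2 * pi * xi 0 j)) * (z 0 j * gs z * sin (2 * pi * dotv z (s *: xi))))).
      rewrite Rint_sum; last first.
        by move=> j; apply: intgZ; have [] := intg_trig (s *: xi) (@intg_coord_gs R n j).
      have -> : \int[mu]_z (phi s z * w z) = \int[mu]_z (gs z * cos (2 * pi * dotv z (s *: xi))).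
        by apply: eq_Rint => z; rewrite /phi wE.
      rewrite /dotv mulr_sumr -sumrN mulr_suml; apply: eq_bigr => j _.
      rewrite RintZ; last by have [] := intg_trig (s *: xi) (@intg_coord_gs R n j).
      rewrite gs_sin_coord mxE -/(dotv _ _); ring.
    apply: eq_Rint => z; rewrite /dphi wE.
    set S := sin _.
    transitivity (\sum_j (z 0 j * xi 0 j) * (- (2 * pi) * gs z * S)).
      by apply: eq_bigr => j _; ring.
    by rewrite -mulr_suml -/(dotv z xi); ring.
  apply: (@Rint_deriv _ _ R mu phi dphi w s 1 (2 * pi * (n%:R * enorm xi))).
  - exact: ltr01.
  - exact: iw.
  - move=> r z _.
    have e : phi ^~ z = (fun r => gs z / w z * cos (2 * pi * dotv (0 + r *: xi) z)).
      by apply/funext => r'; rewrite /phi add0r dotvC.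
    rewrite e; have d := is_deriveM (is_derive_cst (gs z / w z) r 1) (is_derive_cos_line 0 xi z r).
    apply: (@is_derive_eq _ _ _ _ _ _ _ _ d).
    by rewrite /dphi /GRing.scale/= mulr0 addr0 add0r [dotv z (r *: xi)]dotvC [dotv z xi]dotvC.
  - move=> r z _; have q0 : 0 <= gs z / w z by rewrite divr_ge0 ?gs_ge0// ltW.
    rewrite /dphi normrM (ger0_norm q0) normrN normrM.
    have p0 := pi_ge0 R; have p20 : 0 <= 2 * pi :> R by rewrite mulr_ge0.
    rewrite [`|2 * pi * _|]normrM (ger0_norm p20).
    have z0 := enorm_ge0 z; have x0 := enorm_ge0 xi.
    have h1 : gs z / w z * enorm z <= 1.
      by apply: le_trans (gw z); rewrite mulrC ler_wpM2r// lerDr.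
    apply: (@le_trans _ _ (gs z / w z * (2 * pi * (n%:R * (enorm z * enorm xi)) * 1))).
      apply: ler_wpM2l => //; apply: ler_pM; rewrite ?mulr_ge0 ?sin_max//.
      by apply: ler_wpM2l; rewrite ?mulr_ge0// dotv_le.
    have -> : gs z / w z * (2 * pi * (n%:R * (enorm z * enorm xi)) * 1) =
      (2 * pi * (n%:R * enorm xi)) * (gs z / w z * enorm z) by ring.
    by rewrite -[leRHS]mulr1 ler_wpM2l// !mulr_ge0.
  - move=> r _; have [_ i] := intg_trig (r *: xi) (@intg_gs R n).
    by move: i; congr (_.-integrable _ _); apply/funext => z /=; rewrite /phi wE.
pose E (t : R) := expR (pi * t ^+ 2 * dotv xi xi).
have dE (s : R) : is_derive s 1 E ((2 * pi * s * dotv xi xi) * E s).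
  have d1 : is_derive s 1 (fun t : R => pi * t ^+ 2 * dotv xi xi) (2 * pi * s * dotv xi xi).
    by apply: is_derive_eq; rewrite /GRing.scale/= ?mulr1 ?mulr0 ?addr0 ?add0r; ring.
  apply: (@is_derive_eq _ _ _ _ _ _ _ _ (is_derive1_comp (is_derive_expR _) d1)).
  by rewrite mulrC.
have h : G t * E t = G 0 * E 0.
  apply: (@is_derive_0_is_cst R (fun s => G s * E s)) => s.
  apply: (@is_derive_eq _ _ _ _ _ _ _ _ (is_deriveM (dG s) (dE s))).
  by rewrite /GRing.scale/=; ring.
have G0 : G 0 = 1.
  rewrite -(@Rint_gs R n); apply: eq_Rint => z.
  by rewrite dotvZr mul0r mulr0 cos0 mulr1.
have E0 : E 0 = 1 by rewrite /E expr0n/= mulr0 mul0r expR0.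
rewrite expRN -/(E t) -[LHS]mulr1 -(mulfV (lt0r_neq0 (expR_gt0 (pi * t ^+ 2 * dotv xi xi)))).
by rewrite -/(E t) mulrA h G0 E0 mulr1 mul1r.
Qed.

Lemma gs_sin_fourier j (t : R) xi :
  \int[mu]_z (z 0 j * gs z * sin (2 * pi * (t * dotv z xi))) =
  t * xi 0 j * expR (- (pi * t ^+ 2 * dotv xi xi)).
Proof.
rewrite -gs_fourier.
transitivity (\int[mu]_z (z 0 j * gs z * sin (2 * pi * dotv z (t *: xi)))).
  by apply: eq_Rint => z; rewrite dotvZr.
by rewrite gs_sin_coord mxE; congr (_ * _); apply: eq_Rint => z; rewrite dotvZr.
Qed.

End gaussian_fourier.

(** * The Fourier symbol of the truncated Riesz kernels *)

Section riesz_fourier.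
Context (R : realType) (n : nat).
Local Notation leb := (@lebesgue_measure R).
Local Notation mu := (lebesgue_rv R n).
Implicit Types (f : 'rV[R]_n -> R) (x y z u xi : 'rV[R]_n) (j : 'I_n) (e N p : R).

Let ms := @measurable_sin R.
Let mc := @measurable_cos R.

Definition rsym j e N xi : R :=
  \int[mu]_u (ann e N (enorm u) * rk j u * sin (2 * pi * dotv u xi)).

(** The rotation formula at the origin for the bounded function [y -> sin (- 2 pi y.xi)]. *)
Lemma rsymE j e N xi : 0 < e -> rsym j e N xi =
  \int[mu]_z (z 0 j * gs z * sinT (e / enorm z) (N / enorm z) (2 * pi * dotv z xi)).
Proof.
move=> e0; pose f y := sin (2 * pi * dotv (- y) xi).
have mf : measurable_fun setT f.
  by rewrite /f; mfun; apply: measurable_rvN.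
have fB y : `|f y| <= 1 by exact: sin_max.
transitivity (tr j e N f 0).
  by apply: eq_Rint => u; rewrite /f sub0r opprK.
rewrite (rotation j N 0 e0 mf fB); apply: eq_Rint => z.
have [->|z0] := eqVneq z 0; first by rewrite mxE !mul0r.
have zp : 0 < enorm z by rewrite enorm_gt0.
congr (_ * _); apply: eq_Rint => t; rewrite /f sub0r opprK dotvZl.
rewrite /ann ltr_pdivrMr// ler_pdivlMr//; congr (_ * sin _); ring.
Qed.

Lemma measurable_rsym j e N : measurable_fun setT (rsym j e N).
Proof.
have ma := @measurable_ann R e N; have mr := @measurable_rk R n j.
apply: (@measurable_Rint_l _ _ _ _ R mu (fun xi u =>
  ann e N (enorm u) * rk j u * sin (2 * pi * dotv u xi))).
by mfun.
Qed.

Lemma measurable_sinT (c : 'rV[R]_n -> R) (a b : 'rV[R]_n -> R) :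
  measurable_fun setT c -> measurable_fun setT a -> measurable_fun setT b ->
  measurable_fun setT (fun z => sinT (a z) (b z) (c z)).
Proof.
move=> mc' ma mb.
apply: (@measurable_Rint_l _ _ _ _ R leb (fun z (t : R) =>
  ann (a z) (b z) `|t| / t * sin (c z * t))).
by rewrite /ann; mfun.
Qed.

Definition W1 j : R := \int[mu]_z `|z 0 j * gs z|.

Lemma intg_sinT_gs j (a b c : 'rV[R]_n -> R) :
  measurable_fun setT c -> measurable_fun setT a -> measurable_fun setT b ->
  (forall z, z != 0 -> 0 < a z) ->
  intg mu (fun z => z 0 j * gs z * sinT (a z) (b z) (c z)).
Proof.
move=> mc' ma mb a0; have mS := measurable_sinT mc' ma mb.
apply: (intg_le _ _ (intgZ 6 (intg_norm (@intg_coord_gs R n j)))) => [|z].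
  apply: measurable_funM mS; exact: intg_measurable (@intg_coord_gs R n j).
have [->|z0] := eqVneq z 0; first by rewrite mxE !mul0r normr0 mulr0.
by rewrite normrM mulrC ler_wpM2r// sinT_le// a0.
Qed.

Let mdiv e : measurable_fun setT (fun z : 'rV[R]_n => e / enorm z).
Proof. by mfun. Qed.

Let mdot xi : measurable_fun setT (fun z => 2 * pi * dotv z xi).
Proof. by mfun. Qed.

Lemma rsym_le j e N xi : 0 < e -> `|rsym j e N xi| <= 6 * W1 j.
Proof.
move=> e0; rewrite rsymE//.
have i : intg mu (fun z => z 0 j * gs z * sinT (e / enorm z) (N / enorm z) (2 * pi * dotv z xi)).
  by apply: intg_sinT_gs => // z z0; rewrite divr_gt0// enorm_gt0.
apply: le_trans (le_normr_Rint i) _; rewrite /W1 -RintZ; last first.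
  exact: intg_norm (@intg_coord_gs R n j).
apply: le_Rint.
- exact: intg_norm.
- by apply: intgZ; exact: intg_norm (@intg_coord_gs R n j).
- move=> z; have [->|z0] := eqVneq z 0; first by rewrite mxE !mul0r normr0 mulr0.
  by rewrite normrM mulrC ler_wpM2r// sinT_le// divr_gt0// enorm_gt0.
Qed.

Lemma cvg_invS : ((k.+1%:R : R)^-1) @[k --> \oo] --> (0 : R).
Proof. exact: cvg_harmonic. Qed.

Lemma cvg_natS : (k.+1%:R : R) @[k --> \oo] --> +oo.
Proof.
apply/cvgryPge => A; near=> k; apply: (@le_trans _ _ k%:R); last by rewrite ler_nat.
by near: k; exact: nbhs_infty_ger.
Unshelve. all: end_near. Qed.

Lemma Rint_gauss1 xi : xi != 0 ->
  intg leb (fun t : R => expR (- (pi * t ^+ 2 * dotv xi xi))) /\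
  \int[leb]_t expR (- (pi * t ^+ 2 * dotv xi xi)) = (enorm xi)^-1.
Proof.
move=> x0; have xp : 0 < enorm xi by rewrite enorm_gt0.
have i1 : intg leb (fun t : R => expR (- (pi * t ^+ 2))).
  apply: intgP; first exact: measurable_gauss1.
  under eq_integral do rewrite ger0_norm ?expR_ge0//.
  by rewrite int_gauss1 ltry.
have I1 : \int[leb]_t expR (- (pi * t ^+ 2)) = 1.
  by apply: EFin_inj; rewrite EFin_Rint// int_gauss1.
have e (t : R) : expR (- (pi * t ^+ 2 * dotv xi xi)) = expR (- (pi * (enorm xi * t + 0) ^+ 2)).
  by rewrite -enorm2 addr0; congr expR; ring.
split.
  have := @intg_affine R (enorm xi) 0 _ (lt0r_neq0 xp) i1.
  by congr (_.-integrable _ _); apply/funext => t /=; rewrite e.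
apply: (mulfI (lt0r_neq0 xp)); rewrite mulfV ?gt_eqF// -I1.
rewrite [RHS](@Rint_affine R (enorm xi) 0 _ (lt0r_neq0 xp) i1) (gtr0_norm xp).
by congr (_ * _); apply: eq_Rint => t; rewrite e.
Qed.

(** With radii independent of [z] the integrals can be exchanged. The Gaussian integral in [z]
    equals [t xi_j exp (- pi t^2 |xi|^2)], and its factor [t] cancels the singularity of the kernel;
    what remains tends to a Gaussian integral with value [xi_j / |xi|]. *)
Lemma rsym_unscaled j (k : nat) xi :
  \int[mu]_z (z 0 j * gs z * sinT k.+1%:R^-1 k.+1%:R (2 * pi * dotv z xi)) =
  \int[leb]_t (ann k.+1%:R^-1 k.+1%:R `|t| * (xi 0 j * expR (- (pi * t ^+ 2 * dotv xi xi)))).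
Proof.
set e : R := k.+1%:R^-1; set N : R := k.+1%:R.
have e0 : 0 < e by rewrite invr_gt0.
have N0 : 0 <= N by [].
have ma := @measurable_ann R e N.
pose H z (t : R) := z 0 j * gs z * (ann e N `|t| / t * sin (2 * pi * dotv z xi * t)).
have ib : intg leb (fun t => e^-1 * (- N <= t <= N)%R%:R) by apply: intgZ; exact: intg_chi.
have bb (t : R) : `|ann e N `|t| / t| <= e^-1 * (- N <= t <= N)%R%:R.
  rewrite /ann; case: (boolP (e < `|t| <= N)) => [/andP[h1 h2]|_]; last first.
    by rewrite mul0r normr0 mulr_ge0// invr_ge0 ltW.
  rewrite -ler_norml h2 mulr1 mul1r normfV lef_pV2 ?posrE ?(ltW h1)//.
  exact: lt_trans h1.
have H2 : intg2 mu leb H.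
  apply: (intg2_prod _ (intg_norm (@intg_coord_gs R n j)) ib).
    by rewrite /H; mfun.
  move=> z t; rewrite /H normrM ler_wpM2l// normrM -[leRHS]mulr1.
  by apply: ler_pM => //; exact: sin_max.
transitivity (\int[mu]_z (\int[leb]_t H z t)).
  by apply: eq_Rint => z; rewrite /H RintZ//; exact: intg_sinT.
rewrite Rint_fubini//; apply: eq_Rint => t.
transitivity (\int[mu]_z (ann e N `|t| / t * (z 0 j * gs z * sin (2 * pi * dotv z (t *: xi))))).
  apply: eq_Rint => z; rewrite /H dotvZr.
  have -> : 2 * pi * dotv z xi * t = 2 * pi * (t * dotv z xi) by ring.
  ring.
rewrite RintZ; last by have [] := intg_trig (t *: xi) (@intg_coord_gs R n j).
have -> : \int[mu]_z (z 0 j * gs z * sin (2 * pi * dotv z (t *: xi))) =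
    t * xi 0 j * expR (- (pi * t ^+ 2 * dotv xi xi)).
  by rewrite -gs_sin_fourier; apply: eq_Rint => z; rewrite dotvZr.
have [->|t0] := eqVneq t 0; last by field.
rewrite normr0 /ann (_ : e < 0 = false) ?mul0r//.
by apply/negbTE; rewrite -leNgt ltW.
Qed.

Lemma rsym_unscaled_cvg j xi :
  \int[mu]_z (z 0 j * gs z * sinT k.+1%:R^-1 k.+1%:R (2 * pi * dotv z xi)) @[k --> \oo]
    --> xi 0 j / enorm xi.
Proof.
under eq_fun do rewrite rsym_unscaled.
have [->|x0] := eqVneq xi 0.
  rewrite mxE mul0r; under eq_fun => k.
    rewrite (eq_Rint _ (g := fun=> 0)); last by move=> t; rewrite mul0r mulr0.
    rewrite Rintegral_cst// mul0r; over.
  exact: cvg_cst.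
have [i I] := Rint_gauss1 x0.
rewrite -I -RintZ//.
have ma k := @measurable_ann R k.+1%:R^-1 k.+1%:R.
have mg := intg_measurable i.
have [||| _ l] := @Rint_dct _ _ R leb (fun (k : nat) t => ann k.+1%:R^-1 k.+1%:R `|t| * (xi 0 j * expR (- (pi * t ^+ 2 * dotv xi xi))))
    (fun t => (t != 0)%:R * (xi 0 j * expR (- (pi * t ^+ 2 * dotv xi xi)))) _ _ _ (intg_norm (intgZ (xi 0 j) i)).
- by move=> k; have mak := ma k; mfun.
- move=> t; apply: cvg_near_cst; have [->|t0] := eqVneq t 0.
    apply: nearW => k; rewrite normr0 /ann (_ : _ < 0 = false)//.
    by apply/negbTE; rewrite -leNgt invr_ge0.
  have tp : 0 < `|t| by rewrite normr_gt0.
  have [k0 _ hk0] := near_infty_natSinv_lt (PosNum tp).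
  near=> k; rewrite /ann.
  have h1 : k.+1%:R^-1 < `|t| by near: k; exists k0 => // k; exact: hk0.
  have h2 : `|t| <= k.+1%:R.
    apply: (@le_trans _ _ k%:R); last by rewrite ler_nat.
    by near: k; exact: nbhs_infty_ger.
  by rewrite h1 h2.
- move=> k t; rewrite normrM normr_nat -[leRHS]mul1r ler_wpM2r//.
  by rewrite lern1 leq_b1.
move: l; rewrite (_ : \int[leb]_t ((t != 0)%:R * _) = \int[leb]_t (xi 0 j * expR (- (pi * t ^+ 2 * dotv xi xi))))//.
rewrite /Rintegral; congr fine; apply: ae_eq_integral => //.
- apply/measurable_EFinP; apply: measurable_funM; last exact: measurable_funM.
  by apply: measurable_natr_bool; apply: measurable_neg; apply: measurable_fun_eqr.
- by apply/measurable_EFinP; exact: measurable_funM.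
- exists [set 0]; split; [exact: measurable_set1|exact: lebesgue_measure_set1|].
  move=> t /= h; apply: contrapT => t0; apply: h => _.
  have -> : (t != 0) = true by apply/eqP.
  by rewrite mul1r.
Unshelve. all: end_near. Qed.

(** The difference from the unscaled average tends to 0 pointwise by [sinT_cvg], under the
    domination [12 |z_j gs z|] given by twice the bound 6 of [sinT_le]. *)
Lemma rsym_cvg j xi (e N : nat -> R) : (forall k, 0 < e k) -> e @ \oo --> (0 : R) ->
  N k @[k --> \oo] --> +oo -> rsym j (e k) (N k) xi @[k --> \oo] --> xi 0 j / enorm xi.
Proof.
move=> e0 le lN.
have inv0 (k : nat) : 0 < k.+1%:R^-1 :> R by rewrite invr_gt0.
pose D (k : nat) z := z 0 j * gs z * sinT (e k / enorm z) (N k / enorm z) (2 * pi * dotv z xi) -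
  z 0 j * gs z * sinT k.+1%:R^-1 k.+1%:R (2 * pi * dotv z xi).
have i1 k : intg mu (fun z => z 0 j * gs z * sinT (e k / enorm z) (N k / enorm z) (2 * pi * dotv z xi)).
  by apply: intg_sinT_gs => // z z0; rewrite divr_gt0// enorm_gt0.
have i2 (k : nat) : intg mu (fun z => z 0 j * gs z * sinT k.+1%:R^-1 k.+1%:R (2 * pi * dotv z xi)).
  by apply: intg_sinT_gs => //; exact: measurable_cst.
have ig := intg_norm (@intg_coord_gs R n j).
have [||| _ l] := @Rint_dct _ _ R mu D (fun=> 0) _ _ _ (intgZ 12 ig).
- by move=> k; apply: intg_measurable; exact: intgB.
- move=> z; have [->|z0] := eqVneq z 0.
    by under eq_fun do rewrite /D mxE !mul0r subrr; exact: cvg_cst.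
  have zp : 0 < enorm z by rewrite enorm_gt0.
  rewrite -(mulr0 (z 0 j * gs z)).
  under eq_fun do rewrite /D -mulrBr.
  apply: cvgMr; apply: sinT_cvg.
  + by move=> k; rewrite divr_gt0.
  + exact: inv0.
  + by rewrite -(mul0r (enorm z)^-1); apply: cvgMl.
  + exact: cvg_invS.
  + apply/cvgryPge => A; move/cvgryPge : lN => /(_ (A * enorm z)); apply: filterS => k.
    by rewrite ler_pdivlMr.
  + exact: cvg_natS.
- move=> k z; have [->|z0] := eqVneq z 0.
    by rewrite /D mxE !mul0r subrr normr0 mulr0.
  rewrite /D -mulrBr normrM mulrC ler_wpM2r//; apply: le_trans (ler_normB _ _) _.
  have -> : 12 = 6 + 6 :> R by ring.
  by apply: lerD; apply: sinT_le => //; rewrite divr_gt0// enorm_gt0.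
rewrite Rintegral_cst// mul0r in l.
rewrite -[X in _ --> X]addr0.
have -> : (fun k => rsym j (e k) (N k) xi) = (fun k : nat =>
    \int[mu]_z (z 0 j * gs z * sinT k.+1%:R^-1 k.+1%:R (2 * pi * dotv z xi)) + \int[mu]_z D k z).
  by apply/funext => k; rewrite /D RintB// rsymE// addrC subrK.
by apply: cvgD; [exact: rsym_unscaled_cvg|exact: l].
Qed.

(** For real [a] and [b], the real part of the inverse Fourier integral of [a - i b]. With
    [a = fcos f] and [b = fsin f] it is the inversion formula for a real function [f]. *)
Definition trigI (a b : 'rV[R]_n -> R) x : R :=
  \int[mu]_xi (a xi * cos (2 * pi * dotv x xi) + b xi * sin (2 * pi * dotv x xi)).

Section trig.
Variables (a b : 'rV[R]_n -> R).
Hypotheses (ia : intg mu a) (ib : intg mu b).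

Let ma := intg_measurable ia.
Let mb := intg_measurable ib.

Lemma intg_trigI x :
  intg mu (fun xi => a xi * cos (2 * pi * dotv x xi) + b xi * sin (2 * pi * dotv x xi)).
Proof.
have [_ i1] := intg_trig x ia; have [i2 _] := intg_trig x ib.
have := intgD i1 i2; congr (_.-integrable _ _); apply/funext => xi /=.
by rewrite [dotv xi x]dotvC.
Qed.

Lemma intg_trigI' x :
  intg mu (fun xi => a xi * sin (2 * pi * dotv x xi) - b xi * cos (2 * pi * dotv x xi)).
Proof.
have [i1 _] := intg_trig x ia; have [_ i2] := intg_trig x ib.
have := intgB i1 i2; congr (_.-integrable _ _); apply/funext => xi /=.
by rewrite [dotv xi x]dotvC.
Qed.

Lemma rk_odd j u : rk j (- u) = - rk j u.
Proof. by rewrite /rk enormN mxE; ring. Qed.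

Lemma intg_ann_rk j e N : 0 < e -> intg mu (fun u => ann e N (enorm u) * rk j u).
Proof.
move=> e0; have := @intg_tr R n j e N (fun=> 1) 1 0 e0 (measurable_cst _) (fun _ => ltac:(by rewrite normr1)).
by congr (_.-integrable _ _); apply/funext => u /=; rewrite mulr1.
Qed.

Lemma rcos0 j e N xi : 0 < e ->
  \int[mu]_u (ann e N (enorm u) * rk j u * cos (2 * pi * dotv u xi)) = 0.
Proof.
move=> e0; have [_ i] := intg_trig xi (intg_ann_rk j N e0).
set I := LHS; have h : I = - I.
  rewrite {1}/I (Rint_refl_rv 0 i) -mulN1r -RintZ//; apply: eq_Rint => u.
  have -> : 2 * pi * dotv (0 - u) xi = - (2 * pi * dotv u xi) by rewrite sub0r dotvNl; ring.
  by rewrite sub0r enormN rk_odd cosN; ring.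
by move/eqP: h; rewrite -addr_eq0 -mulr2n mulrn_eq0/= => /eqP.
Qed.

(** Expanding the angle difference, the cosine transform of the odd kernel vanishes and only [rsym]
    remains. *)
Lemma tr_trigI j e N x : 0 < e -> tr j e N (trigI a b) x =
  \int[mu]_xi ((a xi * sin (2 * pi * dotv x xi) - b xi * cos (2 * pi * dotv x xi)) * rsym j e N xi).
Proof.
move=> e0; have ik := intg_ann_rk j N e0.
have mk := intg_measurable ik.
pose H u xi := ann e N (enorm u) * rk j u *
  (a xi * cos (2 * pi * dotv (x - u) xi) + b xi * sin (2 * pi * dotv (x - u) xi)).
have H2 : intg2 mu mu H.
  apply: (intg2_prod _ (intg_norm ik) (intgD (intg_norm ia) (intg_norm ib))).
    rewrite /H; have mk' : measurable_fun setT (fun z : 'rV[R]_n * 'rV[R]_n => ann e N (enorm z.1) * rk j z.1).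
      exact: measurableT_comp mk measurable_fst.
    by apply: measurable_funM => //; mfun.
  move=> u xi; rewrite /H normrM ler_wpM2l//; apply: le_trans (ler_normD _ _) _.
  by apply: lerD; rewrite normrM -[leRHS]mulr1 ler_wpM2l// ?sin_max ?cos_max.
transitivity (\int[mu]_u (\int[mu]_xi H u xi)).
  by apply: eq_Rint => u; rewrite /H RintZ//; exact: intg_trigI.
rewrite Rint_fubini//; apply: eq_Rint => xi.
set A := a xi * cos (2 * pi * dotv x xi) + b xi * sin (2 * pi * dotv x xi).
set B := a xi * sin (2 * pi * dotv x xi) - b xi * cos (2 * pi * dotv x xi).
have [i1 i2] := intg_trig xi ik.
transitivity (\int[mu]_u (A * (ann e N (enorm u) * rk j u * cos (2 * pi * dotv u xi)) +
    B * (ann e N (enorm u) * rk j u * sin (2 * pi * dotv u xi)))).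
  by apply: eq_Rint => u; rewrite /H dotvBl mulrBr cosB sinB /A /B; ring.
by rewrite RintD ?RintZ// ?rcos0// ?mulr0 ?add0r//; exact: intgZ.
Qed.

Lemma tr_te p j e f x : 1 < p -> (0 < n)%N -> 0 < e -> Lpf p f ->
  tr j e k.+1%:R f x @[k --> \oo] --> te j e f x.
Proof.
move=> p1 n0 e0 fLp; have i := intg_te p1 n0 j x e0 fLp; have [mf _] := fLp.
have mr := @measurable_rk R n j.
have [||| _ l] := @Rint_dct _ _ R mu (fun (k : nat) u => ann e k.+1%:R (enorm u) * rk j u * f (x - u))
    (fun u => (e < enorm u)%R%:R * rk j u * f (x - u)) _ _ _ (intg_norm i).
- by move=> k; have mak := @measurable_ann R e k.+1%:R; mfun.
- move=> u; apply: cvg_near_cst; near=> k; rewrite /ann.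
  have h2 : enorm u <= k.+1%:R.
    apply: (@le_trans _ _ k%:R); last by rewrite ler_nat.
    by near: k; exact: nbhs_infty_ger.
  by rewrite h2 andbT.
- move=> k u; rewrite !normrM; apply: ler_wpM2r => //; apply: ler_wpM2r => //.
  rewrite !ger0_norm ?ann_ge0// /ann ler_nat.
  by case: (e < enorm u) => //=; case: (_ <= _).
exact: l.
Unshelve. all: by end_near.
Qed.

(** Along a sequence of inner radii, outer radii [N k] are chosen so large that [tr] is within
    [1 / (k + 1)] of [te]. The two limits become one, and the uniform bound on [rsym] gives
    domination. *)
Lemma te_trigI p j x : 1 < p -> (0 < n)%N -> Lpf p (trigI a b) ->
  te j e (trigI a b) x @[e --> 0^'+] -->
  \int[mu]_xi (xi 0 j / enorm xi * (a xi * sin (2 * pi * dotv x xi) - b xi * cos (2 * pi * dotv x xi))).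
Proof.
move=> p1 n0 gLp; apply/cvg_at_rightP => u [u0 lu].
have ex k : exists N : R, k.+1%:R <= N /\ `|te j (u k) (trigI a b) x - tr j (u k) N (trigI a b) x| <= k.+1%:R^-1.
  have h := @tr_te p j (u k) (trigI a b) x p1 n0 (u0 k) gLp.
  have k0 : 0 < k.+1%:R^-1 :> R by rewrite invr_gt0.
  move/cvgrPdist_le : h => /(_ _ k0) [m _ hm].
  exists (maxn m k).+1%:R; split; first by rewrite ler_nat ltnS leq_maxr.
  by apply: hm => /=; exact: leq_maxl.
pose N k := projT1 (cid (ex k)).
have NP k : k.+1%:R <= N k /\ `|te j (u k) (trigI a b) x - tr j (u k) (N k) (trigI a b) x| <= k.+1%:R^-1.
  exact: projT2 (cid (ex k)).
have lN : N k @[k --> \oo] --> +oo.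
  apply: (@ger_cvgy _ _ _ _ (fun k : nat => k.+1%:R)); last exact: cvg_natS.
  by apply: nearW => k; have [] := NP k.
pose h xi := a xi * sin (2 * pi * dotv x xi) - b xi * cos (2 * pi * dotv x xi).
have ih : intg mu h := intg_trigI' x.
have [||| _ l] := @Rint_dct _ _ R mu (fun (k : nat) xi => h xi * rsym j (u k) (N k) xi)
    (fun xi => h xi * (xi 0 j / enorm xi)) _ _ _ (intgZ (6 * W1 j) (intg_norm ih)).
- by move=> k; apply: measurable_funM; [exact: intg_measurable ih|exact: measurable_rsym].
- by move=> xi; apply: cvgMr; exact: rsym_cvg.
- by move=> k xi; rewrite normrM mulrC ler_wpM2r//; exact: rsym_le.
have -> : \int[mu]_xi (xi 0 j / enorm xi * (a xi * sin (2 * pi * dotv x xi) - b xi * cos (2 * pi * dotv x xi))) =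
    0 + \int[mu]_xi (h xi * (xi 0 j / enorm xi)).
  by rewrite add0r; apply: eq_Rint => xi; rewrite mulrC.
have -> : (fun k => te j (u k) (trigI a b) x) = (fun k => (te j (u k) (trigI a b) x - tr j (u k) (N k) (trigI a b) x) +
    \int[mu]_xi (h xi * rsym j (u k) (N k) xi)).
  by apply/funext => k; rewrite tr_trigI// subrK.
apply: cvgD; last exact: l.
apply/norm_cvg0P.
apply: (@squeeze_cvgr _ _ _ _ (fun=> 0) (fun k : nat => k.+1%:R^-1)); last 2 first.
- exact: cvg_cst.
- exact: cvg_invS.
by apply: nearW => k; have [_ ->] := NP k; rewrite normr_ge0.
Qed.

End trig.

End riesz_fourier.

(** * Measurability of continuous functions on R^n *)

Section continuous_measurable.
Context (R : realType) (n : nat).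

Lemma rv_norm_le (x : 'rV[R]_n) (b : R) : 0 <= b -> (forall i, `|x 0 i| <= b) -> `|x| <= b.
Proof.
move=> b0 h; rewrite /Num.norm/= mx_normrE; apply/bigmax_leP; split=> // -[i j] _ /=.
by rewrite (ord1 i).
Qed.

Let rnd (k : nat) (x : 'rV[R]_n) : 'rV[int]_n := \row_i Num.floor (k.+1%:R * x 0 i).

Let unr (k : nat) (m : 'rV[int]_n) : 'rV[R]_n := \row_i ((m 0 i)%:~R / k.+1%:R).

Let unrK x k : `|x - unr k (rnd k x)| <= k.+1%:R^-1.
Proof.
apply: rv_norm_le => [|i]; first by rewrite invr_ge0.
rewrite !mxE; set y := k.+1%:R * x 0 i.
have k0 : 0 < k.+1%:R :> R by [].
have -> : x 0 i - (Num.floor y)%:~R / k.+1%:R = (y - (Num.floor y)%:~R) / k.+1%:R.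
  by rewrite mulrBl /y mulrAC mulfV ?mul1r// gt_eqF.
rewrite normrM [`|_^-1|]ger0_norm ?invr_ge0// -[leRHS]mul1r ler_wpM2r ?invr_ge0//.
have /andP[h1 h2] := floor_itv y.
by rewrite ger0_norm ?subr_ge0//; rewrite intrD in h2; move: h1 h2; lra.
Qed.

Let measurable_rnd k (A : set 'rV[int]_n) : measurable (rnd k @^-1` A).
Proof.
pose B i : set 'rV[R]_n := if unpickle i is Some m then
  [set x | A m /\ rnd k x = m] else set0.
rewrite (_ : _ @^-1` _ = \bigcup_i B i); last first.
  apply/seteqP; split => [x Ax|x [i _]].
    by exists (pickle (rnd k x)) => //; rewrite /B pickleK.
  by rewrite /B; case: unpickle => // m /= [Am ->].
apply: bigcup_measurable => i _; rewrite /B; case: unpickle => [m|]; last exact: measurable0.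
have [Am|nAm] := pselect (A m); last first.
  by rewrite (_ : mkset _ = set0)//; apply/seteqP; split => x //= [].
have -> : [set x : 'rV[R]_n | A m /\ rnd k x = m] =
    [set x : 'rV[R]_n | forall i, [set t | (m 0 i)%:~R <= k.+1%:R * t < (m 0 i + 1)%:~R] (x 0 i)].
  apply/seteqP; split => x /=.
    by move=> [_ <-] j; rewrite !mxE; exact: floor_itv.
  move=> h; split => //; apply/rowP => j; rewrite !mxE.
  by apply/floor_def; exact: h.
apply: (@measurable_box R n (fun i => [set t | (m 0 i)%:~R <= k.+1%:R * t < (m 0 i + 1)%:~R])) => j.
apply: measurable_bool_set; apply: measurable_and.
  by apply: measurable_fun_ler; mfun.
by apply: measurable_fun_ltr; mfun.
Qed.

(** The sigma-algebra is generated by the coordinates and not by open sets. A continuous function is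
    the limit of its values at points rounded to the grid of mesh [1 / (k + 1)], and the rounding
    takes countably many values on boxes. *)
Lemma continuous_measurable (f : 'rV[R]_n -> R) : continuous f -> measurable_fun setT f.
Proof.
move=> cf.
have L (x : 'rV[R]_n) : f (unr k (rnd k x)) @[k --> \oo] --> f x.
  have h : unr k (rnd k x) @[k --> \oo] --> x.
    apply/cvgrPdist_le => e e0.
    have [k0 _ hk] := near_infty_natSinv_lt (PosNum e0).
    exists k0 => // k /= kk; apply: le_trans (unrK x k) _; exact: ltW (hk k kk).
  by apply: continuous_cvg => [|]; [exact: cf|exact: h].
apply: (@measurable_fun_cvg _ _ _ _ (fun k x => f (unr k (rnd k x)))).
  move=> k _ Y mY; rewrite setTI.
  exact: (measurable_rnd k [set m | Y (f (unr k m))]).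
by move=> x _; exact: L.
Qed.

End continuous_measurable.

(** * Decay of Schwartz functions *)

Section schwartz_decay.
Context (R : realType) (n : nat).
Local Notation leb := (@lebesgue_measure R).
Local Notation mu := (lebesgue_rv R n).
Local Notation ee k := (delta_mx 0 k : 'rV[R]_n).
Implicit Types (f g : 'rV[R]_n -> R) (x y xi : 'rV[R]_n).

Lemma schwartz_partials s f : schwartz_fun f -> schwartz_fun (partials s f).
Proof.
move=> h s'; have -> : partials s' (partials s f) = partials (s' ++ s) f.
  by rewrite /partials foldr_cat.
exact: h.
Qed.

Lemma schwartz_continuous f : schwartz_fun f -> continuous f.
Proof. by move=> h x; apply: differentiable_continuous; have [/(_ x)] := h [::]. Qed.

Lemma schwartz_measurable f : schwartz_fun f -> measurable_fun setT f.
Proof. by move=> h; apply: continuous_measurable; exact: schwartz_continuous. Qed.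

Lemma is_derive_line f x (v : 'rV[R]_n) (s : R) : (forall y, differentiable f y) ->
  is_derive s 1 (fun s : R => f (x + s *: v)) ('D_v f (x + s *: v)).
Proof.
move=> df; have dv : derivable f (x + s *: v) v by apply: diff_derivable.
have e : (fun h : R => h^-1 *: ((fun s : R => f (x + s *: v)) (h *: (1 : R) + s) - f (x + s *: v))) =
    (fun h : R => h^-1 *: (f (h *: v + (x + s *: v)) - f (x + s *: v))).
  apply/funext => h; congr (_ *: (f _ - _)).
  have -> : h *: (1 : R) = h by rewrite /GRing.scale/= mulr1.
  by rewrite scalerDl addrCA.
apply: DeriveDef; first by rewrite /derivable e; exact: dv.
by rewrite /derive e.
Qed.

Lemma continuous_line f x (v : 'rV[R]_n) : continuous f ->
  continuous (fun s : R => f (x + s *: v)).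
Proof.
move=> cf s; apply: (@continuous_comp _ _ _ (fun s : R => x + s *: v) f); last exact: cf.
apply: cvgD; first exact: cvg_cst.
by apply: cvgZl; exact: cvg_id.
Qed.

(** A weight whose integral factorises over the coordinates, each factor being [pk 1]; this makes
    integrability immediate in every dimension. *)
Definition pw x : R := \prod_(k < n) (1 + x 0 k ^+ 2)^-1.

Lemma pw_gt0 x : 0 < pw x.
Proof. by apply: prodr_gt0 => k _; rewrite invr_gt0 ltr_pwDl ?sqr_ge0. Qed.

(** Every factor is at most that of the largest [s k], and [(1 + t)^n <= 2^n (1 + t^n)]. Dimension 0
    is separate because it has no largest index. *)
Lemma prod_le_pow (s : 'I_n -> R) : (forall k, 0 <= s k) ->
  \prod_k (1 + s k) <= 2 ^+ n * (1 + \sum_k s k ^+ n).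
Proof.
move=> s0; have [n0|n0] := posnP n.
  have -> : \prod_k (1 + s k) = 1 by apply: big1 => k _; have kn := ltn_ord k; exfalso; move: kn; rewrite [X in (_ < X)%N]n0 ltn0.
  have -> : \sum_k s k ^+ n = 0 by apply: big1 => k _; have kn := ltn_ord k; exfalso; move: kn; rewrite [X in (_ < X)%N]n0 ltn0.
  by rewrite addr0 mulr1 n0.
pose k0 : 'I_n := Ordinal n0.
pose k1 := [arg max_(k > k0) s k]%O.
have tk k : s k <= s k1.
  by rewrite /k1; case: Order.TotalTheory.arg_maxP => // i _ h; exact: h.
set t := s k1 in tk; have t0 : 0 <= t by exact: s0.
have tS : t ^+ n <= \sum_k s k ^+ n.
  by rewrite (bigD1 k1)//= lerDl; apply: sumr_ge0 => k _; exact: exprn_ge0.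
apply: (@le_trans _ _ ((1 + t) ^+ n)).
  rewrite -[X in _ <= _ ^+ X](card_ord n) -prodr_const; apply: ler_prod => k _.
  by rewrite addr_ge0//= lerD2l.
apply: (@le_trans _ _ (2 ^+ n * (1 + t ^+ n))); last by rewrite ler_wpM2l ?exprn_ge0// lerD2l.
have [t1|t1] := leP t 1.
  apply: (@le_trans _ _ (2 ^+ n)).
    by apply: lerXn2r; rewrite ?nnegrE ?addr_ge0//; lra.
  by rewrite -[leLHS]mulr1 ler_wpM2l ?exprn_ge0// lerDl exprn_ge0.
apply: (@le_trans _ _ ((2 * t) ^+ n)).
  by apply: lerXn2r; rewrite ?nnegrE ?addr_ge0 ?mulr_ge0//; lra.
by rewrite exprMn ler_wpM2l ?exprn_ge0// lerDr.
Qed.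

(** Only pure powers of single coordinates are required, and these are what repeated derivatives in
    one direction provide on the Fourier side. *)
Lemma pw_decay g (C0 : R) (C : 'I_n -> R) : (forall x, `|g x| <= C0) ->
  (forall k x, (x 0 k ^+ 2) ^+ n * `|g x| <= C k) ->
  exists2 D : R, 0 <= D & forall x, `|g x| <= D * pw x.
Proof.
move=> h0 hk; exists (2 ^+ n * (C0 + \sum_k C k)).
  rewrite mulr_ge0 ?exprn_ge0// addr_ge0//; first exact: le_trans (normr_ge0 _) (h0 0).
  apply: sumr_ge0 => k _; apply: le_trans (hk k 0).
  by rewrite mulr_ge0// exprn_ge0// sqr_ge0.
move=> x; have p0 : 0 < \prod_k (1 + x 0 k ^+ 2).
  by apply: prodr_gt0 => k _; rewrite ltr_pwDl ?sqr_ge0.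
rewrite /pw prodfV ler_pdivlMr//.
apply: (@le_trans _ _ (`|g x| * (2 ^+ n * (1 + \sum_k (x 0 k ^+ 2) ^+ n)))).
  by rewrite ler_wpM2l//; apply: prod_le_pow => k; exact: sqr_ge0.
rewrite mulrCA ler_wpM2l ?exprn_ge0// mulrDr mulr1 lerD ?h0//.
by rewrite mulr_sumr; apply: ler_sum => k _; rewrite mulrC hk.
Qed.

Lemma schwartz_pw f : schwartz_fun f -> exists2 D : R, 0 <= D & forall x, `|f x| <= D * pw x.
Proof.
move=> h; have [_ hd] := h [::].
have [C0 h0] := hd 0%N; have [C h1] := hd (2 * n)%N.
apply: (@pw_decay f C0 (fun=> C)) => [x|k x].
  by have := h0 x; rewrite expr0 mul1r.
apply: le_trans (h1 x); rewrite /= ler_wpM2r// exprM.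
apply: lerXn2r; rewrite ?nnegrE ?sqr_ge0//.
rewrite -[x 0 k ^+ 2]ger0_norm ?sqr_ge0// normrX; apply: lerXn2r; rewrite ?nnegrE ?enorm_ge0//.
exact: coord_le_enorm.
Qed.

Lemma schwartz_bounded f : schwartz_fun f -> exists2 D : R, 0 <= D & forall x, `|f x| <= D.
Proof.
move=> h; have [_ hd] := h [::]; have [C0 h0] := hd 0%N; exists C0.
  by apply: le_trans (h0 0); rewrite expr0 mul1r.
by move=> x; have := h0 x; rewrite expr0 mul1r.
Qed.

End schwartz_decay.

Lemma measurable_pw (R : realType) n : measurable_fun setT (@pw R n).
Proof. by apply: measurable_prod => k _; apply: measurable_inv; mfun. Qed.

Lemma int_pw (R : realType) n : (\int[lebesgue_rv R n]_x (pw x)%:E < +oo)%E.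
Proof.
suff [c0 ->] : exists c : R, (\int[lebesgue_rv R n]_x (pw x)%:E = c%:E)%E by rewrite ltry.
elim: n => [|n [c IH]].
  exists 1; rewrite (@integral_dirac _ _ (0 : 'rV[R]_0) R setT measurableT (fun x => (pw x)%:E)).
    by rewrite diracT mul1e /pw big_ord0.
  by apply/measurable_EFinP; exact: measurable_pw.
exists (pi * c); rewrite ge0_int_rvS; last 2 first.
- by apply/measurable_EFinP; exact: measurable_pw.
- by move=> x; rewrite lee_fin ltW// pw_gt0.
have e (t : R) v : pw (rv_cons (t, v)) = pk 1 t * pw v.
  rewrite /pw big_ord_recl mxE unlift_none/= /pk expr1n mul1r addrC; congr (_ * _).
  by apply: eq_bigr => k _; rewrite mxE liftK.
transitivity (\int[lebesgue_measure]_(t in [set: R]) (pk 1 t * c)%:E)%E.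
  apply: eq_integral => t _; under eq_integral do rewrite e.
  rewrite int_Zl ?pk_ge0//; [by rewrite IH EFinM|exact: measurable_pw|].
  by move=> v; rewrite ltW// pw_gt0.
have c0 : 0 <= c by rewrite -lee_fin -IH; apply: integral_ge0 => v _; rewrite lee_fin ltW// pw_gt0.
by rewrite int_Zr// ?int_pk ?EFinM//; [exact: measurable_pk|by move=> t; exact: pk_ge0].
Qed.

Lemma intg_pw (R : realType) n : intg (lebesgue_rv R n) (@pw R n).
Proof.
apply: intgP; first exact: measurable_pw.
under eq_integral => x _ do rewrite ger0_norm ?(ltW (pw_gt0 x))//.
exact: int_pw.
Qed.

(** * Fourier transforms of Schwartz functions and inversion *)

Section schwartz_fourier.
Context (R : realType) (n : nat).
Local Notation leb := (@lebesgue_measure R).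
Local Notation mu := (lebesgue_rv R n).
Local Notation ee k := (delta_mx 0 k : 'rV[R]_n).
Implicit Types (f g : 'rV[R]_n -> R) (x y xi : 'rV[R]_n).

Lemma schwartz_intg f : schwartz_fun f -> intg mu f.
Proof.
move=> h; have [D D0 hD] := schwartz_pw h.
apply: (intg_le _ _ (intgZ D (@intg_pw R n))) => //; exact: schwartz_measurable.
Qed.

Lemma schwartz_Lpf p f : 1 < p -> schwartz_fun f -> Lpf p f.
Proof.
move=> p1 h; split; first exact: schwartz_measurable.
have [D D0 hD] := schwartz_bounded h; have fi := schwartz_intg h.
apply: le_lt_trans (intg_lty (intgZ (D `^ (p - 1)) (intg_norm fi))).
apply: int_mono => x; rewrite lee_fin ?powR_ge0//.
rewrite normrM normr_id (ger0_norm (powR_ge0 _ _)).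
have [->|f0] := eqVneq (f x) 0; first by rewrite normr0 powR0 ?mulr0// gt_eqF// (lt_trans _ p1).
have -> : `|f x| `^ p = `|f x| `^ (p - 1) * `|f x|.
  by rewrite -{3}(powRr1 (normr_ge0 (f x))) -powRD ?subrK// normr_eq0 f0 implybT.
by rewrite ler_wpM2r//; apply: ge0_ler_powR; rewrite ?nnegrE ?subr_ge0// ltW.
Qed.

Definition fcos f xi := \int[mu]_x (f x * cos (2 * pi * dotv x xi)).
Definition fsin f xi := \int[mu]_x (f x * sin (2 * pi * dotv x xi)).

Lemma measurable_fcos f : measurable_fun setT f -> measurable_fun setT (fcos f).
Proof.
move=> mf; have mc := @measurable_cos R.
apply: (@measurable_Rint_l _ _ _ _ R mu (fun xi x => f x * cos (2 * pi * dotv x xi))).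
by mfun.
Qed.

Lemma measurable_fsin f : measurable_fun setT f -> measurable_fun setT (fsin f).
Proof.
move=> mf; have mc := @measurable_sin R.
apply: (@measurable_Rint_l _ _ _ _ R mu (fun xi x => f x * sin (2 * pi * dotv x xi))).
by mfun.
Qed.

Lemma fcos_le f xi : intg mu f -> `|fcos f xi| <= \int[mu]_x `|f x|.
Proof.
move=> fi; have [_ i] := intg_trig xi fi.
apply: le_trans (le_normr_Rint i) _; apply: le_Rint => //; try exact: intg_norm.
by move=> x; rewrite normrM -[leRHS]mulr1 ler_wpM2l// cos_max.
Qed.

Lemma fsin_le f xi : intg mu f -> `|fsin f xi| <= \int[mu]_x `|f x|.
Proof.
move=> fi; have [i _] := intg_trig xi fi.
apply: le_trans (le_normr_Rint i) _; apply: le_Rint => //; try exact: intg_norm.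
by move=> x; rewrite normrM -[leRHS]mulr1 ler_wpM2l// sin_max.
Qed.

Lemma continuous_mul f g : continuous f -> continuous g -> continuous (fun x => f x * g x).
Proof. by move=> cf cg x; exact: (cvgM (cf x) (cg x)). Qed.

Lemma continuous_add f g : continuous f -> continuous g -> continuous (fun x => f x + g x).
Proof. by move=> cf cg x; exact: (cvgD (cf x) (cg x)). Qed.

Lemma continuous_opp f : continuous f -> continuous (fun x => - f x).
Proof. by move=> cf x; exact: (cvgN (cf x)). Qed.

Lemma continuous_const (c : R) : continuous (fun _ : 'rV[R]_n => c).
Proof. exact: cst_continuous. Qed.

Lemma continuous_csin xi : continuous (fun x => sin (2 * pi * dotv x xi)) /\
  continuous (fun x => cos (2 * pi * dotv x xi)).
Proof.
have cs (r : seq 'I_n) : continuous (fun x : 'rV[R]_n => \sum_(i <- r) x 0 i * xi 0 i).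
  elim: r => [|i r IH].
    rewrite (_ : (fun x => _) = fun=> 0); first exact: cst_continuous.
    by apply/funext => x; rewrite big_nil.
  rewrite (_ : (fun x => _) = fun x : 'rV[R]_n => x 0 i * xi 0 i + \sum_(i <- r) x 0 i * xi 0 i).
    apply: continuous_add => //; apply: continuous_mul; last exact: continuous_const.
    exact: coord_continuous.
  by apply/funext => x; rewrite big_cons.
have cd : continuous (fun x => 2 * pi * dotv x xi).
  by apply: continuous_mul; [exact: continuous_const|exact: cs].
split=> x; apply: (@continuous_comp _ _ _ (fun x => 2 * pi * dotv x xi)); try exact: cd.
  exact: continuous_sin.
exact: continuous_cos.
Qed.

Lemma fourier_partial f k xi : schwartz_fun f ->
  fcos ('D_(ee k) f) xi = 2 * pi * xi 0 k * fsin f xi /\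
  fsin ('D_(ee k) f) xi = - (2 * pi * xi 0 k * fcos f xi).
Proof.
move=> h; have df y : differentiable f y by have [] := h [::].
have hk : schwartz_fun ('D_(ee k) f) := schwartz_partials [:: k] h.
have fi := schwartz_intg h; have dfi := schwartz_intg hk.
have [is1 ic1] := intg_trig xi fi; have [is2 ic2] := intg_trig xi dfi.
have cf := schwartz_continuous h; have cdf := schwartz_continuous hk.
have [cs cc] := continuous_csin xi.
split.
  pose dF x := 'D_(ee k) f x * cos (2 * pi * dotv x xi) -
    (2 * pi * xi 0 k) * (f x * sin (2 * pi * dotv x xi)).
  have idF : intg mu dF by apply: intgB => //; exact: intgZ.
  have H : \int[mu]_x dF x = 0.
    apply: (@Rint_dir_deriv R n (fun x => f x * cos (2 * pi * dotv x xi)) dF (ee k)) => //.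
    - move=> x s; have d := is_deriveM (is_derive_line x (ee k) s df) (is_derive_cos_line x (ee k) xi s).
      apply: (@is_derive_eq _ _ _ _ _ _ _ _ d).
      by rewrite /dF /GRing.scale/= dotv_ee; ring.
    - move=> x; apply: (@continuous_line _ _ dF).
      apply: continuous_add; first exact: continuous_mul.
      apply: continuous_opp; apply: continuous_mul; first exact: continuous_const.
      exact: continuous_mul.
  by move: H; rewrite RintB ?RintZ//; [move/eqP; rewrite subr_eq0 => /eqP|exact: intgZ].
pose dF x := 'D_(ee k) f x * sin (2 * pi * dotv x xi) +
  (2 * pi * xi 0 k) * (f x * cos (2 * pi * dotv x xi)).
have idF : intg mu dF by apply: intgD => //; exact: intgZ.
have H : \int[mu]_x dF x = 0.
  apply: (@Rint_dir_deriv R n (fun x => f x * sin (2 * pi * dotv x xi)) dF (ee k)) => //.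
  - move=> x s; have d := is_deriveM (is_derive_line x (ee k) s df) (is_derive_sin_line x (ee k) xi s).
    apply: (@is_derive_eq _ _ _ _ _ _ _ _ d).
    by rewrite /dF /GRing.scale/= dotv_ee; ring.
  - move=> x; apply: (@continuous_line _ _ dF).
    apply: continuous_add; first exact: continuous_mul.
    apply: continuous_mul; first exact: continuous_const.
    exact: continuous_mul.
by move: H; rewrite RintD ?RintZ//; [move/eqP; rewrite addr_eq0 => /eqP|exact: intgZ].
Qed.

(** The squared modulus of the Fourier transform. Each derivative exchanges the cosine and sine
    parts, and the modulus makes the iteration uniform. *)
Definition fnorm2 f xi := fcos f xi ^+ 2 + fsin f xi ^+ 2.

Lemma fnorm2_partials f k m xi : schwartz_fun f ->
  fnorm2 (partials (nseq m k) f) xi = ((2 * pi * xi 0 k) ^+ 2) ^+ m * fnorm2 f xi.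
Proof.
move=> h; elim: m => [|m IH]; first by rewrite expr0 mul1r.
have [e1 e2] := @fourier_partial (partials (nseq m k) f) k xi (schwartz_partials _ h).
rewrite /= {1}/fnorm2 (_ : (fun x => _) = 'D_(ee k) (partials (nseq m k) f))// e1 e2.
transitivity ((2 * pi * xi 0 k) ^+ 2 * fnorm2 (partials (nseq m k) f) xi).
  by rewrite /fnorm2; ring.
by rewrite IH (exprS ((2 * pi * xi 0 k) ^+ 2) m) mulrA.
Qed.

(** [2 n] derivatives in each coordinate supply the powers asked for by [pw_decay]; the factors
    [2 pi >= 1] are dropped. *)
Lemma fourier_decay f : schwartz_fun f ->
  exists2 D : R, 0 <= D & forall xi, `|fcos f xi| <= D * pw xi /\ `|fsin f xi| <= D * pw xi.
Proof.
move=> h; have fi := schwartz_intg h.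
pose g xi := Num.sqrt (fnorm2 f xi).
have n0 F xi : 0 <= fnorm2 F xi by rewrite addr_ge0 ?sqr_ge0.
have gle F xi : intg mu F -> fnorm2 F xi <= 2 * (\int[mu]_x `|F x|) ^+ 2.
  move=> Fi; have I0 : 0 <= \int[mu]_x `|F x| by apply: Rintegral_ge0.
  rewrite /fnorm2 mulr_natl mulr2n; apply: lerD.
    rewrite -[_ ^+ 2 in leLHS]ger0_norm ?sqr_ge0// normrX; apply: lerXn2r; rewrite ?nnegrE//.
    exact: fcos_le.
  rewrite -[_ ^+ 2 in leLHS]ger0_norm ?sqr_ge0// normrX; apply: lerXn2r; rewrite ?nnegrE//.
  exact: fsin_le.
pose I m k := \int[mu]_x `|partials (nseq m k) f x|.
have H0 xi : `|g xi| <= Num.sqrt (2 * (\int[mu]_x `|f x|) ^+ 2).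
  by rewrite ger0_norm ?sqrtr_ge0//; apply: ler_wsqrtr; exact: gle.
have Hk k xi : (xi 0 k ^+ 2) ^+ n * `|g xi| <= Num.sqrt (2 * I (2 * n)%N k ^+ 2).
  have e : Num.sqrt (fnorm2 (partials (nseq (2 * n) k) f) xi) = ((2 * pi * xi 0 k) ^+ 2) ^+ n * g xi.
    rewrite fnorm2_partials// sqrtrM; last by apply: exprn_ge0; exact: sqr_ge0.
    by rewrite -/(g xi) mulnC exprM sqrtr_sqr ger0_norm//; apply: exprn_ge0; exact: sqr_ge0.
  rewrite ger0_norm ?sqrtr_ge0//; apply: (@le_trans _ _ (((2 * pi * xi 0 k) ^+ 2) ^+ n * g xi)).
    apply: ler_wpM2r; first exact: sqrtr_ge0.
    apply: lerXn2r; rewrite ?nnegrE ?sqr_ge0// exprMn.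
    have p2 := @pi_ge2 R; rewrite -[leLHS]mul1r ler_wpM2r ?sqr_ge0//.
    by rewrite expr2; nra.
  rewrite -e; apply: ler_wsqrtr; apply: gle; apply: schwartz_intg.
  exact: schwartz_partials.
have [D D0 hD] := pw_decay H0 Hk.
exists D => // xi; have gD := hD xi; rewrite ger0_norm ?sqrtr_ge0// in gD.
split; apply: le_trans gD; rewrite -sqrtr_sqr; apply: ler_wsqrtr.
  by rewrite lerDl sqr_ge0.
by rewrite lerDr sqr_ge0.
Qed.

Lemma intg_fcos f : schwartz_fun f -> intg mu (fcos f) /\ intg mu (fsin f).
Proof.
move=> h; have [D D0 hD] := fourier_decay h; have mf := schwartz_measurable h.
split; apply: (intg_le _ _ (intgZ D (@intg_pw R n))).
- exact: measurable_fcos.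
- by move=> xi; have [] := hD xi.
- exact: measurable_fsin.
- by move=> xi; have [] := hD xi.
Qed.

(* Gaussian summability of the inversion integral. *)
Lemma fourier_inversion f x : schwartz_fun f -> trigI (fcos f) (fsin f) x = f x.
Proof.
move=> h; have [ia ib] := intg_fcos h; have fi := schwartz_intg h.
have mf := schwartz_measurable h; have [B B0 fB] := schwartz_bounded h.
have cf := schwartz_continuous h.
pose s (k : nat) : R := k.+1%:R^-1.
have s0 k : 0 < s k by rewrite invr_gt0.
have sn0 k : s k != 0 by rewrite gt_eqF.
have ls : s @ \oo --> (0 : R) by exact: cvg_harmonic.
pose T xi := fcos f xi * cos (2 * pi * dotv x xi) + fsin f xi * sin (2 * pi * dotv x xi).
have iT : intg mu T := intg_trigI ia ib x.
have mg k : measurable_fun setT (fun xi : 'rV[R]_n => gs (s k *: xi)) by mfun.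
have [||| _ l1] := @Rint_dct _ _ R mu (fun k xi => gs (s k *: xi) * T xi) T _ _ _ (intg_norm iT).
- by move=> k; apply: measurable_funM => //; exact: intg_measurable iT.
- move=> xi; rewrite -[X in _ --> X]mul1r; apply: cvgMl.
  under eq_fun do rewrite gsZ.
  rewrite -(@expR0 R); apply: (@cvg_comp _ _ _ (fun k => - (pi * s k ^+ 2 * dotv xi xi)) expR _ (nbhs (0 : R))); last first.
    exact: continuous_expR.
  have -> : (0 : R) = - (pi * 0 ^+ 2 * dotv xi xi) by rewrite expr0n/= mulr0 mul0r oppr0.
  apply: cvgN; apply: cvgMl; apply: cvgMr.
  by rewrite expr2; under eq_fun do rewrite expr2; exact: cvgM.
- move=> k xi; rewrite normrM -[leRHS]mul1r ler_wpM2r// ger0_norm ?gs_ge0//; exact: gs_le1.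
have [||| _ l2] := @Rint_dct _ _ R mu (fun k z => gs z * f (x - s k *: z)) (fun z => gs z * f x) _ _ _ (intgZ B (@intg_gs R n)).
- move=> k; apply: measurable_funM; first exact: measurable_gs.
  by apply: (measurableT_comp mf); mfun.
- move=> z; apply: cvgMr.
  apply: (@cvg_comp _ _ _ (fun k => x - s k *: z) f _ (nbhs x)); last exact: cf.
  have h' : (fun k => x - s k *: z) @ \oo --> x - 0 *: z.
    by apply: cvgB; [exact: cvg_cst|exact: cvgZl].
  by rewrite scale0r subr0 in h'.
- by move=> k z; rewrite normrM (ger0_norm (gs_ge0 z)) mulrC ler_wpM2r ?gs_ge0.
have l2' : \int[mu]_z (gs z * f x) = f x.
  transitivity (\int[mu]_z (f x * gs z)); first by apply: eq_Rint => z; rewrite mulrC.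
  by rewrite RintZ ?Rint_gs ?mulr1//; exact: intg_gs.
rewrite l2' in l2.
(* Exchanging the integrals, the transform of the wide Gaussian [gs (s k xi)] is the approximate
   identity of width [s k], here centred at [x]. *)
have e k : \int[mu]_xi (gs (s k *: xi) * T xi) = \int[mu]_z (gs z * f (x - s k *: z)).
  have igs : intg mu (fun xi => gs (s k *: xi)) by exact: intg_gsZ.
  pose H xi y := gs (s k *: xi) * (f y * cos (2 * pi * dotv (x - y) xi)).
  have mc := @measurable_cos R; have mgk := mg k.
  have H2 : intg2 mu mu H.
    apply: (intg2_prod _ igs (intg_norm fi)).
      by rewrite /H; mfun.
    move=> xi y; rewrite /H normrM (ger0_norm (gs_ge0 _)) ler_wpM2l ?gs_ge0//.
    by rewrite normrM -[leRHS]mulr1 ler_wpM2l// cos_max.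
  transitivity (\int[mu]_xi (\int[mu]_y H xi y)).
    apply: eq_Rint => xi; have [i1 i2] := intg_trig xi fi.
    rewrite /T /fcos /fsin ![_ * cos (2 * pi * dotv x xi)]mulrC ![_ * sin (2 * pi * dotv x xi)]mulrC.
    rewrite -!RintZ// -RintD; [|exact: intgZ|exact: intgZ].
    rewrite -RintZ; last by apply: intgD; exact: intgZ.
    by apply: eq_Rint => y; rewrite /H dotvBl mulrBr cosB; ring.
  rewrite Rint_fubini//.
  have inner y : \int[mu]_xi H xi y = f y * ((s k ^+ n)^-1 * gs ((s k)^-1 *: (x - y))).
    pose v := (s k)^-1 *: (x - y).
    have [_ i] := intg_trig v (@intg_gs R n).
    have E := @Rint_affine_rv R n (s k) 0 _ (sn0 k) i.
    have i' := @intg_affine_rv R n (s k) 0 _ (sn0 k) i.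
    have gf := @gs_fourier R n 1 v.
    have sv xi : dotv (s k *: xi + 0) v = dotv (x - y) xi.
      by rewrite addr0 dotvZl dotvZr mulrA mulfV// mul1r dotvC.
    transitivity (f y * \int[mu]_xi (gs (s k *: xi + 0) * cos (2 * pi * dotv (s k *: xi + 0) v))).
      by rewrite -RintZ//; apply: eq_Rint => xi; rewrite /H sv addr0; ring.
    congr (_ * _); apply: (mulfI (expf_neq0 n (sn0 k))).
    rewrite mulrA mulfV ?expf_neq0// mul1r -{1}(gtr0_norm (s0 k)) -E.
    transitivity (\int[mu]_z (gs z * cos (2 * pi * (1 * dotv z v)))).
      by apply: eq_Rint => z; rewrite mul1r.
    by rewrite gf /gs expr1n mulr1.
  transitivity (\int[mu]_y (f y * ((s k ^+ n)^-1 * gs ((s k)^-1 *: (x - y))))).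
    by apply: eq_Rint => y; rewrite inner.
  have iF : intg mu (fun y => f y * ((s k ^+ n)^-1 * gs ((s k)^-1 *: (x - y)))).
    apply: (intg_le _ _ (intgZ (s k ^+ n)^-1 (intg_norm fi))) => [|y]; first by mfun.
    rewrite normrM mulrC ler_wpM2r// normrM ger0_norm ?invr_ge0 ?exprn_ge0 ?(ltW (s0 k))//.
    rewrite -[leRHS]mulr1 ler_wpM2l ?invr_ge0 ?exprn_ge0 ?(ltW (s0 k))//.
    by rewrite ger0_norm ?gs_ge0// gs_le1.
  have msk : - s k != 0 by rewrite oppr_eq0.
  rewrite (@Rint_affine_rv R n (- s k) x _ msk iF) normrN (gtr0_norm (s0 k)) -RintZ; last first.
    exact: (@intg_affine_rv R n (- s k) x _ msk iF).
  apply: eq_Rint => z; rewrite scaleNr [- _ + x]addrC.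
  have -> : (s k)^-1 *: (x - (x - s k *: z)) = z by rewrite subKr scalerA mulVf// scale1r.
  rewrite mulrCA [f _ * _]mulrC mulrA mulfV ?expf_neq0// mul1r mulrC//.
move: l1; under eq_fun do rewrite e; move=> l1.
exact: (@cvg_unique _ _ _ _ _ _ l1 l2).
Qed.

End schwartz_fourier.

(** * Density and almost everywhere convergence *)

Section schwartz_closure.
Context (R : realType) (n : nat).
Local Notation mu := (lebesgue_rv R n).
Local Notation ee k := (delta_mx 0 k : 'rV[R]_n).
Implicit Types (f g q P Q : 'rV[R]_n -> R) (x v : 'rV[R]_n) (s : seq 'I_n).

Lemma partialsD s f g : schwartz_fun f -> schwartz_fun g ->
  partials s (fun x => f x + g x) = (fun x => partials s f x + partials s g x).
Proof.
move=> sf sg; elim: s => [//|k s IH]; rewrite /= IH; apply/funext => x.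
have [df _] := sf s; have [dg _] := sg s.
have dvf : derivable (partials s f) x (ee k) by exact: diff_derivable.
have dvg : derivable (partials s g) x (ee k) by exact: diff_derivable.
exact: deriveD dvf dvg.
Qed.

Lemma partialsZ s c f : schwartz_fun f ->
  partials s (fun x => c * f x) = (fun x => c * partials s f x).
Proof.
move=> sf; elim: s => [//|k s IH]; rewrite /= IH; apply/funext => x.
have [df _] := sf s.
have dvf : derivable (partials s f) x (ee k) by exact: diff_derivable.
exact: (deriveZ c dvf).
Qed.

Lemma schwartzD f g : schwartz_fun f -> schwartz_fun g -> schwartz_fun (fun x => f x + g x).
Proof.
move=> sf sg s; rewrite partialsD//; have [df bf] := sf s; have [dg bg] := sg s.
split=> [x|k]; first by apply: differentiableD; [exact: df|exact: dg].
have [C hC] := bf k; have [D hD] := bg k; exists (C + D) => x.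
apply: (le_trans _ (lerD (hC x) (hD x))).
by rewrite -mulrDr ler_wpM2l ?exprn_ge0 ?enorm_ge0// ler_normD.
Qed.

Lemma schwartzZ c f : schwartz_fun f -> schwartz_fun (fun x => c * f x).
Proof.
move=> sf s; rewrite partialsZ//; have [df bf] := sf s.
split=> [x|k]; first by apply: differentiableM; [exact: differentiable_cst|exact: df].
have [C hC] := bf k; exists (`|c| * C) => x.
by rewrite normrM mulrCA ler_wpM2l.
Qed.

Lemma partials0 s : partials s (fun _ : 'rV[R]_n => 0 : R) = (fun=> 0).
Proof.
elim: s => [//|k s IH]; rewrite /= IH; apply/funext => x.
exact: (derive_cst (0 : R) x (ee k)).
Qed.

Lemma schwartz0 : schwartz_fun (fun _ : 'rV[R]_n => 0 : R).
Proof.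
move=> s; rewrite partials0; split=> [x|k]; first exact: differentiable_cst.
by exists 0 => x; rewrite normr0 mulr0.
Qed.

Lemma deriv_from_line f x v (d : R) : differentiable f x ->
  (forall y, differentiable f y) ->
  is_derive (0 : R) 1 (fun s : R => f (x + s *: v)) d -> 'D_v f x = d.
Proof.
move=> dfx df [_ <-]; have [_ ->] := @is_derive_line _ _ f x v 0 df.
by rewrite scale0r addr0.
Qed.

(** Polynomial functions, given by generators so that differentiability, derivatives and growth
    follow by induction. *)
Inductive polyf : ('rV[R]_n -> R) -> Prop :=
| polyf_cst c : polyf (fun=> c)
| polyf_coord i : polyf (fun x => x 0 i)
| polyf_add P Q : polyf P -> polyf Q -> polyf (fun x => P x + Q x)
| polyf_mul P Q : polyf P -> polyf Q -> polyf (fun x => P x * Q x).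

Lemma polyf_sum (I : Type) (r : seq I) (F : I -> 'rV[R]_n -> R) :
  (forall i, polyf (F i)) -> polyf (fun x => \sum_(i <- r) F i x).
Proof.
move=> sF; elim: r => [|i r IH].
  by under eq_fun do rewrite big_nil; exact: polyf_cst.
by under eq_fun do rewrite big_cons; exact: polyf_add.
Qed.

Lemma polyf_exp P m : polyf P -> polyf (fun x => P x ^+ m).
Proof.
move=> pP; elim: m => [|m IH]; first exact: polyf_cst.
by under eq_fun do rewrite exprS; exact: polyf_mul.
Qed.

Lemma polyf_diff P : polyf P ->
  (forall x, differentiable P x) /\ (forall v, polyf (fun x => 'D_v P x)).
Proof.
elim=> [c|i|{}P Q pP [dP PP] pQ [dQ PQ]|{}P Q pP [dP PP] pQ [dQ PQ]].
- split=> [x|v]; first exact: differentiable_cst.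
  have -> : (fun x => 'D_v (fun=> c) x) = (fun=> 0) by apply/funext => x; exact: (derive_cst c x v).
  exact: polyf_cst.
- split=> [x|v]; first exact: differentiable_coord.
  suff -> : (fun x => 'D_v (fun y : 'rV[R]_n => y 0 i : R) x) = (fun=> v 0 i) by exact: polyf_cst.
  apply/funext => x; apply: deriv_from_line; [exact: differentiable_coord|by move=> y; exact: differentiable_coord|].
  have -> : (fun s : R => (x + s *: v) 0 i) = (fun s : R => x 0 i + s * v 0 i) by apply/funext => r; rewrite !mxE.
  by apply: is_derive_eq; rewrite /GRing.scale/= ; ring.
- split=> [x|v]; first by apply: differentiableD; [exact: dP|exact: dQ].
  suff -> : (fun x => 'D_v (fun x => P x + Q x) x) = (fun x => 'D_v P x + 'D_v Q x) by exact: polyf_add.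
  by apply/funext => x; apply: (@deriveD _ _ _ P Q); apply: diff_derivable; [exact: dP|exact: dQ].
- split=> [x|v]; first by apply: differentiableM; [exact: dP|exact: dQ].
  suff -> : (fun x => 'D_v (fun x => P x * Q x) x) = (fun x => P x * 'D_v Q x + Q x * 'D_v P x).
    by apply: polyf_add; exact: polyf_mul.
  by apply/funext => x; apply: (@deriveM _ _ P Q); apply: diff_derivable; [exact: dP|exact: dQ].
Qed.

Lemma polyf_growth P : polyf P ->
  exists C : R, exists2 m : nat, 0 <= C & forall x, `|P x| <= C * (1 + enorm x) ^+ m.
Proof.
have e1 x : 1 <= 1 + enorm x by rewrite lerDl enorm_ge0.
elim=> [c|i|{}P Q pP [C [m C0 hC]] pQ [D [k D0 hD]]|{}P Q pP [C [m C0 hC]] pQ [D [k D0 hD]]].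
- by exists `|c|; exists 0%N => // x; rewrite expr0 mulr1.
- exists 1; exists 1%N => // x; rewrite mul1r expr1.
  by apply: (le_trans (coord_le_enorm x i)); rewrite lerDr.
- exists (C + D); exists (m + k)%N; first exact: addr_ge0.
  move=> x; apply: (le_trans (ler_normD _ _)); rewrite mulrDl; apply: lerD.
    by apply: (le_trans (hC x)); rewrite ler_wpM2l// ler_weXn2l// leq_addr.
  by apply: (le_trans (hD x)); rewrite ler_wpM2l// ler_weXn2l// leq_addl.
- exists (C * D); exists (m + k)%N; first exact: mulr_ge0.
  by move=> x; rewrite normrM exprD mulrACA ler_pM.
Qed.

Lemma differentiable_expN q x : differentiable q x -> differentiable (fun x => expR (- q x)) x.
Proof.
move=> dq; apply: (@differentiable_comp _ _ _ _ (fun x => - q x) expR).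
  exact: differentiableN.
by apply/derivable1_diffP; exact: derivable_expR.
Qed.

Lemma derive_mul_expN P q v : (forall x, differentiable P x) -> (forall x, differentiable q x) ->
  (fun x => 'D_v (fun x => P x * expR (- q x)) x) =
  (fun x => ('D_v P x + - (1) * (P x * 'D_v q x)) * expR (- q x)).
Proof.
move=> dP dq; apply/funext => x.
have dF y : differentiable (fun x => P x * expR (- q x)) y.
  by apply: differentiableM; [exact: dP|exact: differentiable_expN].
apply: deriv_from_line => //.
have d1 := @is_derive_line _ _ P x v 0 dP.
have d2 := @is_derive_line _ _ q x v 0 dq.
have d3 := is_deriveN d2.
have d4 : is_derive (0 : R) 1 (fun s : R => expR (- q (x + s *: v))) ((- 'D_v q (x + 0 *: v)) * expR (- q (x + 0 *: v))).
  apply: (@is_derive_eq _ _ _ _ _ _ _ _ (is_derive1_comp (is_derive_expR _) d3)).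
  by rewrite /GRing.scale/=; ring.
apply: (@is_derive_eq _ _ _ _ _ _ _ _ (is_deriveM d1 d4)).
by rewrite scale0r addr0 /GRing.scale/=; ring.
Qed.

(** A consequence of [(1 + t / (m+1))^(m+1) <= exp t] with [t = a r^2]; the constant is chosen so
    that [1 + r <= K (1 + t / (m+1))]. *)
Lemma poly_exp_bound (m : nat) (a : R) : 0 < a ->
  exists2 K : R, 0 <= K & forall r : R, 0 <= r -> (1 + r) ^+ m.+1 <= K * expR (a * r ^+ 2).
Proof.
move=> a0; pose K : R := 2 + m.+1%:R / a; have K0 : 0 <= K.
  by rewrite /K addr_ge0// divr_ge0// ltW.
exists (K ^+ m.+1); first exact: exprn_ge0.
move=> r r0; set t := a * r ^+ 2.
have -> : t = (t / m.+1%:R) *+ m.+1 by rewrite -mulr_natr mulfVK.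
rewrite -[_ *+ _]mulr_natr expRM_natr -exprMn; apply: lerXn2r; rewrite ?nnegrE ?addr_ge0 ?mulr_ge0 ?expR_ge0//.
apply: (@le_trans _ _ (K * (1 + t / m.+1%:R))); last by rewrite ler_wpM2l// expR_ge1Dx.
have t0 : 0 <= t by rewrite /t mulr_ge0 ?sqr_ge0// ltW.
have E : m.+1%:R / a * (t / m.+1%:R) = r ^+ 2.
  have M0 : (m.+1%:R : R) != 0 by rewrite pnatr_eq0.
  by rewrite /t; move: M0; move: (m.+1%:R : R) => M M0; field; rewrite M0 gt_eqF.
have h1 : 0 <= 2 * (t / m.+1%:R) by rewrite mulr_ge0// divr_ge0.
have h2 : 0 <= m.+1%:R / a by rewrite divr_ge0// ltW.
have -> : K * (1 + t / m.+1%:R) = 2 + m.+1%:R / a + 2 * (t / m.+1%:R) + r ^+ 2 by rewrite -E /K; ring.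
have hr : r <= 1 + r ^+ 2 by have := sqr_ge0 (r - 2^-1); rewrite expr2; nra.
by move: hr h1 h2; set u := 2 * _; set v := _ / a; lra.
Qed.

(** Every derivative is again a polynomial times [exp (- Q)], and the quadratic lower bound on [Q]
    beats polynomial growth. *)
Lemma polyf_exp_schwartz P Q (a b : R) : 0 < a -> polyf P -> polyf Q ->
  (forall x, a * enorm x ^+ 2 - b <= Q x) ->
  schwartz_fun (fun x => P x * expR (- Q x)).
Proof.
move=> a0 pP pQ hQ s.
have [dQ PQ] := polyf_diff pQ.
suff [P' pP' ->] : exists2 P', polyf P' & partials s (fun x => P x * expR (- Q x)) = (fun x => P' x * expR (- Q x)).
  have [dP' _] := polyf_diff pP'; split=> [x|k].
    by apply: differentiableM; [exact: dP'|exact: differentiable_expN].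
  have [C [m C0 hC]] := polyf_growth pP'.
  have [K K0 hK] := poly_exp_bound (k + m) a0.
  exists (C * K * expR b) => x; set r := enorm x; have r0 : 0 <= r := enorm_ge0 x.
  have r1 : 1 <= 1 + r by rewrite lerDl.
  rewrite normrM [`|expR _|]ger0_norm ?expR_ge0// mulrA.
  have h : r ^+ k * `|P' x| <= C * (K * expR (a * r ^+ 2)).
    apply: (le_trans _ (ler_wpM2l C0 (hK r r0))).
    rewrite exprS exprD mulrCA mulrC.
    apply: (@le_trans _ _ ((C * (1 + r) ^+ m) * (1 + r) ^+ k)).
      apply: ler_pM; [exact: normr_ge0|exact: exprn_ge0|exact: hC|].
      by apply: lerXn2r; rewrite ?nnegrE ?addr_ge0// lerDr.
    have -> : (1 + r) * (C * ((1 + r) ^+ k * (1 + r) ^+ m)) = (C * (1 + r) ^+ m * (1 + r) ^+ k) * (1 + r) by ring.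
    by rewrite ler_peMr// mulr_ge0 ?mulr_ge0 ?exprn_ge0 ?addr_ge0.
  apply: (le_trans (ler_wpM2r (expR_ge0 _) h)).
  rewrite -!mulrA -!expRD; do 2 rewrite ler_wpM2l//.
  by rewrite ler_expR; have := hQ x; rewrite -/r; lra.
elim: s => [|k s [P' pP' IH]]; first by exists P.
have [dP' PP'] := polyf_diff pP'.
exists (fun x => 'D_(ee k) P' x + - (1) * (P' x * 'D_(ee k) Q x)).
  by apply: polyf_add => //; apply: polyf_mul; [exact: polyf_cst|exact: polyf_mul].
by rewrite /= IH derive_mul_expN.
Qed.

End schwartz_closure.

Lemma bernoulli_le (R : realDomainType) (c : R) m : 0 <= c -> 1 + c *+ m <= (1 + c) ^+ m.
Proof.
move=> c0; elim: m => [|m IH]; first by rewrite mulr0n addr0.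
rewrite exprS; apply: (@le_trans _ _ ((1 + c) * (1 + c *+ m))); last by rewrite ler_wpM2l// addr_ge0.
rewrite mulrS; have : 0 <= c * (c *+ m) by rewrite mulr_ge0// mulrn_wge0.
move: (c *+ m) => t ct; have -> : (1 + c) * (1 + t) = 1 + (c + t) + c * t by ring.
by rewrite lerDl.
Qed.

(** * Approximation by Schwartz functions in L^p *)

Section density.
Context (R : realType) (n : nat) (p : R).
Hypothesis p1 : 1 < p.
Local Notation mu := (lebesgue_rv R n).
Implicit Types (f g h : 'rV[R]_n -> R).

Let p0 : 0 < p. Proof. exact: lt_trans ltr01 p1. Qed.

(** The [p]-th power of the norm. The quasi-triangle inequality with constant [2^p] then takes the
    place of Minkowski's, which is enough for density and for null limits. *)
Definition eLp f : \bar R := (\int[mu]_x (`|f x| `^ p)%:E)%E.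

Lemma eLp_ge0 f : (0 <= eLp f)%E.
Proof. by apply: integral_ge0 => x _; rewrite lee_fin powR_ge0. Qed.

Lemma eq_eLp f g : f =1 g -> eLp f = eLp g.
Proof. by move=> fg; congr (integral _ _ _); apply/funext => x; rewrite fg. Qed.

Lemma eLp_le f g : (forall x, `|f x| <= `|g x|) -> (eLp f <= eLp g)%E.
Proof.
move=> fg; apply: int_mono => x; rewrite lee_fin ?powR_ge0//.
by apply: ge0_ler_powR; rewrite ?nnegrE// ltW.
Qed.

Lemma measurable_norm_powR f : measurable_fun setT f -> measurable_fun setT (fun x => `|f x| `^ p).
Proof. by move=> mf; apply: measurable_fun_powR; exact: measurableT_comp. Qed.

Lemma eLpD f g : measurable_fun setT f -> measurable_fun setT g ->
  (eLp (fun x => (f x + g x)%R) <= (2 `^ p)%:E * (eLp f + eLp g))%E.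
Proof.
move=> mf mg; have Mf := measurable_norm_powR mf; have Mg := measurable_norm_powR mg.
have E : (eLp f + eLp g = \int[mu]_x (`|f x| `^ p + `|g x| `^ p)%:E)%E.
  by rewrite /eLp -ge0_integralD//; exact/measurable_EFinP.
rewrite E -int_Zl; [|exact: powR_ge0|exact: measurable_funD|by move=> x; rewrite addr_ge0 ?powR_ge0].
apply: int_mono => x; rewrite lee_fin ?powR_ge0//.
apply: (le_trans _ (powRD_le (normr_ge0 _) (normr_ge0 _) (ltW p0))).
by apply: ge0_ler_powR; rewrite ?nnegrE ?ler_normD ?addr_ge0// ltW.
Qed.

Lemma eLpZ c f : measurable_fun setT f -> eLp (fun x => (c * f x)%R) = ((`|c| `^ p)%:E * eLp f)%E.
Proof.
move=> mf; rewrite /eLp -int_Zl; [|exact: powR_ge0|exact: measurable_norm_powR|by move=> x; exact: powR_ge0].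
by congr (integral _ _ _); apply/funext => x; rewrite normrM powRM.
Qed.

Lemma eLpN f : eLp (fun x => (- f x)%R) = eLp f.
Proof. by congr (integral _ _ _); apply/funext => x; rewrite normrN. Qed.

Lemma eLp_dist f g h : measurable_fun setT f -> measurable_fun setT g -> measurable_fun setT h ->
  (eLp (fun x => (f x - h x)%R) <= (2 `^ p)%:E * (eLp (fun x => (f x - g x)%R) + eLp (fun x => (g x - h x)%R)))%E.
Proof.
move=> mf mg mh; rewrite (@eq_eLp _ (fun x => (f x - g x) + (g x - h x))); last by move=> x; ring.
by apply: eLpD; exact: measurable_funB.
Qed.

Lemma LpfD f g : Lpf p f -> Lpf p g -> Lpf p (fun x => f x + g x).
Proof.
move=> [mf ff] [mg gf]; split; first exact: measurable_funD.
have h := eLpD mf mg; apply: (le_lt_trans h); apply: lte_mul_pinfty; [by rewrite lee_fin powR_ge0|by []|exact: lte_add_pinfty].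
Qed.

Lemma LpfZ c f : Lpf p f -> Lpf p (fun x => c * f x).
Proof.
move=> [mf ff]; split; first exact: measurable_funM.
rewrite -/(eLp _) eLpZ//; apply: lte_mul_pinfty; [by rewrite lee_fin powR_ge0|by []|exact: ff].
Qed.

Lemma LpfB f g : Lpf p f -> Lpf p g -> Lpf p (fun x => f x - g x).
Proof.
move=> lf lg; have := LpfD lf (LpfZ (-1) lg).
by under eq_fun do rewrite mulN1r.
Qed.

Lemma Lpf_norm f : Lpf p f -> Lpf p (fun x => `|f x|).
Proof.
move=> [mf ff]; split; first exact: measurableT_comp.
by under eq_integral do rewrite normr_id.
Qed.

Lemma Lpf_le f g : measurable_fun setT f -> (forall x, `|f x| <= `|g x|) -> Lpf p g -> Lpf p f.
Proof. by move=> mf fg [_ gf]; split=> //; exact: (le_lt_trans (eLp_le fg)). Qed.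

Lemma Lpf0 : Lpf p (fun _ : 'rV[R]_n => 0).
Proof.
split; first exact: measurable_cst.
by under eq_integral do rewrite normr0 powR0 ?gt_eqF//; rewrite integral0.
Qed.

Lemma Lpf_sum (I : Type) (r : seq I) (F : I -> 'rV[R]_n -> R) :
  (forall i, Lpf p (F i)) -> Lpf p (fun x => \sum_(i <- r) F i x).
Proof.
move=> sF; elim: r => [|i r IH].
  have -> : (fun x => \sum_(i <- [::]) F i x) = (fun=> 0) by apply/funext => x; rewrite big_nil.
  exact: Lpf0.
have -> : (fun x => \sum_(j <- i :: r) F j x) = (fun x => F i x + \sum_(j <- r) F j x).
  by apply/funext => x; rewrite big_cons.
exact: LpfD.
Qed.

Lemma intg_Lpf f : Lpf p f -> intg mu (fun x => `|f x| `^ p).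
Proof.
move=> [mf ff]; apply: intgP; first exact: measurable_norm_powR.
by under eq_integral do rewrite ger0_norm ?powR_ge0//.
Qed.

Lemma eLp_dct (f_ : nat -> 'rV[R]_n -> R) f g : (forall k, measurable_fun setT (f_ k)) ->
  (forall x, f_ k x @[k --> \oo] --> f x) -> Lpf p g -> (forall k x, `|f_ k x| <= g x) ->
  Lpf p f /\ forall d : R, 0 < d -> exists k0, forall k, (k0 <= k)%N -> (eLp (fun x => (f_ k x - f x)%R) < d%:E)%E.
Proof.
move=> mf cf lg fg.
have mlim : measurable_fun setT f by exact: measurable_fun_cvg (fun x _ => cf x).
have fg' x : `|f x| <= g x.
  have c : `|f_ k x| @[k --> \oo] --> `|f x| by apply: cvg_norm; exact: cf.
  have <- := cvg_lim (@Rhausdorff R) c; apply: limr_le; first by apply/cvg_ex; exists `|f x|.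
  by apply: nearW => k; exact: fg.
have g0 x : `|g x| = g x by rewrite ger0_norm// (le_trans _ (fg' x)).
have lf : Lpf p f by apply: (Lpf_le mlim _ lg) => x; rewrite g0.
split=> // d d0.
pose u k x := `|f_ k x - f x| `^ p.
have mu_ k : measurable_fun setT (u k) by apply: measurable_norm_powR; exact: measurable_funB.
have ub k x : `|u k x| <= 2 `^ p * `|g x| `^ p.
  rewrite ger0_norm ?powR_ge0// -powRM//; apply: ge0_ler_powR; rewrite ?nnegrE ?mulr_ge0 ?(ltW p0)//.
  apply: (le_trans (ler_normB _ _)); rewrite g0.
  by have := fg k x; have := fg' x; lra.
have [] := @Rint_dct _ _ R mu u (fun=> 0) (fun x => 2 `^ p * `|g x| `^ p) mu_ _ _ ub.
- move=> x; rewrite -(powR0 (lt0r_neq0 p0)); apply: cvg_powR => //.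
  have -> : (0 : R) = `|f x - f x| by rewrite subrr normr0.
  by apply: cvg_norm; apply: cvgB; [exact: cf|exact: cvg_cst].
- by apply: intgZ; exact: intg_Lpf.
move=> _; rewrite Rintegral_cst// mul0r => /cvgr0Pnorm_lt /(_ _ d0)[N _ hN].
exists N => k Nk; have := hN k Nk.
have iu : intg mu (u k) by apply: intg_le (mu_ k) (ub k) _; apply: intgZ; exact: intg_Lpf.
move=> /(le_lt_trans (ler_norm _)); rewrite -lte_fin EFin_Rint//.
Qed.

Definition apx f := Lpf p f /\ forall d : R, 0 < d ->
  exists2 phi, schwartz_fun phi & (eLp (fun x => (phi x - f x)%R) < d%:E)%E.

Lemma eLp0 : eLp (fun=> 0) = 0%E.
Proof. by rewrite /eLp; under eq_integral do rewrite normr0 powR0 ?gt_eqF//; rewrite integral0. Qed.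

Lemma apx_schwartz f : schwartz_fun f -> apx f.
Proof.
move=> sf; split; first exact: schwartz_Lpf.
move=> d d0; exists f => //; rewrite (@eq_eLp _ (fun=> 0)) ?eLp0 ?lte_fin//.
by move=> x; rewrite subrr.
Qed.

Let C : R := 2 `^ p.
Let C0 : 0 < C. Proof. by rewrite powR_gt0. Qed.

Let half (d : R) (a b : \bar R) : (a < (d / (2 * C))%:E)%E -> (b < (d / (2 * C))%:E)%E ->
  (C%:E * (a + b) < d%:E)%E.
Proof.
move=> ha hb; have -> : d%:E = (C%:E * (d / (2 * C) + d / (2 * C))%R%:E)%E.
  by rewrite -EFinM; congr EFin; field; rewrite gt_eqF.
by rewrite lte_pmul2l// EFinD; exact: lteD.
Qed.

Lemma apxD f g : apx f -> apx g -> apx (fun x => f x + g x).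
Proof.
move=> [lf hf] [lg hg]; split; first exact: LpfD.
move=> d d0; have e0 : 0 < d / (2 * C) by rewrite divr_gt0// mulr_gt0.
have [u su hu] := hf _ e0; have [v sv hv] := hg _ e0.
exists (fun x => u x + v x); first exact: schwartzD.
have mu' := schwartz_measurable su; have mv := schwartz_measurable sv.
rewrite (@eq_eLp _ (fun x => (u x - f x) + (v x - g x))); last by move=> x; ring.
by apply: (le_lt_trans _ (half hu hv)); apply: eLpD; apply: measurable_funB => //; [exact: lf.1|exact: lg.1].
Qed.

Lemma apxZ c f : apx f -> apx (fun x => c * f x).
Proof.
move=> [lf hf]; split; first exact: LpfZ.
move=> d d0; pose a : R := `|c| `^ p + 1; have a0 : 0 < a by rewrite /a ltr_wpDl// powR_ge0.
have e0 : 0 < d / a by rewrite divr_gt0.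
have [u su hu] := hf _ e0.
exists (fun x => c * u x); first exact: schwartzZ.
have mu' := schwartz_measurable su.
rewrite (@eq_eLp _ (fun x => c * (u x - f x))); last by move=> x; ring.
rewrite eLpZ; last by apply: measurable_funB => //; exact: lf.1.
apply: (@le_lt_trans _ _ (a%:E * eLp (fun x => (u x - f x)%R))%E).
  by apply: lee_wpmul2r; rewrite ?eLp_ge0// lee_fin lerDl.
have -> : d%:E = (a%:E * (d / a)%:E)%E by rewrite -EFinM mulrC divfK ?gt_eqF.
by rewrite lte_pmul2l.
Qed.

Lemma apx0 : apx (fun=> 0).
Proof. exact: apx_schwartz (@schwartz0 R n). Qed.

Lemma apx_sum (I : Type) (r : seq I) (F : I -> 'rV[R]_n -> R) :
  (forall i, apx (F i)) -> apx (fun x => \sum_(i <- r) F i x).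
Proof.
move=> sF; elim: r => [|i r IH].
  have -> : (fun x => \sum_(i <- [::]) F i x) = (fun=> 0) by apply/funext => x; rewrite big_nil.
  exact: apx0.
have -> : (fun x => \sum_(j <- i :: r) F j x) = (fun x => F i x + \sum_(j <- r) F j x).
  by apply/funext => x; rewrite big_cons.
exact: apxD.
Qed.

(** Closure under dominated pointwise limits drives the whole density proof: boxes, measurable sets
    and nonnegative functions are each reached by such a limit. *)
Lemma apx_lim (f_ : nat -> 'rV[R]_n -> R) f g : (forall k, apx (f_ k)) ->
  (forall x, f_ k x @[k --> \oo] --> f x) -> Lpf p g -> (forall k x, `|f_ k x| <= g x) -> apx f.
Proof.
move=> af cf lg fg.
have [lf hl] := eLp_dct (fun k => (af k).1.1) cf lg fg.
split=> // d d0; have e0 : 0 < d / (2 * C) by rewrite divr_gt0// mulr_gt0.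
have [k0 /(_ k0 (leqnn _)) hk] := hl _ e0.
have [u su hu] := (af k0).2 _ e0; exists u => //.
have mu' := schwartz_measurable su.
by apply: (le_lt_trans _ (half hu hk)); apply: eLp_dist => //; [exact: (af k0).1.1|exact: lf.1].
Qed.

Definition box (lo hi x : 'rV[R]_n) : bool := [forall i, lo 0 i <= x 0 i <= hi 0 i].

(** [exp (- bump)] tends at every point to the indicator of the closed box with centre [a] and
    half-widths [r], while being a Schwartz function. The exponents are even, so the polynomial is
    nonnegative. *)
Let bump (a r : 'rV[R]_n) (k : nat) (x : 'rV[R]_n) : R :=
  \sum_i ((r 0 i + k.+1%:R^-1)^-1 * (x 0 i - a 0 i)) ^+ (2 * k.+1 ^ 2).

Let dom (a r x : 'rV[R]_n) : R := \sum_i ((r 0 i + 1)^-1 * (x 0 i - a 0 i)) ^+ 2.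

Let polyf_lin (c b : R) i : polyf (fun x : 'rV[R]_n => c * (x 0 i - b)).
Proof.
apply: polyf_mul; first exact: polyf_cst.
by apply: (@polyf_add _ _ _ (fun=> - b)); [exact: polyf_coord|exact: polyf_cst].
Qed.

Let inv_le1 (k : nat) : 0 < (k.+1%:R : R)^-1 <= 1.
Proof. by rewrite invr_gt0 ltr0n invf_le1 ?ltr0n// ler1n. Qed.

(** A square is at most 1 or at most its higher powers, so each coordinate loses at most 1. This
    yields a domination independent of [k]. *)
Let dom_le_bump (a r : 'rV[R]_n) k (x : 'rV[R]_n) : (forall i, 0 <= r 0 i) -> dom a r x - n%:R <= bump a r k x.
Proof.
move=> r0; have -> : (n%:R : R) = \sum_(i < n) 1 by rewrite sumr_const card_ord.
rewrite -sumrB; apply: ler_sum => i _.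
have /andP[k0 k1] := inv_le1 k; move: k0 k1; set e : R := _^-1 => k0 k1.
have ri := r0 i; set y := x 0 i - a 0 i.
set t := ((r 0 i + e)^-1 * y) ^+ 2.
have t0 : 0 <= t := sqr_ge0 _.
have ht : ((r 0 i + 1)^-1 * y) ^+ 2 <= t.
  rewrite /t !exprMn ler_wpM2r ?sqr_ge0//; apply: lerXn2r; rewrite ?nnegrE ?invr_ge0; try lra.
  by rewrite lef_pV2 ?posrE; lra.
rewrite exprM -/t.
have [t1|t1] := leP t 1.
  have t2 : 0 <= t ^+ (k.+1 ^ 2)%N by exact: exprn_ge0.
  by move: ht t1 t2; set u := (_ * _) ^+ 2; set v := t ^+ _; lra.
have : t <= t ^+ (k.+1 ^ 2)%N by apply: ler_eXnr; [rewrite expn_gt0|exact: ltW].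
by move: ht; set u := (_ * _) ^+ 2; set v := t ^+ _; lra.
Qed.

Let dom_coercive (a r : 'rV[R]_n) : (forall i, 0 <= r 0 i) ->
  exists c b : R, 0 < c /\ forall x : 'rV[R]_n, c * enorm x ^+ 2 - b <= dom a r x.
Proof.
move=> r0; pose M := 1 + 2 * \sum_i (r 0 i + 1) ^+ 2.
have s0 : 0 <= \sum_i (r 0 i + 1) ^+ 2 by apply: sumr_ge0 => i _; exact: sqr_ge0.
have M0 : 0 < M by rewrite /M; lra.
exists M^-1; exists (\sum_i a 0 i ^+ 2); split; first by rewrite invr_gt0.
move=> x; rewrite enorm2 /dotv mulr_sumr -sumrB; apply: ler_sum => i _.
have ri := r0 i; set s := r 0 i + 1; have s1 : 1 <= s by rewrite /s; lra.
have sM : 2 * s ^+ 2 <= M.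
  rewrite /M (bigD1 i)//= -/s mulrDr.
  have : 0 <= \sum_(j | j != i) (r 0 j + 1) ^+ 2 by apply: sumr_ge0 => j _; exact: sqr_ge0.
  lra.
have si0 : 0 <= s^-1 by rewrite invr_ge0; lra.
have si1 : s^-1 <= 1 by rewrite invf_le1//; lra.
have hM : M^-1 <= s^-1 ^+ 2 / 2.
  have -> : s^-1 ^+ 2 / 2 = (2 * s ^+ 2)^-1 by rewrite exprVn [RHS]invfM mulrC.
  by rewrite lef_pV2// posrE mulr_gt0// exprn_gt0//; lra.
apply: (@le_trans _ _ (s^-1 ^+ 2 / 2 * (x 0 i * x 0 i) - s^-1 ^+ 2 * a 0 i ^+ 2)).
  apply: lerB; first by rewrite ler_wpM2r// -expr2 sqr_ge0.
  by rewrite ler_piMl ?sqr_ge0// expr_le1.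
rewrite exprMn.
have : 0 <= s^-1 ^+ 2 * (x 0 i - 2 * a 0 i) ^+ 2 by rewrite mulr_ge0 ?sqr_ge0.
rewrite !expr2; nra.
Qed.

Let schwartz_dom (a r : 'rV[R]_n) (b : R) : (forall i, 0 <= r 0 i) ->
  schwartz_fun (fun x => b * expR (- dom a r x)).
Proof.
move=> r0; have [c [d [c0 h]]] := dom_coercive a r0.
apply: (polyf_exp_schwartz c0) h; first exact: polyf_cst.
by apply: polyf_sum => i; apply: polyf_exp; exact: polyf_lin.
Qed.

Let schwartz_bump (a r : 'rV[R]_n) k : (forall i, 0 <= r 0 i) ->
  schwartz_fun (fun x => 1 * expR (- bump a r k x)).
Proof.
move=> r0; have [c [d [c0 h]]] := dom_coercive a r0.
apply: (@polyf_exp_schwartz _ _ _ _ c (d + n%:R) c0); first exact: polyf_cst.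
  by apply: polyf_sum => i; apply: polyf_exp; exact: polyf_lin.
by move=> x; apply: (le_trans _ (dom_le_bump a k x r0)); have := h x; lra.
Qed.

(** The delicate case is the boundary [|y| = r]: there the base is below 1 only by about [1 / k],
    and the exponent of order [k^2] still forces the power to 0. *)
Let bump_in (r y : R) : 0 <= r -> `|y| <= r ->
  ((r + k.+1%:R^-1)^-1 * y) ^+ (2 * k.+1 ^ 2) @[k --> \oo] --> (0 : R).
Proof.
move=> r0 yr.
apply: (@squeeze_cvgr _ _ _ _ (fun=> 0) (fun k : nat => (r + 1) * (k.+1%:R : R)^-1)); last 2 first.
- exact: cvg_cst.
- rewrite -[X in _ --> X](mulr0 (r + 1)); apply: cvgMr; exact: cvg_invS.
apply: nearW => k; rewrite exprM; set t := (_ * y) ^+ 2.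
have t0 : 0 <= t := sqr_ge0 _.
rewrite exprn_ge0//=.
have /andP[k0 k1] := inv_le1 k; move: k0 k1 @t t0; set e : R := _^-1 => k0 k1 t t0.
have re : 0 < r + e by lra.
have h1 : `|(r + e)^-1 * y| <= expR (- (e / (r + e))).
  rewrite normrM ger0_norm ?invr_ge0 ?(ltW re)//.
  apply: (@le_trans _ _ (1 - e / (r + e))); last exact: expR_ge1Dx.
  have -> : 1 - e / (r + e) = (r + e)^-1 * r by field; rewrite gt_eqF.
  by rewrite ler_wpM2l// invr_ge0 ltW.
have h2 : t <= expR (- (2 * (e / (r + e)))).
  have -> : expR (- (2 * (e / (r + e)))) = expR (- (e / (r + e))) ^+ 2.
    by rewrite -expRM_natr; congr expR; ring.
  by rewrite /t -[_ ^+ 2]real_normK ?num_real//; apply: lerXn2r; rewrite ?nnegrE ?expR_ge0.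
have ke : k.+1%:R * e = 1 by rewrite /e mulfV.
apply: (@le_trans _ _ (expR (- (2 * (e / (r + e)))) ^+ (k.+1 ^ 2)%N)).
  by apply: lerXn2r; rewrite ?nnegrE ?expR_ge0.
rewrite -expRM_natr natrX.
have -> : - (2 * (e / (r + e))) * k.+1%:R ^+ 2 = - (2 * (k.+1%:R / (r + e))).
  have -> : - (2 * (e / (r + e))) * k.+1%:R ^+ 2 = - (2 * ((k.+1%:R * e) * (k.+1%:R / (r + e)))).
    by rewrite expr2; move: (k.+1%:R : R) (r + e)^-1 => K I; ring.
  by rewrite ke mul1r.
set w := 2 * _; have w0 : 0 <= w by rewrite /w mulr_ge0// divr_ge0// ltW.

rewrite expRN; apply: (@le_trans _ _ (1 + w)^-1).
  by rewrite lef_pV2 ?posrE ?expR_gt0 ?expR_ge1Dx//; lra.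
have kw : k.+1%:R / (r + 1) <= 1 + w.
  apply: (@le_trans _ _ (k.+1%:R / (r + e))); last first.
    have : 0 <= k.+1%:R / (r + e) by rewrite divr_ge0// ltW.
    by rewrite /w; set v := _ / (r + e); lra.
  by rewrite ler_wpM2l// lef_pV2 ?posrE; lra.
have -> : (r + 1) * e = (k.+1%:R / (r + 1))^-1 by rewrite invfM invrK mulrC.
by rewrite lef_pV2 ?posrE//; [lra|rewrite divr_gt0//; lra].
Qed.

(** Outside the box the square of the base eventually exceeds a fixed [1 + c], and Bernoulli's
    inequality gives divergence. *)
Let bump_out (r y : R) : 0 <= r -> r < `|y| ->
  ((r + k.+1%:R^-1)^-1 * y) ^+ (2 * k.+1 ^ 2) @[k --> \oo] --> +oo.
Proof.
move=> r0 ry; pose d : R := `|y| - r; have d0 : 0 < d by rewrite subr_gt0.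
pose c : R := d / (r + d / 2); have c0 : 0 < c by rewrite divr_gt0//; lra.
apply: (@ger_cvgy _ _ _ _ (fun k : nat => c * k.+1%:R)); last first.
  apply/cvgryPge => A; move/cvgryPge : (@cvg_natS R) => /(_ (A / c))[K _ hK].
  by exists K => // k /hK /=; rewrite ler_pdivrMr// mulrC.
have d2 : 0 < d / 2 by lra.
have [k0 _ hk] := near_infty_natSinv_lt (PosNum d2).
exists k0 => // k /hk /= ke; rewrite exprM.
have /andP[e0 e1] := inv_le1 k; move: ke e0 e1; set e : R := k.+1%:R^-1 => ke e0 e1.
have h : 1 + c / 2 <= `|(r + e)^-1 * y|.
  rewrite normrM ger0_norm ?invr_ge0; last lra.
  have -> : 1 + c / 2 = (r + d / 2)^-1 * `|y|.
    have -> : `|y| = r + d by rewrite /d; ring.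
    by rewrite /c; field; rewrite gt_eqF//; lra.
  by rewrite ler_wpM2r// lef_pV2 ?posrE; lra.
have h2 : 1 + c <= ((r + e)^-1 * y) ^+ 2.
  rewrite -[leRHS]real_normK ?num_real//.
  apply: (@le_trans _ _ ((1 + c / 2) ^+ 2)); first by rewrite sqrrD expr1n; have := sqr_ge0 (c / 2); lra.
  by apply: lerXn2r; rewrite ?nnegrE//; lra.
apply: (@le_trans _ _ ((1 + c) ^+ (k.+1 ^ 2)%N)).
  apply: (@le_trans _ _ (1 + c *+ (k.+1 ^ 2)%N)); last first.
    by apply: bernoulli_le; exact: ltW.
  rewrite -[c *+ _]mulr_natr natrX expr2.
  have k1 : 1 <= k.+1%:R :> R by rewrite ler1n.
  have : c * k.+1%:R <= c * (k.+1%:R * k.+1%:R) by rewrite ler_wpM2l ?ler_peMr// ltW.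
  lra.
by apply: lerXn2r; rewrite ?nnegrE//; [lra|exact: sqr_ge0].
Qed.

Lemma apx_box (lo hi : 'rV[R]_n) : apx (fun x => (box lo hi x)%:R).
Proof.
have [lh|] := boolP [forall i, lo 0 i <= hi 0 i]; last first.
  rewrite negb_forall => /existsP[i]; rewrite -ltNge => hl.
  rewrite (_ : (fun _ => _) = (fun=> 0)); first exact: apx0.
  apply/funext => x; rewrite (_ : box lo hi x = false)//; apply/negbTE.
  rewrite negb_forall; apply/existsP; exists i; apply/negP => /andP[h1 h2].
  by have := le_trans h1 h2; rewrite leNgt hl.
pose a : 'rV[R]_n := \row_i ((lo 0 i + hi 0 i) / 2).
pose r : 'rV[R]_n := \row_i ((hi 0 i - lo 0 i) / 2).
have r0 i : 0 <= r 0 i by rewrite mxE divr_ge0// subr_ge0; exact: (forallP lh).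
have boxE i (x : 'rV[R]_n) : (lo 0 i <= x 0 i <= hi 0 i) = (`|x 0 i - a 0 i| <= r 0 i).
  by rewrite !mxE ler_norml; apply/idP/idP => /andP[h1 h2]; apply/andP; split; lra.
apply: (@apx_lim (fun k x => 1 * expR (- bump a r k x)) _ (fun x => expR n%:R * expR (- dom a r x))).
- by move=> k; apply: apx_schwartz; exact: schwartz_bump.
- move=> x; under eq_fun do rewrite mul1r.
  have b0 i k : 0 <= ((r 0 i + k.+1%:R^-1)^-1 * (x 0 i - a 0 i)) ^+ (2 * k.+1 ^ 2).
    by rewrite exprM exprn_ge0// sqr_ge0.
  have [bx|] := boolP (box lo hi x).
    have -> : (true%:R : R) = expR (- 0) by rewrite oppr0 expR0.
    apply: (@cvg_comp _ _ _ (fun k => - bump a r k x) expR); last exact: continuous_expR.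
    apply: cvgN; have -> : (0 : R) = \sum_(i < n) 0 by rewrite big1.
    apply: cvg_big => [|i _]; first exact: add_continuous; apply: bump_in => //; rewrite -boxE; exact: (forallP bx).
  rewrite negb_forall => /existsP[i]; rewrite boxE -ltNge => ri.
  apply: (@squeeze_cvgr _ _ _ _ (fun=> 0) (fun k : nat => (((r 0 i + k.+1%:R^-1)^-1 * (x 0 i - a 0 i)) ^+ (2 * k.+1 ^ 2))^-1)).
  - move/cvgryPgt : (bump_out (r0 i) ri) => /(_ 0)[K _ hK]; exists K => // k /hK /= h.
    rewrite expR_ge0/= expRN lef_pV2 ?posrE ?expR_gt0//.
    apply: (@le_trans _ _ (1 + bump a r k x)); last exact: expR_ge1Dx.
    rewrite /bump (bigD1 i)//=.
    have : 0 <= \sum_(j | j != i) ((r 0 j + k.+1%:R^-1)^-1 * (x 0 j - a 0 j)) ^+ (2 * k.+1 ^ 2).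
      by apply: sumr_ge0 => j _.
    set u := \sum_(_ | _) _; set v := _ ^+ _; lra.
  - exact: cvg_cst.
  - have h := bump_out (r0 i) ri; move/cvgryPgt : (h) => /(_ 0) hp.
    exact: (proj2 (gtr0_cvgV0 hp) h).
- by apply: schwartz_Lpf => //; exact: schwartz_dom.
- move=> k x; rewrite mul1r ger0_norm ?expR_ge0// -expRD ler_expR.
  by have := dom_le_bump a k x r0; lra.
Qed.

End density.

Section simple_approximation.
Import HBNNSimple.

(** The simple functions are presented as explicit sums over values and level sets, the form to
    which closure under sums and multiples applies. *)
Lemma simple_approximation d (T : measurableType d) (R : realType) (f : T -> R) :
  measurable_fun setT f -> (forall x, 0 <= f x) ->
  exists (r : nat -> seq R) (A : nat -> R -> set T),
    let g k x := \sum_(y <- r k) (y * \1_(A k y) x) in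
    [/\ forall k y, measurable (A k y), forall k x, 0 <= g k x <= f x &
      forall x, g k x @[k --> \oo] --> f x].
Proof.
move=> mf f0; have mfE : measurable_fun setT (EFin \o f) by apply/measurable_EFinP.
pose g := nnsfun_approx measurableT mfE.
have cg x : g k x @[k --> \oo] --> f x.
  have := @cvg_nnsfun_approx _ _ _ _ measurableT _ mfE (fun x _ => f0 x) x I.
  by move/fine_cvgP => [].
exists (fun k => finmap.enum_fset (fset_set (range (g k)))), (fun k y => g k @^-1` [set y]) => /=.
have E k x : \sum_(y <- finmap.enum_fset (fset_set (range (g k)))) (y * \1_(g k @^-1` [set y]) x) = g k x.
  by rewrite fimfunE fsbig_finite.
split.
- by move=> k y; exact: measurable_sfunP.
- move=> k x; rewrite E; apply/andP; split; first by [].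
  have nd : nondecreasing_seq (fun k => g k x).
    by move=> a b ab; have /lefP := nd_nnsfun_approx measurableT mfE ab; apply.
  have <- := cvg_lim (@Rhausdorff R) (cg x).
  by apply: nondecreasing_cvgn_le => //; apply/cvg_ex; exists (f x).
- by move=> x; under eq_fun do rewrite E; exact: cg.
Qed.

End simple_approximation.

(** * From boxes to measurable sets to L^p functions *)

Section schwartz_dense.
Context (R : realType) (n : nat) (p : R).
Hypothesis p1 : 1 < p.
Local Notation mu := (lebesgue_rv R n).
Implicit Types (f g h : 'rV[R]_n -> R) (A : set 'rV[R]_n).
Let p0 : 0 < p. Proof. exact: lt_trans ltr01 p1. Qed.

Let boxes : set (set 'rV[R]_n) := [set A | exists lo hi : 'rV[R]_n, A = [set x | box lo hi x]].

Let boxI (lo hi lo' hi' x : 'rV[R]_n) : box lo hi x && box lo' hi' x =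
  box (\row_i Num.max (lo 0 i) (lo' 0 i)) (\row_i Num.min (hi 0 i) (hi' 0 i)) x.
Proof.
apply/andP/forallP => [[/forallP a /forallP b] i|h].
  have /andP[a1 a2] := a i; have /andP[b1 b2] := b i.
  by rewrite !mxE ge_max le_min a1 a2 b1 b2.
split; apply/forallP => i; have := h i; rewrite !mxE ge_max le_min.
  by move=> /andP[/andP[-> _] /andP[-> _]].
by move=> /andP[/andP[_ ->] /andP[_ ->]].
Qed.

Let measurable_boxb (lo hi : 'rV[R]_n) : measurable [set x : 'rV[R]_n | box lo hi x].
Proof.
have -> : [set x : 'rV[R]_n | box lo hi x] = [set x | forall i, `[lo 0 i, hi 0 i]%classic (x 0 i)].
  by apply/seteqP; split => x /=; [move/forallP => h i; rewrite /= in_itv/=; exact: h|move=> h; apply/forallP => i; have := h i; rewrite /= in_itv].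
by apply: (@measurable_box R n (fun i => `[lo 0 i, hi 0 i]%classic)) => i; exact: measurable_itv.
Qed.

(** A half-space [x_i >= r] is the countable union of boxes with lower bound [r] in coordinate [i]
    and [- k] in the others, all upper bounds being [k]. *)
Let measurable_boxesE : @measurable _ 'rV[R]_n = <<s boxes >>.
Proof.
apply/seteqP; split; last first.
  by apply: smallest_sub; [exact: sigma_algebra_measurable|move=> _ [lo [hi ->]]; exact: measurable_boxb].
move=> A mA.
have mid : measurable_fun setT (id : g_sigma_algebraType boxes -> 'rV[R]_n).
  apply: measurable_fun_rvP => i.
  apply: (measurability (@RGenCInfty.G R)) => [|/= _ [_] [r] -> <-]; first exact: RGenCInfty.measurableE.
  rewrite setTI.
  have -> : (fun x : g_sigma_algebraType boxes => (x : 'rV[R]_n) 0 i : measurableTypeR R) @^-1` `[r, +oo[%classic =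
      \bigcup_(k : nat) [set x : 'rV[R]_n | box (\row_j if j == i then r else - k%:R) (const_mx k%:R) x].
    apply/seteqP; split => x /=.
      rewrite in_itv/= andbT => rx; pose M := \sum_j `|x 0 j|.
      have xM j : `|x 0 j| <= M by rewrite /M (bigD1 j)//= lerDl sumr_ge0.
      exists (Num.truncn M).+1 => //=; apply/forallP => j; rewrite !mxE.
      have MK : M <= (Num.truncn M).+1%:R by rewrite ltW// truncnS_gt.
      have := le_trans (xM j) MK; rewrite ler_norml => /andP[h1 h2].
      by rewrite h2 andbT; case: eqP => [->|].
    move=> [k _ /forallP /(_ i)] /=; rewrite !mxE eqxx in_itv/= andbT.
    by move=> /andP[].
  apply: bigcup_measurable => k _; apply: sub_sigma_algebra.
  by exists (\row_j if j == i then r else - k%:R), (const_mx k%:R).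
by have := mid measurableT _ mA; rewrite setTI preimage_id.
Qed.

Let cube (k : nat) (x : 'rV[R]_n) : R := (box (const_mx (- k%:R)) (const_mx k%:R) x)%:R.

Let cube01 k x : 0 <= cube k x <= 1.
Proof. by rewrite /cube; case: (box _ _ _); rewrite ?lexx ?ler01. Qed.

Let apx_cube k : apx p (cube k). Proof. exact: apx_box. Qed.

(** Boxes form a generating class stable under intersection, so a Dynkin argument applies. The
    cut-off by a cube gives all indicators a common dominating L^p function, as countable disjoint
    unions require. *)
Lemma apx_indic A : measurable A -> forall k, apx p (fun x => \1_A x * cube k x).
Proof.
rewrite measurable_boxesE => sA.
apply: (@dynkin_induction _ 'rV[R]_n boxes (fun A => forall k, apx p (fun x => \1_A x * cube k x)) measurable_boxesE) sA.
- move=> _ _ [lo [hi ->]] [lo' [hi' ->]].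
  exists (\row_i Num.max (lo 0 i) (lo' 0 i)), (\row_i Num.min (hi 0 i) (hi' 0 i)).
  by apply/seteqP; split => x /=; rewrite -boxI => /andP.
- move=> k; have -> : (fun x => \1_[set: 'rV[R]_n] x * cube k x) = cube k.
    by apply/funext => x; rewrite indicT mul1r.
  exact: apx_cube.
- move=> _ [lo [hi ->]] k.
  have -> : (fun x => \1_[set x | box lo hi x] x * cube k x) =
      (fun x => (box (\row_i Num.max (lo 0 i) ((const_mx (- k%:R) : 'rV[R]_n) 0 i)) (\row_i Num.min (hi 0 i) ((const_mx k%:R : 'rV[R]_n) 0 i)) x)%:R : R).
    apply/funext => x; rewrite -boxI /cube indicE.
    have -> : (x \in [set x | box lo hi x]) = box lo hi x by apply/idP/idP; rewrite inE.
    by case: (box _ _ _); rewrite ?mul1r ?mul0r.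
  exact: apx_box.
- move=> S mS hS k.
  have -> : (fun x => \1_(~` S) x * cube k x) = (fun x => cube k x + (-1) * (\1_S x * cube k x)).
    apply/funext => x; rewrite !indicE in_setC; case: (x \in S) => /=; ring.
  exact: (@apxD R n p p1 _ _ (apx_cube k) (@apxZ R n p (-1) _ (hS k))).
- move=> F mF tF hF k.
  apply: (@apx_lim R n p p1 (fun m x => \sum_(i <- iota 0 m) (\1_(F i) x * cube k x)) _ (cube k)).
  + by move=> m; apply: (@apx_sum R n p p1) => i; exact: hF.
  + move=> x; rewrite indicE.
    have [|Fx] := boolP (x \in \bigcup_k F k).
      rewrite inE => -[j _ Fj].
      apply: cvg_near_cst; exists j.+1 => // m /= jm.
      rewrite (bigD1_seq j) ?mem_iota ?iota_uniq//= indicE mem_set// big1 ?addr0//.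
      move=> i ij; rewrite indicE memNset ?mul0r// => Fi.
      by move/trivIsetP : tF => /(_ i j I I ij); apply/eqP/set0P; exists x.
    apply: cvg_near_cst; apply: nearW => m; rewrite big1 ?mul0r// => i _.
    rewrite indicE memNset ?mul0r// => Fi; move: Fx; rewrite notin_setE; apply.
    by exists i.
  + exact: (apx_cube k).1.
  + move=> m x; have /andP[c0 c1] := cube01 k x.
    rewrite ger0_norm; last by apply: sumr_ge0 => i _; rewrite mulr_ge0.
    rewrite -mulr_suml -[leRHS]mul1r ler_wpM2r//.
    have [[j jm Fj]|nF] := pselect (exists2 j, (j < m)%N & F j x).
      rewrite (bigD1_seq j) ?mem_iota ?iota_uniq//= indicE mem_set// big1 ?addr0//.
      move=> i ij; rewrite indicE memNset// => Fi.
      by move/trivIsetP : tF => /(_ i j I I ij); apply/eqP/set0P; exists x.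
    rewrite big_seq big1// => i; rewrite mem_iota/= add0n => im; rewrite indicE memNset// => Fi.
    by apply: nF; exists i.
Qed.

Let cube_cvg x : cube k x @[k --> \oo] --> (1 : R).
Proof.
pose M := \sum_j `|x 0 j|.
apply: cvg_near_cst; exists (Num.truncn M).+1 => // k /= Mk; rewrite /cube.
suff -> : box (const_mx (- k%:R)) (const_mx k%:R) x by [].
apply/forallP => j; rewrite !mxE -ler_norml.
have xM : `|x 0 j| <= M by rewrite /M (bigD1 j)//= lerDl sumr_ge0.
apply: (le_trans xM); apply: (@le_trans _ _ (Num.truncn M).+1%:R); last by rewrite ler_nat.
by rewrite ltW// truncnS_gt.
Qed.

Let apx_ge0 f : (forall x, 0 <= f x) -> Lpf p f -> apx p f.
Proof.
move=> f0 lf; have [r [A [mA gf cg]]] := simple_approximation lf.1 f0.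
apply: (@apx_lim R n p p1 (fun k x => (\sum_(y <- r k) (y * \1_(A k y) x)) * cube k x) _ f _ _ lf).
- move=> k.
  have -> : (fun x => (\sum_(y <- r k) (y * \1_(A k y) x)) * cube k x) =
      (fun x => \sum_(y <- r k) (y * (\1_(A k y) x * cube k x))).
    by apply/funext => x; rewrite mulr_suml; apply: eq_bigr => y _; rewrite mulrA.
  apply: (@apx_sum R n p p1) => y; apply: (@apxZ R n p); apply: apx_indic; exact: mA.
- move=> x; rewrite -[X in _ --> X](mulr1 (f x)); apply: cvgM; [exact: cg|exact: cube_cvg].
- move=> k x; have /andP[c0 c1] := cube01 k x; have /andP[g0 g1] := gf k x.
  rewrite ger0_norm ?mulr_ge0//; apply: (le_trans _ g1); exact: ler_piMr.
Qed.

Theorem schwartz_dense f (d : R) : Lpf p f -> 0 < d ->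
  exists2 phi, schwartz_fun phi & (eLp p (fun x => (phi x - f x)%R) < d%:E)%E.
Proof.
move=> lf; suff [_ h] : apx p f by exact: h.
have -> : f = (fun x => 2^-1 * (`|f x| + f x) + - 2^-1 * (`|f x| - f x)).
  by apply/funext => x; field.
have la := Lpf_norm lf.
apply: (@apxD R n p p1); apply: (@apxZ R n p); apply: apx_ge0.
- by move=> x; have := ler_norm (- f x); rewrite normrN; lra.
- exact: (@LpfD R n p p1).
- by move=> x; have := ler_norm (f x); lra.
- exact: (@LpfB R n p p1).
Qed.

End schwartz_dense.

Lemma le_limit_powR (R : realType) (p : R) (u : R -> R) (l : R) (b : \bar R) : 0 < p ->
  (forall e, 0 < e -> ((`|u e| `^ p)%:E <= b)%E) -> u e @[e --> 0^'+] --> l ->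
  ((`|l| `^ p)%:E <= b)%E.
Proof.
move=> p0 hb cu; have ek (k : nat) : 0 < k.+1%:R^-1 :> R by rewrite invr_gt0.
have b0 : (0 <= b)%E by apply: (le_trans _ (hb 1 ltr01)); rewrite lee_fin powR_ge0.
have cl : `|u k.+1%:R^-1| @[k --> \oo] --> `|l|.
  by apply: cvg_norm; move/cvg_at_rightP : cu => /(_ (fun k => k.+1%:R^-1)); apply; split=> //; exact: cvg_invS.
case: b b0 hb => [b| |] b0 hb; [|by rewrite leey|by []].
have c := cvg_powR p0 (fun k => normr_ge0 (u k.+1%:R^-1)) (normr_ge0 l) cl.
rewrite -(cvg_lim (@Rhausdorff R) c) lee_fin; apply: limr_le; first by apply/cvg_ex; eexists; exact: c.
by apply: nearW => k; have := hb _ (ek k); rewrite lee_fin.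
Qed.

Section null_inf.
Context d (T : measurableType d) (R : realType) (mu : {measure set T -> \bar R}).

(** The pointwise infimum of the [P k] has integral 0, hence vanishes almost everywhere. This
    replaces the extraction of an almost everywhere convergent subsequence. *)
Lemma ae_inf_eq0 (P : nat -> T -> \bar R) : (forall k, measurable_fun setT (P k)) ->
  (forall k x, 0 <= P k x)%E ->
  (forall b : R, 0 < b -> exists k, (\int[mu]_x P k x <= b%:E)%E) ->
  {ae mu, forall x, forall b : R, 0 < b -> exists k, (P k x < b%:E)%E}.
Proof.
move=> mP P0 hP; pose Q x := einfs (P ^~ x) 0%N.
have mQ : measurable_fun setT Q by exact: measurable_fun_einfs.
have Q0 x : (0 <= Q x)%E by apply: le_ereal_inf_tmp => _ [k _ <-].
have QP k x : (Q x <= P k x)%E by apply: ereal_inf_lbound; exists k.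
have iQ : (\int[mu]_x `|Q x| = 0)%E.
  have -> : (\int[mu]_x `|Q x| = \int[mu]_x Q x)%E by apply: eq_integral => x _; rewrite gee0_abs.
  apply/eqP; rewrite eq_le integral_ge0// andbT; apply/lee_addgt0Pr => b b0; rewrite add0e.
  by have [k hk] := hP b b0; apply: (le_trans _ hk); exact: int_mono.
have [N [mN N0 hN]] := (ae_eq_integral_abs mu measurableT mQ).1 iQ.
exists N; split => // x nx; apply: hN => /= h; apply: nx => b b0.
have Qb : (Q x < b%:E)%E by rewrite h// lte_fin.
have [_ [k _ <-] Pk] := ereal_inf_lt Qb.
by exists k.
Qed.

End null_inf.

(** * Almost everywhere convergence and L^p bounds for Riesz transforms *)

Section riesz_Lp.
Context (R : realType) (n : nat) (p : R).
Hypotheses (p1 : 1 < p) (n0 : (0 < n)%N).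
Local Notation mu := (lebesgue_rv R n).
Implicit Types (f g : 'rV[R]_n -> R) (x : 'rV[R]_n) (j : 'I_n).

Let p0 : 0 < p. Proof. exact: lt_trans ltr01 p1. Qed.

Lemma te_maximal_function : exists2 C : R, 0 <= C & forall f j, Lpf p f ->
  exists P : 'rV[R]_n -> \bar R, [/\ measurable_fun setT P, forall x, (0 <= P x)%E,
    forall x e, 0 < e -> ((`|te j e f x| `^ p)%:E <= P x)%E &
    (\int[mu]_x P x <= C%:E * eLp p f)%E].
Proof.
have [C C0 hC] := @tr_maximal R n p p1.
exists C => // f j lf; have h := @te_sup R n p p1 n0 C f j hC C0 lf; exact: h.
Qed.

Lemma te_lin c f g j e x : 0 < e -> Lpf p f -> Lpf p g ->
  te j e (fun y => c * f y + g y) x = c * te j e f x + te j e g x.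
Proof.
move=> e0 lf lg; have i1 := intg_te p1 n0 j x e0 lf; have i2 := intg_te p1 n0 j x e0 lg.
rewrite /te -RintZ// -RintD//; last exact: intgZ.
by apply: eq_Rint => u; ring.
Qed.

(** The real form of the multiplier: [- i m] times [fcos f - i fsin f] is [- m fsin f - i m fcos f]
    for [m = xi_j / |xi|]. *)
Lemma te_cvg_schwartz j f x : schwartz_fun f ->
  te j e f x @[e --> 0^'+] -->
  trigI (fun xi : 'rV[R]_n => - (xi 0 j / enorm xi * fsin f xi)) (fun xi : 'rV[R]_n => xi 0 j / enorm xi * fcos f xi) x.
Proof.
move=> sf; have [ia ib] := intg_fcos sf.
have E : trigI (fcos f) (fsin f) = f by apply/funext => y; exact: fourier_inversion.
have lf : Lpf p (trigI (fcos f) (fsin f)) by rewrite E; exact: schwartz_Lpf.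
have := @te_trigI R n _ _ ia ib p j x p1 n0 lf; rewrite E.
rewrite (_ : Rintegral _ _ _ = trigI (fun xi : 'rV[R]_n => - (xi 0 j / enorm xi * fsin f xi)) (fun xi : 'rV[R]_n => xi 0 j / enorm xi * fcos f xi) x)//.
by apply: eq_Rint => xi; ring.
Qed.

(** For Schwartz approximants the truncations converge everywhere. At almost every point some
    [phi k] has a maximal error below any given bound, so the truncations of [f] are Cauchy
    there. *)
Lemma te_ae_cvg j f : Lpf p f -> {ae mu, forall x, cvg (te j e f x @[e --> 0^'+])}.
Proof.
move=> lf; have [C C0 hC] := te_maximal_function.
have ex k : exists phi, schwartz_fun phi /\ (eLp p (fun x => (phi x - f x)%R) < (k.+1%:R^-1)%:E)%E.
  have k0 : 0 < k.+1%:R^-1 :> R by rewrite invr_gt0.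
  by have [phi sphi h] := schwartz_dense p1 lf k0; exists phi.
pose phi k := projT1 (cid (ex k)).
have [sphi dphi] : (forall k, schwartz_fun (phi k)) /\
    forall k, (eLp p (fun x => (phi k x - f x)%R) < (k.+1%:R^-1)%:E)%E.
  by split=> k; have [] := projT2 (cid (ex k)).
have lh k : Lpf p (fun x => phi k x - f x).
  by apply: (@LpfB R n p p1); [exact: (schwartz_Lpf p1)|exact: lf].
have exP k := hC _ j (lh k).
pose P k := projT1 (cid (exP k)).
have PP k : [/\ measurable_fun setT (P k), forall x, (0 <= P k x)%E,
    forall x e, 0 < e -> ((`|te j e (fun y => phi k y - f y) x| `^ p)%:E <= P k x)%E &
    (\int[mu]_x P k x <= C%:E * eLp p (fun y => (phi k y - f y)%R))%E] := projT2 (cid (exP k)).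
have [||| N [mN N0 hN]] := @ae_inf_eq0 _ _ R mu P.
- by move=> k; have [] := PP k.
- by move=> k x; have [_ h _ _] := PP k.
- move=> b b0; have Cb : 0 < (C + 1) / b by rewrite divr_gt0// ltr_wpDl.
  have [m hm] : exists m : nat, (C + 1) / b < m.+1%:R.
    by exists (Num.truncn ((C + 1) / b)); exact: truncnS_gt.
  exists m; have [_ _ _ h] := PP m; apply: (le_trans h).
  apply: (@le_trans _ _ (C%:E * (m.+1%:R^-1)%:E)%E).
    by apply: lee_wpmul2l; [rewrite lee_fin|apply: ltW; exact: dphi].
  rewrite -EFinM lee_fin ler_pdivrMr//; rewrite ltr_pdivrMr// mulrC in hm.
  by apply: (le_trans _ (ltW hm)); rewrite lerDl.
exists N; split => // x nx; apply: hN => /= h; apply: nx.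
apply: cauchy_cvg; apply: cauchy_exP => b b0.
have bp : 0 < (b / 2) `^ p by rewrite powR_gt0// divr_gt0.
have [k Pk] := h _ bp; have [_ _ hk _] := PP k.
have lt2 e : 0 < e -> `|te j e (fun y => phi k y - f y) x| < b / 2.
  move=> e0; have := le_lt_trans (hk x e e0) Pk; rewrite lte_fin => h1.
  rewrite ltNge; apply/negP => h2.
  have : (b / 2) `^ p <= `|te j e (fun y => phi k y - f y) x| `^ p.
    by apply: ge0_ler_powR; rewrite ?nnegrE ?(ltW p0) ?divr_ge0 ?(ltW b0).
  by rewrite leNgt h1.
have c := @te_cvg_schwartz j (phi k) x (sphi k); set l := trigI _ _ x in c.
exists l; have b2 : 0 < b / 2 by rewrite divr_gt0.
move/cvgrPdist_lt : c => /(_ _ b2) c.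
change (\forall e \near 0^'+, ball l b (te j e f x)); near=> e; rewrite /ball/=.
have e0 : 0 < e by near: e; exact: nbhs_right_gt.
have h1 : `|l - te j e (phi k) x| < b / 2 by near: e.
have h2 := lt2 e e0.
have lphi := schwartz_Lpf p1 (sphi k).
have E : te j e (fun y => phi k y - f y) x = te j e (phi k) x - te j e f x.
  have := @te_lin (-1) f (phi k) j e x e0 lf lphi.
  have -> : (fun y => -1 * f y + phi k y) = (fun y => phi k y - f y) by apply/funext => y; ring.
  by move=> ->; ring.
rewrite E in h2.
have -> : l - te j e f x = (l - te j e (phi k) x) + (te j e (phi k) x - te j e f x) by ring.
by apply: (le_lt_trans (ler_normD _ _)); move: h1 h2; lra.
Unshelve. all: by end_near. Qed.

(* A measurable representative of the Riesz transform, which is itself only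
   known to agree almost everywhere with measurable functions. *)
Definition rz j f x : R := fine (limn_esup (fun k : nat => (te j k.+1%:R^-1 f x)%:E)).

Lemma rz_lim j f x (l : R) : te j e f x @[e --> 0^'+] --> l -> rz j f x = l.
Proof.
move=> cu.
have cl : te j k.+1%:R^-1 f x @[k --> \oo] --> l.
  move/cvg_at_rightP : cu => /(_ (fun k => k.+1%:R^-1)); apply; split; last exact: cvg_invS.
  by move=> k; rewrite invr_gt0.
have ce : (fun k : nat => (te j k.+1%:R^-1 f x)%:E) @ \oo --> l%:E.
  by apply: cvg_EFin; [exact: nearW|exact: cl].
by rewrite /rz; have [_ ->] := cvg_limn_einf_sup ce.
Qed.

Lemma rz_ae_cvg j f : Lpf p f -> {ae mu, forall x, te j e f x @[e --> 0^'+] --> rz j f x}.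
Proof.
move=> lf; have := te_ae_cvg j lf; apply: filterS => x /cvg_ex[l cl].
by rewrite (rz_lim cl).
Qed.

Lemma measurable_te j e f : measurable_fun setT f -> measurable_fun setT (te j e f).
Proof.
move=> mf; have mr := @measurable_rk R n j.
by apply: (@measurable_Rint_l _ _ _ _ R mu (fun x u =>
    (e < enorm u)%R%:R * rk j u * f (x - u))); mfun.
Qed.

Lemma measurable_rz j f : measurable_fun setT f -> measurable_fun setT (rz j f).
Proof.
move=> mf; rewrite /rz; apply: (measurableT_comp (@fine_measurable R setT measurableT)).
by apply: measurable_fun_limn_esup => k; apply/measurable_EFinP; exact: measurable_te.
Qed.

Lemma eLp_ae_le (f : 'rV[R]_n -> R) (P : 'rV[R]_n -> \bar R) : measurable_fun setT f ->
  measurable_fun setT P -> (forall x, 0 <= P x)%E ->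
  {ae mu, forall x, ((`|f x| `^ p)%:E <= P x)%E} -> (eLp p f <= \int[mu]_x P x)%E.
Proof.
move=> mf mP P0 h; apply: ae_ge0_le_integral => //.
- by apply/measurable_EFinP; exact: measurable_norm_powR.
- by apply: filterS h => x.
Qed.

Lemma rz_bounded : exists2 C : R, 0 <= C & forall f j, Lpf p f -> (eLp p (rz j f) <= C%:E * eLp p f)%E.
Proof.
have [C C0 hC] := te_maximal_function; exists C => // f j lf.
have [P [mP P0 tP iP]] := hC f j lf.
apply: (le_trans _ iP); apply: eLp_ae_le => //.
  by apply: measurable_rz; exact: lf.1.
have := rz_ae_cvg j lf; apply: filterS => x c.
exact: (@le_limit_powR _ _ (fun e => te j e f x) _ _ p0 (tP x)).
Qed.

Lemma rz_Lpf j f : Lpf p f -> Lpf p (rz j f).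
Proof.
move=> lf; have [C C0 hC] := rz_bounded; split; first by apply: measurable_rz; exact: lf.1.
apply: (le_lt_trans (hC f j lf)); apply: lte_mul_pinfty; [by rewrite lee_fin|by []|exact: lf.2].
Qed.

Lemma riesz_rz_ae j f : Lpf p f -> {ae mu, forall x, riesz j f x = rz j f x}.
Proof.
move=> lf; have := rz_ae_cvg j lf; apply: filterS => x c.
exact: (riesz_lim p1 n0 lf c).
Qed.

Lemma rz_lin_ae j c f g : Lpf p f -> Lpf p g ->
  {ae mu, forall x, rz j (fun y => c * f y + g y) x = c * rz j f x + rz j g x}.
Proof.
move=> lf lg; have := rz_ae_cvg j lf; have := rz_ae_cvg j lg; apply: filterS2 => x cg cf.
apply: rz_lim.
have h : c * te j e f x + te j e g x @[e --> 0^'+] --> c * rz j f x + rz j g x.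
  by apply: cvgD => //; apply: cvgMr.
apply: cvg_trans h; apply: near_eq_cvg; near=> e; rewrite te_lin//.
Unshelve. all: by end_near. Qed.

Lemma rz_schwartz j f : schwartz_fun f ->
  rz j f = trigI (fun xi : 'rV[R]_n => - (xi 0 j / enorm xi * fsin f xi)) (fun xi : 'rV[R]_n => xi 0 j / enorm xi * fcos f xi).
Proof. by move=> sf; apply/funext => x; apply: rz_lim; exact: te_cvg_schwartz. Qed.

Lemma measurable_symbol j : measurable_fun setT (fun xi : 'rV[R]_n => xi 0 j / enorm xi).
Proof. by mfun. Qed.

Lemma symbol_le1 j (xi : 'rV[R]_n) : `|xi 0 j / enorm xi| <= 1.
Proof.
have [e0|e0] := eqVneq (enorm xi) 0; first by rewrite e0 invr0 mulr0 normr0.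
rewrite normrM normrV ?unitfE// [`|enorm xi|]ger0_norm ?enorm_ge0//.
by rewrite ler_pdivrMr ?mul1r ?coord_le_enorm// lt_neqAle eq_sym e0 enorm_ge0.
Qed.

Lemma intg_symbol j (a : 'rV[R]_n -> R) : intg mu a -> intg mu (fun xi : 'rV[R]_n => xi 0 j / enorm xi * a xi).
Proof.
move=> ia; have ma := intg_measurable ia; have ms := measurable_symbol j.
apply: (intg_le _ _ (intg_norm ia)) => [|xi]; first exact: measurable_funM.
by rewrite normrM ler_piMl// symbol_le1.
Qed.

(** [rz j f] need not be a Schwartz function, as its symbol is singular at the origin. It is still a
    [trigI] of integrable functions lying in L^p, which is what [te_trigI] asks for. *)
Lemma rz2_schwartz i j f x : schwartz_fun f ->
  rz i (rz j f) x = - trigI (fun xi : 'rV[R]_n => xi 0 i / enorm xi * (xi 0 j / enorm xi) * fcos f xi)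
    (fun xi : 'rV[R]_n => xi 0 i / enorm xi * (xi 0 j / enorm xi) * fsin f xi) x.
Proof.
move=> sf; have [ia ib] := intg_fcos sf; have lr : Lpf p (rz j f) := rz_Lpf j (schwartz_Lpf p1 sf).
rewrite rz_schwartz// in lr *; apply: rz_lim.
have ia' : intg mu (fun xi : 'rV[R]_n => - (xi 0 j / enorm xi * fsin f xi)).
  have := intgZ (-1) (intg_symbol j ib); congr (_.-integrable _ _).
  by apply/funext => xi /=; rewrite mulN1r.
have ib' := intg_symbol j ia.
have h := @te_trigI R n _ _ ia' ib' p i x p1 n0 lr.
suff E : \int[mu]_xi (xi 0 i / enorm xi * (- (xi 0 j / enorm xi * fsin f xi) * sin (2 * pi * dotv x xi) -
    xi 0 j / enorm xi * fcos f xi * cos (2 * pi * dotv x xi))) =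
  - trigI (fun xi : 'rV[R]_n => xi 0 i / enorm xi * (xi 0 j / enorm xi) * fcos f xi)
    (fun xi : 'rV[R]_n => xi 0 i / enorm xi * (xi 0 j / enorm xi) * fsin f xi) x by rewrite -E.
rewrite -[RHS]mulN1r /trigI -RintZ; last first.
  apply: intg_trigI.
    have := intg_symbol i (intg_symbol j ia); congr (_.-integrable _ _).
    by apply/funext => xi /=; rewrite mulrA.
  have := intg_symbol i (intg_symbol j ib); congr (_.-integrable _ _).
  by apply/funext => xi /=; rewrite mulrA.
by apply: eq_Rint => xi; ring.
Qed.

End riesz_Lp.

(** * Integrals of almost everywhere equal functions *)

Section integral_ae.
Context d (T : measurableType d) (R : realType) (mu : {measure set T -> \bar R}).
Import HBNNSimple.

(** A simple function below [f], set to 0 on the null set, lies below [g] and keeps its integral. *)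
Let ge0_int_ae_le (f g : T -> \bar R) : (forall x, 0 <= f x)%E -> (forall x, 0 <= g x)%E ->
  {ae mu, forall x, f x = g x} -> (\int[mu]_x f x <= \int[mu]_x g x)%E.
Proof.
move=> f0 g0 [N [mN N0 hN]]; rewrite !ge0_integralTE//.
apply: ge_ereal_sup => _ [h hf <-].
have mN' : measurable (~` N) by exact: measurableC.
apply: (@le_trans _ _ (sintegral mu (proj_nnsfun h mN'))).
  rewrite -!integralT_nnsfun le_eqVlt; apply/orP; left; apply/eqP.
  apply: ge0_ae_eq_integral => //.
  - by apply/measurable_EFinP; exact: measurable_funP.
  - by apply/measurable_EFinP; exact: measurable_funP.
  - by move=> x _; rewrite lee_fin.
  - by move=> x _; rewrite lee_fin.
  exists N; split=> // x /= hx; apply: contrapT => nx; apply: hx => _.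
  by rewrite /= mindicE mem_set//= mulr1.
apply: ereal_sup_ubound; exists (proj_nnsfun h mN') => //= x.
rewrite mindicE; have [xN|xN] := pselect (N x).
  by rewrite memNset ?mulr0// => nx; exact: nx.
rewrite mem_set//= mulr1; have -> : g x = f x; last exact: hf.
by apply/esym; apply: contrapT => ne; apply: xN; exact: hN.
Qed.

(* No measurability is required: the Riesz transform of an L^p function is not
   known to be measurable, and it is integrated again. *)
Lemma int_ae_eq (D : set T) (f g : T -> \bar R) : {ae mu, forall x, f x = g x} ->
  (\int[mu]_(x in D) f x = \int[mu]_(x in D) g x)%E.
Proof.
move=> fg; rewrite integral_mkcond [RHS]integral_mkcond.
have {}fg : {ae mu, forall x, (f \_ D) x = (g \_ D) x}.
  by apply: filterS fg => x; rewrite /patch => ->.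
rewrite integralE [RHS]integralE; congr (_ - _)%E; apply/eqP; rewrite eq_le;
  apply/andP; split; apply: ge0_int_ae_le => //;
  by apply: filterS fg => x E; rewrite ?funeposE ?funenegE E.
Qed.

Lemma Rint_ae_eq (D : set T) (f g : T -> R) : {ae mu, forall x, f x = g x} ->
  \int[mu]_(x in D) f x = \int[mu]_(x in D) g x.
Proof. by move=> fg; congr fine; apply: int_ae_eq; apply: filterS fg => x ->. Qed.

End integral_ae.

(** * Iterated Riesz transforms on L^p *)

Section riesz_ae.
Context (R : realType) (n : nat) (p : R).
Hypotheses (p1 : 1 < p) (n0 : (0 < n)%N).
Local Notation mu := (lebesgue_rv R n).
Implicit Types (f g : 'rV[R]_n -> R) (x : 'rV[R]_n) (i j : 'I_n).

Let p0 : 0 < p. Proof. exact: lt_trans ltr01 p1. Qed.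

Lemma ae_refl_rv x (P : 'rV[R]_n -> Prop) : {ae mu, forall y, P y} -> {ae mu, forall u, P (x - u)}.
Proof.
move=> [N [mN N0 hN]]; exists ((fun u : 'rV[R]_n => -1 *: u + x) @^-1` N).
have m1 : (-1 : R) != 0 by rewrite oppr_eq0 oner_neq0.
split.
- rewrite -[X in measurable X]setTI; exact: measurable_affine_rv.
- by have := leb_affine_rv x m1 mN; rewrite N0 normrN normr1 expr1n mul1e.
- by move=> u /= hu; apply: hN => /= h; apply: hu; move: h; rewrite scaleN1r addrC.
Qed.

Lemma te_eq_ae j f g e x : {ae mu, forall y, f y = g y} -> te j e f x = te j e g x.
Proof. by move=> /(ae_refl_rv x) h; apply: Rint_ae_eq; apply: filterS h => u ->. Qed.

(** Equality holds at every point, because each truncation is an integral of the argument. An outer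
    transform cannot distinguish two almost everywhere equal inner ones. *)
Lemma rz_eq_ae j f g : {ae mu, forall y, f y = g y} -> rz j f = rz j g.
Proof.
move=> h; apply/funext => x; congr (fine (limn_esup _)); apply/funext => k.
by rewrite (te_eq_ae _ _ _ h).
Qed.

Lemma riesz_eq_ae j f g : {ae mu, forall y, f y = g y} -> riesz j f = riesz j g.
Proof.
move=> h; apply/funext => x; rewrite /riesz.
suff -> : (fun e : R => \int[mu]_(y in [set y | e < enorm (x - y)]) ((x 0 j - y 0 j) * f y / enorm (x - y) ^+ n.+1)) =
   (fun e : R => \int[mu]_(y in [set y | e < enorm (x - y)]) ((x 0 j - y 0 j) * g y / enorm (x - y) ^+ n.+1)) by [].
by apply/funext => e; apply: Rint_ae_eq; apply: filterS h => y ->.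
Qed.

Lemma rz2_Lpf i j f : Lpf p f -> Lpf p (rz i (rz j f)).
Proof. by move=> lf; apply: (rz_Lpf p1 n0); exact: (rz_Lpf p1 n0). Qed.

Lemma rz2_lin_ae i j c f g : Lpf p f -> Lpf p g ->
  {ae mu, forall x, rz i (rz j (fun y => c * f y + g y)) x = c * rz i (rz j f) x + rz i (rz j g) x}.
Proof.
move=> lf lg; rewrite (rz_eq_ae i (rz_lin_ae p1 n0 j c lf lg)).
by apply: (rz_lin_ae p1 n0); exact: (rz_Lpf p1 n0).
Qed.

Lemma eLp_ae f g : measurable_fun setT f -> measurable_fun setT g ->
  {ae mu, forall x, f x = g x} -> (eLp p f <= eLp p g)%E.
Proof.
move=> mf mg h; apply: (eLp_ae_le mf).
- by apply/measurable_EFinP; exact: measurable_norm_powR.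
- by move=> x; rewrite lee_fin powR_ge0.
- by apply: filterS h => x ->.
Qed.

Lemma rz2_bounded : exists2 C : R, 0 <= C & forall i j f, Lpf p f ->
  (eLp p (rz i (rz j f)) <= C%:E * eLp p f)%E.
Proof.
have [C C0 hC] := rz_bounded p1 n0; exists (C * C); first exact: mulr_ge0.
move=> i j f lf; apply: (le_trans (hC _ i (rz_Lpf p1 n0 j lf))).
by rewrite EFinM -muleA; apply: lee_wpmul2l; [rewrite lee_fin|exact: hC].
Qed.

Lemma eLp_eq0 f : measurable_fun setT f -> (forall d : R, 0 < d -> (eLp p f <= d%:E)%E) ->
  {ae mu, forall x, f x = 0}.
Proof.
move=> mf h.
have mfp : measurable_fun setT (fun x => (`|f x| `^ p)%:E).
  by apply/measurable_EFinP; exact: measurable_norm_powR.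
have I0 : (\int[mu]_x `|(`|f x| `^ p)%:E| = 0)%E.
  have -> : (\int[mu]_x `|(`|f x| `^ p)%:E| = eLp p f)%E.
    by apply: eq_integral => x _; rewrite gee0_abs// lee_fin powR_ge0.
  apply/eqP; rewrite eq_le eLp_ge0 andbT; apply/lee_addgt0Pr => b b0; rewrite add0e; exact: h.
have := (ae_eq_integral_abs mu measurableT mfp).1 I0; apply: filterS => x /(_ I) [] /powR_eq0_eq0 /eqP.
by rewrite normr_eq0 => /eqP.
Qed.

Let half_le (a C d : R) : 0 <= a -> 0 < a * (2 * C + 1) -> 0 <= d ->
  a * (C * (d / (a * (2 * C + 1))) + C * (d / (a * (2 * C + 1)))) <= d.
Proof.
move=> a0 c0 d0; set c := a * _ in c0 *.
have -> : a * (C * (d / c) + C * (d / c)) = d * (a * (2 * C)) / c by ring.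
by rewrite ler_pdivrMr// ler_wpM2l// /c ler_wpM2l// lerDl.
Qed.

(** The commutator vanishes on Schwartz functions, where the symbol of the composition is symmetric,
    and it is bounded on L^p; by density its norm is below every [d]. *)
Lemma rz2_comm_ae i j f : Lpf p f -> {ae mu, forall x, rz i (rz j f) x = rz j (rz i f) x}.
Proof.
move=> lf; have [C C0 hC] := rz2_bounded.
pose D x := rz i (rz j f) x - rz j (rz i f) x.
have lD : Lpf p D by apply: (LpfB p1); exact: rz2_Lpf.
suff : {ae mu, forall x, D x = 0}.
  by apply: filterS => x /eqP; rewrite subr_eq0 => /eqP.
apply: (eLp_eq0 lD.1) => d d0.
(* Chosen so that two terms bounded by [C * (d / c)], multiplied by the quasi-triangle constant
   [2^p], add up to at most [d]; the [+ 1] keeps [c] positive when [C = 0]. *)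
pose c := 2 `^ p * (2 * C + 1); have c0 : 0 < c.
  by rewrite mulr_gt0 ?powR_gt0// ltr_wpDl// mulr_ge0.
have e0 : 0 < d / c by rewrite divr_gt0.
have [phi sphi hphi] := schwartz_dense p1 lf e0.
have lphi := schwartz_Lpf p1 sphi.
pose g x := phi x - f x; have lg : Lpf p g by exact: (LpfB p1).
have fE : f = (fun y => -1 * g y + phi y) by apply/funext => y; rewrite /g; ring.
have h1 := rz2_lin_ae i j (-1) lg lphi; rewrite -fE in h1.
have h2 := rz2_lin_ae j i (-1) lg lphi; rewrite -fE in h2.
have sym : rz i (rz j phi) = rz j (rz i phi).
  apply/funext => x; rewrite !(rz2_schwartz p1 n0)//; congr (- _); apply: eq_Rint => xi.
  by rewrite [xi 0 j / _ * _]mulrC.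
have lij := rz2_Lpf i j lg; have lji := rz2_Lpf j i lg.
apply: (@le_trans _ _ (eLp p (fun x => (rz j (rz i g) x - rz i (rz j g) x)%R))).
  apply: eLp_ae; [exact: lD.1|exact: (LpfB p1 lji lij).1|].
  apply: filterS2 h1 h2 => x e1 e2; rewrite /D e1 e2 sym.
  by move: (rz i (rz j g) x) (rz j (rz i g) x) (rz j (rz i phi) x) => u v w; ring.
have e3 := @eLpD R n p p1 (rz j (rz i g)) (fun x => - rz i (rz j g) x) lji.1 (measurable_funN lij.1).
apply: (le_trans e3); rewrite eLpN.
have b1 := hC i j g lg; have b2 := hC j i g lg.
have gd : (eLp p g <= (d / c)%:E)%E by apply: ltW.
apply: (@le_trans _ _ ((2 `^ p)%:E * ((C%:E * (d / c)%:E) + (C%:E * (d / c)%:E)))%E).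
  apply: lee_wpmul2l; first by rewrite lee_fin powR_ge0.
  by apply: leeD; [apply: (le_trans b2)|apply: (le_trans b1)]; apply: lee_wpmul2l; rewrite ?lee_fin.
have E : ((2 `^ p)%:E * (C%:E * (d / c)%:E + C%:E * (d / c)%:E) = (2 `^ p * (C * (d / c) + C * (d / c)))%R%:E)%E by [].
rewrite E lee_fin.
exact: half_le (powR_ge0 _ _) c0 (ltW d0).
Qed.

Lemma powR_sum_le (I : finType) (a : I -> R) : (forall k : I, 0 <= a k) ->
  (\sum_(i : I) a i) `^ p <= #|I|%:R `^ p * \sum_(i : I) a i `^ p.
Proof.
move=> a0; pose s := \sum_(i : I) a i `^ p.
have s0 : 0 <= s by apply: sumr_ge0 => i _; exact: powR_ge0.
have am (i : I) : a i <= s `^ p^-1.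
  have {1}-> : a i = (a i `^ p) `^ p^-1 by rewrite -powRrM mulfV ?gt_eqF// powRr1.
  apply: ge0_ler_powR; rewrite ?nnegrE ?powR_ge0 ?invr_ge0 ?(ltW p0)//.
  by rewrite /s (bigD1 i)//= lerDl; apply: sumr_ge0 => k _; exact: powR_ge0.
have h : \sum_(i : I) a i <= #|I|%:R * s `^ p^-1.
  have -> : #|I|%:R * s `^ p^-1 = \sum_(i : I) s `^ p^-1 by rewrite sumr_const mulr_natl.
  by apply: ler_sum => i _; exact: am.
apply: (@le_trans _ _ ((#|I|%:R * s `^ p^-1) `^ p)).
  by apply: ge0_ler_powR; rewrite ?nnegrE ?mulr_ge0 ?powR_ge0 ?sumr_ge0 ?(ltW p0).
by rewrite powRM ?powR_ge0// -powRrM mulVf ?gt_eqF// powRr1.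
Qed.

Lemma ge0_int_sum_powR (I : finType) (F : I -> 'rV[R]_n -> R) (N : 'rV[R]_n -> R) :
  (forall k : I, measurable_fun setT (F k)) -> (forall x, 0 <= N x) ->
  (forall x, N x <= \sum_(i : I) `|F i x|) ->
  (\int[mu]_x (N x `^ p)%:E <= (#|I|%:R `^ p)%:E * \sum_(i : I) eLp p (F i))%E.
Proof.
move=> mF N0 hN.
rewrite /eLp -ge0_integral_sum//; last first.
  by move=> i; apply/measurable_EFinP; exact: measurable_norm_powR.
rewrite (eq_integral (fun x => (\sum_(i : I) `|F i x| `^ p)%:E)); last by move=> x _; rewrite sumEFin.
rewrite -int_Zl; last 3 first.
- exact: powR_ge0.
- by apply: measurable_sum => i; exact: measurable_norm_powR.
- by move=> x; apply: sumr_ge0 => i _; exact: powR_ge0.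
apply: int_mono => x; rewrite lee_fin ?powR_ge0//.
apply: (le_trans _ (powR_sum_le (fun i : I => normr_ge0 (F i x)))).
by apply: ge0_ler_powR; rewrite ?nnegrE ?sumr_ge0 ?(ltW p0).
Qed.

Lemma eLp_sum (I : finType) (F : I -> 'rV[R]_n -> R) : (forall k : I, measurable_fun setT (F k)) ->
  (eLp p (fun x => (\sum_(i : I) F i x)%R) <= (#|I|%:R `^ p)%:E * \sum_(i : I) eLp p (F i))%E.
Proof. by move=> mF; apply: ge0_int_sum_powR => // x; exact: ler_norm_sum. Qed.

End riesz_ae.

(** * Clifford algebra *)

Section clifford_algebra.
Context (K : comNzRingType) (n : nat).
Implicit Types (u v w : multivector K n) (a : 'rV[K]_n) (I J : {set 'I_n}).

Local Notation e i := (blade K [set i]%SET).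
Local Notation one := (blade K (finset.set0 : {set 'I_n})).

Lemma sign_odd (a b : nat) : odd a = odd b -> (-1) ^+ a = (-1) ^+ b :> K.
Proof. by move=> h; rewrite -signr_odd h signr_odd. Qed.

Lemma main_involutionE w I : main_involution w I = (-1) ^+ #|I| * w I.
Proof.
rewrite /main_involution sum_ffunE.
have cI : (#|I| < n.+1)%N by rewrite ltnS -[X in (_ <= X)%N]card_ord max_card.
rewrite (bigD1 (Ordinal cI))//= big1 ?addr0; first by rewrite !ffunE/= eqxx.
move=> k kI; rewrite !ffunE; case: eqP => [E|]; last by rewrite scaler0.
by case/eqP: kI; exact/val_inj.
Qed.

Lemma main_involution_linear : linear (@main_involution K n).
Proof.
move=> c u v; apply/ffunP => I; rewrite main_involutionE !ffunE !main_involutionE.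
by rewrite /GRing.scale/=; ring.
Qed.

Lemma main_involution_blade I : main_involution (blade K I) = (-1) ^+ #|I| *: blade K I.
Proof.
apply/ffunP => J; rewrite main_involutionE !ffunE /GRing.scale/=.
by have [->|] := eqVneq J I; rewrite ?mulr0.
Qed.

Lemma main_involutionK w : main_involution (main_involution w) = w.
Proof.
by apply/ffunP => I; rewrite !main_involutionE mulrA -exprD addnn -signr_odd odd_double mul1r.
Qed.

Lemma main_involution_sum (T : finType) (c : T -> K) (x : T -> multivector K n) :
  main_involution (\sum_i c i *: x i) = \sum_i c i *: main_involution (x i).
Proof.
elim/big_rec2: _ => [|i y1 y2 _ <-]; last exact: main_involution_linear.
by apply/ffunP => I; rewrite main_involutionE !ffunE mulr0.
Qed.

Lemma odd_card_symdiff I J : odd #|symdiff I J| = odd #|I| (+) odd #|J|.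
Proof. by have := odd_sum_symdiff (fun=> 1%N) I J; rewrite !sum1_card. Qed.

Lemma main_involution_clifford u w :
  main_involution (clifford u w) = clifford (main_involution u) (main_involution w).
Proof.
rewrite (multivectorE u) clifford_suml !main_involution_sum clifford_suml.
apply: eq_bigr => I _; congr (_ *: _).
have -> : clifford (blade K I) w = \sum_J w J *: clifford (blade K I) (blade K J).
  by rewrite {1}(multivectorE w) clifford_sumr.
have -> : main_involution w = \sum_J w J *: main_involution (blade K J).
  by rewrite {1}(multivectorE w) main_involution_sum.
rewrite main_involution_sum clifford_sumr.
apply: eq_bigr => J _; congr (_ *: _).
rewrite !main_involution_blade cliffordZl cliffordZr !clifford_blade.
rewrite (_ : (-1) ^+ _ *: _ = \sum_(k < 1) (-1) ^+ inversions I J *: blade K (symdiff I J)); last by rewrite big_ord1.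
rewrite main_involution_sum !big_ord1 main_involution_blade !scalerA; congr (_ *: _).
rewrite -!exprD; apply: sign_odd; rewrite !oddD odd_card_symdiff.
by case: (odd #|I|); case: (odd #|J|); case: (odd _).
Qed.

Lemma main_involution_mvec a : main_involution (mvec a) = - mvec a.
Proof.
rewrite /mvec main_involution_sum -sumrN; apply: eq_bigr => i _.
by rewrite main_involution_blade cards1 expr1 scaleN1r scalerN.
Qed.

Lemma wedge_suml (T : finType) (c : T -> K) (x : T -> multivector K n) w :
  wedge (\sum_i c i *: x i) w = \sum_i c i *: wedge (x i) w.
Proof.
apply/ffunP => L; rewrite wedgeE sum_ffunE.
under [RHS]eq_bigr => i _ do rewrite ffunE wedgeE /GRing.scale/= mulr_sumr.
rewrite exchange_big/=; apply: eq_bigr => I _.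
under [RHS]eq_bigr => i _ do rewrite mulr_sumr.
rewrite exchange_big/=; apply: eq_bigr => J _.
rewrite sum_ffunE mulr_suml mulr_sumr mulr_suml; apply: eq_bigr => i _.
by rewrite !ffunE /GRing.scale/=; ring.
Qed.

Lemma wedge_sumr (T : finType) (c : T -> K) (x : T -> multivector K n) w :
  wedge w (\sum_i c i *: x i) = \sum_i c i *: wedge w (x i).
Proof.
apply/ffunP => L; rewrite wedgeE sum_ffunE.
under [RHS]eq_bigr => i _ do rewrite ffunE wedgeE /GRing.scale/= mulr_sumr.
rewrite exchange_big/=; apply: eq_bigr => I _.
under [RHS]eq_bigr => i _ do rewrite mulr_sumr.
rewrite exchange_big/=; apply: eq_bigr => J _.
rewrite sum_ffunE mulr_sumr mulr_sumr mulr_suml; apply: eq_bigr => i _.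
by rewrite !ffunE /GRing.scale/=; ring.
Qed.

Lemma wedge_blade I J : wedge (blade K I) (blade K J) =
  if [disjoint I & J] then (-1) ^+ inversions I J *: blade K (I :|: J) else 0.
Proof.
rewrite /wedge (bigD1 I)//= [X in _ + X]big1 ?addr0; last first.
  by move=> L LI; rewrite big1// => M _; rewrite !ffunE (negPf LI) mul0r mulr0 scale0r.
case: ifPn => d; last first.
  rewrite big1// => M dM; rewrite !ffunE; have [E|] := eqVneq M J; last by rewrite !mulr0 scale0r.
  by rewrite E (negPf d) in dM.
rewrite (bigD1 J)//= !ffunE !eqxx !mulr1 big1 ?addr0// => L /andP[_ LJ].
by rewrite !ffunE (negPf LJ) !mulr0 scale0r.
Qed.

(** Each element of [J] lies above [i], lies below [i] or equals [i]; counting [J] modulo 2 relates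
    the two inversion numbers. *)
Lemma odd_inversions_swap (i : 'I_n) J :
  odd (inversions J [set i]%SET) = odd (inversions [set i]%SET J) (+) odd #|J| (+) (i \in J).
Proof.
have -> : inversions J [set i]%SET = (\sum_(j in J) (i < j))%N.
  by rewrite /inversions; apply: eq_bigr => j _; rewrite big_set1.
rewrite /inversions big_set1.
have h : (\sum_(j in J) (i < j) + \sum_(j in J) (j < i) + (i \in J) = #|J|)%N.
  rewrite -sum1_card -big_split/=.
  have -> : (i \in J : nat) = (\sum_(j in J) (j == i))%N.
    have [iJ|iJ] := boolP (i \in J).
      by rewrite (bigD1 i)//= eqxx big1 ?addn0// => j /andP[_ /negPf ->].
    by rewrite big1// => j jJ; case: eqP => // E; rewrite E (negPf iJ) in jJ.
  rewrite -big_split/=; apply: eq_bigr => j _.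
  by rewrite -val_eqE/=; case: ltngtP.
have := congr1 odd h; rewrite !oddD oddb => <-.
by case: (odd _); case: (odd _); case: (i \in J).
Qed.

(* Up to the factor 2, the exterior product by a vector is the graded
   symmetrisation of the Clifford product. *)
Lemma wedge_vector a w : 2 *: wedge (mvec a) w =
  clifford (mvec a) w + clifford (main_involution w) (mvec a).
Proof.
rewrite /mvec wedge_suml clifford_suml clifford_sumr scaler_sumr -big_split/=.
apply: eq_bigr => i _; rewrite -scalerDr scalerA [2 * _]mulrC -scalerA; congr (_ *: _).
rewrite (multivectorE w) wedge_sumr clifford_sumr main_involution_sum clifford_suml scaler_sumr -big_split/=.
apply: eq_bigr => J _; rewrite -scalerDr scalerA [2 * _]mulrC -scalerA; congr (_ *: _).
rewrite main_involution_blade cliffordZl wedge_blade !clifford_blade disjoints1 scalerA -exprD.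
have -> : symdiff J [set i]%SET = symdiff [set i]%SET J by rewrite /symdiff finset.setUC.
rewrite -[X in X *: _ + _]signr_odd -[X in _ + X *: _]signr_odd oddD odd_inversions_swap -scalerDl.
case: (boolP (i \in J)) => iJ /=.
  rewrite scaler0; case: (odd _); case: (odd _) => /=; by rewrite ?expr0 ?expr1 ?addrN ?addNr scale0r.
have -> : symdiff [set i]%SET J = [set i]%SET :|: J.
  apply/finset.setP => k; rewrite !inE; have [->|_] := eqVneq k i; by rewrite ?(negPf iJ) ?andbF.
rewrite scalerA -signr_odd addbF addbCA addbb addbF; congr (_ *: _).
by rewrite mulr_natl mulr2n.
Qed.

Lemma cliffordlr_matrix (u v w : multivector K n) J :
  clifford u (clifford w v) J = \sum_I clifford u (clifford (blade K I) v) J * w I.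
Proof.
rewrite {1}(multivectorE w) clifford_suml clifford_sumr sum_ffunE.
by apply: eq_bigr => I _; rewrite !ffunE [LHS]mulrC.
Qed.

Hypothesis two_reg : forall x y : K, 2 * x = 2 * y -> x = y.

Lemma scale2_inj u w : 2 *: u = 2 *: w -> u = w.
Proof.
move=> h; apply/ffunP => I; apply: two_reg.
by have := congr1 (fun z : multivector K n => z I) h; rewrite !ffunE.
Qed.

Section reflection.
Variable m : 'rV[K]_n.
Hypothesis m1 : \sum_i m 0 i * m 0 i = 1.

Let A : 'M[K]_n := 1%:M - 2 *: (m^T *m m).

Lemma cliffordDl u v w : clifford (u + v) w = clifford u w + clifford v w.
Proof. by have := clifford_linear_l w 1 u v; rewrite !scale1r. Qed.

Lemma cliffordDr u v w : clifford w (u + v) = clifford w u + clifford w v.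
Proof. by have := clifford_linear_r w 1 u v; rewrite !scale1r. Qed.

Lemma cliffordNl u w : clifford (- u) w = - clifford u w.
Proof. by rewrite -scaleN1r cliffordZl scaleN1r. Qed.

Lemma cliffordNr u w : clifford w (- u) = - clifford w u.
Proof. by rewrite -scaleN1r cliffordZr scaleN1r. Qed.

Lemma clifford1l w : clifford one w = w.
Proof.
rewrite {2}(multivectorE w) {1}(multivectorE w) clifford_sumr; apply: eq_bigr => J _.
rewrite clifford_blade (_ : inversions _ _ = 0%N); last by rewrite /inversions big_set0.
rewrite expr0 scale1r; congr (_ *: blade _ _); apply/finset.setP => k; rewrite !inE.
by case: (k \in J).
Qed.

Lemma clifford_mvecC a b : clifford (mvec a) (mvec b) + clifford (mvec b) (mvec a) =
  (2 * \sum_i a 0 i * b 0 i) *: one.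
Proof.
rewrite mulr_sumr scaler_suml {1 4}/mvec !(clifford_suml, clifford_sumr) -big_split/=.
apply: eq_bigr => i _; rewrite -scalerDr /mvec clifford_sumr clifford_suml -big_split/=.
under eq_bigr => j _ do rewrite -scalerDr -!mvec_delta clifford_basis scalerA.
rewrite (bigD1 i)//= eqxx mulr1 big1 ?addr0; first by rewrite scalerA; congr (_ *: _); ring.
by move=> j ji; rewrite eq_sym (negPf ji) !mulr0 scale0r.
Qed.

Let mm : clifford (mvec m) (mvec m) = one.
Proof.
by apply: scale2_inj; rewrite scaler_nat mulr2n clifford_mvecC m1 mulr1.
Qed.

Let Phi w := clifford (clifford (mvec m) (main_involution w)) (mvec m).

Let colA i : mvec (col i A)^T = Phi (e i).
Proof.
rewrite /Phi main_involution_blade cards1 expr1 scaleN1r cliffordNr cliffordNl.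
have h := clifford_mvecC m (delta_mx 0 i); rewrite mvec_delta in h.
have s : \sum_k m 0 k * (delta_mx 0 i : 'rV[K]_n) 0 k = m 0 i.
  rewrite (bigD1 i)//= mxE !eqxx mulr1 big1 ?addr0// => k ki.
  by rewrite mxE (negPf ki) andbF mulr0.
have {}h : clifford (mvec m) (e i) = (2 * m 0 i) *: one - clifford (e i) (mvec m).
  by rewrite -s -h addrK.
rewrite h cliffordDl cliffordNl -cliffordA mm cliffordZl clifford1l.
have -> : clifford (e i) one = e i.
  rewrite clifford_blade (_ : inversions _ _ = 0%N); last first.
    by rewrite /inversions big1// => k _; rewrite big_set0.
  rewrite expr0 scale1r; congr blade; apply/finset.setP => k; rewrite !inE.
  by case: (k == i).
rewrite -mvec_delta /mvec scaler_sumr -sumrB -sumrN; apply: eq_bigr => k _.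
rewrite scalerA -scalerBl -scaleNr; congr (_ *: _).
rewrite !mxE (bigD1 ord0)//= big1 ?addr0; last by move=> l; rewrite (ord1 l).
by rewrite mxE; change (m ord0 k) with (m 0 k); change (m ord0 i) with (m 0 i); ring.
Qed.

Let Phi_wedge i w : wedge (Phi (e i)) (Phi w) = Phi (wedge (e i) w).
Proof.
apply: scale2_inj; rewrite -colA wedge_vector colA.
have hatP : main_involution (Phi w) = clifford (clifford (mvec m) w) (mvec m).
  rewrite /Phi !main_involution_clifford main_involutionK main_involution_mvec.
  by rewrite cliffordNr !cliffordNl opprK.
have PhiE : Phi (e i) = - clifford (clifford (mvec m) (e i)) (mvec m).
  by rewrite /Phi main_involution_blade cards1 expr1 scaleN1r cliffordNr cliffordNl.
(* Conjugation by [m] is multiplicative, because the inner pair [m m] is 1. *)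
have mid u v : clifford (clifford (clifford (mvec m) u) (mvec m)) (clifford (clifford (mvec m) v) (mvec m)) =
    clifford (clifford (mvec m) (clifford u v)) (mvec m).
  rewrite -!cliffordA; congr clifford; congr clifford.
  by rewrite cliffordA mm clifford1l.
rewrite hatP PhiE cliffordNl cliffordNr [Phi w]/Phi !mid.
have -> : 2 *: Phi (wedge (e i) w) = Phi (2 *: wedge (e i) w).
  rewrite /Phi; have := main_involution_sum (fun _ : 'I_1 => 2) (fun _ => wedge (e i) w).
  by rewrite !big_ord1 => ->; rewrite cliffordZr cliffordZl.
rewrite -mvec_delta wedge_vector /Phi.
have hatD u v : main_involution (u + v) = main_involution u + main_involution v.
  by have := main_involution_linear 1 u v; rewrite !scale1r.
rewrite hatD !main_involution_clifford main_involutionK main_involution_mvec.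
by rewrite cliffordNl cliffordNr !cliffordDr !cliffordDl !cliffordNr !cliffordNl.
Qed.

(** [enum] lists [I] in increasing order, so the iterated product has no inversions and hence no
    sign. *)
Let wedge_enum I : \big[@wedge K n/one]_(i <- enum I) e i = blade K I.
Proof.
have srt : sorted (relpre val ltn) (enum I).
  rewrite /enum_mem; apply: sorted_filter; first by move=> j i k; exact: ltn_trans.
  by rewrite -enumT -sorted_map val_enum_ord iota_ltn_sorted.
have -> : blade K I = blade K [set i in enum I]%SET.
  by congr blade; apply/finset.setP => k; rewrite inE mem_enum.
elim: (enum I) srt => [|i s IH] /= srt.
  by rewrite big_nil; congr blade; apply/finset.setP => k; rewrite !inE.
rewrite big_cons IH; last exact: path_sorted srt.
have lt_i : all (fun j : 'I_n => (i < j)%N) s.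
  by apply: order_path_min srt => j' i' k'; exact: ltn_trans.
rewrite wedge_blade disjoints1 inE.
have -> : (i \notin s) by apply/negP => /(allP lt_i); rewrite ltnn.
rewrite (_ : inversions _ _ = 0%N); last first.
  rewrite /inversions big_set1 big1// => j; rewrite inE => /(allP lt_i) ij.
  by rewrite ltnNge (ltnW ij).
by rewrite expr0 scale1r; congr blade; apply/finset.setP => k; rewrite !inE.
Qed.

Lemma exterior_map_reflection w : exterior_map A w =
  clifford (clifford (mvec m) (main_involution w)) (mvec m).
Proof.
rewrite {2}(multivectorE w) main_involution_sum clifford_sumr clifford_suml.
apply: eq_bigr => I _; congr (_ *: _); rewrite -/(Phi _) -(wedge_enum I).
elim: (enum I) => [|i s IH]; last by rewrite !big_cons IH colA Phi_wedge.
by rewrite !big_nil /Phi main_involution_blade cards0 expr0 scale1r -cliffordA clifford1l mm.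
Qed.

End reflection.
End clifford_algebra.

(** * The Beurling-Ahlfors operator *)

Section riesz_fields.
Context (R : realType) (n : nat) (p : R).
Hypotheses (p1 : 1 < p) (n0 : (0 < n)%N).
Local Notation mu := (lebesgue_rv R n).
Local Notation mv := (multivector R n).
Local Notation e i := (mvec (delta_mx 0 i : 'rV[R]_n)).
Implicit Types (F G : mvfield R n) (x : 'rV[R]_n) (i j : 'I_n) (I J : {set 'I_n}).

Definition Lpmv F := forall I, Lpf p (fun x => F x I).

Definition rzf i F : mvfield R n := fun x => [ffun I => rz i (fun y => F y I) x].

Lemma rz_sum_ae i (T : Type) (r : seq T) (c : T -> R) (g : T -> 'rV[R]_n -> R) :
  (forall k, Lpf p (g k)) ->
  {ae mu, forall x, rz i (fun y => \sum_(k <- r) c k * g k y) x = \sum_(k <- r) c k * rz i (g k) x}.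
Proof.
move=> lg; elim: r => [|k r IH].
  have h := rz_lin_ae p1 n0 i (-1) (@Lpf0 R n p p1) (@Lpf0 R n p p1).
  apply: filterS h => x; rewrite big_nil.
  have -> : (fun y : 'rV[R]_n => -1 * 0 + 0 : R) = (fun=> 0) by apply/funext => y; ring.
  have -> : (fun y => \sum_(k <- [::]) c k * g k y) = (fun=> 0) by apply/funext => y; rewrite big_nil.
  by move=> ->; ring.
have -> : (fun y => \sum_(l <- k :: r) c l * g l y) = (fun y => c k * g k y + \sum_(l <- r) c l * g l y).
  by apply/funext => y; rewrite big_cons.
have ls : Lpf p (fun y => \sum_(l <- r) c l * g l y).
  by apply: (@Lpf_sum R n p p1) => l; exact: LpfZ.
have h := rz_lin_ae p1 n0 i (c k) (lg k) ls.
by apply: filterS2 h IH => x -> ->; rewrite big_cons.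
Qed.

Lemma rzf_Lp i F : Lpmv F -> Lpmv (rzf i F).
Proof.
move=> lF I; have := rz_Lpf p1 n0 i (lF I); congr Lpf; apply/funext => x.
by rewrite ffunE.
Qed.

(** * Riesz transforms commute with constant-coefficient linear maps *)

Section linear_fields.
Variables (T : finType) (L : T -> mv -> mv) (c : T -> {set 'I_n} -> {set 'I_n} -> R).
Hypothesis LE : forall k w J, L k w J = \sum_I c k I J * w I.
Variable G : T -> mvfield R n.
Hypothesis lG : forall k, Lpmv (G k).

Let sumE (V : T -> mv) J : (\sum_k L k (V k)) J =
  \sum_(q : T * {set 'I_n}) c q.1 q.2 J * V q.1 q.2.
Proof.
rewrite sum_ffunE; under eq_bigr => k _ do rewrite LE.
exact: (pair_bigA _ (fun k I => c k I J * V k I)).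
Qed.

Lemma linear_field_Lp : Lpmv (fun y => \sum_k L k (G k y)).
Proof.
move=> J; have -> : (fun y => (\sum_k L k (G k y)) J) =
    (fun y => \sum_(q : T * {set 'I_n}) c q.1 q.2 J * G q.1 y q.2).
  by apply/funext => y; rewrite sumE.
by apply: (@Lpf_sum R n p p1) => q; apply: LpfZ; exact: lG.
Qed.

(** Each component is a finite combination of components with constant coefficients, so scalar
    linearity suffices. The matrix form covers left and right Clifford multiplication at once. *)
Lemma rzf_linear_ae i :
  {ae mu, forall x, rzf i (fun y => \sum_k L k (G k y)) x = \sum_k L k (rzf i (G k) x)}.
Proof.
have h : {ae mu, forall x, forall J, rz i (fun y => (\sum_k L k (G k y)) J) x =
    \sum_(q : T * {set 'I_n}) c q.1 q.2 J * rz i (fun y => G q.1 y q.2) x}.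
  apply: filter_forall => J.
  have -> : (fun y => (\sum_k L k (G k y)) J) =
      (fun y => \sum_(q : T * {set 'I_n}) c q.1 q.2 J * G q.1 y q.2).
    by apply/funext => y; rewrite sumE.
  by apply: (@rz_sum_ae i _ _ _ (fun (q : T * {set 'I_n}) y => G q.1 y q.2)) => q; exact: lG.
apply: filterS h => x h; apply/ffunP => J; rewrite ffunE h sumE.
by apply: eq_bigr => q _; rewrite ffunE.
Qed.

End linear_fields.

Lemma cliffordl_matrix (u w : mv) J : clifford u w J = \sum_I clifford u (blade R I) J * w I.
Proof.
rewrite {1}(multivectorE w) clifford_sumr sum_ffunE.
by apply: eq_bigr => I _; rewrite !ffunE [LHS]mulrC.
Qed.

Lemma cliffordr_matrix (u w : mv) J : clifford w u J = \sum_I clifford (blade R I) u J * w I.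
Proof.
rewrite {1}(multivectorE w) clifford_suml sum_ffunE.
by apply: eq_bigr => I _; rewrite !ffunE [LHS]mulrC.
Qed.

Definition rzl F : mvfield R n := fun x => \sum_i clifford (e i) (rzf i F x).
Definition rzr F : mvfield R n := fun x => \sum_i clifford (rzf i F x) (e i).

Lemma rzl_Lp F : Lpmv F -> Lpmv (rzl F).
Proof.
move=> lF; apply: (linear_field_Lp (fun i => @cliffordl_matrix (e i))) => i.
exact: rzf_Lp.
Qed.

Lemma rzr_Lp F : Lpmv F -> Lpmv (rzr F).
Proof.
move=> lF; apply: (linear_field_Lp (fun i => @cliffordr_matrix (e i))) => i.
exact: rzf_Lp.
Qed.

Lemma riesz_mv_ae F : Lpmv F -> {ae mu, forall x, forall i, riesz_mv i F x = rzf i F x}.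
Proof.
move=> lF; apply: filter_forall => i.
have h : {ae mu, forall x, forall I, riesz i (fun y => F y I) x = rz i (fun y => F y I) x}.
  by apply: filter_forall => I; exact: (riesz_rz_ae p1 n0 i (lF I)).
by apply: filterS h => x h; apply/ffunP => I; rewrite !ffunE h.
Qed.

Lemma riesz_cliffordl_ae F : Lpmv F -> {ae mu, forall x, riesz_cliffordl F x = rzl F x}.
Proof.
by move=> /riesz_mv_ae; apply: filterS => x h; apply: eq_bigr => i _; rewrite h.
Qed.

Lemma riesz_cliffordr_ae F : Lpmv F -> {ae mu, forall x, riesz_cliffordr F x = rzr F x}.
Proof.
by move=> /riesz_mv_ae; apply: filterS => x h; apply: eq_bigr => i _; rewrite h.
Qed.

Lemma riesz_mv_eq_ae i F G : {ae mu, forall x, F x = G x} -> riesz_mv i F = riesz_mv i G.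
Proof.
move=> h; apply/funext => x; apply/ffunP => I; rewrite !ffunE.
by rewrite (@riesz_eq_ae R n i (fun y => F y I) (fun y => G y I))//; apply: filterS h => y ->.
Qed.

Definition rzf2 i j F := rzf i (rzf j F).

Lemma rzf2E i j F x I : rzf2 i j F x I = rz i (rz j (fun y => F y I)) x.
Proof.
rewrite /rzf2 {1}/rzf ffunE.
have -> : (fun y => rzf j F y I) = rz j (fun y => F y I) by apply/funext => y; rewrite /rzf ffunE.
by [].
Qed.

Lemma rzf2_comm_ae F : Lpmv F -> {ae mu, forall x, forall i j, rzf2 i j F x = rzf2 j i F x}.
Proof.
move=> lF; apply: filter_forall => i; apply: filter_forall => j.
have h : {ae mu, forall x, forall I, rz i (rz j (fun y => F y I)) x = rz j (rz i (fun y => F y I)) x}.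
  by apply: filter_forall => I; exact: (rz2_comm_ae p1 n0 i j (lF I)).
apply: filterS h => x h; apply/ffunP => I.
by rewrite [LHS]rzf2E [RHS]rzf2E; exact: h.
Qed.

Definition rzz F : mvfield R n := fun x =>
  \sum_i \sum_j clifford (e i) (clifford (rzf2 i j F x) (e j)).

Lemma clifford_sumr1 (T : finType) (V : T -> mv) w :
  clifford w (\sum_k V k) = \sum_k clifford w (V k).
Proof.
have := clifford_sumr (fun=> 1) V w.
under eq_bigr do rewrite scale1r.
by move=> ->; apply: eq_bigr => k _; rewrite scale1r.
Qed.

Lemma clifford_suml1 (T : finType) (V : T -> mv) w :
  clifford (\sum_k V k) w = \sum_k clifford (V k) w.
Proof.
have := clifford_suml (fun=> 1) V w.
under eq_bigr do rewrite scale1r.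
by move=> ->; apply: eq_bigr => k _; rewrite scale1r.
Qed.

Lemma riesz_lr_ae F : Lpmv F -> {ae mu, forall x, riesz_cliffordl (riesz_cliffordr F) x = rzz F x}.
Proof.
move=> lF; have E : riesz_cliffordl (riesz_cliffordr F) = riesz_cliffordl (rzr F).
  apply/funext => x; apply: eq_bigr => i _.
  by rewrite (riesz_mv_eq_ae i (riesz_cliffordr_ae lF)).
rewrite E; have h1 := riesz_cliffordl_ae (rzr_Lp lF).
have h2 : {ae mu, forall x, forall i, rzf i (rzr F) x = \sum_j clifford (rzf2 i j F x) (e j)}.
  apply: filter_forall => i.
  exact: (rzf_linear_ae (fun j => @cliffordr_matrix (e j)) (fun j => rzf_Lp j lF) i).
apply: filterS2 h1 h2 => x -> h2; apply: eq_bigr => i _.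
by rewrite h2 clifford_sumr1.
Qed.

(** This grouping produces the two transforms in the opposite order relative to their basis vectors.
    After exchanging the summation indices, [rzf2_comm_ae] and associativity restore the double sum
    [rzz]. *)
Lemma riesz_rl_ae F : Lpmv F -> {ae mu, forall x, riesz_cliffordr (riesz_cliffordl F) x = rzz F x}.
Proof.
move=> lF; have E : riesz_cliffordr (riesz_cliffordl F) = riesz_cliffordr (rzl F).
  apply/funext => x; apply: eq_bigr => i _.
  by rewrite (riesz_mv_eq_ae i (riesz_cliffordl_ae lF)).
rewrite E; have h1 := riesz_cliffordr_ae (rzl_Lp lF).
have h2 : {ae mu, forall x, forall i, rzf i (rzl F) x = \sum_j clifford (e j) (rzf2 i j F x)}.
  apply: filter_forall => i.
  exact: (rzf_linear_ae (fun j => @cliffordl_matrix (e j)) (fun j => rzf_Lp j lF) i).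
have h3 := rzf2_comm_ae lF.
apply: filterS3 h1 h2 h3 => x -> h2 h3; rewrite /rzz exchange_big/=; apply: eq_bigr => j _.
rewrite h2 clifford_suml1; apply: eq_bigr => i _.
by rewrite (h3 j i) cliffordA.
Qed.

Lemma rzz_matrix i j F x J : clifford (e i) (clifford (rzf2 i j F x) (e j)) J =
  \sum_I clifford (e i) (clifford (blade R I) (e j)) J * rz i (rz j (fun y => F y I)) x.
Proof.
rewrite cliffordlr_matrix; apply: eq_bigr => I _.
by rewrite rzf2E.
Qed.

End riesz_fields.

From mathcomp Require Import complex.

Section complex_parts.
Context (R : realType).
Implicit Types z w : R[i].

Lemma Re_mul z w : complex.Re (z * w) = complex.Re z * complex.Re w - complex.Im z * complex.Im w.
Proof. by case: z => a b; case: w. Qed.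

Lemma Im_mul z w : complex.Im (z * w) = complex.Re z * complex.Im w + complex.Im z * complex.Re w.
Proof. by case: z => a b; case: w. Qed.

Lemma Re_sum (T : Type) (r : seq T) (F : T -> R[i]) :
  complex.Re (\sum_(k <- r) F k) = \sum_(k <- r) complex.Re (F k).
Proof. by elim/big_rec2: _ => [//|k y1 y2 _ <-]; case: (F k); case: y2. Qed.

Lemma Im_sum (T : Type) (r : seq T) (F : T -> R[i]) :
  complex.Im (\sum_(k <- r) F k) = \sum_(k <- r) complex.Im (F k).
Proof. by elim/big_rec2: _ => [//|k y1 y2 _ <-]; case: (F k); case: y2. Qed.

End complex_parts.

(** The structure constants are signs, which ring morphisms preserve; this carries the real
    coefficients into the complexified algebra. *)
Lemma clifford_blade_rmorph (K1 K2 : comNzRingType) (f : {rmorphism K1 -> K2}) n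
    (A I B J : {set 'I_n}) :
  clifford (blade K2 A) (clifford (blade K2 I) (blade K2 B)) J =
  f (clifford (blade K1 A) (clifford (blade K1 I) (blade K1 B)) J).
Proof.
rewrite !clifford_blade !cliffordZr !clifford_blade !ffunE /GRing.scale/=.
by rewrite !rmorphM !rmorphXn rmorphN1 rmorph_nat.
Qed.

(** * The multiplier operator on Schwartz fields *)

Section ba_schwartz.
Context (R : realType) (n : nat) (p : R).
Hypotheses (p1 : 1 < p) (n0 : (0 < n)%N).
Local Notation mu := (lebesgue_rv R n).
Local Notation e i := (mvec (delta_mx 0 i : 'rV[R]_n)).
Local Notation C := (real_complex R).
Implicit Types (phi : mvfield R n) (x xi : 'rV[R]_n) (i j : 'I_n) (I J : {set 'I_n}).

Let T := ('I_n * 'I_n * {set 'I_n})%type.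

Let triple_sum (V : nmodType) (F : 'I_n -> 'I_n -> {set 'I_n} -> V) :
  \sum_i \sum_j \sum_I F i j I = \sum_(q : T) F q.1.1 q.1.2 q.2.
Proof.
rewrite pair_bigA/=.
exact: (pair_bigA _ (fun (r : 'I_n * 'I_n) I => F r.1 r.2 I)).
Qed.

Let sg (q : T) J : R := clifford (e q.1.1) (clifford (blade R q.2) (e q.1.2)) J.

Let m i xi : R := xi 0 i / enorm xi.

(** [exterior_map_reflection] is applied over [R[i]] with its bilinear, not Hermitian, pairing; this
    is legitimate because [xi / |xi|] has real entries, so its bilinear square is 1. *)
Lemma ba_symbolE xi (W : multivector R[i] n) J : xi != 0 ->
  ba_symbol xi W J = \sum_(q : T) C (m q.1.1 xi * m q.1.2 xi * sg q J) * main_involution W q.2.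
Proof.
move=> xi0; have e0 : enorm xi != 0 by rewrite enorm_eq0.
pose m' : 'rV[R[i]]_n := \row_i C (m i xi).
have m1 : \sum_i m' 0 i * m' 0 i = 1.
  have -> : 1 = C 1 by rewrite rmorph1.
  have <- : \sum_i m i xi * m i xi = 1.
    have -> : \sum_i m i xi * m i xi = dotv xi xi / enorm xi ^+ 2.
      rewrite /dotv mulr_suml; apply: eq_bigr => i _.
      by rewrite /m mulrACA -invfM -expr2.
    by rewrite enorm2 mulfV// -enorm2 expf_neq0.
  by rewrite rmorph_sum; apply: eq_bigr => i _; rewrite !mxE; exact/esym/rmorphM.
have two (a b : R[i]) : 2 * a = 2 * b -> a = b.
  by apply: mulfI; rewrite pnatr_eq0.
have mE : map_mx C (reflection xi) = 1%:M - 2 *: (m'^T *m m').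
  apply/matrixP => i j; rewrite !mxE !big_ord1 !mxE rmorphB rmorph_nat; congr (_ - _).
  rewrite -rmorphM -[2 in RHS](rmorph_nat C) -rmorphM; congr C.
  by rewrite /m; field.
rewrite /ba_symbol mE exterior_map_reflection// -cliffordA.
rewrite /mvec clifford_suml sum_ffunE -(triple_sum (fun i j I => C (m i xi * m j xi * sg (i, j, I) J) * main_involution W I)).
apply: eq_bigr => i _; rewrite clifford_sumr clifford_sumr.
rewrite [LHS]ffunE sum_ffunE [LHS]/GRing.scale/= mulr_sumr; apply: eq_bigr => j _.
rewrite [X in _ * X]ffunE cliffordlr_matrix /GRing.scale/= !mulr_sumr; apply: eq_bigr => I _.
rewrite (clifford_blade_rmorph C) /sg/= !mvec_delta !mxE !rmorphM.
by rewrite !mulrA.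
Qed.

Lemma fourier_involution phi xi I : schwartz phi ->
  main_involution (fourier (complexify phi) xi) I =
  Complex (fcos (fun y => main_involution (phi y) I) xi) (- fsin (fun y => main_involution (phi y) I) xi).
Proof.
move=> sphi; have ip := schwartz_intg (sphi I).
have [js jc] := intg_trig xi ip.
have E : (fun y => main_involution (phi y) I) = (fun y => (-1) ^+ #|I| * phi y I).
  by apply/funext => y; rewrite main_involutionE.
rewrite main_involutionE ffunE E.
have -> : fcos (fun y => (-1) ^+ #|I| * phi y I) xi = (-1) ^+ #|I| * fcos (fun y => phi y I) xi.
  by rewrite /fcos -RintZ//; apply: eq_Rint => y; rewrite mulrA.
have -> : fsin (fun y => (-1) ^+ #|I| * phi y I) xi = (-1) ^+ #|I| * fsin (fun y => phi y I) xi.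
  by rewrite /fsin -RintZ//; apply: eq_Rint => y; rewrite mulrA.
have -> : cintegral (fun y => cis (- (2 * pi * dotv y xi)) * complexify phi y I) =
    Complex (fcos (fun y => phi y I) xi) (- fsin (fun y => phi y I) xi).
  rewrite /cintegral; congr Complex.
    by apply: eq_Rint => y; rewrite Re_mul ffunE/= cosN mulr0 subr0 mulrC.
  rewrite /fsin -mulN1r -RintZ//; apply: eq_Rint => y.
  by rewrite Im_mul ffunE/= sinN mulr0 add0r; ring.
have -> : ((-1) ^+ #|I| : R[i]) = C ((-1) ^+ #|I|) by rewrite rmorphXn rmorphN1.
by apply/eqP; rewrite eq_complex/= !mul0r subr0 addr0 mulrN !eqxx.
Qed.

Let odd_int0 (h : 'rV[R]_n -> R) : intg mu h -> (forall xi, h (- xi) = - h xi) ->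
  \int[mu]_xi h xi = 0.
Proof.
move=> ih hN; set I := LHS; have E : I = - I.
  rewrite {1}/I (Rint_refl_rv 0 ih) -mulN1r -RintZ//; apply: eq_Rint => xi.
  by rewrite sub0r hN mulN1r.
by move/eqP: E; rewrite -addr_eq0 -mulr2n mulrn_eq0/= => /eqP.
Qed.

Lemma dotvNr x xi : dotv x (- xi) = - dotv x xi.
Proof. by rewrite dotvC dotvNl dotvC. Qed.

Lemma fcosN f xi : fcos f (- xi) = fcos f xi.
Proof. by apply: eq_Rint => y; rewrite dotvNr mulrN cosN. Qed.

Lemma fsinN f xi : intg mu f -> fsin f (- xi) = - fsin f xi.
Proof.
move=> iff; have [js _] := intg_trig xi iff.
rewrite -mulN1r /fsin -RintZ//; apply: eq_Rint => y.
by rewrite dotvNr mulrN sinN; ring.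
Qed.

(** Expanding the symbol gives the products [m_i m_j] with a plus sign, whereas [rz2_schwartz]
    carries the sign of [(- i)^2]; hence the minus in front of [rzz]. *)
Lemma ba_schwartzE phi x : schwartz phi ->
  ba_schwartz phi x = complexify (fun x => - rzz (involution_field phi) x) x.
Proof.
move=> sphi; apply/ffunP => J.
pose g I y := main_involution (phi y) I.
have sg_ I : schwartz_fun (g I).
  have -> : g I = (fun y => (-1) ^+ #|I| * phi y I) by apply/funext => y; rewrite /g main_involutionE.
  exact: schwartzZ.
pose t xi := 2 * pi * dotv x xi.
pose hr (q : T) xi := m q.1.1 xi * m q.1.2 xi * fcos (g q.2) xi * cos (t xi) +
  m q.1.1 xi * m q.1.2 xi * fsin (g q.2) xi * sin (t xi).
pose hi (q : T) xi := m q.1.1 xi * m q.1.2 xi * fcos (g q.2) xi * sin (t xi) -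
  m q.1.1 xi * m q.1.2 xi * fsin (g q.2) xi * cos (t xi).
have ic (q : T) : intg mu (fun xi => m q.1.1 xi * m q.1.2 xi * fcos (g q.2) xi).
  have := intg_symbol q.1.1 (intg_symbol q.1.2 (intg_fcos (sg_ q.2)).1).
  by congr (_.-integrable _ _); apply/funext => xi /=; rewrite mulrA.
have js (q : T) : intg mu (fun xi => m q.1.1 xi * m q.1.2 xi * fsin (g q.2) xi).
  have := intg_symbol q.1.1 (intg_symbol q.1.2 (intg_fcos (sg_ q.2)).2).
  by congr (_.-integrable _ _); apply/funext => xi /=; rewrite mulrA.
have ihr q : intg mu (hr q) := intg_trigI (ic q) (js q) x.
have ihi q : intg mu (hi q) := intg_trigI' (ic q) (js q) x.
(* The expansion of the symbol requires [xi != 0]; the origin is a null set in positive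
   dimension. *)
have key : {ae mu, forall xi, cis (t xi) * ba_symbol xi (fourier (complexify phi) xi) J =
    Complex (\sum_(q : T) sg q J * hr q xi) (\sum_(q : T) sg q J * hi q xi)}.
  apply: filterS (@ae_neq R n 0 n0) => xi xi0; rewrite ba_symbolE// mulr_sumr.
  apply/eqP; rewrite eq_complex Re_sum Im_sum; apply/andP; split; apply/eqP; apply: eq_bigr => q _ /=.
    rewrite fourier_involution// -/(g q.2) Re_mul Re_mul Im_mul/= /hr; ring.
  rewrite fourier_involution// -/(g q.2) Im_mul Re_mul Im_mul/= /hi; ring.
rewrite [LHS]ffunE [RHS]ffunE /cintegral.
have -> : \int[mu]_xi complex.Re (cis (2 * pi * dotv x xi) * ba_symbol xi (fourier (complexify phi) xi) J) =
    \int[mu]_xi \sum_(q : T) sg q J * hr q xi.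
  by apply: Rint_ae_eq; apply: filterS key => xi ->.
have -> : \int[mu]_xi complex.Im (cis (2 * pi * dotv x xi) * ba_symbol xi (fourier (complexify phi) xi) J) =
    \int[mu]_xi \sum_(q : T) sg q J * hi q xi.
  by apply: Rint_ae_eq; apply: filterS key => xi ->.
rewrite !Rint_sum; [|by move=> q; exact: intgZ|by move=> q; exact: intgZ].
(* The products [m_i m_j] and [fcos] are even and [fsin] is odd, so [hi q] is odd and integrates to
   0: the operator maps real fields to real fields. *)
have -> : \sum_(q : T) \int[mu]_xi (sg q J * hi q xi) = 0.
  apply: big1 => q _; rewrite RintZ// odd_int0 ?mulr0// => xi.
  by rewrite /hi /m /t fcosN fsinN ?enormN; [rewrite !mxE dotvNr mulrN sinN cosN; ring|exact: schwartz_intg].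
suff -> : \sum_(q : T) \int[mu]_xi (sg q J * hr q xi) = (- rzz (involution_field phi) x) J by [].
rewrite ffunE sum_ffunE.
under [in RHS]eq_bigr => i _ do rewrite sum_ffunE.
under [in RHS]eq_bigr => i _ do under eq_bigr => j _ do rewrite rzz_matrix.
rewrite (triple_sum (fun i j I => clifford (e i) (clifford (blade R I) (e j)) J *
   rz i (rz j (fun y => involution_field phi y I)) x)) -sumrN.
apply: eq_bigr => q _; rewrite RintZ// -/(sg q J) -mulrN; congr (_ * _).
by rewrite -[fun y => involution_field phi y q.2]/(g q.2) (rz2_schwartz p1 n0)// opprK.
Qed.

End ba_schwartz.

(** * Extension of the operator to L^p fields *)

Section Lp_fields.
Context (R : realType) (n : nat) (p : R).
Hypotheses (p1 : 1 < p) (n0 : (0 < n)%N).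
Local Notation mu := (lebesgue_rv R n).
Implicit Types (F G : mvfield R n) (x : 'rV[R]_n) (I J : {set 'I_n}) (N : 'rV[R]_n -> R).

Let p0 : 0 < p. Proof. exact: lt_trans ltr01 p1. Qed.

Let LnormE N : (forall x, 0 <= N x) ->
  Lnorm mu p%:E (fun x => (N x)%:E) = ((\int[mu]_x (N x `^ p)%:E) `^ p^-1)%E.
Proof.
move=> N0; rewrite unlock; congr (_ `^ _)%E; apply: eq_integral => x _.
by rewrite abse_EFin poweR_EFin ger0_norm.
Qed.

(** Turns comparisons of norms into comparisons of [p]-th powers, where the [eLp] estimates live. *)
Lemma Lnorm_lt N (d : R) : (forall x, 0 <= N x) -> 0 < d ->
  (Lnorm mu p%:E (fun x => (N x)%:E) < d%:E)%E = (\int[mu]_x (N x `^ p)%:E < (d `^ p)%:E)%E.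
Proof.
move=> N0 d0; rewrite LnormE//.
have I0 : (0 <= \int[mu]_x (N x `^ p)%:E)%E by apply: integral_ge0 => x _; rewrite lee_fin powR_ge0.
have ip : p^-1 != 0 by rewrite invr_eq0 gt_eqF.
case: (\int[mu]_x _)%E I0 => [r|_|//]; last by rewrite poweRyr.
rewrite lee_fin => r0; rewrite poweR_EFin !lte_fin; apply/idP/idP => h.
  have -> : r = (r `^ p^-1) `^ p by rewrite -powRrM mulVf ?gt_eqF// powRr1.
  by apply: gt0_ltr_powR; rewrite ?nnegrE ?powR_ge0// ltW.
have -> : d = (d `^ p) `^ p^-1 by rewrite -powRrM mulfV ?gt_eqF// powRr1// ltW.
by apply: gt0_ltr_powR; rewrite ?nnegrE ?powR_ge0// invr_gt0.
Qed.

Lemma Lnorm_lty N : (forall x, 0 <= N x) ->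
  (Lnorm mu p%:E (fun x => (N x)%:E) < +oo)%E = (\int[mu]_x (N x `^ p)%:E < +oo)%E.
Proof.
move=> N0; rewrite LnormE//.
have I0 : (0 <= \int[mu]_x (N x `^ p)%:E)%E by apply: integral_ge0 => x _; rewrite lee_fin powR_ge0.
have ip : p^-1 != 0 by rewrite invr_eq0 gt_eqF.
case: (\int[mu]_x _)%E I0 => [r _|_|//]; first by rewrite poweR_EFin !ltry.
by rewrite poweRyr.
Qed.

Lemma sqrt_sum_le (K : finType) (a : K -> R) : Num.sqrt (\sum_k a k * a k) <= \sum_k `|a k|.
Proof.
have s0 : 0 <= \sum_k `|a k| by apply: sumr_ge0.
rewrite -[leRHS]ger0_norm// -sqrtr_sqr ler_sqrt ?sqr_ge0// expr2 mulr_suml.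
apply: ler_sum => k _; apply: (le_trans (ler_norm _)); rewrite normrM ler_wpM2l//.
by rewrite (bigD1 k)//= lerDl; exact: sumr_ge0.
Qed.

Lemma mv_norm_le (w : multivector R n) : mv_norm w <= \sum_I `|w I|.
Proof. exact: sqrt_sum_le. Qed.

Lemma le_mv_norm (w : multivector R n) I : `|w I| <= mv_norm w.
Proof.
rewrite /mv_norm -sqrtr_sqr ler_sqrt; last by apply: sumr_ge0 => J _; rewrite -expr2 sqr_ge0.
rewrite /mv_inner (bigD1 I)//= expr2 lerDl; apply: sumr_ge0 => J _; by rewrite -expr2 sqr_ge0.
Qed.

Lemma mv_norm_ge0 (w : multivector R n) : 0 <= mv_norm w.
Proof. exact: sqrtr_ge0. Qed.

Lemma eLp_component F I : (eLp p (fun x => F x I) <= \int[mu]_x (mv_norm (F x) `^ p)%:E)%E.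
Proof.
apply: int_mono => x; rewrite lee_fin ?powR_ge0//.
by apply: ge0_ler_powR; rewrite ?nnegrE ?mv_norm_ge0 ?le_mv_norm ?(ltW p0).
Qed.

Let M : R := #|{set 'I_n}|%:R `^ p.

Lemma int_mv_norm_le F : (forall I, measurable_fun setT (fun x => F x I : R)) ->
  (\int[mu]_x (mv_norm (F x) `^ p)%:E <= M%:E * \sum_I eLp p (fun x => F x I))%E.
Proof.
move=> mF; apply: (ge0_int_sum_powR p1 mF) => x; [exact: mv_norm_ge0|exact: mv_norm_le].
Qed.

Lemma in_LpP F : in_Lp p F <-> Lpmv p F.
Proof.
split=> [[mF fF] I|lF].
  split; first exact: mF.
  rewrite /Lp_norm Lnorm_lty in fF; last by move=> x; exact: mv_norm_ge0.
  exact: (le_lt_trans (eLp_component F I)).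
split; first by move=> I; exact: (lF I).1.
rewrite /Lp_norm Lnorm_lty; last by move=> x; exact: mv_norm_ge0.
apply: (le_lt_trans (int_mv_norm_le (fun I => (lF I).1))).
apply: lte_mul_pinfty; [by rewrite lee_fin powR_ge0|by []|].
by apply: lte_sum_pinfty => I _; exact: (lF I).2.
Qed.

Let sum_lt (K : finType) (g : K -> \bar R) (b : R) : (forall k, (g k <= b%:E)%E) ->
  (\sum_k g k <= (#|K|%:R * b)%:E)%E.
Proof.
move=> h; have -> : (#|K|%:R * b)%:E = (\sum_(k : K) b%:E)%E.
  by rewrite sumEFin sumr_const mulr_natl.
by apply: lee_sum => k _; exact: h.
Qed.

Lemma fields_dense F (d : R) : Lpmv p F -> 0 < d ->
  exists2 phi, schwartz phi & (Lp_norm p (fun x => (phi x - F x)%R) < d%:E)%E.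
Proof.
move=> lF d0; pose K : R := #|{set 'I_n}|%:R.
have K0 : 0 <= K by [].
pose D := M * K + 1; have D0 : 0 < D by rewrite ltr_wpDl// mulr_ge0// powR_ge0.
have b0 : 0 < d `^ p / D by rewrite divr_gt0// powR_gt0.
have ex I : exists phi, schwartz_fun phi /\ (eLp p (fun x => (phi x - F x I)%R) < (d `^ p / D)%:E)%E.
  by have [phi sphi h] := schwartz_dense p1 (lF I) b0; exists phi.
pose ph I := projT1 (cid (ex I)).
have phP I : schwartz_fun (ph I) /\ (eLp p (fun x => (ph I x - F x I)%R) < (d `^ p / D)%:E)%E.
  exact: projT2 (cid (ex I)).
pose phi : mvfield R n := fun x => [ffun I => ph I x].
have phE I : (fun x => phi x I) = ph I by apply/funext => x; rewrite ffunE.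
exists phi; first by move=> I; rewrite phE; exact: (phP I).1.
rewrite /Lp_norm Lnorm_lt//; last by move=> x; exact: mv_norm_ge0.
have cE I : (fun x => (phi x - F x) I) = (fun x => ph I x - F x I).
  by apply/funext => x; rewrite !ffunE.
have mD I : measurable_fun setT (fun x => (phi x - F x) I : R).
  rewrite cE; apply: measurable_funB; last exact: (lF I).1.
  exact: schwartz_measurable (phP I).1.
apply: (le_lt_trans (int_mv_norm_le mD)).
apply: (@le_lt_trans _ _ (M%:E * (K * (d `^ p / D))%:E)%E).
  apply: lee_wpmul2l; first by rewrite lee_fin powR_ge0.
  by apply: sum_lt => I; rewrite cE; apply: ltW; have [] := phP I.
rewrite -EFinM lte_fin; have -> : M * (K * (d `^ p / D)) = d `^ p * (M * K) / D by ring.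
by rewrite ltr_pdivrMr// ltr_pM2l ?powR_gt0// /D ltrDl.
Qed.

Definition ba F : mvfield R n := fun x => - rzz (involution_field F) x.

Let T := ('I_n * 'I_n * {set 'I_n})%type.

Let sg (q : T) J : R := clifford (mvec (delta_mx 0 q.1.1)) (clifford (blade R q.2) (mvec (delta_mx 0 q.1.2))) J.

Lemma baE F x J : ba F x J = \sum_(q : T) - sg q J *
  rz q.1.1 (rz q.1.2 (fun y => involution_field F y q.2)) x.
Proof.
rewrite ffunE sum_ffunE.
under eq_bigr => i _ do rewrite sum_ffunE.
under eq_bigr => i _ do under eq_bigr => j _ do rewrite rzz_matrix.
rewrite pair_bigA/= (pair_bigA _ (fun (r : 'I_n * 'I_n) I =>
  clifford (mvec (delta_mx 0 r.1)) (clifford (blade R I) (mvec (delta_mx 0 r.2))) J *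
  rz r.1 (rz r.2 (fun y => involution_field F y I)) x))/= -sumrN.
by apply: eq_bigr => q _; rewrite mulNr.
Qed.

Lemma involution_Lp F : Lpmv p F -> Lpmv p (involution_field F).
Proof.
move=> lF I; have := @LpfZ R n p ((-1) ^+ #|I|) _ (lF I); congr Lpf; apply/funext => x.
by rewrite /involution_field main_involutionE.
Qed.

Lemma ba_Lp F : Lpmv p F -> Lpmv p (ba F).
Proof.
move=> /involution_Lp lF J.
have -> : (fun x => ba F x J) = (fun x => \sum_(q : T) - sg q J *
  rz q.1.1 (rz q.1.2 (fun y => involution_field F y q.2)) x) by apply/funext => x; rewrite baE.
by apply: (@Lpf_sum R n p p1) => q; apply: LpfZ; exact: (rz2_Lpf p1 n0).
Qed.

(** [ba] is linear only almost everywhere, so continuity is stated for differences. In the constant,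
    [A] pays for the number of terms, [C] for two Riesz transforms, and [S] sums the coefficients
    over all output components to be uniform in [J]. *)
Lemma ba_bounded : exists2 C : R, 0 <= C & forall F G (b : R), Lpmv p F -> Lpmv p G -> 0 <= b ->
  (forall I, (eLp p (fun x => (F x I - G x I)%R) <= b%:E)%E) ->
  forall J, (eLp p (fun x => (ba F x J - ba G x J)%R) <= (C * b)%:E)%E.
Proof.
have [C C0 hC] := rz2_bounded p1 n0 (p := p).
pose A : R := #|{: T}|%:R `^ p; have A0 : 0 <= A by exact: powR_ge0.
pose S : R := \sum_J \sum_(q : T) `|sg q J| `^ p.
have S0 : 0 <= S by apply: sumr_ge0 => J _; apply: sumr_ge0 => q _; exact: powR_ge0.
exists (A * (S * C)); first by rewrite !mulr_ge0.
move=> F G b lF lG b0 h J.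
have lF' := involution_Lp lF; have lG' := involution_Lp lG.
pose D (q : T) y := involution_field F y q.2 - involution_field G y q.2.
have lD q : Lpf p (D q) by apply: (LpfB p1); [exact: lF'|exact: lG'].
have eD q : (eLp p (D q) <= b%:E)%E.
  have -> : D q = (fun y => (-1) ^+ #|q.2| * (F y q.2 - G y q.2)).
    by apply/funext => y; rewrite /D /involution_field !main_involutionE mulrBr.
  rewrite eLpZ; last by apply: measurable_funB; [exact: (lF _).1|exact: (lG _).1].
  by rewrite normrX normrN1 expr1n powR1 mul1e; exact: h.
pose H (q : T) x := - sg q J * rz q.1.1 (rz q.1.2 (D q)) x.
have lH q : Lpf p (H q) by apply: LpfZ; exact: (rz2_Lpf p1 n0).
have ae : {ae mu, forall x, ba F x J - ba G x J = \sum_(q : T) H q x}.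
  have ha : {ae mu, forall x, forall q : T, rz q.1.1 (rz q.1.2 (fun y => involution_field F y q.2)) x =
      1 * rz q.1.1 (rz q.1.2 (D q)) x + rz q.1.1 (rz q.1.2 (fun y => involution_field G y q.2)) x}.
    apply: filter_forall => q.
    have := rz2_lin_ae p1 n0 q.1.1 q.1.2 1 (lD q) (lG' q.2).
    have -> : (fun y => 1 * D q y + involution_field G y q.2) = (fun y => involution_field F y q.2).
      by apply/funext => y; rewrite /D mul1r subrK.
    by [].
  apply: filterS ha => x ha.
  have eF := baE F x J.
  have eG := baE G x J.
  rewrite [X in X - _]eF.
  rewrite [X in _ - X]eG.
  rewrite -sumrB; apply: eq_bigr => q _.
  rewrite /H -mulrBr; congr (_ * _).
  have E := ha q; rewrite [X in X - _]E.
  by rewrite mul1r addrK.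
have mB : measurable_fun setT (fun x => ba F x J - ba G x J).
  by apply: measurable_funB; [exact: (ba_Lp lF J).1|exact: (ba_Lp lG J).1].
have mS : measurable_fun setT (fun x => \sum_(q : T) H q x) := (@Lpf_sum R n p p1 _ _ _ lH).1.
have h1 := eLp_ae p mB mS ae.
have h2 := @eLp_sum R n p p1 T H (fun q => (lH q).1).
apply: (le_trans (le_trans h1 h2)); rewrite -/A.
have -> : (A * (S * C) * b)%:E = (A%:E * (S * C * b)%:E)%E by rewrite -EFinM -!mulrA.
apply: lee_wpmul2l; first by rewrite lee_fin.
apply: (@le_trans _ _ (\sum_(q : T) (`|sg q J| `^ p * (C * b))%:E)%E).
  apply: lee_sum => q _; rewrite eLpZ; last exact: (rz2_Lpf p1 n0 _ _ (lD q)).1.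
  rewrite normrN EFinM; apply: lee_wpmul2l; first by rewrite lee_fin powR_ge0.
  apply: (le_trans (hC _ _ _ (lD q))); rewrite EFinM; apply: lee_wpmul2l; first by rewrite lee_fin.
  exact: eD.
rewrite sumEFin lee_fin -mulr_suml -mulrA ler_wpM2r ?mulr_ge0//.
rewrite /S (bigD1 J)//= lerDl; apply: sumr_ge0 => J' _; apply: sumr_ge0 => q _; exact: powR_ge0.
Qed.

Let subE (u w : multivector R n) J : (u - w) J = u J - w J.
Proof. by rewrite !ffunE. Qed.

Lemma cmv_norm_complexify (u w : mvfield R n) x :
  cmv_norm (complexify u x - complexify w x) = mv_norm (u x - w x).
Proof.
rewrite /cmv_norm /mv_norm /mv_inner; congr Num.sqrt; apply: eq_bigr => I _.
by rewrite !ffunE/= subrr expr0n addr0 expr2.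
Qed.

(** On Schwartz fields [ba] coincides with [ba_schwartz], so the last clause becomes continuity of
    [ba] on L^p, obtained component by component. *)
Lemma ba_beurling_ahlfors F : Lpmv p F -> is_beurling_ahlfors p F (ba F).
Proof.
move=> lF; split.
- by apply/in_LpP; exact: ba_Lp.
- by move=> d d0; exact: fields_dense.
move=> b b0; have [C C0 hC] := ba_bounded.
pose K : R := #|{set 'I_n}|%:R; have K0 : 0 <= K by [].
have M0 : 0 <= M by exact: powR_ge0.
(* [M] is the price of passing from components to the norm, [K] counts the component errors and [C]
   bounds the operator; the [+ 1] makes [D] positive. *)
pose D := M * (K * C) + 1; have D0 : 0 < D by rewrite ltr_wpDl// !mulr_ge0.
pose s := b `^ p / D; have s0 : 0 < s by rewrite divr_gt0// powR_gt0.
exists (s `^ p^-1); first by rewrite powR_gt0.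
move=> phi sphi; rewrite /Lp_norm Lnorm_lt ?powR_gt0//; last by move=> x; exact: mv_norm_ge0.
have -> : (s `^ p^-1) `^ p = s by rewrite -powRrM mulVf ?gt_eqF// powRr1// ltW.
move=> hs; have lphi : Lpmv p phi by move=> I; exact: (schwartz_Lpf p1 (sphi I)).
have hI I : (eLp p (fun x => (phi x I - F x I)%R) <= s%:E)%E.
  have := eLp_component (fun x => phi x - F x) I.
  rewrite (_ : (fun x => (phi x - F x) I) = (fun x => phi x I - F x I)); last first.
    by apply/funext => x; rewrite !ffunE.
  by move=> h; apply: (le_trans h); exact: ltW.
rewrite /cLp_norm.
have -> : (fun x => (cmv_norm (ba_schwartz phi x - complexify (ba F) x))%:E) =
    (fun x => (mv_norm (ba phi x - ba F x))%:E).
  by apply/funext => x; rewrite (ba_schwartzE p1 n0 x sphi) cmv_norm_complexify.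
rewrite Lnorm_lt//; last by move=> x; exact: mv_norm_ge0.
have cE J : (fun x => (ba phi x - ba F x) J) = (fun x => ba phi x J - ba F x J).
  by apply/funext => x; exact: subE.
have mD J : measurable_fun setT (fun x => (ba phi x - ba F x) J : R).
  by rewrite cE; apply: measurable_funB; [exact: (ba_Lp lphi J).1|exact: (ba_Lp lF J).1].
apply: (le_lt_trans (int_mv_norm_le mD)).
apply: (@le_lt_trans _ _ (M%:E * (K * (C * s))%:E)%E).
  apply: lee_wpmul2l; first by rewrite lee_fin.
  by apply: sum_lt => J; rewrite cE; apply: (hC _ _ _ lphi lF (ltW s0) hI).
rewrite -EFinM lte_fin /s; have -> : M * (K * (C * (b `^ p / D))) = b `^ p * (M * (K * C)) / D by ring.
by rewrite ltr_pdivrMr// ltr_pM2l ?powR_gt0// /D ltrDl.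
Qed.

End Lp_fields.

Theorem proposition8p1 (R : realType) (n : nat) (n_gt0 : (0 < n)%N) (p : R)
    (p_gt1 : 1 < p) (omega : mvfield R n) (omega_Lp : in_Lp p omega) :
  exists S : mvfield R n,
    [/\ is_beurling_ahlfors p omega S,
        {ae lebesgue_rv R n, forall x, S x =
          - riesz_cliffordl (riesz_cliffordr (involution_field omega)) x}
      & {ae lebesgue_rv R n, forall x, S x =
          - riesz_cliffordr (riesz_cliffordl (involution_field omega)) x}].
Proof.
have lw : Lpmv p omega by apply/(in_LpP p_gt1).
have lw' := involution_Lp lw.
exists (ba omega); split; first exact: ba_beurling_ahlfors.
- by apply: filterS (riesz_lr_ae p_gt1 n_gt0 lw') => x ->.
- by apply: filterS (riesz_rl_ae p_gt1 n_gt0 lw') => x ->.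
Qed.
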